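(* Let $N\geq3$. If $\Omega$ is a finite disjoint union of annuli, i.e., $$\Omega:=\bigcup_{i=1}^n\{x\in\mathbb{R}^N:a_i<|x|<b_i\},\qquad 0<a_1<b_1<a_2<\cdots<a_n<b_n$$ for some $n\in\mathbb{N}$, and $\lambda\in(-\Lambda_\Omega,0]$, then the problem $$-\Delta u+\lambda\mathds{1}_\Omega u=Q_\Omega(x)|u|^{2^*-2}u,\qquad u\in D^{1,2}(\mathbb{R}^N),$$ has infinitely many radial solutions.
   Context: $2^*:=\frac{2N}{N-2}$; $\mathds{1}_\Omega$ is the characteristic function of $\Omega$; $Q_\Omega(x):=1$ if $x\in\Omega$ and $Q_\Omega(x):=-1$ if $x\in\mathbb{R}^N\smallsetminus\Omega$. $D^{1,2}(\mathbb{R}^N)=\{u\in L^{2^*}(\mathbb{R}^N):\nabla u\in L^2(\mathbb{R}^N;\mathbb{R}^N)\}$, and $$\Lambda_\Omega:=\inf_{u\in D^{1,2}(\mathbb{R}^N),\,u\neq0}\frac{\int_{\mathbb{R}^N}|\nabla u|^2}{\int_\Omega u^2}$$ (the quotient being $+\infty$ if the denominator vanishes). Solutions are the critical points of $J_\lambda(u):=\frac12\int_{\mathbb{R}^N}(|\nabla u|^2+\lambda\mathds{1}_\Omega u^2)-\frac1{2^*}\int_{\mathbb{R}^N}Q_\Omega|u|^{2^*}$ on $D^{1,2}(\mathbb{R}^N)$. *)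

(* Defs.v *)
From HB Require Import structures.
From mathcomp Require Import all_boot all_order all_algebra.
From mathcomp Require Import all_classical all_reals all_analysis.

Set Implicit Arguments.
Unset Strict Implicit.
Unset Printing Implicit Defensive.

Import Order.TTheory GRing.Theory Num.Theory.
Import numFieldNormedType.Exports.

Local Open Scope classical_set_scope.
Local Open Scope ring_scope.

Definition rV_display : measure_display. Proof. exact. Qed.

(* The sigma-algebra on R^n generated by the coordinates, as the library does
   for n.-tuple R; it is the Borel sigma-algebra. *)
Section rV_measurable.
Context (R : realType) (n : nat).

Let coord (i : 'I_n) (x : 'rV[R]_n) : R := x 0 i.

Let rV_set0 : g_sigma_preimage coord set0.
Proof. exact: sigma_algebra0. Qed.

Let rV_setC A : g_sigma_preimage coord A -> g_sigma_preimage coord (~` A).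
Proof. exact: sigma_algebraC. Qed.

Let rV_bigcup (F : (set 'rV[R]_n)^nat) :
  (forall i, g_sigma_preimage coord (F i)) ->
  g_sigma_preimage coord (\bigcup_i (F i)).
Proof. exact: sigma_algebra_bigcup. Qed.

HB.instance Definition _ := @isMeasurable.Build rV_display
  'rV[R]_n (g_sigma_preimage coord) rV_set0 rV_setC rV_bigcup.

Lemma measurable_coord (i : 'I_n) :
  measurable_fun [set: 'rV[R]_n] (fun x => x 0 i).
Proof.
move=> _ Y mY; rewrite setTI; apply: sub_sigma_algebra => /=.
rewrite -bigcup_seq/=; exists i => /=; first by rewrite mem_index_enum.
by exists Y => //; rewrite setTI.
Qed.

Lemma measurable_fun_rVP d (T : measurableType d) (f : T -> 'rV[R]_n) :
  (forall i, measurable_fun [set: T] (fun x => f x 0 i)) ->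
  measurable_fun [set: T] f.
Proof.
move=> mf.
have H : g_sigma_preimage (fun i => coord i \o f) `<=` measurable.
  apply: smallest_sub; first exact: sigma_algebra_measurable.
  rewrite -bigcup_seq; apply: bigcup_sub => i _ A [B mB <-]; exact: mf.
move: H; rewrite (@g_sigma_preimage_comp _ _ _ _ coord _ f) => H _ A mA.
by apply: H; exists A.
Qed.

End rV_measurable.

Section cons_measure.
Context (R : realType) (n : nat).

Definition rV_cons (p : measurableTypeR R * 'rV[R]_n) : 'rV[R]_n.+1 :=
  \row_i oapp (fun j => p.2 0 j) p.1 (unlift ord0 i).

Definition rV_uncons (x : 'rV[R]_n.+1) : measurableTypeR R * 'rV[R]_n :=
  (x 0 ord0, \row_j x 0 (lift ord0 j)).

Lemma rV_consK : cancel rV_cons rV_uncons.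
Proof.
move=> [t v]; rewrite /rV_uncons mxE unlift_none; congr pair.
by apply/rowP => j; rewrite !mxE liftK.
Qed.

Lemma measurable_rV_cons : measurable_fun [set: _] rV_cons.
Proof.
apply: measurable_fun_rVP => i.
under eq_fun do rewrite mxE.
case: (unlift ord0 i) => [j|] /=; last exact: measurable_fst.
exact: (measurableT_comp (@measurable_coord R n j) measurable_snd).
Qed.

Lemma measurable_rV_uncons : measurable_fun [set: _] rV_uncons.
Proof.
apply: measurable_fun_pair; first exact: measurable_coord.
apply: measurable_fun_rVP => j.
by under eq_fun do rewrite mxE; exact: measurable_coord.
Qed.

Variable mu : {sigma_finite_measure set 'rV[R]_n -> \bar R}.

Definition cons_measure : set 'rV[R]_n.+1 -> \bar R :=
  pushforward (lebesgue_measure \x mu)%E rV_cons.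

Let mcons A : measurable A -> measurable (rV_cons @^-1` A).
Proof. by move=> mA; rewrite -[X in measurable X]setTI; exact: measurable_rV_cons. Qed.

Let cons_measure0 : cons_measure set0 = 0%E.
Proof. by rewrite /cons_measure /pushforward preimage_set0 measure0. Qed.

Let cons_measure_ge0 A : (0 <= cons_measure A)%E.
Proof. by rewrite /cons_measure /pushforward measure_ge0. Qed.

Let cons_measure_sigma_additive : semi_sigma_additive cons_measure.
Proof.
move=> F mF tF mUF; rewrite /cons_measure /pushforward preimage_bigcup.
apply: measure_semi_sigma_additive.
- by move=> k; exact: mcons.
- apply/trivIsetP => /= i j _ _ ij; rewrite -preimage_setI.
  by move/trivIsetP : tF => /(_ _ _ _ _ ij) ->//; rewrite preimage_set0.
- by rewrite -preimage_bigcup; exact: mcons.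
Qed.

HB.instance Definition _ := isMeasure.Build _ _ _ cons_measure
  cons_measure0 cons_measure_ge0 cons_measure_sigma_additive.

Let cons_measure_sigma_finite : sigma_finite setT cons_measure.
Proof.
have /sigma_finiteP[F [TF ndF Foo]] := sigma_finiteT (@lebesgue_measure R).
have /sigma_finiteP[G [TG ndG Goo]] := sigma_finiteT mu.
exists (fun k => rV_uncons @^-1` (F k `*` G k)).
  apply/esym; rewrite -preimage_bigcup -subTset => x _ /=.
  have [k _ Fk] : (\bigcup_k F k) (rV_uncons x).1 by rewrite -TF.
  have [l _ Gl] : (\bigcup_k G k) (rV_uncons x).2 by rewrite -TG.
  exists (maxn k l) => //; split.
  - by move: Fk; exact/subsetPset/ndF/leq_maxl.
  - by move: Gl; exact/subsetPset/ndG/leq_maxr.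
move=> k; have [mF Fkoo] := Foo k; have [mG Gkoo] := Goo k; split.
  rewrite -[X in measurable X]setTI; apply: measurable_rV_uncons => //.
  exact: measurableX.
rewrite /cons_measure /pushforward -comp_preimage.
rewrite (_ : rV_uncons \o rV_cons = id); last exact/funext/rV_consK.
rewrite preimage_id product_measure1E//.
by rewrite lte_mul_pinfty// ge0_fin_numE.
Qed.

HB.instance Definition _ := Measure_isSigmaFinite.Build _ _ _ cons_measure
  cons_measure_sigma_finite.

End cons_measure.

(* Lebesgue measure on R^n, as an iterated product: a point mass on the
   one-point space R^0, then lebesgue_measure \x leb n carried to R^n.+1. *)
Fixpoint leb (R : realType) (n : nat) :
    {sigma_finite_measure set 'rV[R]_n -> \bar R} :=
  match n with
  | 0 => dirac (0 : 'rV[R]_0)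
  | m.+1 => cons_measure (leb R m)
  end.

Section euclidean.
Context (R : realType) (N : nat).
Notation rn := ('rV[R]_N).
Notation mu := (leb R N).
Implicit Types (u v g phi : rn -> R) (Omega : set rn).

(* The library's norm on row vectors is the sup norm; it induces the same
   topology, hence the same derivatives and compact sets. *)
Definition enorm (x : rn) : R := Num.sqrt (\sum_(i < N) x 0 i ^+ 2).

Definition partial (i : 'I_N) phi : rn -> R := 'D_(delta_mx 0 i) phi.

Fixpoint Ck (k : nat) phi : Prop :=
  match k with
  | 0 => continuous phi
  | m.+1 => (forall x, differentiable phi x) /\
            (forall i : 'I_N, Ck m (partial i phi))
  end.

Definition test_function phi : Prop :=
  (forall k, Ck k phi) /\ compact (closure [set x | phi x != 0]).

Definition loc_integrable u : Prop :=
  measurable_fun setT u /\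
  forall K : set rn, compact K -> (\int[mu]_(x in K) `|u x|%:E < +oo)%E.

Definition is_weak_partial (i : 'I_N) u g : Prop :=
  [/\ loc_integrable u, loc_integrable g &
      forall phi, test_function phi ->
        \int[mu]_x (u x * partial i phi x) = - \int[mu]_x (g x * phi x)].

(* A choice of representative, unique up to a null set; junk if the weak
   derivative does not exist. *)
Definition weak_partial (i : 'I_N) u : rn -> R :=
  xget (cst 0) [set g | is_weak_partial i u g].

Definition grad_sq u (x : rn) : R := \sum_(i < N) weak_partial i u x ^+ 2.

Definition crit_exp : R := 2 * N%:R / (N%:R - 2).

Definition D12 u : Prop :=
  u \in Lfun mu crit_exp%:E /\
  forall i : 'I_N, exists2 g, is_weak_partial i u g & g \in Lfun mu 2%:E.

Definition D12_norm u : R := Num.sqrt (\int[mu]_x grad_sq u x).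

Definition rayleigh Omega u : \bar R :=
  let den := (\int[mu]_(x in Omega) (u x ^+ 2)%:E)%E in
  if den == 0%E then +oo%E else (\int[mu]_x (grad_sq u x)%:E / den)%E.

Definition Lambda Omega : \bar R :=
  ereal_inf [set rayleigh Omega u |
    u in [set u | D12 u /\ ~ (u = cst 0 %[ae mu])]].

Definition Q Omega (x : rn) : R := if x \in Omega then 1 else -1.

Definition J Omega (lambda : R) u : R :=
  2^-1 * \int[mu]_x (grad_sq u x + lambda * \1_Omega x * u x ^+ 2)
  - crit_exp^-1 * \int[mu]_x (Q Omega x * `|u x| `^ crit_exp).

(* The Frechet derivative of F at u vanishes, in the space D12 with the norm
   D12_norm. *)
Definition critical_point (F : (rn -> R) -> R) u : Prop :=
  D12 u /\
  forall e : R, 0 < e -> exists2 d : R, 0 < d &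
    forall v, D12 v -> D12_norm v < d ->
      `|F (u \+ v) - F u| <= e * D12_norm v.

Definition solution Omega (lambda : R) u : Prop :=
  critical_point (J Omega lambda) u.

Definition radial u : Prop := forall x y, enorm x = enorm y -> u x = u y.

(* Elements of D12 are functions up to almost everywhere equality: this is the
   element represented by u. *)
Definition ae_class u : set (rn -> R) := [set v | v = u %[ae mu]].

Definition annulus (r s : R) : set rn := [set x | r < enorm x < s].

End euclidean.

(* Main.v *)
(* In the variable r = |x|^2 a radial function u(x) = U(r) solves the problem when
   4 r U'' + 2 N U' = lambda 1_Omega U - Q |U|^(p-2) U, where p = 2^*. Off Omega,
   with c = (N-2)/2, explicit solutions are the bubbles k |r - mu|^(-c) for a
   suitable k: those with mu > a_1^2 are regular at the origin, and those with
   0 <= mu < b_n^2 decay at infinity.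

   Shoot from the inner bubbles, writing h = U and z = r^(N/2) U' in polar
   coordinates with an angle and a log-amplitude. As mu tends to infinity the
   amplitude at r = a_1^2 vanishes, as mu tends to a_1^2 it blows up. Across an
   annulus every solution survives and a large amplitude makes the angle rotate
   arbitrarily far. Across a gap the angle stays nonnegative, but a solution
   entering with angle 2 j pi and large amplitude explodes; as the angle is
   unbounded there is a first parameter of explosion, and when it is approached
   the amplitude at the end of the gap is unbounded again. So after the last
   annulus the angle is an unbounded continuous function of mu, and the
   intermediate value theorem matches infinitely many trajectories with an outer
   bubble. They are told apart by U(0), which is monotone in mu.

   The functions u so obtained are critical points: integrating by parts along
   lines yields the Euler-Lagrange equation against every v in D^{1,2}, whose
   restrictions to almost all lines are absolutely continuous, and the Sobolev
   inequality (Gagliardo's proof) bounds the remainder of J. *)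
Require Import Defs.
From mathcomp Require Import all_boot all_order all_algebra.
From mathcomp Require Import all_classical all_reals all_analysis.
From mathcomp Require Import measurable_realfun.
From mathcomp Require Import ring lra.
Import Order.TTheory GRing.Theory Num.Theory.
Import numFieldNormedType.Exports.
Set Implicit Arguments.
Unset Strict Implicit.
Unset Printing Implicit Defensive.
Local Open Scope classical_set_scope.
Local Open Scope ring_scope.

(** * Lebesgue measure on R^n *)

Arguments leb : simpl never.

Section insertion.
Context (R : realType).
Local Notation RR := (measurableTypeR R).
Local Notation leb := (leb R).
Local Notation lbg := (@lebesgue_measure R).

(** Explicit bubbles at both ends confine the dynamics to a compact range of positive radii, away
    from the singular point r = 0 and from infinity. The weight in z = r^(N/2) U' absorbs the
    first-order term, as 4 r U'' + 2 N U' = 4 r^(1-N/2) (r^(N/2) U')'; this leaves h' = A z and z' =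
    - B times a function of h, with A, B > 0. The obstacle is the sign of Q. In an annulus the
    energy is coercive and lambda <= 0 makes the angle nondecreasing. In a gap the equation is
    repulsive, so the shooting map exists only up to some parameter. What survives an induction over
    the annuli is a continuous family on ]0, sg[ with nonnegative angle, amplitude vanishing at one
    end and diverging at the other, where [sg] may shrink at each gap. Explosion from the angles 2 j
    pi comes from h = 0 < z: h then grows and obeys a superlinear differential inequality. At the
    first exploding parameter the amplitude must diverge at the end of the gap: in a gap it has no
    interior maximum, so bounds at both ends would bound the whole trajectory and let it
    continue. *)

Definition ins n (i : 'I_n.+1) (p : RR * 'rV[R]_n) : 'rV[R]_n.+1 :=
  \row_j oapp (fun k => p.2 0 k) p.1 (unlift i j).

Lemma ins_at n (i : 'I_n.+1) t y : ins i (t, y) 0 i = t.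
Proof. by rewrite mxE unlift_none. Qed.

Lemma ins_lift n (i : 'I_n.+1) t y j : ins i (t, y) 0 (lift i j) = y 0 j.
Proof. by rewrite mxE liftK. Qed.

Lemma measurable_ins n (i : 'I_n.+1) : measurable_fun [set: _] (ins i).
Proof.
apply: measurable_fun_rVP => j; under eq_fun do rewrite mxE.
case: (unlift i j) => [k|] /=; last exact: measurable_fst.
exact: (measurableT_comp (@measurable_coord R n k) measurable_snd).
Qed.

Lemma leb_tonelli0 n (f : 'rV[R]_n.+1 -> \bar R) :
  measurable_fun setT f -> (forall x, 0 <= f x)%E ->
  (\int[leb n.+1]_x f x = \int[lbg]_t \int[leb n]_y f (ins ord0 (t, y)))%E.
Proof.
move=> mf f0.
rewrite -(fubini_tonelli1 (f \o ins ord0)) /=; last 2 first.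
- exact: measurableT_comp mf (measurable_ins _).
- by move=> p; exact: f0.
rewrite (_ : ins ord0 = @rV_cons R n)//.
have := @ge0_integral_pushforward _ _ _ _ R _ (@measurable_rV_cons R n)
   (lbg \x leb n)%E setT f measurableT mf (fun x _ => f0 x).
rewrite preimage_setT => <-.
by apply: eq_measure_integral; first exact: measurable_rV_cons.
Qed.

Lemma ins_lift_cons n (i : 'I_n.+1) s t y :
  ins (lift ord0 i) (t, ins ord0 (s, y)) = ins ord0 (s, ins i (t, y)).
Proof.
apply/rowP => j; case: (unliftP ord0 j) => [k ->|->].
  rewrite ins_lift; case: (unliftP i k) => [l ->|->].
    have -> : lift ord0 (lift i l) = lift (lift ord0 i) (lift ord0 l) :> 'I_n.+2.
      by apply/val_inj => /=; rewrite /bump /= !add1n ltnS addnS.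
    by rewrite !ins_lift.
  by rewrite !ins_at.
rewrite ins_at.
have -> : ord0 = lift (lift ord0 i) ord0 :> 'I_n.+2 by apply/val_inj.
by rewrite ins_lift ins_at.
Qed.

(** [leb] is built by peeling off the first coordinate only. For another coordinate, the first is
    peeled off, the induction hypothesis is applied to the slices, the two one-dimensional integrals
    are exchanged, and the slices are reassembled with [ins_lift_cons]. *)
Lemma leb_tonelli n (i : 'I_n.+1) (f : 'rV[R]_n.+1 -> \bar R) :
  measurable_fun setT f -> (forall x, 0 <= f x)%E ->
  (\int[leb n.+1]_x f x = \int[lbg]_t \int[leb n]_y f (ins i (t, y)))%E.
Proof.
elim: n i f => [|n IH] i f mf f0.
  by rewrite (leb_tonelli0 mf f0) (ord1 i).
case: (unliftP ord0 i) => [j ->|->]; last exact: leb_tonelli0.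
rewrite (leb_tonelli0 mf f0).
transitivity (\int[lbg]_s \int[lbg]_t \int[leb n]_y f (ins ord0 (s, ins j (t, y))))%E.
  apply: eq_integral => s _; rewrite -(IH j (fun z => f (ins ord0 (s, z))))//.
  apply: (measurableT_comp mf); apply: (measurableT_comp (measurable_ins _)).
  exact: measurable_pair1.
pose g (p : RR * RR) := (\int[leb n]_y f (ins ord0 (p.1, ins j (p.2, y))))%E.
have mg : measurable_fun setT g.
  apply: (@measurable_fun_fubini_tonelli_F _ _ (RR * RR)%type 'rV[R]_n R (leb n)
    (fun q : (RR * RR) * 'rV[R]_n => f (ins ord0 (q.1.1, ins j (q.1.2, q.2))))).
    apply: (measurableT_comp mf); apply: (measurableT_comp (measurable_ins _)).
    apply: measurable_fun_pair.
      exact: measurableT_comp measurable_fst measurable_fst.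
    apply: (measurableT_comp (measurable_ins _)).
    apply: measurable_fun_pair => //.
    exact: measurableT_comp measurable_snd measurable_fst.
  by move=> q; exact: f0.
have g0 p : (0 <= g p)%E by apply: integral_ge0.
have := @fubini_tonelli _ _ RR RR R lbg lbg g mg g0.
rewrite /g /= => ->; apply: eq_integral => t _.
have mf' : measurable_fun setT (fun y => f (ins (lift ord0 j) (t, y))).
  apply: (measurableT_comp mf); apply: (measurableT_comp (measurable_ins _)).
  exact: measurable_pair1.
rewrite (leb_tonelli0 mf' (fun y => f0 _)).
by apply: eq_integral => s _; apply: eq_integral => y _; rewrite ins_lift_cons.
Qed.

Lemma leb_insE n (i : 'I_n.+1) A : measurable A ->
  leb n.+1 A = (lbg \x leb n)%E (ins i @^-1` A).
Proof.
move=> mA.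
have mA' : measurable (ins i @^-1` A).
  by rewrite -[X in measurable X]setTI; exact: measurable_ins.
rewrite -[X in leb _ X](setIT A) -integral_indic//.
rewrite (leb_tonelli i)//; last by apply/measurable_EFinP/measurable_indic.
rewrite /product_measure1; apply: eq_integral => t _ /=.
rewrite -[X in leb _ X](setIT (xsection _ _)) -integral_indic//; last first.
  exact: measurable_xsection.
apply: eq_integral => y _; rewrite !indicE; congr EFin.
by congr (nat_of_bool _)%:R; apply/idP/idP; rewrite /xsection !inE/= inE.
Qed.

Lemma leb_pushforward n (i : 'I_n.+1) (f : 'rV[R]_n.+1 -> \bar R) :
  (\int[leb n.+1]_x f x = \int[pushforward (lbg \x leb n) (ins i)]_x f x)%E.
Proof. apply: eq_measure_integral; first exact: measurable_ins.
by move=> m A mA _; exact: (leb_insE i mA). Qed.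

Lemma integrable_ins n (i : 'I_n.+1) (f : 'rV[R]_n.+1 -> \bar R) :
  (leb n.+1).-integrable setT f -> (lbg \x leb n)%E.-integrable setT (f \o ins i).
Proof.
move=> /integrableP[mf foo]; apply/integrableP; split.
  exact: measurableT_comp mf (measurable_ins _).
move: foo; rewrite (leb_tonelli i)//; last exact: measurableT_comp.
rewrite (fubini_tonelli1 (abse \o (f \o ins i)))//.
apply: measurableT_comp => //.
  exact: measurableT_comp mf (measurable_ins _).
by move=> p; exact: abse_ge0.
Qed.

Lemma integral_ins n (i : 'I_n.+1) (f : 'rV[R]_n.+1 -> \bar R) :
  (leb n.+1).-integrable setT f ->
  (\int[leb n.+1]_x f x = \int[(lbg \x leb n)]_p f (ins i p))%E.
Proof.
move=> fi; rewrite (leb_pushforward i).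
rewrite (integral_pushforward (measurable_ins i)) ?preimage_setT//.
  by case/integrableP : fi.
exact: integrable_ins.
Qed.

End insertion.

(** The sets over which the integral of [f] vanishes form a Dynkin system, so a generating family
    closed under intersection is enough. It is applied to boxes of R^n and to intervals with
    rational ends. *)
Lemma dynkin_integral_eq0 d (T : measurableType d) (R : realType)
    (mu : {measure set T -> \bar R}) (G : set (set T)) (D : set T)
    (f : T -> \bar R) :
  @measurable _ T = <<s G >> -> setI_closed G -> measurable D ->
  mu.-integrable D f -> (\int[mu]_(x in D) f x = 0)%E ->
  (forall A, G A -> \int[mu]_(x in D `&` A) f x = 0)%E ->
  ae_eq mu D f (cst 0%E).
Proof.
move=> mG GI mD fD fD0 fG0.
have fDI A : measurable A -> mu.-integrable (D `&` A) f.
  move=> mA; apply: integrableS fD => //; exact: measurableI.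
suff H S : <<s G >> S -> (\int[mu]_(x in D `&` S) f x = 0)%E.
  apply: integral_ae_eq => // E ED mE.
  by rewrite integral0 -(setIidr ED) H// -mG.
move=> GS; apply: (@dynkin_induction _ T G
  (fun S => \int[mu]_(x in D `&` S) f x = 0)%E mG GI) GS => //.
- by rewrite setIT.
- move=> A mA A0.
  have := @integral_setU _ _ _ mu (D `&` A) (D `&` ~` A) f.
  rewrite -setIUr setUCr setIT fD0 A0 add0e => <- //.
  + exact: measurableI.
  + by apply: measurableI => //; exact: measurableC.
  + exact: (measurable_int mu).
  + by apply/disj_setPLR => x [_ Ax] [_ /(_ Ax)].
- move=> F mF tF F0; rewrite setI_bigcupr integral_bigcup.
  + by rewrite eseries0.
  + by apply: trivIset_setIl.
  + by move=> k; exact: measurableI.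
  + by rewrite -setI_bigcupr; apply: fDI; exact: bigcupT_measurable.
Qed.

Lemma ae_mono d (T : measurableType d) (R : realType)
    (mu : {measure set T -> \bar R}) (P Q : T -> Prop) :
  (forall x, P x -> Q x) -> {ae mu, forall x, P x} -> {ae mu, forall x, Q x}.
Proof.
move=> PQ [A [mA A0 PA]]; exists A; split => //; apply: subset_trans PA => x /=.
by apply: contra_not => /PQ.
Qed.

Lemma ae_and d (T : measurableType d) (R : realType)
    (mu : {measure set T -> \bar R}) (P Q : T -> Prop) :
  {ae mu, forall x, P x} -> {ae mu, forall x, Q x} ->
  {ae mu, forall x, P x /\ Q x}.
Proof.
move=> hP hQ; have := negligibleU hP hQ; apply: negligibleS => x /= /not_andP.
by move=> [h|h]; [left|right].
Qed.

(** * Half-open boxes and the Borel structure of R^n *)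

Section boxes.
Context (R : realType).
Local Notation leb := (leb R).
Local Notation lbg := (@lebesgue_measure R).

Definition ocbox n (a b : 'I_n -> R) : set 'rV[R]_n :=
  [set x | forall j, a j < x 0 j <= b j].

Lemma measurable_ocbox n (a b : 'I_n -> R) : measurable (ocbox a b).
Proof.
rewrite (_ : ocbox a b =
  \bigcap_(j in [set: 'I_n]) ((fun x : 'rV[R]_n => x 0 j) @^-1` `]a j, b j])).
  apply: fin_bigcap_measurable => // j _; rewrite -[X in measurable X]setTI.
  exact: measurable_coord.
by rewrite eqEsubset; split => x /= h j; have := h j; rewrite /= in_itv/=; auto.
Qed.

Lemma bounded_coord n (x : 'rV[R]_n) : exists k : nat, forall j, `|x 0 j| < k%:R.
Proof.
exists (Num.bound (\sum_j `|x 0 j|)) => j.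
apply: le_lt_trans (archi_boundP _); last exact: sumr_ge0.
by rewrite (bigD1 j)//= lerDl sumr_ge0.
Qed.

Definition cube n (k : nat) : set 'rV[R]_n := ocbox (fun=> - k%:R) (fun=> k%:R).

Arguments cube : clear implicits.

Lemma bigcup_cube n : \bigcup_k cube n k = setT.
Proof.
rewrite -subTset => x _; have [k xk] := bounded_coord x; exists k => // j.
by have := xk j; rewrite ltr_norml => /andP[-> /ltW ->].
Qed.

Lemma ocbox_setI n (a b a' b' : 'I_n -> R) : ocbox a b `&` ocbox a' b' =
  ocbox (fun j => Num.max (a j) (a' j)) (fun j => Num.min (b j) (b' j)).
Proof.
rewrite eqEsubset; split => [x [h h'] j|x h]; last split => j.
- by have := h j; have := h' j; rewrite gt_max le_min => /andP[-> ->] /andP[-> ->].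
- by have := h j; rewrite gt_max le_min => /andP[/andP[-> _] /andP[-> _]].
- by have := h j; rewrite gt_max le_min => /andP[/andP[_ ->] /andP[_ ->]].
Qed.

Definition ocboxes n : set (set 'rV[R]_n) :=
  [set A | exists a b, A = ocbox a b].

Arguments ocboxes : clear implicits.

Lemma setI_closed_ocboxes n : setI_closed (ocboxes n).
Proof.
move=> A B [a [b ->]] [a' [b' ->]]; rewrite ocbox_setI.
by eexists; eexists.
Qed.

Lemma measurable_ocboxes n : @measurable _ 'rV[R]_n = <<s ocboxes n >>.
Proof.
rewrite eqEsubset; split; last first.
  apply: smallest_sub; first exact: sigma_algebra_measurable.
  by move=> _ [a [b ->]]; exact: measurable_ocbox.
pose T := g_sigma_algebraType (ocboxes n).
suff mid : measurable_fun [set: T] (id : T -> 'rV[R]_n).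
  by move=> A mA; have := mid measurableT A mA; rewrite setTI.
apply: measurable_fun_rVP => i.
apply: (measurability _ (RGenOInfty.measurableE R)) => _ [_ [x ->] <-].
rewrite setTI.
(* A half-space is the union of the boxes bounded by the hyperplane on one side and by the cubes of
   side 2k on the others. *)
rewrite (_ : _ @^-1` _ = \bigcup_k ocbox (fun j => if j == i then x else - k%:R)
   (fun=> k%:R)).
  apply: bigcupT_measurable => k; apply: sub_sigma_algebra.
  by do 2 eexists.
rewrite eqEsubset; split => y /=; rewrite ?in_itv/= ?andbT.
  move=> xy; have [k yk] := bounded_coord (y : 'rV[R]_n); exists k => // j.
  by have := yk j; rewrite ltr_norml => /andP[? /ltW ->]; case: eqP => [->|_];
    rewrite andbT.
by move=> [k _] /(_ i); rewrite eqxx => /andP[].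
Qed.

(** Finiteness gives local integrability of bounded functions; positivity is what later separates
    solutions by their values at the origin. *)
Lemma leb_ocbox n (a b : 'I_n -> R) : (forall j, a j < b j) ->
  (0 < leb n (ocbox a b) < +oo)%E.
Proof.
elim: n a b => [|n IH] a b ab.
  rewrite (_ : ocbox a b = setT); last by rewrite -subTset => x _ [].
  by rewrite /leb/= diracT lte01 ltry.
rewrite (leb_insE ord0 (measurable_ocbox _ _)).
rewrite (_ : _ @^-1` _ = `]a ord0, b ord0] `*`
   ocbox (fun j => a (lift ord0 j)) (fun j => b (lift ord0 j))).
  rewrite product_measure1E//; last exact: measurable_ocbox.
  have /andP[h1 h2] := IH (fun j => a (lift ord0 j)) (fun j => b (lift ord0 j))
    (fun j => ab _).
  set B := ocbox _ _ in h1 h2 *.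
  have lE : lbg `]a ord0, b ord0] = (b ord0 - a ord0)%:E.
    by rewrite lebesgue_measure_itv/= lte_fin ab.
  change (0 < lbg `]a ord0, b ord0]%classic * leb n B < +oo)%E.
  rewrite lE mule_gt0 ?lte_fin ?subr_gt0//=.
  by rewrite lte_mul_pinfty ?lee_fin ?subr_ge0 ?(ltW (ab _)).
rewrite eqEsubset; split => -[t y] /=.
  move=> h; split => [|j]; first by have := h ord0; rewrite ins_at in_itv.
  by have := h (lift ord0 j); rewrite ins_lift.
move=> [ht hy] j; case: (unliftP ord0 j) => [k ->|->].
  by rewrite ins_lift.
by rewrite ins_at; move: ht; rewrite in_itv.
Qed.

Lemma cube_fin n k : (leb n (cube n k) < +oo)%E.
Proof.
(* [leb_ocbox] asks for nondegenerate sides, which the cube of index 0 does not have; the next cube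
   does. *)
apply: (@le_lt_trans _ _ (leb n (cube n k.+1))); last first.
  have kk : - k.+1%:R < k.+1%:R :> R by rewrite -subr_gt0 opprK -natrD ltr0n.
  by have /andP[] := @leb_ocbox n (fun=> - k.+1%:R) (fun=> k.+1%:R) (fun=> kk).
apply: le_measure; rewrite ?inE; [exact: measurable_ocbox..|].
move=> x h j; have /andP[h1 h2] := h j; apply/andP; split.
  by apply: le_lt_trans h1; rewrite lerN2 ler_nat.
by apply: le_trans h2 _; rewrite ler_nat.
Qed.

Lemma ae0_ocbox n (h : 'rV[R]_n -> \bar R) :
  (forall k, (leb n).-integrable (cube n k) h) ->
  (forall a b, (leb n).-integrable (ocbox a b) h ->
     \int[leb n]_(x in ocbox a b) h x = 0)%E ->
  {ae leb n, forall x, h x = 0%E}.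
Proof.
move=> hi h0.
have H k : ae_eq (leb n) (cube n k) h (cst 0%E).
  apply: (dynkin_integral_eq0 (measurable_ocboxes n) (@setI_closed_ocboxes n)).
  - exact: measurable_ocbox.
  - exact: hi.
  - by apply: h0; exact: hi.
  - move=> _ [a [b ->]]; have := hi k; rewrite /cube ocbox_setI => hk.
    apply: h0; apply: integrableS (hi k); rewrite /cube -?ocbox_setI.
    + exact: measurable_ocbox.
    + by apply: measurableI; exact: measurable_ocbox.
    + exact: subIsetl.
have : {ae leb n, forall x k, cube n k x -> h x = 0%E}.
  exact/ae_foralln.
apply: ae_mono => x hx.
have : (\bigcup_k cube n k) x by rewrite bigcup_cube.
by move=> [k _ /hx].
Qed.

(** The sigma-algebra is generated by coordinates, so an open set has to be exhibited as a countable
    union: here of the cells of radius 1/(k+1) centred on the grid of mesh 1/(k+1) that it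
    contains. *)
Lemma open_measurable_rV n (U : set 'rV[R]_n) : open U -> measurable U.
Proof.
move=> oU.
pose cell (p : nat * 'rV[int]_n) : set 'rV[R]_n :=
  [set y | forall j, `|y 0 j - (p.2 0 j)%:~R / p.1.+1%:R| < p.1.+1%:R^-1].
have mcell p : measurable (cell p).
  rewrite (_ : cell p = \bigcap_(j in [set: 'I_n]) ((fun x : 'rV[R]_n => x 0 j)
     @^-1` [set t | `|t - (p.2 0 j)%:~R / p.1.+1%:R| < p.1.+1%:R^-1])).
    apply: fin_bigcap_measurable => // j _; rewrite -[X in measurable X]setTI.
    apply: measurable_coord => //.
    rewrite (_ : [set t | _] = ball ((p.2 0 j)%:~R / p.1.+1%:R : R) p.1.+1%:R^-1).
      exact: measurable_ball.
    by apply/seteqP; split => t /=; rewrite /ball/= distrC.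
  by rewrite eqEsubset; split => x /= h j *; exact: h.
pose F m := if unpickle m is Some p then
   if `[< cell p `<=` U >] then cell p else set0 else set0.
rewrite (_ : U = \bigcup_m F m).
  apply: bigcupT_measurable => m; rewrite /F; case: unpickle => [p|//].
  by case: asboolP.
rewrite eqEsubset; split => [x Ux|x [m _]]; last first.
  by rewrite /F; case: unpickle => [p|//]; case: asboolP => // + ?; apply.
have /nbhs_ballP[e /= e0 eU] : nbhs x U by exact: open_nbhs_nbhs.
(* Two points of one cell are less than 2/(k+1) apart in each coordinate, so such a cell through [x]
   stays in the ball of radius [e]. *)
have [k ke] : exists k : nat, (2 * k.+1%:R^-1 : R) < e.
  exists (Num.bound (2 / e)); rewrite -ltr_pdivlMl// mulrC.
  rewrite -[ltRHS]invrK ltf_pV2 ?posrE ?invr_gt0 ?mulr_gt0 ?invr_gt0//.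
  rewrite invfM invrK mulrC.
  apply: (@lt_trans _ _ (Num.bound (2 / e))%:R); last by rewrite ltr_nat.
  by apply: archi_boundP; rewrite divr_ge0// ltW.
pose z : 'rV[int]_n := \row_j Num.floor (x 0 j * k.+1%:R).
have k0 : 0 < k.+1%:R :> R by rewrite ltr0n.
have xz : cell (k, z) x.
  move=> j /=; rewrite mxE.
  have -> : x 0 j - (Num.floor (x 0 j * k.+1%:R))%:~R / k.+1%:R =
     (x 0 j * k.+1%:R - (Num.floor (x 0 j * k.+1%:R))%:~R) / k.+1%:R.
    by rewrite mulrBl mulfK// gt_eqF.
  rewrite normrM [X in _ * X]gtr0_norm ?invr_gt0// ltr_pdivrMr// mulVf ?gt_eqF//.
  have /andP[f1 f2] := floor_itv (x 0 j * k.+1%:R).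
  by rewrite ger0_norm ?subr_ge0// ltrBlDl -[1]/(1%:~R) -intrD.
exists (pickle (k, z)) => //; rewrite /F pickleK asboolT// => y yz.
apply: eU; rewrite mx_norm_ball /ball_/= /Num.norm/= mx_normrE.
apply/bigmax_ltP; split => // -[i j] _ /=; rewrite ord1 !mxE.
apply: lt_trans ke; rewrite -(subrKA ((z 0 j)%:~R / k.+1%:R)) mulr_natl mulr2n.
by rewrite (le_lt_trans (ler_normD _ _))// ltrD// ?(xz j)// distrC (yz j).
Qed.

Lemma continuous_measurable_rV n (f : 'rV[R]_n -> R) :
  continuous f -> measurable_fun setT f.
Proof.
move=> cf; apply: (measurability _ (RGenOpens.measurableE R)).
move=> _ [_ [U [oU ->] <-]]; rewrite setTI.
by apply: open_measurable_rV; apply: open_comp => // x _; exact: cf.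
Qed.

Lemma compact_measurable_rV n (K : set 'rV[R]_n) : compact K -> measurable K.
Proof.
move=> cK; rewrite -[K]setCK; apply: measurableC; apply: open_measurable_rV.
by apply: closed_openC; apply: compact_closed => //; exact: norm_hausdorff.
Qed.

Lemma compact_sub_cube n (K : set 'rV[R]_n) : compact K ->
  exists k, K `<=` cube n k.
Proof.
move=> /compact_bounded[M [Mr HM]].
exists (Num.bound (`|M| + 1)) => x Kx j.
have xM : `|x| <= `|M| + 1 by apply: HM => //; rewrite ltr_pwDr// ler_norm.
have : `|x 0 j| < (Num.bound (`|M| + 1))%:R.
  apply: le_lt_trans (archi_boundP _) => //; apply: le_trans xM.
  by rewrite {2}/Num.norm/= mx_normrE; apply: (le_bigmax _ _ (0, j)).
by rewrite ltr_norml => /andP[-> /ltW ->].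
Qed.

End boxes.
Arguments cube : clear implicits.

(** * Smooth functions of one variable *)

Section calculus.
Context (R : realType).
Implicit Types (f g : R -> R) (x d df dg : R).

(** Stated without quotient, so that [h] = 0 is allowed and a Taylor estimate yields a derivative at
    once. *)
Lemma derivE_dist x f d :
  (forall e : R, 0 < e -> exists2 del : R, 0 < del & forall h, `|h| < del ->
     `|f (x + h) - f x - d * h| <= e * `|h|) -> is_derive x 1 f d.
Proof.
move=> H.
have L : h^-1 *: ((f \o shift x) (h *: 1) - f x) @[h --> 0^'] --> d.
  apply/cvgrPdist_le => e e0; have [del del0 Hd] := H e e0.
  near=> h.
  have h0 : h != 0 by near: h; exact: nbhs_dnbhs_neq.
  have hd : `|h| < del by near: h; apply: dnbhs0_lt.
  have := Hd h hd; rewrite /= [h%:A]mulr1 [h + x]addrC => Hh.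
  rewrite /GRing.scale/=.
  rewrite -(@ler_pM2r _ `|h|) ?normr_gt0// -normrM mulrBl mulrAC mulVf// mul1r.
  by rewrite distrC.
apply: DeriveDef.
  by apply/cvg_ex; exists d.
exact/cvg_lim.
Unshelve. all: by end_near. Qed.

Lemma is_derive_dist x f d : is_derive x 1 f d ->
  forall e : R, 0 < e -> exists2 del : R, 0 < del & forall h, `|h| < del ->
     `|f (x + h) - f x - d * h| <= e * `|h|.
Proof.
move=> [df dE] e e0.
have : h^-1 *: ((f \o shift x) (h *: 1) - f x) @[h --> 0^'] --> d by rewrite -dE.
move/cvgrPdist_le => /(_ e e0)[del /= del0 Hd]; exists del => // h hd.
have [->|h0] := eqVneq h 0; first by rewrite addr0 subrr mulr0 subrr !normr0 mulr0.
have := Hd h; rewrite /ball_/= sub0r normrN => /(_ hd h0).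
rewrite [h%:A]mulr1 [h + x]addrC /GRing.scale/=.
rewrite -(@ler_pM2r _ `|h|) ?normr_gt0// -normrM mulrBl mulrAC mulVf// mul1r.
by rewrite distrC.
Qed.

Lemma is_derive_continuous x f d : is_derive x 1 f d -> {for x, continuous f}.
Proof. by move=> [df _]; apply/differentiable_continuous/derivable1_diffP. Qed.

Lemma is_derive_near x f g d : (\forall y \near x, f y = g y) ->
  is_derive x 1 f d -> is_derive x 1 g d.
Proof.
move=> [del /= del0 fg] fd; apply: derivE_dist => e e0.
have [del' del'0 H] := is_derive_dist fd e0.
exists (Num.min del del'); first by rewrite lt_min del0.
move=> h; rewrite lt_min => /andP[h1 h2]; rewrite -!fg ?H//=.
  by rewrite subrr normr0.
by rewrite opprD addrA subrr sub0r normrN.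
Qed.

Lemma dcst x (c : R) : is_derive x 1 (fun=> c) 0.
Proof. exact: is_derive_cst. Qed.

Lemma did x : is_derive x 1 (fun t : R => t) 1.
Proof. exact: is_derive_id. Qed.

Lemma dD x f g df dg : is_derive x 1 f df -> is_derive x 1 g dg ->
  is_derive x 1 (fun t => f t + g t) (df + dg).
Proof. by move=> hf hg; exact: is_deriveD. Qed.

Lemma dB x f g df dg : is_derive x 1 f df -> is_derive x 1 g dg ->
  is_derive x 1 (fun t => f t - g t) (df - dg).
Proof. by move=> hf hg; exact: is_deriveB. Qed.

Lemma dN x f df : is_derive x 1 f df -> is_derive x 1 (fun t => - f t) (- df).
Proof. by move=> hf; exact: is_deriveN. Qed.

Lemma dM x f g df dg : is_derive x 1 f df -> is_derive x 1 g dg ->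
  is_derive x 1 (fun t => f t * g t) (df * g x + f x * dg).
Proof.
move=> hf hg; apply: (is_derive_eq (@is_deriveM _ _ f g x 1 df dg hf hg)).
by rewrite /GRing.scale/= addrC (mulrC (g x)).
Qed.

Lemma dZ x f df (c : R) : is_derive x 1 f df ->
  is_derive x 1 (fun t => c * f t) (c * df).
Proof.
by move=> hf; apply: (is_derive_eq (dM (dcst x c) hf)); rewrite mul0r add0r.
Qed.

Lemma dV x f df : f x != 0 -> is_derive x 1 f df ->
  is_derive x 1 (fun t => (f t)^-1) (- df / f x ^+ 2).
Proof.
move=> f0 [hf <-]; apply: DeriveDef; first exact: derivableV.
by rewrite deriveV// /GRing.scale/= mulrC mulrN mulNr.
Qed.

Lemma dcomp x f g df dg : is_derive (f x) 1 g dg -> is_derive x 1 f df ->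
  is_derive x 1 (fun t => g (f t)) (dg * df).
Proof. move=> [hg <-] [hf <-]; apply: DeriveDef.
  have hf' := (derivable1_diffP f x).1 hf.
  have hg' := (derivable1_diffP g (f x)).1 hg.
  exact: (derivable1_diffP (g \o f) x).2 (differentiable_comp hf' hg').
by rewrite -derive1E -(derive1E g) -(derive1E f); exact: (@derive1_comp R f g x hf hg). Qed.

Lemma dX x f df n : is_derive x 1 f df ->
  is_derive x 1 (fun t => f t ^+ n) (n%:R * f x ^+ n.-1 * df).
Proof.
move=> hf; apply: (@dcomp x f (fun y : R => y ^+ n)) => //.
apply: DeriveDef; first exact: exprn_derivable.
by rewrite exp_derive /GRing.scale/= mulr1.
Qed.

Lemma derive_ge0_le f (f' : R -> R) (a b : R) : a <= b ->
  {within `[a, b], continuous f} ->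
  (forall t, a < t < b -> is_derive t 1 f (f' t)) ->
  (forall t, a < t < b -> 0 <= f' t) -> f a <= f b.
Proof.
move=> ab cf df f0.
apply: (@ger0_derive1_ndecr _ f a b) => //.
- by move=> t; rewrite in_itv => /df[].
- by move=> t; rewrite in_itv/= => h; rewrite derive1E; have [_ ->] := df t h; exact: f0.
Qed.

Lemma derive_le0_ge f (f' : R -> R) (a b : R) : a <= b ->
  {within `[a, b], continuous f} ->
  (forall t, a < t < b -> is_derive t 1 f (f' t)) ->
  (forall t, a < t < b -> f' t <= 0) -> f b <= f a.
Proof.
move=> ab cf df f0; rewrite -lerN2.
apply: (@derive_ge0_le (fun t => - f t) (fun t => - f' t)) => //.
- by move=> t; apply: continuousN; exact: cf.
- by move=> t /df h; exact: dN.
- by move=> t /f0; rewrite oppr_ge0.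
Qed.

Lemma derive_eq0_cst f (a b : R) : a <= b ->
  {within `[a, b], continuous f} ->
  (forall t, a < t < b -> is_derive t 1 f 0) -> f a = f b.
Proof.
move=> ab cf df; apply/eqP; rewrite eq_le.
by rewrite (@derive_ge0_le f (fun=> 0))// (@derive_le0_ge f (fun=> 0)).
Qed.

End calculus.

Section smooth.
Context (R : realType).
Implicit Types (f g : R -> R) (k n : nat) (t x : R).

(** The bottom case is trivial rather than continuity: since [smooth] ranges over all orders,
    continuity of each derivative comes from the next one. *)
Fixpoint smk k f : Prop := match k with
  | 0 => True
  | m.+1 => exists2 f' : R -> R, (forall x : R, is_derive x 1 f (f' x)) & smk m f'
  end.

Lemma smkS k f : smk k.+1 f -> smk k f.
Proof.
elim: k f => [//|k IH] f [f' df sf']; exists f' => //; exact: IH.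
Qed.

Lemma smk_cst k (c : R) : smk k (fun=> c).
Proof.
elim: k c => [//|k IH] c; exists (fun=> 0) => // x; exact: dcst.
Qed.

Lemma smk_id k : smk k (fun t : R => t).
Proof.
case: k => [//|k]; exists (fun=> 1); [exact: did|exact: smk_cst].
Qed.

Lemma smkD k f g : smk k f -> smk k g -> smk k (fun t => f t + g t).
Proof.
elim: k f g => [//|k IH] f g [f' df sf] [g' dg sg].
exists (fun t => f' t + g' t); [by move=> x; apply: dD|exact: IH].
Qed.

Lemma smkM k f g : smk k f -> smk k g -> smk k (fun t => f t * g t).
Proof.
elim: k f g => [//|k IH] f g /[dup] /smkS sf0 [f' df sf] /[dup] /smkS sg0 [g' dg sg].
exists (fun t => f' t * g t + f t * g' t); first by move=> x; apply: dM.
by apply: smkD; apply: IH.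
Qed.

Lemma smkV k f : (forall x, f x != 0) -> smk k f -> smk k (fun t => (f t)^-1).
Proof.
move=> f0; elim: k => [//|k IH] /[dup] /smkS sf0 [f' df sf].
exists (fun t => (-1 * f' t) * ((f t)^-1 * (f t)^-1)).
  by move=> x; apply: (is_derive_eq (dV (f0 x) (df x))); rewrite mulN1r expr2 invfM.
by do 2 ?apply: smkM => //; [exact: smk_cst|exact: IH|exact: IH].
Qed.

Lemma smk_comp_affine k f (c d : R) : smk k f -> smk k (fun t => f (c * t + d)).
Proof.
elim: k f => [//|k IH] f [f' df sf]; exists (fun t => f' (c * t + d) * c).
  move=> x; apply: (@dcomp _ x (fun t => c * t + d) f c) => //.
  by apply: (is_derive_eq (dD (dZ c (did x)) (dcst x d))); rewrite addr0 mulr1.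
by apply: smkM; [exact: IH|exact: smk_cst].
Qed.

Lemma smkB k f g : smk k f -> smk k g -> smk k (fun t => f t - g t).
Proof.
move=> sf sg; rewrite (_ : (fun _ => _) = fun t => f t + (-1) * g t).
  by apply: smkD => //; apply: smkM => //; exact: smk_cst.
by apply/funext => t; rewrite mulN1r.
Qed.

Definition smooth f := forall k, smk k f.

Lemma smooth_derive f : smooth f ->
  (forall x, is_derive x 1 f ('D_1 f x)) /\ smooth (fun x => 'D_1 f x).
Proof.
move=> sf; have df x : is_derive x 1 f ('D_1 f x).
  have [f' df _] := sf 1%N; have [h _] := df x.
  exact: derivableP.
split=> // k; have [f' df' sf'] := sf k.+1.
suff -> : (fun x => 'D_1 f x) = f' by [].
by apply/funext => x; have [_ ->] := df' x.
Qed.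

Lemma smooth_continuous f : smooth f -> continuous f.
Proof. by move=> /smooth_derive[df _] x; exact: is_derive_continuous (df x). Qed.

(* The functions [t^-n * exp (-1/t)], extended by 0 to [t <= 0], form a family
   closed under differentiation. *)
Definition flat n (t : R) : R := if 0 < t then t ^- n * expR (- t^-1) else 0.

(** The term of order n + 2 in the exponential series of 1/t beats t^-n with two powers of t to
    spare, which is what differentiability at 0 takes. *)
Lemma flat_le n (t : R) : 0 < t -> flat n t <= (n.+2)`!%:R * t ^+ 2.
Proof.
move=> t0; rewrite /flat t0 expRN.
have tn : 0 < t ^+ n by exact: exprn_gt0.
have f0 : 0 < (n.+2)`!%:R :> R by rewrite ltr0n fact_gt0.
have := @expR_ge1Dxn R t^-1 n.+1; rewrite invr_ge0 ltW// => /(_ isT) H.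
have H2 : t ^- n.+2 / (n.+2)`!%:R <= expR t^-1.
  by apply: le_trans H; rewrite exprVn lerDr.
have p0 : 0 < t ^- n.+2 / (n.+2)`!%:R by rewrite divr_gt0// invr_gt0 exprn_gt0.
have := H2; rewrite -lef_pV2 ?posrE ?expR_gt0// => H3.
apply: (@le_trans _ _ (t ^- n * (t ^- n.+2 / (n.+2)`!%:R)^-1)).
  by rewrite ler_pM2l// invr_gt0.
rewrite invfM !invrK mulrCA [X in _ <= X]mulrC -addn2 exprD.
by rewrite mulrACA divff ?gt_eqF// mul1r.
Qed.

Lemma flat_ge0 n t : 0 <= flat n t.
Proof.
rewrite /flat; case: ifP => // t0.
by rewrite mulr_ge0 ?expR_ge0// invr_ge0 exprn_ge0// ltW.
Qed.

Lemma is_derive_flat n t :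
  is_derive t 1 (flat n) (- n%:R * flat n.+1 t + flat n.+2 t).
Proof.
have [t0|t0|->] := ltgtP t 0.
- rewrite /flat ltNge (ltW t0)/= mulr0 addr0.
  apply: (is_derive_near _ (dcst t 0)).
  near=> y; rewrite ltNge ifN// negbK.
  by near: y; exact: lt_le_nbhsl.
- apply: (@is_derive_near _ t (fun s : R => s ^- n * expR (- s^-1))).
    near=> y; rewrite /flat ifT//; near: y; exact: lt_nbhsr.
  have t00 : t != 0 by rewrite gt_eqF.
  rewrite /flat t0.
  apply: is_derive_eq.
    apply: dM; first by apply: (dV _ (dX n (did t))); rewrite expf_neq0.
    by apply: (dcomp (is_derive_expR _)); apply: dN; apply: (dV t00 (did t)).
  set E := expR _; case: n => [|m] /=.
    by rewrite !expr0 !exprS expr0; field.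
  have u0 : t ^+ m != 0 by rewrite expf_neq0.
  rewrite -/E; move: E => E; rewrite !exprS; move: u0; set u := t ^+ m => u0.
  by field; rewrite t00 u0.
- rewrite {2 3}/flat ltxx mulr0 addr0; apply: derivE_dist => e e0.
  have c0 : 0 < (n.+2)`!%:R :> R by rewrite ltr0n fact_gt0.
  exists (e / (n.+2)`!%:R); first by rewrite divr_gt0.
  move=> h; rewrite add0r mul0r subr0 [flat n 0]/flat ltxx subr0.
  rewrite (ger0_norm (flat_ge0 n h)) (@ltr_pdivlMr R _ _ _ c0) => he.
  have [h0|h0] := ltP 0 h; last first.
    by rewrite /flat ltNge h0/= mulr_ge0// ltW.
  rewrite (le_trans (flat_le n h0))// gtr0_norm// expr2 mulrA ler_pM2r//.
  by rewrite mulrC; move: he; rewrite gtr0_norm// => /ltW.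
Unshelve. all: by end_near. Qed.

Lemma smooth_flat n : smooth (flat n).
Proof.
move=> k; elim: k n => [//|k IH] n.
exists (fun t => - n%:R * flat n.+1 t + flat n.+2 t); first exact: is_derive_flat.
by apply: smkD; [apply: smkM; [exact: smk_cst|exact: IH]|exact: IH].
Qed.

(** The classical smooth transition from 0 to 1 over [0, 1]; the two terms of the denominator never
    vanish together. *)
Definition step (t : R) : R := flat 0 t / (flat 0 t + flat 0 (1 - t)).

Lemma step_den_gt0 t : 0 < flat 0 t + flat 0 (1 - t).
Proof.
have [t0|t0] := ltP 0 t.
  by rewrite ltr_wpDr ?flat_ge0// /flat t0 expr0 invr1 mul1r expR_gt0.
by rewrite ltr_wpDl ?flat_ge0// /flat ifT ?expr0 ?invr1 ?mul1r ?expR_gt0//; lra.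
Qed.

Lemma smooth_step : smooth step.
Proof.
move=> k; apply: smkM; first exact: smooth_flat.
apply: smkV; first by move=> x; rewrite gt_eqF// step_den_gt0.
apply: smkD; first exact: smooth_flat.
rewrite (_ : (fun t => _) = fun t => flat 0 ((-1) * t + 1)).
  exact/smk_comp_affine/smooth_flat.
by apply/funext => t; rewrite mulN1r addrC.
Qed.

Lemma step_le0 t : t <= 0 -> step t = 0.
Proof. by move=> t0; rewrite /step /flat ltNge t0/= mul0r. Qed.

Lemma step_ge1 t : 1 <= t -> step t = 1.
Proof.
move=> t1; rewrite /step; have -> : flat 0 (1 - t) = 0.
  by rewrite /flat ltNge subr_le0 t1.
rewrite addr0 divff// /flat ifT; last by lra.
by rewrite expr0 invr1 mul1r gt_eqF// expR_gt0.
Qed.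

Lemma step_itv t : 0 <= step t <= 1.
Proof.
rewrite /step divr_ge0 ?flat_ge0 ?(ltW (step_den_gt0 _))//=.
by rewrite ler_pdivrMr ?step_den_gt0// mul1r lerDl flat_ge0.
Qed.

End smooth.

(** * Test functions *)

Section test_functions.
Context (R : realType).

Lemma ins_shift n (i : 'I_n.+1) (h t : R) y :
  ins i (h + t, y) = h *: delta_mx 0 i + ins i (t, y) :> 'rV[R]_n.+1.
Proof.
apply/rowP => j; rewrite !mxE; case: (unliftP i j) => [k ->|->] /=.
  by rewrite eq_sym (negbTE (neq_lift _ _)) mulr0 add0r.
by rewrite eqxx mulr1.
Qed.

Lemma derivable_ins n (i : 'I_n.+1) (phi : 'rV[R]_n.+1 -> R) (t : R) y :
  derivable (fun s : R => phi (ins i (s, y))) t 1 =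
  derivable phi (ins i (t, y)) (delta_mx 0 i).
Proof.
have E : (fun h : R => h^-1 *: (((fun s : R => phi (ins i (s, y))) \o shift t) (h *: 1)
    - phi (ins i (t, y)))) =
  (fun h => h^-1 *: ((phi \o shift (ins i (t, y))) (h *: delta_mx 0 i)
    - phi (ins i (t, y)))).
  by apply/funext => h /=; rewrite [h%:A]mulr1 ins_shift.
by rewrite /derivable E.
Qed.

Lemma derive_ins n (i : 'I_n.+1) (phi : 'rV[R]_n.+1 -> R) (t : R) y :
  'D_1 (fun s : R => phi (ins i (s, y))) t = partial i phi (ins i (t, y)).
Proof.
have E : (fun h : R => h^-1 *: (((fun s : R => phi (ins i (s, y))) \o shift t) (h *: 1)
    - phi (ins i (t, y)))) =
  (fun h => h^-1 *: ((phi \o shift (ins i (t, y))) (h *: delta_mx 0 i)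
    - phi (ins i (t, y)))).
  by apply/funext => h /=; rewrite [h%:A]mulr1 ins_shift.
by rewrite /partial /derive E.
Qed.

Definition del n (i : 'I_n.+1) (x : 'rV[R]_n.+1) : 'rV[R]_n :=
  \row_k x 0 (lift i k).

Lemma ins_del n (i : 'I_n.+1) (x : 'rV[R]_n.+1) : ins i (x 0 i, del i x) = x.
Proof.
apply/rowP => j; rewrite mxE; case: (unliftP i j) => [k ->|->] //=.
by rewrite mxE.
Qed.

Definition tprod n (f : 'I_n -> R -> R) (x : 'rV[R]_n) : R :=
  \prod_(j < n) f j (x 0 j).

Lemma tprod_ins n (i : 'I_n.+1) (f : 'I_n.+1 -> R -> R) t y :
  tprod f (ins i (t, y)) = f i t * tprod (fun k => f (lift i k)) y.
Proof.
rewrite /tprod (bigD1_ord i)//= ins_at; congr (_ * _).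
by apply: eq_bigr => k _; rewrite ins_lift.
Qed.

Lemma differentiable_tprod n (f : 'I_n -> R -> R) x :
  (forall j, smooth (f j)) -> differentiable (tprod f) x.
Proof.
move=> sf; rewrite /tprod.
rewrite (_ : (fun _ => _) = \prod_(j < n) (fun x : 'rV[R]_n => f j (x 0 j))); last first.
  apply/funext => y.
  by elim/big_ind2: _ => // g1 g2 h1 h2 -> ->.
elim/big_ind : _ => [|g h dg dh|j _]; first exact: differentiable_cst.
  exact: differentiableM.
apply: (@differentiable_comp _ _ _ _ (fun x : 'rV[R]_n => x 0 j) (f j)).
  exact: differentiable_coord.
apply: (derivable1_diffP _ _).1.
by have [df _] := smooth_derive (sf j); have [] := df (x 0 j).
Qed.

Lemma partial_tprod n (i : 'I_n) (f : 'I_n -> R -> R) :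
  (forall j, smooth (f j)) ->
  partial i (tprod f) = tprod (fun j => if j == i then 'D_1 (f j) else f j).
Proof.
case: n i f => [[]//|n] i f sf; apply/funext => x.
rewrite -(ins_del i x) -derive_ins tprod_ins.
rewrite eqxx (_ : (fun s : R => _) = fun s => f i s * tprod (fun k => f (lift i k)) (del i x)); last first.
  by apply/funext => s; rewrite tprod_ins.
have [df _] := smooth_derive (sf i).
have [_ ->] := dM (df (x 0 i)) (dcst (x 0 i) (tprod (fun k => f (lift i k)) (del i x))).
rewrite mulr0 addr0; congr (_ * tprod _ _).
by apply/funext => k; rewrite eq_sym (negbTE (neq_lift _ _)).
Qed.

(** A partial derivative of a product of one-variable functions is again such a product, with one
    factor differentiated, so the induction on the order never leaves this class. *)
Lemma Ck_tprod n k (f : 'I_n -> R -> R) :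
  (forall j, smooth (f j)) -> Ck k (tprod f).
Proof.
elim: k f => [|k IH] f sf /=.
  by move=> x; apply: differentiable_continuous; exact: differentiable_tprod.
split=> [x|i]; first exact: differentiable_tprod.
rewrite partial_tprod//; apply: IH => j; case: eqP => // _.
by have [] := smooth_derive (sf j).
Qed.

Lemma test_tprod n (f : 'I_n -> R -> R) (L : R) :
  (forall j, smooth (f j)) -> (forall j t, L < `|t| -> f j t = 0) ->
  test_function (tprod f).
Proof.
move=> sf f0; split=> [k|]; first exact: Ck_tprod.
apply: bounded_closed_compact; last exact: closed_closure.
have sub : [set x | tprod f x != 0] `<=` [set x | `|x| <= `|L|].
  move=> x /=; rewrite /tprod prodf_seq_neq0 => /allP H.
  rewrite {1}/Num.norm/= mx_normrE; apply/bigmax_leP; split => // -[i j] _ /=.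
  rewrite ord1 leNgt; apply/negP => Lx.
  have := H j (mem_index_enum _) => /=; rewrite f0 ?eqxx//.
  by apply: le_lt_trans Lx; exact: ler_norm.
have cl : closure [set x : 'rV[R]_n | tprod f x != 0] `<=` [set x | `|x| <= `|L|].
  have cT : closed [set x : 'rV[R]_n | `|x| <= `|L|].
    apply: (@closed_comp _ _ (fun x : 'rV[R]_n => `|x|) [set r | r <= `|L|]).
      by move=> x _; exact: norm_continuous.
    exact: closed_le.
  rewrite [X in _ `<=` X](closure_id _).1//; exact: closure_subset.
exists `|L|; split => // r Lr x /= /cl /= /le_trans; apply; exact: ltW.
Qed.

End test_functions.

(** * Smooth approximations of indicators and of piecewise linear functions *)

Section bumps.
Context (R : realType).
Implicit Types (a b t : R) (k : nat).

(** The transitions sharpen as [k] grows, and the limit is the indicator of ]a, b]. The interval is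
    half-open because [step] vanishes at 0. *)
Definition bump k a b t : R := step (k.+1%:R * (t - a)) - step (k.+1%:R * (t - b)).

Lemma smooth_affine f (c d : R) : smooth f -> smooth (fun t => f (c * (t - d))).
Proof.
move=> sf k; rewrite (_ : (fun t => _) = fun t => f (c * t + (- (c * d)))).
  exact: smk_comp_affine.
by apply/funext => t; rewrite mulrBr.
Qed.

Lemma smooth_bump k a b : smooth (bump k a b).
Proof.
by move=> m; apply: smkB; apply: smooth_affine => // ?; exact: smooth_step.
Qed.

Lemma bump_le1 k a b t : `|bump k a b t| <= 1.
Proof.
have := step_itv (k.+1%:R * (t - a)); have := step_itv (k.+1%:R * (t - b)).
by rewrite /bump ler_norml; lra.
Qed.

Lemma natS_ge1 k : 1 <= k.+1%:R :> R.
Proof. by rewrite ler1n. Qed.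

Lemma mulSn_ge1 k t : 1 <= t -> 1 <= k.+1%:R * t.
Proof. by move=> t1; have := natS_ge1 k; nra. Qed.

Lemma mulSn_le0 k t : t <= 0 -> k.+1%:R * t <= 0.
Proof. by move=> t1; rewrite pmulr_rle0// ltr0n. Qed.

Lemma bump0 k a b t : `|a| + `|b| + 1 < `|t| -> bump k a b t = 0.
Proof.
move=> h; rewrite /bump.
have ha := ler_norm a; have ha' := ler_norm (- a).
have hb := ler_norm b; have hb' := ler_norm (- b).
move: ha' hb'; rewrite !normrN => ha' hb'.
have [t0|t0] := leP 0 t.
  rewrite (ger0_norm t0) in h.
  have H1 : 1 <= t - a by lra.
  have H2 : 1 <= t - b by lra.
  by rewrite !step_ge1 ?subrr// mulSn_ge1.
rewrite (ltr0_norm t0) in h.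
have H1 : t - a <= 0 by lra.
have H2 : t - b <= 0 by lra.
by rewrite !step_le0 ?subrr// mulSn_le0.
Qed.

Lemma cvg_dilate (f : R -> R) a t : (forall s, s <= 0 -> f s = 0) ->
  (forall s, 1 <= s -> f s = 1) ->
  f (k.+1%:R * (t - a)) @[k --> \oo] --> ((a < t)%R%:R : R).
Proof.
move=> f0 f1; have [at_|ta] := ltP a t; last first.
  rewrite (_ : (fun k => _) = fun=> 0); first exact: cvg_cst.
  by apply/funext => k; rewrite f0// mulSn_le0// subr_le0.
apply: cvg_near_cst; near=> k; apply: f1.
rewrite -ler_pdivrMr ?subr_gt0//; apply: (@le_trans _ _ k%:R); last by rewrite ler_nat.
near: k; exact: nbhs_infty_ger.
Unshelve. all: by end_near. Qed.

Lemma cvg_bump a b t : bump k a b t @[k --> \oo] -->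
  ((a < t)%R%:R - (b < t)%R%:R : R).
Proof.
by apply: cvgB; apply: cvg_dilate; [exact: step_le0|exact: step_ge1|exact: step_le0|exact: step_ge1].
Qed.

(** A smooth version of the positive part, exact outside ]0, 1[; dilations of it tend to the
    positive part. *)
Definition ramp t : R := t * step t.

Lemma smooth_ramp : smooth ramp.
Proof. by move=> k; apply: smkM; [exact: smk_id|exact: smooth_step]. Qed.

Lemma ramp_le0 t : t <= 0 -> ramp t = 0.
Proof. by move=> t0; rewrite /ramp step_le0// mulr0. Qed.

Lemma ramp_ge1 t : 1 <= t -> ramp t = t.
Proof. by move=> t0; rewrite /ramp step_ge1// mulr1. Qed.

Lemma ramp_itv t : 0 <= ramp t <= `|t|.
Proof.
have [t0|t0] := leP t 0; first by rewrite ramp_le0// lexx normr_ge0.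
have /andP[s0 s1] := step_itv t.
by rewrite /ramp mulr_ge0 ?(ltW t0)//= gtr0_norm// ler_piMr// ltW.
Qed.

Lemma derive_ramp t : is_derive t 1 ramp ('D_1 ramp t).
Proof. by have [+ _] := smooth_derive smooth_ramp. Qed.

Lemma dramp_le0 t : t <= 0 -> 'D_1 ramp t = 0.
Proof.
move=> t0; have cD : continuous ('D_1 ramp : R -> R).
  by have [_ /smooth_continuous] := smooth_derive smooth_ramp.
have neg s : s < 0 -> 'D_1 ramp s = 0.
  move=> s0; have [_ E] : is_derive s 1 ramp 0.
    apply: (is_derive_near _ (dcst s 0)).
    near=> y; rewrite ramp_le0//; near: y; exact: lt_le_nbhsl.
  exact: E.
(* At the end point 0 the value is the left limit of the continuous derivative. *)
move: t0; rewrite le_eqVlt => /predU1P[->|/neg//].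
have : 'D_1 ramp x @[x --> 0^'-] --> 'D_1 ramp (0 : R).
  by apply: cvg_at_left_filter; exact: cD.
have : 'D_1 ramp x @[x --> (0:R)^'-] --> (0 : R).
  apply: cvg_near_cst; near=> s; apply: neg.
  by near: s; exact: nbhs_left_lt.
by move=> h1 h2; apply: (cvg_unique _ h2 h1).
Unshelve. all: by end_near. Qed.

Lemma dramp_ge1 t : 1 <= t -> 'D_1 ramp t = 1.
Proof.
move=> t0; have cD : continuous ('D_1 ramp : R -> R).
  by have [_ /smooth_continuous] := smooth_derive smooth_ramp.
have neg s : 1 < s -> 'D_1 ramp s = 1.
  move=> s0; have [_ E] : is_derive s 1 ramp 1.
    apply: (is_derive_near _ (did s)).
    near=> y; rewrite ramp_ge1//; near: y; exact: lt_le_nbhsr.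
  exact: E.
move: t0; rewrite le_eqVlt => /predU1P[<-|/neg//].
have : 'D_1 ramp x @[x --> 1^'+] --> 'D_1 ramp (1 : R).
  by apply: cvg_at_right_filter; exact: cD.
have : 'D_1 ramp x @[x --> (1:R)^'+] --> (1 : R).
  apply: cvg_near_cst; near=> s; apply: neg.
  by near: s; exact: nbhs_right_gt.
by move=> h1 h2; apply: (cvg_unique _ h2 h1).
Unshelve. all: by end_near. Qed.

Lemma dramp_bounded : exists2 M : R, 1 <= M & forall t, `|'D_1 ramp t| <= M.
Proof.
have cD : continuous ('D_1 (ramp : R -> R)).
  by have [_ /smooth_continuous] := smooth_derive smooth_ramp.
have cD' : {within `[0, 1], continuous (fun t : R => `|'D_1 (ramp : R -> R) t|)}.
  by apply: continuous_subspaceT => t; apply: cvg_norm; exact: cD.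
have [c _ Hc] := @EVT_max R _ 0 1 ler01 cD'.
exists (`|'D_1 ramp c| + 1); first by rewrite lerDr.
move=> t; have [t0|t0] := leP t 0.
  by rewrite dramp_le0// normr0 addr_ge0.
have [t1|t1] := leP 1 t; first by rewrite dramp_ge1// normr1 lerDr.
apply: (@le_trans _ _ `|'D_1 ramp c|); last by rewrite lerDl.
by apply: (Hc t); rewrite in_itv/= (ltW t0) (ltW t1).
Qed.

(* A smooth approximation of the compactly supported primitive of
   [1_]a, b] - (b - a) 1_]0, 1]]. *)
Definition tri k a b t : R :=
  (ramp (k.+1%:R * (t - a)) - ramp (k.+1%:R * (t - b))) / k.+1%:R
  - (b - a) * ((ramp (k.+1%:R * (t - 0)) - ramp (k.+1%:R * (t - 1))) / k.+1%:R).

Definition dtri k a b t : R :=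
  ('D_1 ramp (k.+1%:R * (t - a)) - 'D_1 ramp (k.+1%:R * (t - b)))
  - (b - a) * ('D_1 ramp (k.+1%:R * (t - 0)) - 'D_1 ramp (k.+1%:R * (t - 1))).

(** One fixed reference interval ]0, 1] serves all [a] and [b]: it cancels the plateau b - a left by
    ]a, b], and it lets every mean be compared with the mean over [0, 1]. *)
Definition tri_oo a b t : R :=
  (Num.max 0 (t - a) - Num.max 0 (t - b))
  - (b - a) * (Num.max 0 (t - 0) - Num.max 0 (t - 1)).

Definition dtri_oo a b t : R :=
  ((a < t)%R%:R - (b < t)%R%:R) - (b - a) * ((0 < t)%R%:R - (1 < t)%R%:R).

Lemma smooth_tri k a b : smooth (tri k a b).
Proof.
have sr (d : R) : smooth (fun t => ramp (k.+1%:R * (t - d))).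
  exact/smooth_affine/smooth_ramp.
move=> m; apply: smkB.
  by apply: smkM; [apply: smkB; exact: sr|exact: smk_cst].
apply: smkM; first exact: smk_cst.
by apply: smkM; [apply: smkB; exact: sr|exact: smk_cst].
Qed.

Lemma derive_tri k a b t : 'D_1 (tri k a b) t = dtri k a b t.
Proof.
have k0 : k.+1%:R != 0 :> R by rewrite pnatr_eq0.
have dr (d : R) : is_derive t 1 (fun t => ramp (k.+1%:R * (t - d)))
   ('D_1 ramp (k.+1%:R * (t - d)) * k.+1%:R).
  apply: (dcomp (derive_ramp _)).
  apply: (is_derive_eq (dZ k.+1%:R (dB (did t) (dcst t d)))).
  by rewrite subr0 mulr1.
have dr2 (d e : R) : is_derive t 1 (fun t =>
    (ramp (k.+1%:R * (t - d)) - ramp (k.+1%:R * (t - e))) / k.+1%:R)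
   ('D_1 ramp (k.+1%:R * (t - d)) - 'D_1 ramp (k.+1%:R * (t - e))).
  apply: (is_derive_eq (dM (dB (dr d) (dr e)) (dcst t k.+1%:R^-1))).
  by rewrite mulr0 addr0 -mulrBl mulfK.
have [_ E] := dB (dr2 a b) (dZ (b - a) (dr2 0 1)).
exact: E.
Qed.

Lemma cvg_dtri a b t : dtri k a b t @[k --> \oo] --> dtri_oo a b t.
Proof.
have H d : 'D_1 ramp (k.+1%:R * (t - d)) @[k --> \oo] --> ((d < t)%R%:R : R).
  exact: (@cvg_dilate (fun s : R => 'D_1 (ramp : R -> R) s) d t dramp_le0 dramp_ge1).
apply: cvgB; first exact: cvgB.
by apply: cvgM; [exact: cvg_cst|exact: cvgB].
Qed.

Lemma cvg_tri a b t : tri k a b t @[k --> \oo] --> tri_oo a b t.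
Proof.
have H d : ramp (k.+1%:R * (t - d)) / k.+1%:R @[k --> \oo] --> Num.max 0 (t - d).
  have [td|td] := leP (t - d) 0.
    rewrite (_ : (fun k => _) = fun=> 0); first exact: cvg_cst.
    by apply/funext => k; rewrite ramp_le0 ?mul0r// mulSn_le0.
  apply: cvg_near_cst; near=> k.
  rewrite ramp_ge1; first by rewrite mulrAC mulfV ?mul1r// pnatr_eq0.
  rewrite -ler_pdivrMr//; apply: (@le_trans _ _ k%:R); last by rewrite ler_nat.
  near: k; exact: nbhs_infty_ger.
rewrite /tri; under eq_fun do rewrite !(mulrBl (_^-1)).
apply: cvgB; first exact: cvgB.
by apply: cvgM; [exact: cvg_cst|exact: cvgB].
Unshelve. all: by end_near. Qed.

Lemma tri0 k a b t : `|a| + `|b| + 2 < `|t| -> tri k a b t = 0.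
Proof.
move=> h; rewrite /tri.
have k0 : k.+1%:R != 0 :> R by rewrite pnatr_eq0.
have ha := ler_norm a; have ha' := ler_norm (- a).
have hb := ler_norm b; have hb' := ler_norm (- b).
move: ha' hb'; rewrite !normrN => ha' hb'.
have [t0|t0] := leP 0 t.
  rewrite (ger0_norm t0) in h.
  rewrite !ramp_ge1; try (apply: mulSn_ge1; lra).
  by field.
rewrite (ltr0_norm t0) in h.
by rewrite !ramp_le0 ?subrr ?mul0r ?mulr0 ?subrr//; apply: mulSn_le0; lra.
Qed.

Lemma tri_oo0 a b t : `|a| + `|b| + 2 < `|t| -> tri_oo a b t = 0.
Proof.
move=> h; apply/esym; apply: (cvg_unique _ _ (cvg_tri (a := a) (b := b) (t := t))) => //.
by rewrite (_ : (fun k => _) = fun=> 0); [exact: cvg_cst|apply/funext => k; exact: tri0].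
Qed.

Lemma tri_bounded a b : exists2 M : R, 0 <= M & forall k t, `|tri k a b t| <= M.
Proof.
pose L := `|a| + `|b| + 2.
pose M := (L + `|a|) + (L + `|b|) + `|b - a| * (L + L + 1).
have M0 : 0 <= M by rewrite /M /L !(addr_ge0, mulr_ge0).
exists M => // k t; have [tL|Lt] := leP `|t| L; last by rewrite tri0// normr0.
have H d : `|ramp (k.+1%:R * (t - d)) / k.+1%:R| <= L + `|d|.
  have k0 : 0 < k.+1%:R :> R by rewrite ltr0n.
  rewrite normrM [X in _ * X]gtr0_norm ?invr_gt0// ler_pdivrMr//.
  have /andP[r0 r1] := ramp_itv (k.+1%:R * (t - d)).
  rewrite ger0_norm// (le_trans r1)// normrM gtr0_norm// mulrC ler_pM2r//.
  by rewrite (le_trans (ler_normB _ _))// lerD2r.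
rewrite /tri !(mulrBl (_^-1)).
rewrite (le_trans (ler_normB _ _))// lerD//.
  by rewrite (le_trans (ler_normB _ _))// lerD.
rewrite normrM ler_wpM2l// (le_trans (ler_normB _ _))//.
have := H 0; have := H 1; rewrite normr0 normr1; lra.
Qed.

Lemma dtri_bounded a b : exists2 M : R, 0 <= M & forall k t, `|dtri k a b t| <= M.
Proof.
have [C C1 HC] := dramp_bounded.
exists ((C + C) + `|b - a| * (C + C)) => [|k t].
  by rewrite addr_ge0 ?mulr_ge0//; lra.
rewrite /dtri (le_trans (ler_normB _ _))// lerD//.
  by rewrite (le_trans (ler_normB _ _))// lerD.
by rewrite normrM ler_wpM2l// (le_trans (ler_normB _ _))// lerD.
Qed.

Lemma dtri0 k a b t : `|a| + `|b| + 2 < `|t| -> dtri k a b t = 0.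
Proof.
move=> h; rewrite -derive_tri.
have [_ E] : is_derive t 1 (tri k a b) 0; last exact: E.
apply: (is_derive_near _ (dcst t 0)); near=> s; rewrite tri0//.
near: s; apply: (cvgr_gt `|t|) => //; exact: norm_continuous.
Unshelve. all: by end_near. Qed.

End bumps.

(** * Primitives of locally integrable functions *)

Section primitives.
Context (R : realType).
Local Notation lbg := (@lebesgue_measure R).
Implicit Types (f g F G V : R -> R) (a b c t : R).

Definition locint g := measurable_fun setT g /\
  forall a b, lbg.-integrable `[a, b] (EFin \o g).

Definition rint a b g : R := \int[lbg]_(t in `[a, b]) g t.

(** Absolute continuity of [V] with derivative [g], expressed through the integral so that [g]
    counts only up to null sets. *)
Definition primitive V g := locint g /\
  forall a b, a <= b -> V b - V a = rint a b g.

Lemma locint_sub g (A : set R) a b : locint g -> measurable A ->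
  A `<=` `[a, b] -> lbg.-integrable A (EFin \o g).
Proof. by move=> [_ /(_ a b)] gi mA Aab; exact: integrableS gi. Qed.

Lemma locint_oc f a b : locint f -> lbg.-integrable `]a, b] (EFin \o f).
Proof.
move=> fi; apply: (locint_sub (a := a) (b := b) fi) => //; exact: subset_itv_oc_cc.
Qed.

Lemma rint_split g a b c : locint g -> a <= b -> b <= c ->
  rint a c g = rint a b g + rint b c g.
Proof.
move=> gi ab bc; have /= H := @Rintegral_itvB R g (BLeft a) (BRight c) b (gi.2 a c).
have := H _ _; rewrite !bnd_simp => /(_ ab bc) /eqP; rewrite subr_eq => /eqP.
rewrite /rint => ->; rewrite addrC; congr (_ + _); apply: Rintegral_itv_obnd_cbnd.
apply: (locint_sub (a := b) (b := c) gi) => //.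
exact: subset_itv_oc_cc.
Qed.

Lemma rintxx g a : rint a a g = 0.
Proof. by rewrite /rint set_itv1 Rintegral_set1. Qed.

Lemma locint_continuous f : continuous f -> locint f.
Proof.
move=> cf; split; first exact: continuous_measurable_fun.
move=> a b; apply: continuous_compact_integrable; first exact: segment_compact.
exact: continuous_subspaceT.
Qed.

Lemma locint_bounded f (M : R) : measurable_fun setT f -> (forall t, `|f t| <= M) ->
  locint f.
Proof.
move=> mf fM; split => // a b.
apply: (@le_integrable _ _ _ lbg `[a, b] _ _ (EFin \o cst M)) => //.
- by apply/measurable_EFinP; exact: measurable_funTS.
- by move=> t _ /=; rewrite lee_fin (le_trans (fM t))// ler_norm.
- by apply: (locint_continuous (f := cst M) _).2 => t; exact: cvg_cst.
Qed.

Lemma primitive_ex g : locint g -> exists2 V, primitive V g & V 0 = 0.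
Proof.
move=> gi; pose V t := if 0 <= t then rint 0 t g else - rint t 0 g.
exists V; last by rewrite /V lexx rintxx.
split=> // a b ab; rewrite /V; case: (leP 0 a) => a0; case: (leP 0 b) => b0.
- by rewrite (rint_split gi a0 ab); ring.
- by move: (lt_le_trans b0 a0); rewrite ltNge ab.
- by rewrite (rint_split gi (ltW a0) b0); ring.
- by rewrite (rint_split gi ab (ltW b0)); ring.
Qed.

Lemma primitive_continuous V g : primitive V g -> continuous V.
Proof.
move=> [gi Vg] t.
have h : {within `[t - 1, t + 1], continuous V}.
  have := @parameterized_integral_continuous R (t - 1) (t + 1) g _ (gi.2 _ _).
  rewrite -subr_ge0 (_ : _ - _ = 2); last by ring.
  move=> /(_ (ler0n _ _)) H.
  have : {within `[t - 1, t + 1], continuous (fun x =>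
      V (t - 1) + parameterized_integral lbg (t - 1) x g)}.
    by move=> x; apply: cvgD; [exact: cvg_cst|exact: H].
  apply: subspace_eq_continuous => x; rewrite inE/= in_itv/= => /andP[tx _].
  change (V (t - 1) + rint (t - 1) x g = V x).
  by rewrite -(Vg _ _ tx); ring.
have := h; rewrite continuous_within_itvP; last by rewrite ltrD2l; lra.
by move=> [+ _ _]; apply; rewrite in_itv/=; apply/andP; split; lra.
Qed.

Lemma primitive_locint V g : primitive V g -> locint V.
Proof. by move/primitive_continuous/locint_continuous. Qed.

Lemma cst_off_finite (S : seq R) F a b : a <= b ->
  {within `[a, b], continuous F} ->
  (forall t, a < t < b -> t \notin S -> is_derive t 1 F 0) -> F a = F b.
Proof.
elim: S a b => [|s S IH] a b ab cF dF.
  by apply: derive_eq0_cst => // t h; exact: dF.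
have [/andP[as_ sb]|nsab] := boolP (a < s < b).
  transitivity (F s); apply: IH; rewrite ?(ltW as_) ?(ltW sb)//.
  - apply: continuous_subspaceW cF; apply: subset_itvl; rewrite bnd_simp; exact: ltW.
  - move=> t /andP[t1 t2] tS; apply: dF; first by rewrite t1 (lt_trans t2).
    by rewrite inE negb_or tS lt_eqF.
  - apply: continuous_subspaceW cF; apply: subset_itvr; rewrite bnd_simp; exact: ltW.
  - move=> t /andP[t1 t2] tS; apply: dF; first by rewrite t2 (lt_trans as_).
    by rewrite inE negb_or tS gt_eqF.
apply: IH => // t tab tS; apply: dF => //; rewrite inE negb_or tS andbT.
by apply: contraNneq nsab => <-.
Qed.

Lemma primitive_derive V g t : primitive V g -> {for t, continuous g} ->
  is_derive t 1 V (g t).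
Proof.
move=> [gi Vg] ct.
have t1 : t < t + 1 by rewrite ltrDl.
have t2 : t - 1 < t by lra.
have /= [D E] := @continuous_FTC1_closed R g (t - 1) t (t + 1) t1 (gi.2 _ _) t2 ct.
have H : is_derive t 1 (fun x => V (t - 1) + rint (t - 1) x g) (0 + g t).
  apply: (dD (dcst t _)); apply: DeriveDef; first exact: D.
  by rewrite -derive1E; exact: E.
rewrite add0r in H; apply: is_derive_near H.
near=> x; rewrite -Vg; first by ring.
by near: x; exact: lt_le_nbhsr.
Unshelve. all: by end_near. Qed.

Lemma primitive_off_finite (S : seq R) F f : continuous F -> locint f ->
  (forall t, t \notin S -> {for t, continuous f}) ->
  (forall t, t \notin S -> is_derive t 1 F (f t)) -> primitive F f.
Proof.
move=> cF fi cf df; split => // a b ab.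
have [V Vf _] := primitive_ex fi.
have H : F a - V a = F b - V b.
  apply: (@cst_off_finite S (fun t => F t - V t)) => //.
    apply: continuous_subspaceT => t; apply: cvgB; first exact: cF.
    exact: primitive_continuous Vf t.
  move=> t _ tS; rewrite -(subrr (f t)); apply: dB; first exact: df.
  exact: primitive_derive Vf (cf _ tS).
by rewrite -Vf.2//; lra.
Qed.

Lemma locintM f g : locint f -> measurable_fun setT g ->
  (forall a b, exists M : R, forall t, a <= t <= b -> `|g t| <= M) ->
  locint (fun t => f t * g t).
Proof.
move=> [mf fi] mg gM; split; first exact: measurable_funM.
move=> a b; have [K HK] := gM a b.
apply: (@le_integrable _ _ _ lbg `[a, b] _ _ (fun t => (`|K| * `|f t|)%:E)) => //.
- by apply/measurable_EFinP; apply: measurable_funTS; exact: measurable_funM.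
- move=> t /=; rewrite in_itv/= => tab; rewrite lee_fin.
  rewrite [leRHS]ger0_norm ?mulr_ge0// normrM mulrC ler_wpM2r//.
  by rewrite (le_trans (HK t tab))// ler_norm.
- have := @integrableZl _ _ _ lbg `[a, b] _ `|K| (EFin \o (fun t => `|f t|)).
  by apply => //; apply: (@integrable_abse _ _ _ lbg `[a,b] (EFin \o f)).
Qed.

Lemma continuous_bounded_itv f : continuous f ->
  forall a b, exists M : R, forall t, a <= t <= b -> `|f t| <= M.
Proof.
move=> cf a b; have [ab|ba] := leP a b; last first.
  by exists 0 => t /andP[h1 h2]; have := le_lt_trans (le_trans h1 h2) ba; rewrite ltxx.
have cf' : {within `[a, b], continuous (fun t => `|f t|)}.
  by apply: continuous_subspaceT => t; apply: cvg_norm; exact: cf.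
have [c _ Hc] := EVT_max ab cf'.
by exists `|f c| => t tab; apply: Hc; rewrite in_itv.
Qed.


(* Both sides of [int f (G - G a) = int g (F b - F)] are the integral of
   [f t * g s] over the triangle [a <= s <= t <= b]. *)
Lemma primitive_parts F f G g : primitive F f -> primitive G g ->
  primitive (fun t => F t * G t) (fun t => f t * G t + F t * g t).
Proof.
move=> Ff Gg.
have [fi HF] := Ff; have [gi HG] := Gg.
have cF := primitive_continuous Ff; have cG := primitive_continuous Gg.
have fGi : locint (fun t => f t * G t).
  by apply: locintM => //; [exact: continuous_measurable_fun|exact: continuous_bounded_itv].
have Fgi : locint (fun t => F t * g t).
  rewrite (_ : (fun t => _) = fun t => g t * F t); last by apply/funext => t; rewrite mulrC.
  by apply: locintM => //; [exact: continuous_measurable_fun|exact: continuous_bounded_itv].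
split.
  split; first by apply: measurable_funD; [exact: fGi.1|exact: Fgi.1].
  move=> a b; apply: (@integrableD _ _ _ lbg `[a, b] _
    (EFin \o (fun t => f t * G t)) (EFin \o (fun t => F t * g t))) => //.
  - exact: fGi.2.
  - exact: Fgi.2.
move=> a b ab.
rewrite /rint RintegralD//; [|exact: fGi.2|exact: Fgi.2].
rewrite -!/(rint _ _ _).
pose D := `[a, b]%classic : set R.
have mD : measurable D by exact: measurable_itv.
have inD s : (s \in D) = (a <= s <= b) by rewrite mem_setE in_itv.
pose chi (t s : R) : R := ((a <= s) && (s <= t) && (t <= b))%R%:R.
pose Phi (p : measurableTypeR R * measurableTypeR R) : R :=
  chi p.1 p.2 * (f p.1 * g p.2).
have mchi : measurable_fun setT (fun p : measurableTypeR R * measurableTypeR R =>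
    chi p.1 p.2).
  have -> : (fun p : measurableTypeR R * measurableTypeR R => chi p.1 p.2) =
     \1_([set p | a <= p.2] `&` [set p | p.2 <= p.1] `&` [set p | p.1 <= b]).
    apply/funext => p; rewrite /chi indicE; congr ((nat_of_bool _)%:R).
    apply/idP/idP.
      by move=> /andP[/andP[h1 h2] h3]; rewrite inE.
    by rewrite inE => -[[/= -> ->] ->].
  apply: measurable_indic; apply: measurableI; first apply: measurableI.
  - rewrite -[X in measurable X]setTI; apply: measurable_fun_le => //.
  - rewrite -[X in measurable X]setTI; apply: measurable_fun_le => //.
  - rewrite -[X in measurable X]setTI; apply: measurable_fun_le => //.
have mPhi : measurable_fun setT (EFin \o Phi).
  apply/measurable_EFinP; apply: measurable_funM => //; apply: measurable_funM.
    by apply: measurableT_comp measurable_fst; exact: fi.1.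
  by apply: measurableT_comp measurable_snd; exact: gi.1.
have iPhi : (lbg \x lbg)%E.-integrable setT (EFin \o Phi).
  apply/integrable12ltyP => //=.
  pose I := (\int[lbg]_(s in D) `|(g s)%:E|)%E.
  have Ioo : (I < +oo)%E by have /integrableP[] := gi.2 a b.
  have I0 : (0 <= I)%E by apply: integral_ge0.
  apply: (@le_lt_trans _ _ (\int[lbg]_(t in D) (`|(f t)%:E| * I))%E); last first.
    rewrite ge0_integralZr//.
    + apply: lte_mul_pinfty => //; first exact: integral_ge0.
      rewrite ge0_fin_numE; first by have /integrableP[] := fi.2 a b.
      by apply: integral_ge0.
    + by apply: measurableT_comp => //; apply/measurable_EFinP/measurable_funTS; exact: fi.1.
  rewrite [leRHS]integral_mkcond.
  apply: ge0_le_integral => //.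
  - by move=> t _; apply: integral_ge0.
  - apply: (measurable_fun_fubini_tonelli_F (fun p => `|(Phi p)%:E|)%E) => //.
    exact: measurableT_comp.
  - apply/(measurable_restrictT _ _).1 => //; apply: emeasurable_funM => //.
    by apply: measurableT_comp => //; apply/measurable_EFinP/measurable_funTS; exact: fi.1.
  - move=> t _; rewrite patchE; case: ifPn => tD.
      rewrite -ge0_integralZl//; last first.
        by apply: measurableT_comp => //; apply/measurable_EFinP/measurable_funTS; exact: gi.1.
      rewrite [leRHS]integral_mkcond; apply: ge0_le_integral => //.
      + apply/measurable_EFinP; apply: measurableT_comp => //.
        by apply/measurable_EFinP; exact: (measurableT_comp mPhi (measurable_pair1 t)).
      + apply/(measurable_restrictT _ _).1 => //; apply: emeasurable_funM => //.
        by apply: measurableT_comp => //; apply/measurable_EFinP/measurable_funTS; exact: gi.1.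
      + move=> s _; rewrite patchE; case: ifPn => sD.
          rewrite /Phi/= lee_fin !normrM ler_piMl ?mulr_ge0//.
          by rewrite /chi; case: (_ && _); rewrite ?normr1 ?normr0.
        rewrite /Phi/= /chi (_ : _ && _ = false) ?mul0r ?normr0//.
        apply: contraNF sD => /andP[/andP[h1 h2] h3]; rewrite inD h1/=.
        exact: le_trans h3.
    rewrite [leLHS]integral0_eq// => s _; rewrite /Phi/= /chi (_ : _ && _ = false) ?mul0r ?normr0//.
    apply: contraNF tD => /andP[/andP[h1 h2] h3]; rewrite inD h3 andbT.
    exact: le_trans h2.
have := Fubini iPhi.
have -> : (\int[lbg]_t \int[lbg]_s (EFin \o Phi) (t, s) =
   (rint a b (fun t => f t * (G t - G a)))%:E)%E.
  have i1 : lbg.-integrable `[a, b] (EFin \o (fun t => f t * (G t - G a))).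
    apply: (locintM fi _ _).2.
      by apply: measurable_funB => //; exact: continuous_measurable_fun.
    by apply: continuous_bounded_itv => t; apply: cvgB; [exact: cG|exact: cvg_cst].
  rewrite /rint /Rintegral fineK; last exact: integrable_fin_num.
  rewrite [RHS]integral_mkcond -/D; apply: eq_integral => t _.
  rewrite patchE; case: ifPn => [|tD]; last first.
    rewrite integral0_eq// => s _; rewrite /Phi/= /chi (_ : _ && _ = false) ?mul0r//.
    apply: contraNF tD => /andP[/andP[h1 h2] h3]; rewrite inD h3 andbT.
    exact: le_trans h2.
  rewrite inD => /andP[at_ tb].
  rewrite EFinM HG// /rint /Rintegral fineK; last exact/integrable_fin_num/gi.2.
  rewrite -integralZl//; last exact: gi.2.
  rewrite [RHS]integral_mkcond -/D; apply: eq_integral => s _.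
  rewrite patchE mem_setE in_itv/= /Phi/chi/= tb andbT.
  by case: (_ && _); rewrite ?mul1r ?mul0r// EFinM.
have -> : (\int[lbg]_s \int[lbg]_t (EFin \o Phi) (t, s) =
   (rint a b (fun s => (F b - F s) * g s))%:E)%E.
  have i1 : lbg.-integrable `[a, b] (EFin \o (fun s => (F b - F s) * g s)).
    rewrite (_ : (fun s => _) = (fun s => g s * (F b - F s))); last first.
      by apply/funext => s; rewrite mulrC.
    apply: (locintM gi _ _).2.
      by apply: measurable_funB => //; exact: continuous_measurable_fun.
    by apply: continuous_bounded_itv => t; apply: cvgB; [exact: cvg_cst|exact: cF].
  rewrite /rint /Rintegral fineK; last exact: integrable_fin_num.
  rewrite [RHS]integral_mkcond -/D; apply: eq_integral => s _.
  rewrite patchE; case: ifPn => [|sD]; last first.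
    rewrite integral0_eq// => t _; rewrite /Phi/= /chi (_ : _ && _ = false) ?mul0r//.
    apply: contraNF sD => /andP[/andP[h1 h2] h3]; rewrite inD h1/=.
    exact: le_trans h3.
  rewrite inD => /andP[as_ sb].
  rewrite mulrC EFinM HF// /rint /Rintegral fineK; last exact/integrable_fin_num/fi.2.
  rewrite -integralZl//; last exact: fi.2.
  rewrite [RHS]integral_mkcond -/D; apply: eq_integral => t _.
  rewrite patchE mem_setE in_itv/= /Phi/chi/= as_/=.
  by case: (_ && _); rewrite ?mul1r ?mul0r// EFinM muleC.
move=> -[].
rewrite (_ : (fun t => f t * (G t - G a)) = fun t => f t * G t - G a * f t); last first.
  by apply/funext => t; ring.
rewrite (_ : (fun t => (F b - F t) * g t) = fun t => F b * g t - F t * g t); last first.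
  by apply/funext => t; ring.
have cZ (c : R) h : locint h -> lbg.-integrable `[a, b] (EFin \o (fun t => c * h t)).
  move=> hi; apply: (@integrableZl _ _ _ lbg `[a, b] _ c (EFin \o h)) => //; exact: hi.2.
rewrite /rint !RintegralB//; [|exact: cZ|exact: Fgi.2|exact: fGi.2|exact: cZ].
rewrite !RintegralZl//; [|exact: gi.2|exact: fi.2].
rewrite -!/(rint _ _ _) -HF// -HG//; lra.
Qed.


Lemma rat_ocitv_generate : @measurable _ (measurableTypeR R) =
  <<s [set A | exists q r : rat, A = `]ratr q : R, ratr r]%classic] >>.
Proof.
rewrite eqEsubset; split; last first.
  apply: smallest_sub; first exact: sigma_algebra_measurable.
  by move=> _ [q [r ->]]; exact: measurable_itv.
pose T := g_sigma_algebraType [set A | exists q r : rat, A = `]ratr q : R, ratr r]%classic].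
suff mid : measurable_fun [set: T] (id : T -> R).
  by move=> A mA; have := mid measurableT A mA; rewrite setTI.
apply: (measurability _ (RGenOInfty.measurableE R)) => _ [_ [x ->] <-].
rewrite setTI preimage_id.
rewrite (_ : `]x, +oo[%classic = \bigcup_(q : rat) \bigcup_(r : rat)
    (if (x <= ratr q) then `]ratr q : R, ratr r]%classic else set0)).
  apply: (@bigcupT_measurable_rat _ T) => q; apply: (@bigcupT_measurable_rat _ T) => r.
  case: ifP => // _; apply: sub_sigma_algebra; by exists q, r.
rewrite eqEsubset; split => y /=; rewrite ?in_itv/= ?andbT.
  move=> xy; have [q] := rat_in_itvoo xy; rewrite in_itv/= => /andP[xq qy].
  have [r] := rat_in_itvoo (ltr_pwDr (@ltr01 R) (lexx y)).
  rewrite in_itv/= => /andP[yr _].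
  exists q => //; exists r => //; rewrite (ltW xq)/= in_itv/= qy; exact: ltW.
move=> [q _ [r _]]; case: ifP => // xq /=; rewrite in_itv/= => /andP[qy _].
exact: le_lt_trans qy.
Qed.

(** Only countably many conditions are imposed on [h]. When they hold for almost every line
    separately, they hold jointly for almost every line. *)
Lemma ae0_rat h : locint h ->
  (forall q r : rat, (ratr q : R) <= ratr r -> rint (ratr q) (ratr r) h = 0) ->
  {ae lbg, forall t, h t = 0}.
Proof.
move=> hi h0.
pose G := [set A | exists q r : rat, A = `]ratr q : R, ratr r]%classic].
have ratn (n : nat) : ratr (n%:R : rat) = n%:R :> R by rewrite ratr_nat.
have sub (q r q' r' : rat) : `]ratr q : R, ratr r] `&` `]ratr q', ratr r'] =
   `]ratr (Num.max q q') : R, ratr (Num.min r r')]%classic.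
  apply/seteqP; split => t /=; rewrite !in_itv/=.
    move=> [/andP[h1 h2] /andP[h3 h4]]; apply/andP; split.
      by case: (leP q q').
    by case: (leP r r').
  move=> /andP[h1 h2]; have qm : (ratr q : R) <= ratr (Num.max q q') /\
     (ratr q' : R) <= ratr (Num.max q q').
    by rewrite !ler_rat !le_max !lexx orbT.
  have rm : (ratr (Num.min r r') : R) <= ratr r /\ (ratr (Num.min r r') : R) <= ratr r'.
    by rewrite !ler_rat !ge_min !lexx orbT.
  split; apply/andP; split.
  - exact: le_lt_trans qm.1 h1.
  - exact: le_trans h2 rm.1.
  - exact: le_lt_trans qm.2 h1.
  - exact: le_trans h2 rm.2.
have G0 (q r : rat) : (\int[lbg]_(t in `]ratr q, ratr r]) (h t)%:E = 0)%E.
  have [qr|rq] := leP (ratr q : R) (ratr r); last first.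
    rewrite set_itv_ge ?integral_set0// bnd_simp -leNgt; exact: ltW.
  have hqr := hi.2 (ratr q) (ratr r).
  rewrite integral_itv_obnd_cbnd; last first.
    by apply/measurable_EFinP; apply: measurable_funTS; exact: hi.1.
  by rewrite -[LHS]fineK ?integrable_fin_num//; congr EFin; exact: h0.
pose D (n : nat) := `]ratr (- n%:R : rat) : R, ratr (n%:R : rat)]%classic.
have H n : ae_eq lbg (D n) (EFin \o h) (cst 0%E).
  apply: (@dynkin_integral_eq0 _ (measurableTypeR R) R lbg G (D n)).
  - exact: rat_ocitv_generate.
  - by move=> _ _ [q [r ->]] [q' [r' ->]]; rewrite sub; do 2 eexists.
  - exact: measurable_itv.
  - exact: locint_oc.
  - exact: G0.
  - by move=> _ [q [r ->]]; rewrite /D sub; exact: G0.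
have : {ae lbg, forall t n, D n t -> (h t)%:E = 0%E} by exact/ae_foralln.
apply: ae_mono => t ht.
have : (\bigcup_n D n) t.
  exists (Num.bound `|t|) => //; rewrite /D /= in_itv/= rmorphN/= ratn.
  have : `|t| < (Num.bound `|t|)%:R by apply: archi_boundP.
  by rewrite ltr_norml => /andP[-> /ltW ->].
by move=> [n _ /ht[]].
Qed.

Lemma rint_indic f a b L : locint f -> - L <= a -> a <= b -> b <= L ->
  rint (- L) L (fun t => f t * ((a < t)%R%:R - (b < t)%R%:R)) = rint a b f.
Proof.
move=> fi La ab bL.
rewrite /rint -[in RHS]Rintegral_itv_obnd_cbnd; last first.
  exact: locint_oc.
rewrite [LHS]Rintegral_mkcond [RHS]Rintegral_mkcond.
apply: eq_Rintegral => t _; rewrite !patchE !mem_setE !in_itv/=.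
have [at_|ta] := ltP a t; have [bt|tb] := ltP b t; rewrite /= ?subrr ?subr0 ?mulr0 ?mulr1 ?if_same//.
- by rewrite (le_trans La (ltW at_)) (le_trans tb bL).
- by have := lt_le_trans bt ta; rewrite ltNge ab.
Qed.

Lemma measurable_gt_indic (d : R) : measurable_fun setT (fun t : R => (d < t)%R%:R : R).
Proof.
rewrite (_ : (fun t : R => _) = \1_(`]d, +oo[%classic)); first exact: measurable_indic.
by apply/funext => t; rewrite indicE mem_setE in_itv/= andbT.
Qed.

Lemma measurable_dtri_oo a b : measurable_fun setT (dtri_oo a b : R -> R).
Proof.
have m := measurable_gt_indic.
by do 4 (apply: measurable_funB || apply: measurable_funM || idtac) => //;
  try exact: m; apply: measurable_funB; exact: m.
Qed.

Lemma dtri_oo_bounded a b : exists M : R, forall t, `|dtri_oo a b t| <= M.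
Proof.
exists (1 + `|b - a|) => t; rewrite /dtri_oo.
have h (c d : R) : `|(c < t)%R%:R - (d < t)%R%:R| <= 1 :> R.
  by case: (c < t); case: (d < t); rewrite /= ?subrr ?subr0 ?sub0r ?normrN ?normr0 ?normr1.
by rewrite (le_trans (ler_normB _ _))// lerD// normrM ler_piMr.
Qed.

Lemma primitive_tri_oo a b : primitive (tri_oo a b) (dtri_oo a b).
Proof.
have cm (d : R) : continuous (fun t : R => Num.max 0 (t - d)).
  rewrite (_ : (fun t : R => _) = fun t => 2^-1 * (t - d + `|t - d|)); last first.
    by apply/funext => t; case: (leP (t - d) 0) => h;
      [rewrite ler0_norm|rewrite gtr0_norm]; rewrite //; lra.
  have cd : continuous (fun t : R => t - d).
    by move=> t; apply: cvgB; [exact: cvg_id|exact: cvg_cst].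
  move=> t; apply: cvgM; first exact: cvg_cst.
  by apply: cvgD; [exact: cd|apply: cvg_norm; exact: cd].
have dm (d t : R) : t != d -> is_derive t 1 (fun t : R => Num.max 0 (t - d)) ((d < t)%R%:R).
  move=> td; have [lt|gt|e] := ltgtP d t.
  - apply: (is_derive_near _ (is_derive_eq (dB (did t) (dcst t d)) (subr0 _))).
    near=> y; rewrite max_r// subr_ge0; near: y; exact: lt_le_nbhsr.
  - apply: (is_derive_near _ (dcst t 0)).
    near=> y; rewrite max_l// subr_le0; near: y; exact: lt_le_nbhsl.
  - by rewrite e eqxx in td.
have cl (d t : R) : t != d -> {for t, continuous (fun t : R => (d < t)%R%:R : R)}.
  move=> td; have [lt|gt|e] := ltgtP d t.
  - rewrite /prop_for /continuous_at lt; apply: cvg_near_cst; near=> y.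
    by rewrite (_ : d < y)//; near: y; exact: lt_nbhsr.
  - rewrite /prop_for /continuous_at ltNge (ltW gt)/=; apply: cvg_near_cst; near=> y.
    by rewrite ltNge (_ : y <= d)//; near: y; exact: lt_le_nbhsl.
  - by rewrite e eqxx in td.
apply: (@primitive_off_finite [:: a; b; 0; 1]).
- move=> t; apply: cvgB; first by apply: cvgB; exact: cm.
  by apply: cvgM; [exact: cvg_cst|apply: cvgB; exact: cm].
- have [M HM] := dtri_oo_bounded a b.
  exact: (locint_bounded (measurable_dtri_oo a b) HM).
- move=> t; rewrite !inE !negb_or => /and4P[ta tb t0 t1].
  apply: cvgB; first by apply: cvgB; exact: cl.
  by apply: cvgM; [exact: cvg_cst|apply: cvgB; exact: cl].
- move=> t; rewrite !inE !negb_or => /and4P[ta tb t0 t1].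
  by apply: dB; [apply: dB; exact: dm|apply: dZ; apply: dB; exact: dm].
Unshelve. all: by end_near. Qed.

(* Du Bois-Reymond's lemma, tested on countably many functions only. *)
Lemma primitive_of_tri v g : locint v -> locint g ->
  (forall q r : rat, (ratr q : R) < ratr r ->
   forall L : R, `|ratr q : R| + `|ratr r| + 2 < L ->
     rint (- L) L (fun t => v t * dtri_oo (ratr q) (ratr r) t
       + g t * tri_oo (ratr q) (ratr r) t) = 0) ->
  exists2 V, primitive V g & {ae lbg, forall t, v t = V t}.
Proof.
move=> vi gi H.
have [V Vg _] := primitive_ex gi; have cV := primitive_continuous Vg.
have Vi := primitive_locint Vg.
pose w t := v t - V t.
have sub_ f h : locint f -> locint h -> locint (fun t => f t - h t).
  move=> fi hi; split; first by apply: measurable_funB; [exact: fi.1|exact: hi.1].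
  move=> a b; apply: (@integrableB _ _ _ lbg `[a, b] _ (EFin \o f) (EFin \o h)) => //.
  - exact: fi.2.
  - exact: hi.2.
have wi : locint w by exact: sub_.
(* The test functions show that the mean of [w] over every rational interval equals its mean [c]
   over the reference interval, so [w] is constant almost everywhere. *)
pose c := rint 0 1 w.
have key (q r : rat) : (ratr q : R) < ratr r ->
    rint (ratr q) (ratr r) w = (ratr r - ratr q) * c.
  set a : R := ratr q; set b : R := ratr r => ab.
  pose L := `|a| + `|b| + 3.
  have L0 : 0 <= L by rewrite /L !addr_ge0.
  have na := ler_norm a; have na' := ler_norm (- a).
  have nb := ler_norm b; have nb' := ler_norm (- b); rewrite !normrN in na' nb'.
  have LL : - L <= L by lra.
  have tL : tri_oo a b L = 0 by apply: tri_oo0; rewrite (ger0_norm L0) /L; lra.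
  have tL' : tri_oo a b (- L) = 0 by apply: tri_oo0; rewrite normrN (ger0_norm L0) /L; lra.
  have Tp := primitive_tri_oo a b.
  have P := primitive_parts Vg Tp.
  have := P.2 _ _ LL; rewrite tL tL' !mulr0 subrr => P0.
  have HL : `|a| + `|b| + 2 < L by rewrite /L; lra.
  have H0 := H q r ab L HL; rewrite -/a -/b in H0.
  have Ti : continuous (tri_oo a b : R -> R) := primitive_continuous Tp.
  have [M HM] := dtri_oo_bounded a b.
  have vd f : locint f -> locint (fun t => f t * dtri_oo a b t).
    move=> fi; apply: locintM => //; first exact: measurable_dtri_oo.
    by move=> *; exists M.
  have gt : locint (fun t => g t * tri_oo a b t).
    apply: locintM => //; first exact: continuous_measurable_fun.
    exact: continuous_bounded_itv.
  have E : rint (- L) L (fun t => w t * dtri_oo a b t) = 0.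
    rewrite -[RHS](subrr 0) -{1}H0 P0 /rint -RintegralB//; last 2 first.
    - apply: (@integrableD _ _ _ lbg _ _ (EFin \o (fun t => v t * dtri_oo a b t))
        (EFin \o (fun t => g t * tri_oo a b t))) => //; [exact: (vd _ vi).2|exact: gt.2].
    - exact: P.1.2.
    by apply: eq_Rintegral => t _; rewrite /w; ring.
  have i1 (x y : R) : locint (fun t => w t * ((x < t)%R%:R - (y < t)%R%:R)).
    apply: locintM => //.
      by apply: measurable_funB; exact: measurable_gt_indic.
    by move=> *; exists 1 => t _; case: (x < t); case: (y < t);
      rewrite /= ?subrr ?subr0 ?sub0r ?normrN ?normr0 ?normr1.
  move: E; rewrite (_ : (fun t => _) = fun t =>
     w t * ((a < t)%R%:R - (b < t)%R%:R)
     - (b - a) * (w t * ((0 < t)%R%:R - (1 < t)%R%:R))); last first.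
    by apply/funext => t; rewrite /dtri_oo; ring.
  rewrite /rint RintegralB//; last 2 first.
  - exact: (i1 a b).2.
  - apply: (@integrableZl _ _ _ lbg _ _ (b - a) (EFin \o (fun t =>
      w t * ((0 < t)%R%:R - (1 < t)%R%:R)))) => //; exact: (i1 0 1).2.
  rewrite RintegralZl//; last exact: (i1 0 1).2.
  have La : - L <= a by rewrite /L; lra.
  have bL : b <= L by rewrite /L; lra.
  have L1 : 1 <= L by rewrite /L; lra.
  have L00 : - L <= 0 by rewrite oppr_le0.
  rewrite -!/(rint _ _ _) (rint_indic wi La (ltW ab) bL) (rint_indic wi L00 ler01 L1).
  by move/eqP; rewrite subr_eq0 => /eqP.
exists (fun t => V t - - c).
  split=> // x y xy; rewrite -Vg.2//; lra.
have : {ae lbg, forall t, w t - c = 0}.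
  apply: ae0_rat.
    by apply: sub_ => //; apply: locint_continuous => t; exact: cvg_cst.
  move=> q r; rewrite le_eqVlt => /predU1P[->|qr]; first by rewrite rintxx.
  have ci : lbg.-integrable `[ratr q : R, ratr r] (EFin \o cst c).
    by apply: (locint_continuous (f := cst c) _).2 => t; exact: cvg_cst.
  rewrite /rint RintegralB//; last exact: wi.2.
  have -> : \int[lbg]_(x in `[ratr q, ratr r]) c = c * (ratr r - ratr q).
    rewrite Rintegral_cst//; congr (_ * _).
    have lE : lbg `[ratr q : R, ratr r] = (ratr r - ratr q)%:E.
      by rewrite lebesgue_measure_itv/= lte_fin qr.
    exact: (f_equal fine lE).
  have := key q r qr; rewrite /rint => ->; lra.
by apply: ae_mono => t; rewrite /w => ?; lra.
Qed.

End primitives.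

(** * Weak partial derivatives *)

Section weak.
Context (R : realType).
Local Notation leb := (leb R).
Local Notation lbg := (@lebesgue_measure R).

Lemma measurable_cube n k : measurable (cube R n k).
Proof. exact: measurable_ocbox. Qed.

Lemma loc_cube n (u : 'rV[R]_n -> R) k : loc_integrable u ->
  (leb n).-integrable (cube R n k) (EFin \o u).
Proof.
move=> [mu ui].
pose K := [set x : 'rV[R]_n | forall j, `[- k%:R : R, k%:R]%classic (x ord0 j)].
have cK : compact K by apply: (@rV_compact R n (fun=> `[- k%:R : R, k%:R]%classic)) => j; exact: segment_compact.
have mK : measurable K by exact: compact_measurable_rV.
apply: (@integrableS _ _ _ _ K) => //; first exact: measurable_cube.
  move=> x h j; have := h j => /= /andP[h1 h2]; rewrite in_itv/= h2 andbT; exact: ltW.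
apply/integrableP; split; last exact: ui.
by apply/measurable_EFinP; exact: measurable_funTS.
Qed.

Lemma loc_mul n (u phi : 'rV[R]_n -> R) (M : R) k : loc_integrable u ->
  measurable_fun setT phi -> (forall x, `|phi x| <= M) ->
  (forall x, ~ cube R n k x -> phi x = 0) ->
  (leb n).-integrable setT (EFin \o (fun x => u x * phi x)).
Proof.
move=> ui mphi phiM phi0; have mc := @measurable_cube n k.
have ri := (integrable_mkcond (EFin \o u) mc).1 (loc_cube k ui).
apply: (@le_integrable _ _ _ (leb n) setT _ _ (fun x => M%:E * `|((EFin \o u) \_ (cube R n k)) x|)%E) => //.
- by apply/measurable_EFinP; apply: measurable_funM => //; case: ui.
- move=> x _; rewrite patchE; case: ifPn => xk.
    rewrite /= lee_fin normrM [X in _ <= X]ger0_norm ?mulr_ge0//; last first.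
      exact: le_trans (phiM x).
    by rewrite mulrC ler_wpM2r.
  by rewrite /= phi0 ?mulr0 ?normr0 ?lee_fin ?normr_ge0// => /mem_set; apply/negP.
- by apply: integrableZl => //; exact: integrable_abse.
Qed.

Lemma loc_cvg n (u : 'rV[R]_n -> R) (phi_ : nat -> 'rV[R]_n -> R) phi (M : R) k :
  loc_integrable u ->
  (forall m, measurable_fun setT (phi_ m)) -> (forall m x, `|phi_ m x| <= M) ->
  (forall m x, ~ cube R n k x -> phi_ m x = 0) ->
  (forall x, phi_ m x @[m --> \oo] --> phi x) ->
  \int[leb n]_x (u x * phi_ m x) @[m --> \oo] --> \int[leb n]_x (u x * phi x).
Proof.
move=> ui mphi phiM phi0 cphi; have mc := @measurable_cube n k.
have mphioo : measurable_fun setT phi.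
  by apply: (measurable_fun_cvg mphi) => x _; exact: cphi.
have phiM' x : `|phi x| <= M.
  have c : `|phi_ m x| @[m --> \oo] --> `|phi x| by apply: cvg_norm; exact: cphi.
  rewrite -(cvg_lim (@Rhausdorff R) c).
  by apply: limr_le; [apply/cvg_ex; eexists; exact: c|exact: nearW].
have phi0' x : ~ cube R n k x -> phi x = 0.
  move=> xk; apply: (cvg_unique _ (cphi x)) => //.
  rewrite /= (_ : (fun m => phi_ m x) = fun=> 0); first exact: cvg_cst.
  by apply/funext => m; exact: phi0.
have ri := (integrable_mkcond (EFin \o u) mc).1 (loc_cube k ui).
have D : (\int[leb n]_x (u x * phi_ m x)%:E @[m --> \oo] --> \int[leb n]_x (u x * phi x)%:E)%E.
  apply: (@dominated_cvg _ _ _ (leb n) setT measurableT _ _ (fun x => M%:E * `|((EFin \o u) \_ (cube R n k)) x|)%E) => //.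
  - move=> m; apply/measurable_EFinP; apply: measurable_funM => //; by case: ui.
  - by move=> x _; apply: cvg_EFin; [exact: nearW|apply: cvgM => //; exact: cvg_cst].
  - by move=> x _; rewrite patchE; case: ifP.
  - by apply: integrableZl => //; exact: integrable_abse.
  - move=> m x _; rewrite patchE; case: ifPn => xk.
      by rewrite /= lee_fin normrM mulrC ler_wpM2r.
    by rewrite /= phi0 ?mulr0 ?normr0 ?mule0// => /mem_set; apply/negP.
apply: fine_cvg; rewrite fineK//.
apply: integrable_fin_num => //; exact: (loc_mul (M := M) (k := k)).
Qed.

Lemma measurable_tprod n (f : 'I_n -> R -> R) :
  (forall j, measurable_fun setT (f j)) -> measurable_fun setT (tprod f).
Proof.
move=> mf; rewrite /tprod.
apply: (@measurable_prod _ _ _ setT _ _ (fun j (x : 'rV[R]_n) => f j (x 0 j))) => j _.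
exact: measurableT_comp (mf j) (measurable_coord _).
Qed.

Lemma tprod_le n (f : 'I_n -> R -> R) (M : R) x : 1 <= M ->
  (forall j t, `|f j t| <= M) -> `|tprod f x| <= M ^+ n.
Proof.
move=> M1 fM; rewrite /tprod normr_prod -[in X in _ <= X](card_ord n) -prodr_const.
by apply: ler_prod => j _; rewrite normr_ge0 fM.
Qed.

Lemma tprod0 n (f : 'I_n -> R -> R) (k : nat) x :
  (forall j t, k%:R <= `|t| -> f j t = 0) -> ~ cube R n k x -> tprod f x = 0.
Proof.
move=> f0 xk; apply/eqP; rewrite /tprod prodf_seq_eq0; apply/hasP.
apply: contrapT => H; apply: xk => j.
have : `|x 0 j| < k%:R.
  rewrite ltNge; apply/negP => kx; apply: H; exists j; first exact: mem_index_enum.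
  by rewrite /= f0.
by rewrite ltr_norml => /andP[-> /ltW ->].
Qed.

Lemma cvg_tprod n (f_ : nat -> 'I_n -> R -> R) (f : 'I_n -> R -> R) x :
  (forall j t, f_ m j t @[m --> \oo] --> f j t) ->
  tprod (f_ m) x @[m --> \oo] --> tprod f x.
Proof.
move=> H; rewrite /tprod; elim: (index_enum _) => [|j s IH].
  by under eq_fun do rewrite big_nil; rewrite big_nil; exact: cvg_cst.
by under eq_fun do rewrite big_cons; rewrite big_cons; apply: cvgM.
Qed.

Definition wstep (a b t : R) : R := (a < t)%R%:R - (b < t)%R%:R.

Lemma wstep_indic n (a b : 'I_n -> R) (x : 'rV[R]_n) : (forall j, a j <= b j) ->
  tprod (fun j => wstep (a j) (b j)) x = \1_(ocbox a b) x.
Proof.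
move=> ab; rewrite indicE /tprod; case: (boolP (x \in ocbox a b)) => xo.
  rewrite big1// => j _; move: xo; rewrite inE => /(_ j)/andP[h1 h2].
  by rewrite /wstep h1 ltNge h2/= subr0.
apply/eqP; rewrite prodf_seq_eq0; apply/hasP; apply: contrapT => H.
move/negP: xo; apply; rewrite inE => j.
have := contrapT; apply => xj; apply: H; exists j; first exact: mem_index_enum.
rewrite /= /wstep; apply/eqP; move/negP: xj; rewrite negb_and -leNgt -ltNge.
move=> /orP[h|h]; first by rewrite !ltNge h (le_trans h (ab j))/= subrr.
by rewrite h (le_lt_trans (ab j) h) subrr.
Qed.

(** Dominated convergence carries the integration by parts formula to bounded pointwise limits of
    smooth product functions with common support, thus to products of box indicators with a
    piecewise linear function. *)
Lemma weak_partial_cvg n (i : 'I_n) (v g : 'rV[R]_n -> R)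
    (f_ df_ : nat -> 'I_n -> R -> R) (f df : 'I_n -> R -> R) (M : R) (k : nat) :
  is_weak_partial i v g -> 1 <= M ->
  (forall m j, smooth (f_ m j)) ->
  (forall m j, df_ m j = if j == i then 'D_1 (f_ m j) else f_ m j) ->
  (forall m j t, `|f_ m j t| <= M) -> (forall m j t, `|df_ m j t| <= M) ->
  (forall m j t, k%:R <= `|t| -> f_ m j t = 0) ->
  (forall m j t, k%:R <= `|t| -> df_ m j t = 0) ->
  (forall j t, f_ m j t @[m --> \oo] --> f j t) ->
  (forall j t, df_ m j t @[m --> \oo] --> df j t) ->
  \int[leb n]_x (v x * tprod df x) = - \int[leb n]_x (g x * tprod f x).
Proof.
move=> [vi gi H] M1 sf dfE fM dfM f0 df0 cf cdf.
have sdf m j : smooth (df_ m j).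
  by rewrite dfE; case: ifP => // _; have [] := smooth_derive (sf m j).
have ms h : smooth h -> measurable_fun setT (h : R -> R).
  by move=> /smooth_continuous; exact: continuous_measurable_fun.
have c1 := @loc_cvg n v (fun m => tprod (df_ m)) (tprod df) (M ^+ n) k vi
  (fun m => measurable_tprod (fun j => ms _ (sdf m j)))
  (fun m x => tprod_le x M1 (dfM m)) (fun m x => @tprod0 n _ k x (df0 m))
  (fun x => @cvg_tprod n _ _ x cdf).
have c2 := @loc_cvg n g (fun m => tprod (f_ m)) (tprod f) (M ^+ n) k gi
  (fun m => measurable_tprod (fun j => ms _ (sf m j)))
  (fun m x => tprod_le x M1 (fM m)) (fun m x => @tprod0 n _ k x (f0 m))
  (fun x => @cvg_tprod n _ _ x cf).
apply: (cvg_unique _ c1) => //; move/cvgN: c2; apply: cvg_trans.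
apply: near_eq_cvg; apply: nearW => m /=.
transitivity (- \int[leb n]_x (g x * tprod (f_ m) x)); first by [].
rewrite -(H (tprod (f_ m))); last first.
  by apply: (test_tprod (L := k%:R)) => // j t /ltW; exact: f0.
rewrite partial_tprod//; apply: eq_Rintegral => x _; congr (_ * tprod _ _).
by apply/funext => j; rewrite dfE.
Qed.

Lemma cvg_wstep a b t : bump m a b t @[m --> \oo] --> wstep a b t.
Proof. exact: cvg_bump. Qed.

Lemma nat_ge (s : seq R) : exists k : nat, forall x, x \in s -> x <= k%:R.
Proof.
elim: s => [|x s [k IH]]; first by exists 0%N.
exists (maxn k (Num.bound `|x|)) => y; rewrite inE => /predU1P[->|/IH yk].
  apply: (@le_trans _ _ (Num.bound `|x|)%:R); last by rewrite ler_nat leq_maxr.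
  by apply: (le_trans (ler_norm _)); apply/ltW/archi_boundP.
by apply: (le_trans yk); rewrite ler_nat leq_maxl.
Qed.

Lemma bound_ord n (f : 'I_n -> R) : exists k : nat, forall j, f j < k%:R.
Proof.
have [k H] := nat_ge [seq f j | j <- enum 'I_n].
exists k.+1 => j; apply: (@le_lt_trans _ _ k%:R); last by rewrite ltr_nat.
by apply: H; apply: map_f; rewrite mem_enum.
Qed.

(** The limiting test function is piecewise linear in direction [i] and a box indicator in the
    others; letting the box vary localises the identity to almost every line. *)
Lemma weak_partial_tri n (i : 'I_n.+1) (v g : 'rV[R]_n.+1 -> R) (a b : R)
    (a' b' : 'I_n -> R) : is_weak_partial i v g ->
  (forall j, a' j <= b' j) ->
  \int[leb n.+1]_x (v x * (dtri_oo a b (x 0 i) * \1_(ocbox a' b') (del i x))) =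
  - \int[leb n.+1]_x (g x * (tri_oo a b (x 0 i) * \1_(ocbox a' b') (del i x))).
Proof.
move=> H ab'.
have [M1 M10 HM1] := tri_bounded a b.
have [M2 M20 HM2] := dtri_bounded a b.
have [k1 Hk1] := bound_ord (fun j => `|a' j| + `|b' j| + 1).
have [k2 Hk2] := nat_ge [:: `|a| + `|b| + 2 + 1].
have {}Hk2 : `|a| + `|b| + 2 < k2%:R.
  by apply: lt_le_trans (Hk2 _ (mem_head _ _)); rewrite ltrDl.
pose F (m : nat) (j : 'I_n.+1) : R -> R :=
  oapp (fun l => bump m (a' l) (b' l)) (tri m a b) (unlift i j).
pose dF (m : nat) (j : 'I_n.+1) : R -> R :=
  oapp (fun l => bump m (a' l) (b' l)) (dtri m a b) (unlift i j).
pose f (j : 'I_n.+1) : R -> R :=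
  oapp (fun l => wstep (a' l) (b' l)) (tri_oo a b) (unlift i j).
pose df (j : 'I_n.+1) : R -> R :=
  oapp (fun l => wstep (a' l) (b' l)) (dtri_oo a b) (unlift i j).
pose k := maxn k1 k2.
have kk1 : k1%:R <= k%:R :> R by rewrite ler_nat leq_maxl.
have kk2 : k2%:R <= k%:R :> R by rewrite ler_nat leq_maxr.
have E := @weak_partial_cvg n.+1 i v g F dF f df (1 + M1 + M2) k H.
have {E} : \int[leb n.+1]_x (v x * tprod df x) = - \int[leb n.+1]_x (g x * tprod f x).
  apply: E.
  - by rewrite -addrA lerDl addr_ge0.
  - move=> m j; rewrite /F; case: unliftP => [l _|_]; [exact: smooth_bump|exact: smooth_tri].
  - move=> m j; rewrite /dF /F; case: unliftP => [l ->|->] /=.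
      by rewrite eq_sym (negbTE (neq_lift _ _)).
    by rewrite eqxx; apply/funext => t; rewrite derive_tri.
  - move=> m j t; rewrite /F; case: unliftP => [l _|_] /=.
      by apply: le_trans (bump_le1 _ _ _ _) _; rewrite -addrA lerDl addr_ge0.
    by apply: le_trans (HM1 _ _) _; rewrite addrAC lerDr addr_ge0.
  - move=> m j t; rewrite /dF; case: unliftP => [l _|_] /=.
      by apply: le_trans (bump_le1 _ _ _ _) _; rewrite -addrA lerDl addr_ge0.
    by apply: le_trans (HM2 _ _) _; rewrite lerDr addr_ge0.
  - move=> m j t kt; rewrite /F; case: unliftP => [l _|_] /=.
      by apply: bump0; apply: lt_le_trans (Hk1 l) (le_trans kk1 kt).
    by apply: tri0; apply: lt_le_trans Hk2 (le_trans kk2 kt).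
  - move=> m j t kt; rewrite /dF; case: unliftP => [l _|_] /=.
      by apply: bump0; apply: lt_le_trans (Hk1 l) (le_trans kk1 kt).
    by apply: dtri0; apply: lt_le_trans Hk2 (le_trans kk2 kt).
  - move=> j t; rewrite /F /f; case: unliftP => [l _|_] /=; [exact: cvg_wstep|exact: cvg_tri].
  - move=> j t; rewrite /dF /df; case: unliftP => [l _|_] /=; [exact: cvg_wstep|exact: cvg_dtri].
have E1 x : tprod f x = tri_oo a b (x 0 i) * \1_(ocbox a' b') (del i x).
  rewrite -{1}(ins_del i x) tprod_ins {1}/f unlift_none/= -wstep_indic//.
  by congr (_ * tprod _ _); apply/funext => l; rewrite /f liftK.
have E2 x : tprod df x = dtri_oo a b (x 0 i) * \1_(ocbox a' b') (del i x).
  rewrite -{1}(ins_del i x) tprod_ins {1}/df unlift_none/= -wstep_indic//.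
  by congr (_ * tprod _ _); apply/funext => l; rewrite /df liftK.
under eq_Rintegral do rewrite E2.
by under [in RHS]eq_Rintegral do rewrite E1.
Qed.

(** Testing with smooth bumps that tend to the indicator of a box gives [g] and [g'] the same
    integral over every box, because the side of the identity that involves [v] is the same for
    both. *)
Lemma weak_partial_unique n (i : 'I_n) (v g g' : 'rV[R]_n -> R) :
  is_weak_partial i v g -> is_weak_partial i v g' -> {ae leb n, forall x, g x = g' x}.
Proof.
move=> H H'; have [_ gi _] := H; have [_ gi' _] := H'.
have E (a b : 'I_n -> R) : (forall j, a j <= b j) ->
    \int[leb n]_(x in ocbox a b) g x = \int[leb n]_(x in ocbox a b) g' x.
  move=> ab.
  have [k Hk] := bound_ord (fun j => `|a j| + `|b j| + 1).
  pose F (m : nat) (j : 'I_n) : R -> R := bump m (a j) (b j).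
  pose f (j : 'I_n) : R -> R := wstep (a j) (b j).
  have T h : is_weak_partial i v h ->
     lim (\int[leb n]_x (v x * partial i (tprod (F m)) x) @[m --> \oo]) =
     - \int[leb n]_(x in ocbox a b) h x.
    move=> [_ hi Hh]; apply/cvg_lim => //.
    have c2 := @loc_cvg n h (fun m => tprod (F m)) (tprod f) (1 ^+ n) k hi.
    have : \int[leb n]_x (h x * tprod (F m) x) @[m --> \oo] -->
        \int[leb n]_x (h x * tprod f x).
      apply: c2.
      + move=> m; apply: measurable_tprod => j.
        apply: continuous_measurable_fun; apply: smooth_continuous; exact: smooth_bump.
      + move=> m x; apply: tprod_le => // j t; exact: bump_le1.
      + move=> m x; apply: tprod0 => j t kt; apply: bump0; exact: lt_le_trans (Hk j) kt.
      + move=> x; apply: cvg_tprod => j t; exact: cvg_wstep.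
    have -> : \int[leb n]_x (h x * tprod f x) = \int[leb n]_(x in ocbox a b) h x.
      rewrite [RHS]Rintegral_mkcond; apply: eq_Rintegral => x _.
      rewrite wstep_indic// patchE indicE; case: ifP => _; rewrite ?mulr1 ?mulr0//.
    move/cvgN; apply: cvg_trans; apply: near_eq_cvg; apply: nearW => m /=.
    transitivity (- \int[leb n]_x (h x * tprod (F m) x)); first by [].
    rewrite -Hh//; apply: (test_tprod (L := k%:R)).
      by move=> j; exact: smooth_bump.
    move=> j t kt; apply: bump0; exact: lt_trans (Hk j) kt.
  by apply: oppr_inj; rewrite -(T _ H) -(T _ H').
have ci f k : loc_integrable f -> (leb n).-integrable (cube R n k) (EFin \o f).
  exact: loc_cube.
have : {ae leb n, forall x, (g x - g' x)%:E = 0%E}.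
  apply: ae0_ocbox => [k|a b hi].
    by apply: (@integrableB _ _ _ (leb n) _ _ (EFin \o g) (EFin \o g')) => //;
      [exact: measurable_cube|exact: ci|exact: ci].
  have mo := measurable_ocbox a b.
  have [ab|] := pselect (forall j, a j <= b j); last first.
    move=> /existsNP[j ab]; rewrite (_ : ocbox a b = set0) ?integral_set0//.
    rewrite -subset0 => x /(_ j) /andP[h1 h2]; apply: ab; exact: ltW (lt_le_trans h1 h2).
  have [k Hk] : exists k : nat, ocbox a b `<=` cube R n k.
    have [k1 K1] := bound_ord (fun j => - a j); have [k2 K2] := bound_ord b.
    exists (maxn k1 k2) => x h j; have /andP[h1 h2] := h j.
    apply/andP; split.
      rewrite ltrNl; apply: (@lt_le_trans _ _ k1%:R); last by rewrite ler_nat leq_maxl.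
      by apply: lt_trans (K1 j); rewrite ltrN2.
    apply: (le_trans h2); apply: (@le_trans _ _ k2%:R); last by rewrite ler_nat leq_maxr.
    exact/ltW/K2.
  have go : (leb n).-integrable (ocbox a b) (EFin \o g).
    by apply: (integrableS _ _ Hk) (ci _ _ gi) => //; exact: measurable_cube.
  have go' : (leb n).-integrable (ocbox a b) (EFin \o g').
    by apply: (integrableS _ _ Hk) (ci _ _ gi') => //; exact: measurable_cube.
  rewrite -[LHS]fineK; last exact: integrable_fin_num hi.
  congr EFin; rewrite -/(Rintegral _ _ _) RintegralB//.
  by rewrite (E _ _ ab) subrr.
by apply: ae_mono => x [] /eqP; rewrite subr_eq0 => /eqP.
Qed.


(** Fubini on each of the countably many cubes; every segment of a line lies in one of them. *)
Lemma loc_slice n (i : 'I_n.+1) (u : 'rV[R]_n.+1 -> R) : loc_integrable u ->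
  {ae leb n, forall y, locint (fun t => u (ins i (t, y)))}.
Proof.
move=> ui; have mu : measurable_fun setT u by case: ui.
have H k : {ae leb n, forall y, lbg.-integrable setT
    (fun t => ((EFin \o u) \_ (cube R n.+1 k)) (ins i (t, y)))}.
  have ri := (integrable_mkcond (EFin \o u) (@measurable_cube _ k)).1 (loc_cube k ui).
  exact: (ae_integrable2 (integrable_ins i ri)).
have : {ae leb n, forall y k, lbg.-integrable setT
    (fun t => ((EFin \o u) \_ (cube R n.+1 k)) (ins i (t, y)))} by exact/ae_foralln.
apply: ae_mono => y Hy; split.
  apply: (measurableT_comp mu); apply: (measurableT_comp (measurable_ins i)).
  exact: measurable_pair2.
move=> a b.
have [k1 Hk1] := bounded_coord y.
have [k2 Hk2] := nat_ge [:: `|a| + 1; `|b|].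
pose k := maxn k1 k2.
apply: (@le_integrable _ _ _ lbg `[a, b] _ _
  (fun t => ((EFin \o u) \_ (cube R n.+1 k)) (ins i (t, y)))) => //.
- apply: measurable_funTS; apply/measurable_EFinP.
  apply: (measurableT_comp mu); apply: (measurableT_comp (measurable_ins i)).
  exact: measurable_pair2.
- move=> t /=; rewrite in_itv/= => /andP[at_ tb]; rewrite patchE ifT//.
  rewrite inE => j; case: (unliftP i j) => [l ->|->].
    rewrite ins_lift; have : `|y 0 l| < k%:R.
      by apply: lt_le_trans (Hk1 l) _; rewrite ler_nat leq_maxl.
    by rewrite ltr_norml => /andP[-> /ltW ->].
  have k2k : k2%:R <= k%:R :> R by rewrite ler_nat leq_maxr.
  rewrite ins_at; apply/andP; split.
    have := Hk2 _ (mem_head _ _); have := ler_norm (- a); rewrite normrN; lra.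
  by have := Hk2 _ (mem_last _ _); rewrite /=; have := ler_norm b; lra.
- exact: integrableS (Hy k).
Qed.

Lemma integrable_slices d1 d2 (T1 : measurableType d1) (T2 : measurableType d2)
    (m1 : {sigma_finite_measure set T1 -> \bar R})
    (m2 : {sigma_finite_measure set T2 -> \bar R}) (f : T1 * T2 -> \bar R) :
  (m1 \x m2)%E.-integrable setT f ->
  m2.-integrable setT (fun y => \int[m1]_t f (t, y))%E.
Proof.
move=> fi; have mf : measurable_fun setT f by case/integrableP : fi.
apply/integrableP; split; first exact: measurable_fubini_G fi.
have h := (integrable21ltyP m1 m2 mf).1 fi; apply: (le_lt_trans _ h).
apply: ge0_le_integral => //.
- by apply: measurableT_comp => //; exact: measurable_fubini_G fi.
- apply: (measurable_fun_fubini_tonelli_G (fun p => `|f p|)%E) => //.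
  exact: measurableT_comp.
- move=> y _; apply: le_abse_integral => //.
  exact: measurableT_comp (measurable_pair2 y).
Qed.

(** The characterisation of weak differentiability by absolute continuity on almost every line
    parallel to an axis. It reduces the Sobolev inequality and the weak equation to calculus in one
    variable. *)
Theorem weak_primitive n (i : 'I_n.+1) (v g : 'rV[R]_n.+1 -> R) :
  is_weak_partial i v g ->
  {ae leb n, forall y, locint (fun t => v (ins i (t, y))) /\
    exists2 V, primitive V (fun t => g (ins i (t, y))) &
      {ae lbg, forall t, v (ins i (t, y)) = V t}}.
Proof.
move=> H; have [vi gi _] := H.
have mv : measurable_fun setT v by case: vi.
have mg : measurable_fun setT g by case: gi.
pose I (q r : rat) (y : 'rV[R]_n) := (\int[lbg]_t (v (ins i (t, y)) * dtri_oo (ratr q) (ratr r) t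
   + g (ins i (t, y)) * tri_oo (ratr q) (ratr r) t)%:E)%E.
have mco : measurable_fun setT (fun x : 'rV[R]_n.+1 => x 0 i) by exact: measurable_coord.
have mdel : measurable_fun setT (@del R n i).
  by apply: measurable_fun_rVP => j; under eq_fun do rewrite mxE; exact: measurable_coord.
have mtri (a b : R) : measurable_fun setT (tri_oo a b : R -> R).
  by apply: continuous_measurable_fun; exact: primitive_continuous (primitive_tri_oo a b).
have bt (a b : R) : exists M : R, forall t, `|tri_oo a b t| <= M.
  have [M M0 HM] := tri_bounded a b; exists M => t.
  have c : `|tri m a b t| @[m --> \oo] --> `|tri_oo a b t|.
    by apply: cvg_norm; exact: cvg_tri.
  rewrite -(cvg_lim (@Rhausdorff R) c).
  by apply: limr_le; [apply/cvg_ex; eexists; exact: c|exact: nearW].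
(* For fixed [q] and [r] the line integral is a function of the transverse variable whose integral
   over every box vanishes by [weak_partial_tri]. *)
have I0 (q r : rat) : {ae leb n, forall y, I q r y = 0%E}.
  set a : R := ratr q; set b : R := ratr r.
  have [k0 Hk0] := nat_ge [:: `|a| + `|b| + 2 + 1].
  have {}Hk0 t : k0%:R <= `|t| -> `|a| + `|b| + 2 < `|t|.
    by apply: lt_le_trans; apply: lt_le_trans (Hk0 _ (mem_head _ _)); rewrite ltrDl.
  have dtri_oo0 t : `|a| + `|b| + 2 < `|t| -> dtri_oo a b t = 0.
    move=> ht; apply/esym; apply: (cvg_unique _ _ (cvg_dtri (a := a) (b := b) (t := t))) => //.
    by rewrite /= (_ : (fun m => _) = fun=> 0); [exact: cvg_cst|apply/funext => m; exact: dtri0].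
  have [Mt HMt] := bt a b; have [Md HMd] := dtri_oo_bounded a b.
  have cubeP k (x : 'rV[R]_n.+1) : ~ cube R n.+1 (maxn k k0) x ->
     ~ cube R n k (del i x) \/ k0%:R <= `|x 0 i|.
    move=> xk; have [h|] := leP k0%:R `|x 0 i|; first by right.
    rewrite ltr_norml => /andP[h1 h2]; left => xd; apply: xk => j.
    case: (unliftP i j) => [l ->|->].
      have := xd l; rewrite mxE => /andP[h3 h4]; apply/andP; split.
        by apply: le_lt_trans h3; rewrite lerN2 ler_nat leq_maxl.
      by apply: (le_trans h4); rewrite ler_nat leq_maxl.
    apply/andP; split.
      by apply: le_lt_trans h1; rewrite lerN2 ler_nat leq_maxr.
    by apply: (le_trans (ltW h2)); rewrite ler_nat leq_maxr.
  have key (A : set 'rV[R]_n) k : measurable A -> A `<=` cube R n k ->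
     (leb n.+1).-integrable setT (EFin \o (fun x =>
        v x * (dtri_oo a b (x 0 i) * \1_A (del i x)))) /\
     (leb n.+1).-integrable setT (EFin \o (fun x =>
        g x * (tri_oo a b (x 0 i) * \1_A (del i x)))).
    move=> mA Ak.
    have i1 (x : 'rV[R]_n.+1) : `|\1_A (del i x) : R| <= 1.
      by rewrite indicE; case: (_ \in _); rewrite ?normr1 ?normr0.
    have m1 : measurable_fun setT (fun x : 'rV[R]_n.+1 => \1_A (del i x) : R).
      by apply: measurableT_comp mdel; exact: measurable_indic.
    have z (x : 'rV[R]_n.+1) : ~ cube R n k (del i x) -> \1_A (del i x) = 0 :> R.
      by move=> h; rewrite indicE memNset// => /Ak.
    split.
      apply: (loc_mul (M := Md) (k := maxn k k0)) => //.
      - by apply: measurable_funM => //; apply: measurableT_comp mco; exact: measurable_dtri_oo.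
      - by move=> x; rewrite normrM; apply: le_trans (HMd (x 0 i)); rewrite ler_piMr.
      - by move=> x /cubeP[/z->|/Hk0 /dtri_oo0 ->]; rewrite ?mulr0 ?mul0r.
    apply: (loc_mul (M := Mt) (k := maxn k k0)) => //.
    - by apply: measurable_funM => //; apply: measurableT_comp mco; exact: mtri.
    - by move=> x; rewrite normrM; apply: le_trans (HMt (x 0 i)); rewrite ler_piMr.
    - by move=> x /cubeP[/z->|/Hk0 /tri_oo0 ->]; rewrite ?mulr0 ?mul0r.
  pose G A (x : 'rV[R]_n.+1) := v x * (dtri_oo a b (x 0 i) * \1_A (del i x))
     + g x * (tri_oo a b (x 0 i) * \1_A (del i x)).
  have delE t y : del i (ins i (t, y)) = y.
    by apply/rowP => j; rewrite mxE ins_lift.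
  have GE A y : (\int[lbg]_t (G A (ins i (t, y)))%:E = (I q r \_ A) y)%E.
    rewrite patchE; case: ifPn => yA.
      by apply: eq_integral => t _; rewrite /G delE ins_at indicE yA !mulr1.
    rewrite integral0_eq// => t _.
    by rewrite /G delE ins_at indicE (negbTE yA) !mulr0 addr0.
  have Gi A k : measurable A -> A `<=` cube R n k ->
      (leb n.+1).-integrable setT (EFin \o G A).
    move=> mA Ak; have [i1 i2] := key A k mA Ak.
    exact: (integrableD measurableT i1 i2).
  have Ii A k : measurable A -> A `<=` cube R n k -> (leb n).-integrable A (I q r).
    move=> mA Ak; apply/integrable_mkcond => //.
    have := integrable_slices (integrable_ins i (Gi A k mA Ak)).
    by congr integrable; apply/funext => y; rewrite -GE.
  apply: ae0_ocbox => [k|a' b' hi].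
    by apply: (Ii _ k) => //; exact: measurable_cube.
  have [ab'|] := pselect (forall j, a' j <= b' j); last first.
    move=> /existsNP[j ab']; rewrite (_ : ocbox a' b' = set0) ?integral_set0//.
    rewrite -subset0 => x /(_ j) /andP[h1 h2]; apply: ab'; exact: ltW (lt_le_trans h1 h2).
  have [k Hk] : exists k : nat, ocbox a' b' `<=` cube R n k.
    have [k1 K1] := bound_ord (fun j => - a' j); have [k2 K2] := bound_ord b'.
    exists (maxn k1 k2) => x h j; have /andP[h1 h2] := h j.
    apply/andP; split.
      rewrite ltrNl; apply: (@lt_le_trans _ _ k1%:R); last by rewrite ler_nat leq_maxl.
      by apply: lt_trans (K1 j); rewrite ltrN2.
    apply: (le_trans h2); apply: (@le_trans _ _ k2%:R); last by rewrite ler_nat leq_maxr.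
    exact/ltW/K2.
  have mo := measurable_ocbox a' b'.
  rewrite integral_mkcond; under eq_integral => y _ do rewrite -GE.
  have := integral21_prod_meas1 (integrable_ins i (Gi _ k mo Hk)).
  rewrite /fubini_G /= => ->.
  rewrite -(integral_ins i (Gi _ k mo Hk)).
  have [i1 i2] := key _ k mo Hk.
  have := integralD measurableT i1 i2 => /= ->.
  have := weak_partial_tri a b H ab'.
  rewrite /Rintegral => E.
  rewrite -[X in (X + _)%E]fineK; last exact: integrable_fin_num i1.
  rewrite -[X in (_ + X)%E]fineK; last exact: integrable_fin_num i2.
  by rewrite E -EFinD addNr.
(* The pairs of rationals are enumerated by [unpickle], which merges countably many null sets of
   lines into one. *)
have {}I0 : {ae leb n, forall y, forall q r : rat, I q r y = 0%E}.
  have : {ae leb n, forall y, forall m : nat,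
      forall q r, unpickle m = Some (q, r) -> I q r y = 0%E}.
    apply: ae_foralln => m; case: (unpickle m : option (rat * rat)) => [[q r]|].
      by apply: ae_mono (I0 q r) => y Iy q' r' [<- <-].
    exact: aeW.
  apply: ae_mono => y Hy q r; apply: (Hy (pickle (q, r))); exact: pickleK.
have sv := loc_slice i vi; have sg := loc_slice i gi.
apply: ae_mono (ae_and (ae_and sv sg) I0) => y [[v1 g1] Iy].
split => //; apply: primitive_of_tri => // q r qr L HL.
have := Iy q r; rewrite /I => E.
rewrite /rint (_ : Rintegral _ _ _ = fine 0%E)//; congr fine; rewrite -[RHS]E.
rewrite integral_mkcond; apply: eq_integral => t _; rewrite patchE; case: ifPn => //.
rewrite notin_setE /= in_itv/= => /negP tL.
have Lt : `|ratr q : R| + `|ratr r| + 2 < `|t|.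
  apply: lt_trans HL _; rewrite ltNge ler_norml; exact: tL.
rewrite tri_oo0// mulr0 addr0.
have -> : dtri_oo (ratr q) (ratr r) t = 0.
  apply/esym; apply: (cvg_unique _ _ (cvg_dtri (a := ratr q) (b := ratr r) (t := t))) => //.
  by rewrite /= (_ : (fun m => _) = fun=> 0); [exact: cvg_cst|apply/funext => m; exact: dtri0].
by rewrite mulr0.
Qed.

End weak.

(** * Real powers and the nonlinearity |x|^(p-2) x *)

Section power.
Context {R : realType}.
Implicit Types x y a b r p : R.

Lemma powR_le r x y : 0 <= r -> 0 <= x -> x <= y -> x `^ r <= y `^ r.
Proof. by move=> r0 x0 xy; apply: ge0_ler_powR; rewrite ?nnegrE// (le_trans x0). Qed.

Lemma powR_lt r x y : 0 < r -> 0 <= x -> x < y -> x `^ r < y `^ r.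
Proof. by move=> r0 x0 xy; apply: gt0_ltr_powR; rewrite ?nnegrE// (le_trans x0)// ltW. Qed.

(** Convexity of the power, read off from Young's inequality for x and y^(g-1) with exponents g and
    g/(g-1). *)
Lemma powR_tangent g x y : 1 <= g -> 0 <= x -> 0 <= y ->
  y `^ g - x `^ g <= g * y `^ (g - 1) * (y - x).
Proof.
rewrite le_eqVlt => /predU1P[<- x0 y0|g1 x0 y0].
  by rewrite subrr powRr0 !powRr1// !mul1r.
have g0 : 0 < g by rewrite (lt_trans ltr01).
have g10 : 0 < g - 1 by rewrite subr_gt0.
have := @conjugate_powR R x (y `^ (g - 1)) g (g / (g - 1)) x0 (powR_ge0 _ _) g0.
rewrite divr_gt0// invf_div => /(_ isT).
have -> : g^-1 + (g - 1) / g = 1 by field; rewrite gt_eqF.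
have E : (g - 1) * (g / (g - 1)) = g by field; rewrite gt_eqF.
move=> /(_ erefl); rewrite -powRrM E => H.
have : g * (x * y `^ (g - 1)) <= x `^ g + (g - 1) * y `^ g.
  have := ler_wpM2l (ltW g0) H; rewrite mulrDr.
  have -> : g * (x `^ g / g) = x `^ g by field; rewrite gt_eqF.
  by have -> : g * (y `^ g * ((g - 1) / g)) = (g - 1) * y `^ g by field; rewrite gt_eqF.
have := mulr_powRB1 y0 g0.
move: (y `^ _) (y `^ _) (x `^ _) => A B C <- h.
rewrite mulrBr.
nra.
Qed.

Lemma powR_abs_continuous r : 0 < r -> continuous (fun x => `|x| `^ r).
Proof.
move=> r0 x; have [->|x0] := eqVneq x 0.
  rewrite /continuous_at normr0 powR0 ?gt_eqF//.
  apply/cvgrPdist_lt => e e0; near=> t; rewrite sub0r normrN ger0_norm ?powR_ge0//.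
  rewrite -[ltRHS](powRr1 (ltW e0)) -(mulVf (lt0r_neq0 r0)) powRrM.
  apply: powR_lt => //; near: t; apply/nbhs_ballP; exists (e `^ r^-1) => /=.
    exact: powR_gt0.
  by move=> z /=; rewrite /ball/= sub0r normrN.
apply: (@continuous_comp _ _ _ (fun x : R => `|x|) (fun x => x `^ r)).
  exact: norm_continuous.
by have := is_derive1_powR r (_ : 0 < `|x|); rewrite normr_gt0 => /(_ x0)/is_derive_continuous.
Unshelve. all: by end_near. Qed.

Lemma powR_add_le r x y : 0 <= r -> 0 <= x -> 0 <= y ->
  (x + y) `^ r <= 2 `^ r * (x `^ r + y `^ r).
Proof.
move=> r0; wlog xy : x y / x <= y => [H x0 y0|x0 y0].
  have [xy|/ltW yx] := leP x y; first exact: H.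
  by rewrite addrC [X in _ * X]addrC; exact: H.
apply: (@le_trans _ _ ((2 * y) `^ r)); first by apply: powR_le; rewrite ?addr_ge0//; lra.
by rewrite powRM// ler_wpM2l ?powR_ge0// lerDr powR_ge0.
Qed.

Definition spow p x : R := `|x| `^ (p - 2) * x.

Lemma norm_spow p x : 1 < p -> `|spow p x| = `|x| `^ (p - 1).
Proof.
move=> p1; rewrite normrM (ger0_norm (powR_ge0 _ _)) mulrC.
have -> : p - 2 = (p - 1) - 1 by ring.
by rewrite mulr_powRB1// subr_gt0.
Qed.

Lemma spowM p x : 1 < p -> spow p x * x = `|x| `^ p.
Proof.
move=> p1; rewrite -[RHS]mulr_powRB1 ?(lt_trans ltr01)// -norm_spow// -normrM.
have E : x * spow p x = `|x| `^ (p - 2) * x ^+ 2 by rewrite /spow; ring.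
by rewrite mulrC ger0_norm// E mulr_ge0 ?powR_ge0 ?sqr_ge0.
Qed.

(** When |y| <= |x|, the difference splits into |x|^(p-2) (x - y) and a difference of powers
    multiplied by y. Keeping the factor y matters: it allows the tangent inequality at exponent p -
    1 >= 1, also for p < 3 where t^(p-2) is not Lipschitz at 0. *)
Lemma spow_lip p x y : 2 <= p ->
  `|spow p x - spow p y| <= (p - 1) * (`|x| `^ (p - 2) + `|y| `^ (p - 2)) * `|x - y|.
Proof.
move=> p2; wlog yx : x y / `|y| <= `|x|.
  move=> H; have [|/ltW] := leP `|y| `|x|; first exact: H.
  by move/H; rewrite distrC (distrC y) [X in _ * X * _]addrC.
have -> : spow p x - spow p y =
    `|x| `^ (p - 2) * (x - y) + (`|x| `^ (p - 2) - `|y| `^ (p - 2)) * y.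
  by rewrite /spow; ring.
have A0 : 0 <= `|x| `^ (p - 2) by exact: powR_ge0.
have B0 : 0 <= `|y| `^ (p - 2) by exact: powR_ge0.
have AB : `|y| `^ (p - 2) <= `|x| `^ (p - 2) by apply: powR_le => //; rewrite subr_ge0.
have H : (`|x| `^ (p - 2) - `|y| `^ (p - 2)) * `|y| <= (p - 2) * `|x| `^ (p - 2) * (`|x| - `|y|).
  have p11 : 1 <= p - 1 by lra.
  have := powR_tangent p11 (normr_ge0 y) (normr_ge0 x).
  have E z : `|z| `^ (p - 1) = `|z| * `|z| `^ (p - 2).
    by rewrite -[LHS]mulr_powRB1 ?(lt_le_trans ltr01)//; congr (_ * _ `^ _); ring.
  rewrite !E; have -> : p - 1 - 1 = p - 2 by ring.
  by move: (_ `^ _) (_ `^ _) => A B; nra.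
have D : `|x| - `|y| <= `|x - y| by exact: lerB_dist.
rewrite (le_trans (ler_normD _ _))// !normrM (ger0_norm A0).
have AB0 : 0 <= `|x| `^ (p - 2) - `|y| `^ (p - 2) by rewrite subr_ge0.
rewrite (ger0_norm AB0).
have p20 : 0 <= p - 2 by rewrite subr_ge0.
have d0 := normr_ge0 (x - y).
have := ler_wpM2l (mulr_ge0 p20 A0) D.
have := mulr_ge0 (mulr_ge0 p20 B0) d0; have := mulr_ge0 B0 d0.
lra.
Qed.

Lemma powR_abs_convex p x y : 1 < p -> `|x| `^ p - `|y| `^ p <= p * spow p x * (x - y).
Proof.
move=> p1; apply: (le_trans (powR_tangent (ltW p1) (normr_ge0 _) (normr_ge0 _))).
rewrite -!mulrA ler_pM2l ?(lt_trans ltr01)// [X in _ <= X]mulrA -/(spow p x).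
rewrite [X in X <= _]mulrBr [X in _ <= X]mulrBr (spowM x p1) [X in X - _]mulrC.
rewrite mulr_powRB1 ?(lt_trans ltr01)// lerD2l lerN2 -norm_spow//.
by rewrite -normrM ler_norm.
Qed.

(** Convexity at [a] and at a + b places the remainder between 0 and p (spow (a + b) - spow a) b,
    which [spow_lip] bounds. The two terms on the right are the ones that the Sobolev inequality
    controls. *)
Lemma powR_abs_taylor p : 2 <= p -> exists2 C, 0 <= C & forall a b,
  `| `|a + b| `^ p - `|a| `^ p - p * spow p a * b| <=
  C * (`|a| `^ (p - 2) * b ^+ 2 + `|b| `^ p).
Proof.
move=> p2; have p1 : 1 < p by rewrite (lt_le_trans _ p2)// ltr1n.
have p20 : 0 <= p - 2 by rewrite subr_ge0.
exists (p * (p - 1) * (2 `^ (p - 2) + 1)) => [|a b].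
  have := powR_ge0 (2 : R) (p - 2); move: (_ `^ _) => A A0.
  by rewrite !mulr_ge0//; lra.
have L : 0 <= `|a + b| `^ p - `|a| `^ p - p * spow p a * b.
  have := powR_abs_convex a (a + b) p1.
  have -> : a - (a + b) = - b by ring.
  by rewrite mulrN; lra.
rewrite (ger0_norm L).
have U := powR_abs_convex (a + b) a p1; rewrite [a + b - a]addrAC subrr add0r in U.
apply: (@le_trans _ _ (p * ((spow p (a + b) - spow p a) * b))).
  by move: U; rewrite -mulrA; lra.
rewrite -!mulrA ler_wpM2l//; first lra.
have E : (spow p (a + b) - spow p a) * b <= `|spow p (a + b) - spow p a| * `|b|.
  by rewrite -normrM ler_norm.
apply: (le_trans E); have := spow_lip (a + b) a p2.
rewrite [a + b - a]addrAC subrr add0r => /(ler_wpM2r (normr_ge0 b)) H.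
apply: (le_trans H); rewrite -!mulrA ler_wpM2l//; first lra.
have b2 : `|b| * `|b| = b ^+ 2 by rewrite -expr2 real_normK// num_real.
have bp : `|b| `^ p = `|b| `^ (p - 2) * b ^+ 2.
  rewrite -b2 mulrCA; rewrite -[LHS]mulr_powRB1 ?(lt_trans ltr01)//; congr (_ * _).
  by rewrite -[LHS]mulr_powRB1 ?subr_gt0// [RHS]mulrC; congr (_ * _ `^ _); ring.
rewrite bp -mulrDl [X in _ <= X]mulrA b2 ler_wpM2r ?sqr_ge0//.
have S : `|a + b| `^ (p - 2) <= 2 `^ (p - 2) * (`|a| `^ (p - 2) + `|b| `^ (p - 2)).
  apply: (le_trans _ (powR_add_le p20 (normr_ge0 a) (normr_ge0 b))).
  by apply: powR_le => //; exact: ler_normD.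
have := powR_ge0 `|b| (p - 2).
by rewrite mulrDl mul1r; lra.
Qed.

Lemma is_derive_powR_abs p x : 2 <= p -> is_derive x 1 (fun t => `|t| `^ p) (p * spow p x).
Proof.
move=> p2; have [C C0 H] := powR_abs_taylor p2; apply: derivE_dist => e e0.
pose K := C * (`|x| `^ (p - 2) + 1) + 1.
have K0 : 0 < K by rewrite ltr_wpDl// mulr_ge0// addr_ge0// powR_ge0.
exists (Num.min 1 (e / K)); first by rewrite lt_min ltr01 divr_gt0.
move=> h; rewrite lt_min => /andP[h1 hK]; apply: (le_trans (H x h)).
have hp : `|h| `^ p <= `|h| ^+ 2.
  have [->|h0] := eqVneq h 0; first by rewrite normr0 powR0 ?expr0n//; lra.
  have h01 : 0 < `|h| <= 1 by rewrite normr_gt0 h0 ltW.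
  by rewrite -powR_mulrn//; exact: (ger_powR h01).
have h2 : h ^+ 2 = `|h| ^+ 2 by rewrite real_normK// num_real.
rewrite h2.
apply: (@le_trans _ _ (K * `|h| * `|h|)).
  have := powR_ge0 `|x| (p - 2).
  rewrite /K => B0; have := ler_wpM2l C0 hp; have := sqr_ge0 `|h|; rewrite expr2.
  by move=> h20; nra.
by rewrite ler_wpM2r// -ler_pdivlMl// mulrC ltW.
Qed.

Lemma spow_continuous p : 2 <= p -> continuous (spow p).
Proof.
rewrite le_eqVlt => /predU1P[<- |p2].
  have -> : spow 2 = id by apply/funext => x; rewrite /spow subrr powRr0 mul1r.
  by move=> x; exact: cvg_id.
by move=> x; apply: cvgM; [apply: powR_abs_continuous; rewrite subr_gt0|exact: cvg_id].
Qed.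

End power.

(** * The Sobolev inequality *)

Section hoelder_prod.
Context d (T : measurableType d) (R : realType).
Variable mu : {measure set T -> \bar R}.
Local Open Scope ereal_scope.

Lemma young_poweR (a b : \bar R) (th : R) : (0 < th < 1)%R -> 0 <= a -> 0 <= b ->
  a `^ th * b `^ (1 - th) <= th%:E * a + (1 - th)%:E * b.
Proof.
move=> /andP[t0 t1]; have t1' : (0 < 1 - th)%R by rewrite subr_gt0.
have oo (x y : \bar R) : 0 <= y -> th%:E * +oo + y = +oo /\ (1 - th)%:E * +oo + y = +oo.
  by move=> y0; rewrite !gt0_muley ?lte_fin// addye// gt_eqF// (lt_le_trans _ y0)// ltNy0.
case: a => [a| |]//; case: b => [b| |]// a0 b0.
- rewrite !poweR_EFin -!EFinM -EFinD lee_fin; rewrite !lee_fin in a0 b0.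
  have := @conjugate_powR R (a `^ th)%R (b `^ (1 - th))%R th^-1%R (1 - th)^-1%R
    (powR_ge0 _ _) (powR_ge0 _ _).
  rewrite !invr_gt0 !invrK => /(_ t0 t1'); rewrite addrC subrK => /(_ erefl).
  rewrite -!powRrM !mulfV ?gt_eqF// !powRr1//.
  by rewrite [(a * _)%R]mulrC [(b * _)%R]mulrC.
- by rewrite [X in _ <= _ + X]gt0_muley ?lte_fin// -EFinM addey ?leey.
- by rewrite [X in _ <= X + _]gt0_muley ?lte_fin// -EFinM addye ?leey.
- by rewrite !gt0_muley ?lte_fin// addye ?leey.
Qed.

Lemma measurable_poweR D (f : T -> \bar R) (r : R) : measurable_fun D f ->
  measurable_fun D (fun x => f x `^ r).
Proof.
by move=> mf; apply: (measurableT_comp (measurable_poweR r) mf).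
Qed.

Lemma integral_poweR0 (f g : T -> \bar R) (r : R) : (0 < r)%R ->
  measurable_fun setT f -> measurable_fun setT g ->
  (forall x, 0 <= f x) -> (forall x, 0 <= g x) ->
  \int[mu]_x f x = 0 -> \int[mu]_x (f x `^ r * g x) = 0.
Proof.
move=> r0 mf mg f0 g0 If.
have : ae_eq mu setT f (cst 0).
  apply/ae_eq_integral_abs => //.
  by rewrite -[RHS]If; apply: eq_integral => x _; rewrite gee0_abs.
move=> ae0; have m := emeasurable_funM (measurable_poweR r mf) mg.
have : ae_eq mu setT (fun x => f x `^ r * g x) (cst 0).
  apply: ae_mono ae0 => x /(_ I) /= -> _; rewrite poweR0r ?mul0e// gt_eqF//.
move/(ae_eq_integral_abs mu measurableT m) => <-.
by apply: eq_integral => x _; rewrite gee0_abs// mule_ge0 ?poweR_ge0.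
Qed.

(** Young's inequality is integrated after dividing [f] and [g] by their integrals; the values 0 and
    +oo of these integrals are therefore settled beforehand. *)
Lemma hoelder_ge0 (f g : T -> \bar R) (th : R) : (0 < th < 1)%R ->
  measurable_fun setT f -> measurable_fun setT g ->
  (forall x, 0 <= f x) -> (forall x, 0 <= g x) ->
  \int[mu]_x (f x `^ th * g x `^ (1 - th)) <=
  (\int[mu]_x f x) `^ th * (\int[mu]_x g x) `^ (1 - th).
Proof.
move=> th01 mf mg f0 g0; have /andP[t0 t1] := th01.
have t1' : (0 < 1 - th)%R by rewrite subr_gt0.
have A0 : 0 <= \int[mu]_x f x by exact: integral_ge0.
have B0 : 0 <= \int[mu]_x g x by exact: integral_ge0.
have [Az|An] := eqVneq (\int[mu]_x f x) 0.
  rewrite integral_poweR0// ?mule_ge0 ?poweR_ge0//; first exact: measurable_poweR.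
  by move=> x; exact: poweR_ge0.
have [Bz|Bn] := eqVneq (\int[mu]_x g x) 0.
  rewrite (eq_integral (fun x => g x `^ (1 - th) * f x `^ th)); last first.
    by move=> x _; rewrite muleC.
  rewrite integral_poweR0// ?mule_ge0 ?poweR_ge0//; first exact: measurable_poweR.
  by move=> x; exact: poweR_ge0.
have Agt : 0 < \int[mu]_x f x by rewrite lt_def An.
have Bgt : 0 < \int[mu]_x g x by rewrite lt_def Bn.
have [Aoo|Afin] := eqVneq (\int[mu]_x f x) +oo.
  by rewrite Aoo poweRyr ?gt_eqF// gt0_mulye ?leey// poweR_gt0.
have [Boo|Bfin] := eqVneq (\int[mu]_x g x) +oo.
  by rewrite Boo poweRyr ?gt_eqF// gt0_muley ?leey// poweR_gt0.
have Af : \int[mu]_x f x \is a fin_num by rewrite ge0_fin_numE// ltey.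
have Bf : \int[mu]_x g x \is a fin_num by rewrite ge0_fin_numE// ltey.
move: (Af) (Bf) Agt Bgt => /fineK AE /fineK BE.
set a := fine (\int[mu]_x f x) in AE *; set b := fine (\int[mu]_x g x) in BE *.
rewrite -AE -BE !lte_fin => a0 b0.
pose K := (a `^ th * b `^ (1 - th))%R.
have K0 : (0 <= K)%R by rewrite mulr_ge0 ?powR_ge0.
rewrite !poweR_EFin -EFinM -/K.
have ai0 : 0 <= a^-1%:E by rewrite lee_fin invr_ge0 ltW.
have bi0 : 0 <= b^-1%:E by rewrite lee_fin invr_ge0 ltW.
have th0 : 0 <= th%:E by rewrite lee_fin ltW.
have th'0 : 0 <= (1 - th)%:E by rewrite lee_fin ltW.
have K0' : 0 <= K%:E by rewrite lee_fin.
have mf' : measurable_fun setT (fun x => a^-1%:E * f x) by exact: measurable_funeM.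
have mg' : measurable_fun setT (fun x => b^-1%:E * g x) by exact: measurable_funeM.
have mf'' : measurable_fun setT (fun x => th%:E * (a^-1%:E * f x)) by exact: measurable_funeM.
have mg'' : measurable_fun setT (fun x => (1 - th)%:E * (b^-1%:E * g x)) by exact: measurable_funeM.
have -> : K%:E = \int[mu]_x (K%:E * (th%:E * (a^-1%:E * f x) + (1 - th)%:E * (b^-1%:E * g x))).
  rewrite ge0_integralZl//; last 2 first.
  - exact: emeasurable_funD.
  - by move=> x _; rewrite adde_ge0 ?mule_ge0.
  rewrite ge0_integralD//; try by move=> x _; rewrite !mule_ge0.
  rewrite !ge0_integralZl//; try by move=> x _; rewrite !mule_ge0.
  rewrite -AE -BE -!EFinM mulVf ?gt_eqF// mulVf ?gt_eqF//.
  by rewrite !mulr1 addrC subrK mulr1.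
apply: ge0_le_integral => //.
- by move=> x _; rewrite mule_ge0 ?poweR_ge0.
- by apply: emeasurable_funM; exact: measurable_poweR.
- by apply: measurable_funeM; exact: emeasurable_funD.
- move=> x _.
  have := young_poweR th01 (mule_ge0 ai0 (f0 x)) (mule_ge0 bi0 (g0 x)).
  move=> /(lee_wpmul2l K0'); apply: le_trans.
  rewrite !poweRM// !poweR_EFin muleACA muleA -!EFinM /K.
  rewrite (_ : (_ * _)%R = 1%R) ?mul1e//.
  have ia0 : (0 <= a^-1)%R by rewrite invr_ge0 ltW.
  have ib0 : (0 <= b^-1)%R by rewrite invr_ge0 ltW.
  rewrite mulrACA -(powRM th (ltW a0) ia0).
  rewrite -(powRM (1 - th) (ltW b0) ib0).
  by rewrite !divff ?gt_eqF// !powR1 mulr1.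
Qed.

Lemma emeasurable_prod (I : Type) (s : seq I) (F : I -> T -> \bar R) :
  (forall i, measurable_fun setT (F i)) ->
  measurable_fun setT (fun x => \prod_(i <- s) F i x).
Proof.
move=> mF; elim: s => [|i s IH].
  by under eq_fun do rewrite big_nil; exact: measurable_cst.
by under eq_fun do rewrite big_cons; exact: emeasurable_funM.
Qed.

Lemma prod_poweR (I : Type) (s : seq I) (F : I -> \bar R) (r : R) :
  (forall i, 0 <= F i) ->
  (\prod_(i <- s) F i) `^ r = \prod_(i <- s) (F i `^ r).
Proof.
move=> F0; elim: s => [|i s IHs]; first by rewrite !big_nil poweR1r.
by rewrite !big_cons poweRM ?IHs// prode_ge0.
Qed.

(** Hoelder's inequality with weight 1/(m+2) splits off one factor; the others form a geometric mean
    whose power 1 - 1/(m+2) restores the exponents, and the induction hypothesis applies to it. *)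
Lemma hoelder_prod (m : nat) (f : 'I_m.+1 -> T -> \bar R) :
  (forall j, measurable_fun setT (f j)) -> (forall j x, 0 <= f j x) ->
  \int[mu]_x (\prod_(j < m.+1) (f j x `^ m.+1%:R^-1)) <=
  \prod_(j < m.+1) ((\int[mu]_x f j x) `^ m.+1%:R^-1).
Proof.
elim: m f => [|m IH] f mf f0.
  rewrite big_ord1 invr1 poweRe1 ?integral_ge0//.
  by under eq_integral do rewrite big_ord1 poweRe1//.
have m0 : (0 < m.+2%:R :> R)%R by rewrite ltr0n.
have th01 : (0 < (m.+2%:R^-1 : R) < 1)%R.
  by rewrite invr_gt0 m0 invf_lt1// ltr1n.
pose g x := \prod_(j < m.+1) (f (lift ord0 j) x `^ m.+1%:R^-1).
have th1 : (1 - m.+2%:R^-1 = m.+1%:R / m.+2%:R :> R)%R.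
  by rewrite -[X in (X - _)%R](divff (lt0r_neq0 m0)) -[X in (_ - X)%R]mul1r -mulrBl -[X in ((X - _) / _)%R]natr1 addrK.
have pE (x : \bar R) : x `^ m.+2%:R^-1 = (x `^ m.+1%:R^-1) `^ (1 - m.+2%:R^-1).
  by rewrite -poweRrM th1 mulrA mulVf ?mul1r// pnatr_eq0.
have gE x : \prod_(j < m.+2) (f j x `^ m.+2%:R^-1) =
    f ord0 x `^ m.+2%:R^-1 * g x `^ (1 - m.+2%:R^-1).
  rewrite big_ord_recl; congr (_ * _); rewrite /g prod_poweR; last by move=> j; exact: poweR_ge0.
  by apply: eq_bigr => j _; exact: pE.
under eq_integral do rewrite gE.
have mg : measurable_fun setT g.
  by apply: emeasurable_prod => j; exact: measurable_poweR.
have g0 x : 0 <= g x by apply: prode_ge0 => j _; exact: poweR_ge0.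
apply: (le_trans (hoelder_ge0 th01 (mf ord0) mg (f0 ord0) g0)).
rewrite big_ord_recl lee_wpmul2l ?poweR_ge0//.
under eq_bigr do rewrite pE.
rewrite -prod_poweR; last by move=> j; exact: poweR_ge0.
apply: gt0_ler_poweR.
- by have /andP[_ /ltW] := th01; rewrite subr_ge0.
- by rewrite in_itv/= leey integral_ge0.
- by rewrite in_itv/= leey prode_ge0// => j _; exact: poweR_ge0.
- exact: IH.
Qed.

End hoelder_prod.

Section gagliardo.
Context (R : realType).
Local Notation leb := (leb R).
Local Notation lbg := (@lebesgue_measure R).
Local Open Scope ereal_scope.

Lemma measurable_del n (i : 'I_n.+1) : measurable_fun setT (@del R n i).
Proof.
by apply: measurable_fun_rVP => j; under eq_fun do rewrite mxE; exact: measurable_coord.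
Qed.

Lemma del_ins n (i : 'I_n.+1) (t : R) (y : 'rV[R]_n) : del i (ins i (t, y)) = y.
Proof. by apply/rowP => j; rewrite mxE ins_lift. Qed.

Lemma del_lift_ins n (j : 'I_n.+1) (t : R) (y : 'rV[R]_n.+1) :
  del (lift ord0 j) (ins ord0 (t, y)) = ins ord0 (t, del j y).
Proof. by rewrite -{1}(ins_del j y) -ins_lift_cons del_ins. Qed.

(* The Loomis-Whitney inequality in Gagliardo's form, by induction on the
   dimension: integrate the first coordinate with [hoelder_prod], then apply
   Hoelder's inequality and the induction hypothesis in the remaining ones. *)
Lemma gagliardo n (F : 'I_n.+2 -> 'rV[R]_n.+1 -> \bar R) :
  (forall i, measurable_fun setT (F i)) -> (forall i y, 0 <= F i y) ->
  \int[leb n.+2]_x (\prod_(i < n.+2) (F i (del i x) `^ n.+1%:R^-1)) <=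
  \prod_(i < n.+2) ((\int[leb n.+1]_y F i y) `^ n.+1%:R^-1).
Proof.
elim: n F => [|n IH] F mF F0.
  have mF' i : measurable_fun setT (fun x : 'rV[R]_2 => F i (del i x)).
    exact: measurableT_comp (measurable_del i).
  rewrite !big_ord_recl !big_ord0 invr1.
  rewrite !mule1 !poweRe1 ?integral_ge0//.
  set i1 := lift ord0 ord0.
  have -> : \int[leb 2]_x (\prod_(i < 2) (F i (del i x) `^ 1)) =
     \int[leb 2]_x (F ord0 (del ord0 x) * F i1 (del i1 x)).
    apply: eq_integral => x _.
    by rewrite !big_ord_recl big_ord0 mule1 !poweRe1.
  rewrite (leb_tonelli ord0); last 2 first.
  - exact: emeasurable_funM.
  - by move=> x; exact: mule_ge0.
  (* In the plane the two factors depend on different coordinates, so the inequality is an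
     equality. *)
  rewrite le_eqVlt; apply/orP; left; apply/eqP.
  transitivity (\int[lbg]_t (F i1 (ins ord0 (t, 0%R : 'rV[R]_0)) * \int[leb 1]_y F ord0 y)).
    apply: eq_integral => t _.
    rewrite -ge0_integralZl//.
    apply: eq_integral => y _; rewrite del_ins muleC; congr (F _ _ * _).
    rewrite /i1 del_lift_ins; congr (ins _ (_, _)).
    by apply/rowP => -[].
  rewrite ge0_integralZr//; last 2 first.
  - apply: measurableT_comp => //; exact: measurableT_comp (measurable_ins _) (measurable_pair2 _).
  - exact: integral_ge0.
  rewrite muleC; congr (_ * _).
  rewrite (leb_tonelli ord0)//; apply: eq_integral => t _.
  have -> : \int[leb 0]_y F i1 (ins ord0 (t, y)) = \int[leb 0]_y cst (F i1 (ins ord0 (t, 0%R : 'rV[R]_0))) y.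
    by apply: eq_integral => y _; congr (F _ (ins _ (_, _))); apply/rowP => -[].
  by rewrite integral_cst// /leb/= diracT mule1.
pose q : R := n.+2%:R^-1%R.
(* Integrating out the first coordinate from every factor but the one that omits it leaves n + 2
   functions [H j], each omitting one of the remaining n + 2 coordinates: the situation of the
   induction hypothesis. *)
pose H (j : 'I_n.+2) (z : 'rV[R]_n.+1) := \int[lbg]_t F (lift ord0 j) (ins ord0 (t, z)).
have mFins (j : 'I_n.+3) : measurable_fun setT (fun p => F j (ins ord0 p)).
  exact: measurableT_comp (measurable_ins _).
have mH j : measurable_fun setT (H j).
  exact: (measurable_fun_fubini_tonelli_G (fun p => F (lift ord0 j) (ins ord0 p))).
have H0 j z : 0 <= H j z by exact: integral_ge0.
have IH0 j : \int[leb n.+1]_z H j z = \int[leb n.+2]_y F (lift ord0 j) y.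
  rewrite [RHS](leb_tonelli ord0)//.
  by rewrite (fubini_tonelli (fun p => F (lift ord0 j) (ins ord0 p))).
have mterm (i : 'I_n.+3) : measurable_fun setT (fun x => F i (del i x) `^ q).
  by apply: measurable_poweR; exact: measurableT_comp (measurable_del i).
rewrite (leb_tonelli ord0); last 2 first.
- exact: emeasurable_prod.
- by move=> x; apply: prode_ge0 => i _; exact: poweR_ge0.
pose K (p : measurableTypeR R * 'rV[R]_n.+2) :=
  \prod_(j < n.+2) (F (lift ord0 j) (ins ord0 (p.1, del j p.2)) `^ q).
have mK : measurable_fun setT K.
  apply: emeasurable_prod => j; apply: measurable_poweR.
  apply: (measurableT_comp (mF _)); apply: (measurableT_comp (measurable_ins _)).
  apply: measurable_fun_pair => //.
  exact: measurableT_comp (measurable_del _) measurable_snd.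
have K0 p : 0 <= K p by apply: prode_ge0 => j _; exact: poweR_ge0.
have mFK : measurable_fun setT (fun p : measurableTypeR R * 'rV[R]_n.+2 =>
    F ord0 p.2 `^ q * K p).
  apply: emeasurable_funM => //; apply: measurable_poweR.
  exact: measurableT_comp (mF _) measurable_snd.
have -> : \int[lbg]_t \int[leb n.+2]_y (\prod_(i < n.+3)
      (F i (del i (ins ord0 (t, y))) `^ q)) =
    \int[lbg]_t \int[leb n.+2]_y (F ord0 y `^ q * K (t, y)).
  apply: eq_integral => t _; apply: eq_integral => y _.
  rewrite big_ord_recl del_ins; congr (_ * _).
  by apply: eq_bigr => j _; rewrite del_lift_ins.
rewrite (fubini_tonelli (fun p => F ord0 p.2 `^ q * K p))//; last first.
  by move=> p; rewrite mule_ge0 ?poweR_ge0.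
pose g (y : 'rV[R]_n.+2) := \prod_(j < n.+2) (H j (del j y) `^ n.+1%:R^-1).
have g0 y : 0 <= g y by apply: prode_ge0 => j _; exact: poweR_ge0.
have mg : measurable_fun setT g.
  apply: emeasurable_prod => j; apply: measurable_poweR.
  exact: measurableT_comp (measurable_del _).
have q01 : (0 < q < 1)%R by rewrite /q invr_gt0 ltr0n invf_lt1 ?ltr0n// ltr1n.
have q1 : (1 - q = n.+1%:R / n.+2%:R)%R.
  have m0 : (0 < n.+2%:R :> R)%R by rewrite ltr0n.
  by rewrite -[X in (X - _)%R](divff (lt0r_neq0 m0)) /q -[X in (_ - X)%R]mul1r -mulrBl -[X in ((X - _) / _)%R]natr1 addrK.
have qE (x : \bar R) : (x `^ n.+1%:R^-1) `^ (1 - q) = x `^ q.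
  by rewrite -poweRrM q1 mulrA mulVf ?mul1r// pnatr_eq0.
have gE y : g y `^ (1 - q) = \prod_(j < n.+2) (H j (del j y) `^ q).
  by rewrite prod_poweR => [|j]; [apply: eq_bigr => j _; exact: qE|exact: poweR_ge0].
apply: (@le_trans _ _ (\int[leb n.+2]_y (F ord0 y `^ q * g y `^ (1 - q)))).
  apply: ge0_le_integral => //.
  - move=> y _; apply: integral_ge0 => t _; rewrite mule_ge0 ?poweR_ge0//.
  - apply: (measurable_fun_fubini_tonelli_G (fun p => F ord0 p.2 `^ q * K p)) => //.
    by move=> p; rewrite mule_ge0 ?poweR_ge0.
  - by apply: emeasurable_funM; exact: measurable_poweR.
  - move=> y _; rewrite /= ge0_integralZl//; last 2 first.
    + exact: measurableT_comp (measurable_pair2 _).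
    + exact: poweR_ge0.
    rewrite lee_wpmul2l ?poweR_ge0// gE.
    apply: (@hoelder_prod _ _ _ lbg n.+1 (fun j t => F (lift ord0 j) (ins ord0 (t, del j y)))).
      by move=> j; exact: measurableT_comp (mFins _) (measurable_pair2 _).
    by move=> j t.
apply: (le_trans (hoelder_ge0 _ q01 (mF ord0) mg (F0 ord0) g0)).
rewrite big_ord_recl lee_wpmul2l ?poweR_ge0//.
apply: (@le_trans _ _ ((\prod_(j < n.+2) ((\int[leb n.+1]_z H j z) `^ n.+1%:R^-1)) `^ (1 - q))).
  apply: gt0_ler_poweR.
  - by have /andP[_ /ltW] := q01; rewrite subr_ge0.
  - by rewrite in_itv/= leey integral_ge0.
  - by rewrite in_itv/= leey prode_ge0// => j _; exact: poweR_ge0.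
  - exact: IH.
rewrite prod_poweR => [|j]; last exact: poweR_ge0.
by rewrite le_eqVlt; apply/orP; left; apply/eqP; apply: eq_bigr => j _; rewrite qE IH0.
Qed.

End gagliardo.

(** * Powers of absolutely continuous functions on a line *)

Section chain.
Context (R : realType).
Local Notation lbg := (@lebesgue_measure R).
Implicit Types (V g D : R -> R) (a b e : R).

(** Monotonicity around the supremum of the points already reached carries the inequality past it,
    unless that supremum is [b]. *)
Lemma locally_nonincreasing D a b : a <= b ->
  (forall s, exists2 del : R, 0 < del & forall t t', `|t - s| < del ->
     `|t' - s| < del -> t <= t' -> D t' <= D t) -> D b <= D a.
Proof.
move=> ab H; pose S := [set t | a <= t <= b /\ D t <= D a].
have Sa : S a by rewrite /S/= lexx ab.
have hs : has_sup S by split; [exists a|exists b => t [/andP[_]]].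
have [del del0 Hs] := H (sup S).
have [t [/andP[at_ tb] Dt] tS] := sup_adherent del0 hs.
have tsup : t <= sup S by apply: (sup_upper_bound hs); split=> //; rewrite at_ tb.
have [t' t'E] : exists t', t' = Num.min b (sup S + del / 2) by eexists.
have supb : sup S <= b by apply: ge_sup; [exists a|move=> z [/andP[]]].
have supt' : sup S <= t' by rewrite t'E le_min supb lerDl divr_ge0// ltW.
have t'd : t' <= sup S + del / 2 by rewrite t'E ge_min lexx orbT.
have Dt' : D t' <= D t.
  apply: Hs; last exact: (le_trans tsup).
  - by rewrite ler0_norm ?subr_le0//; lra.
  - by rewrite ger0_norm ?subr_ge0//; lra.
have St' : S t'.
  split; last exact: le_trans Dt' Dt.
  by rewrite (le_trans at_ (le_trans tsup supt'))/= t'E ge_min lexx.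
have := sup_upper_bound hs St'; move: t'd supt' St' Dt'.
rewrite t'E; case: (leP b) => [_ _ _ _ Db _|_ _ _ _ _]; first exact: le_trans Db Dt.
by lra.
Qed.

Lemma le_rint a b f g : locint f -> locint g -> (forall t, a <= t <= b -> f t <= g t) ->
  rint a b f <= rint a b g :> R.
Proof.
move=> [_ fi] [_ gi] fg; apply: le_Rintegral => // t /=; rewrite in_itv/=; exact: fg.
Qed.

Lemma locint_norm g : locint g -> locint (fun t => `|g t|).
Proof.
move=> [mg gi]; split=> [|a b]; first exact: measurableT_comp.
exact: integrable_norm.
Qed.

Lemma locintZ c g : locint g -> locint (fun t => c * g t).
Proof.
move=> gi; have := locintM gi (measurable_cst c).
under eq_fun do rewrite mulrC; apply=> *; exists `|c| => //.
Qed.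

Lemma primitive_le V g a b : primitive V g -> a <= b ->
  `|V b - V a| <= rint a b (fun t => `|g t|).
Proof. by move=> [[mg gi] Vg] ab; rewrite Vg//; exact: le_normr_Rintegral. Qed.

(* Away from smoothness, the chain rule for |V|^ga survives as an inequality:
   locally |V t'|^ga - |V t|^ga <= ga |V t'|^(ga-1) int_t^t' |g| by convexity. *)
Lemma powR_primitive_le V g ga a b : 1 < ga -> primitive V g -> a <= b ->
  `|V b| `^ ga - `|V a| `^ ga <= rint a b (fun t => ga * `|V t| `^ (ga - 1) * `|g t|).
Proof.
move=> ga1 Vg ab; have [gi _] := Vg; have Vc := primitive_continuous Vg.
have ga0 : 0 < ga by rewrite (lt_trans ltr01).
pose w t := ga * `|V t| `^ (ga - 1).
have wc : continuous w.
  move=> t; apply: cvgM; first exact: cvg_cst.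
  apply: (@continuous_comp _ _ _ V (fun x => `|x| `^ (ga - 1)) t (Vc t)).
  by apply: powR_abs_continuous; rewrite subr_gt0.
have w0 t : 0 <= w t by rewrite mulr_ge0 ?powR_ge0 ?ltW.
have gni := locint_norm gi.
have wgi (e : R) : locint (fun t => `|g t| * (w t + e)).
  have wec : continuous (fun t => w t + e) by move=> t; apply: cvgD; [exact: wc|exact: cvg_cst].
  apply: locintM => //; first exact: (continuous_measurable_fun wec).
  exact: continuous_bounded_itv.
have wgi0 : locint (fun t => `|g t| * w t).
  by have := wgi 0; under eq_fun do rewrite addr0.
(* On a short interval the weight [w] at the right end exceeds its values inside by at most [e], by
   continuity; [e] tends to 0 at the end. *)
have key e : 0 < e -> `|V b| `^ ga - `|V a| `^ ga <= rint a b (fun t => `|g t| * (w t + e)).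
  move=> e0; have [G GP _] := primitive_ex (wgi e); have [_ GE] := GP.
  rewrite -(GE _ _ ab).
  suff : `|V b| `^ ga - G b <= `|V a| `^ ga - G a by lra.
  apply: (@locally_nonincreasing (fun t => `|V t| `^ ga - G t)) => // s.
  have /cvgrPdist_lt/(_ (e / 2))[|del/= del0 Hd] := wc s; first by rewrite divr_gt0.
  exists del => // t t' td t'd tt'.
  suff : `|V t'| `^ ga - `|V t| `^ ga <= G t' - G t by lra.
  rewrite GE//; apply: le_trans (powR_tangent (ltW ga1) (normr_ge0 _) (normr_ge0 _)) _.
  rewrite -/(w t'); apply: (@le_trans _ _ (w t' * rint t t' (fun r => `|g r|))).
    rewrite ler_wpM2l//; apply: le_trans (primitive_le Vg tt').
    exact: lerB_dist.
  have [_ gni'] := gni.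
  rewrite /rint -RintegralZl//; apply: le_rint => //.
    exact: locintZ.
  move=> r /andP[tr rt']; rewrite mulrC ler_wpM2l//.
  have rd : `|r - s| < del by move: td t'd; rewrite !ltr_norml => /andP[? ?] /andP[? ?]; lra.
  have := Hd t'; have := Hd r; rewrite /ball/= distrC => /(_ rd) h1; rewrite distrC => /(_ t'd).
  by move: h1; rewrite !ltr_norml => /andP[? ?] /andP[? ?]; lra.
have -> : (fun t => ga * `|V t| `^ (ga - 1) * `|g t|) = (fun t => `|g t| * w t).
  by apply/funext => t; rewrite mulrC.
apply/ler_addgt0Pr => e e0; pose I := rint a b (fun t => `|g t|).
have I0 : 0 <= I by apply: Rintegral_ge0.
have I10 : 0 < I + 1 by rewrite ltr_wpDl.
have e'0 : 0 < e / (I + 1) by rewrite divr_gt0.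
apply: (le_trans (key _ e'0)).
have -> : rint a b (fun t => `|g t| * (w t + e / (I + 1))) =
    rint a b (fun t => `|g t| * w t) + e / (I + 1) * I.
  rewrite /I /rint -RintegralZl//; last exact: (gni.2).
  rewrite -RintegralD//; last 2 first.
  - exact: wgi0.2.
  - exact: (locintZ _ gni).2.
  by congr Rintegral; apply/funext => t; ring.
rewrite lerD2l -mulrA ler_piMr ?(ltW e0)// mulrC ler_pdivrMr// mul1r; lra.
Qed.

(** If |V| >= e held on an interval of length [L], the integral would be at least L e^p. The length
    (I + 1) / e^p is thus too long wherever the interval lies. This replaces decay at infinity,
    which p-integrability alone does not give. *)
Lemma powR_small V p e : 0 < p -> 0 < e -> measurable_fun setT V ->
  (\int[lbg]_s (`|V s| `^ p)%:E < +oo)%E ->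
  exists L : R, forall a, exists2 s, a <= s <= a + L & `|V s| < e.
Proof.
move=> p0 e0 mV Voo.
have mp : measurable_fun setT (fun s => (`|V s| `^ p)%:E).
  apply/measurable_EFinP; apply: (measurableT_comp (measurable_powR p)); exact: measurableT_comp.
have I0 : (0 <= \int[lbg]_s (`|V s| `^ p)%:E)%E.
  by apply: integral_ge0 => s _; rewrite lee_fin powR_ge0.
have /fineK IE : (\int[lbg]_s (`|V s| `^ p)%:E)%E \is a fin_num by rewrite ge0_fin_numE.
set I := fine _ in IE.
have I0' : 0 <= I by rewrite -lee_fin IE.
have ep : 0 < e `^ p by exact: powR_gt0.
exists ((I + 1) / e `^ p) => a; set L := _ / _.
have L0 : 0 < L by rewrite divr_gt0// ltr_wpDl.
apply: contrapT => /forall2NP H.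
suff : I + 1 <= I by lra.
have [b bE] : exists b, b = a + L by eexists.
rewrite -lee_fin IE; apply: (@le_trans _ _ (\int[lbg]_(s in `[a, b]) cst (e `^ p)%:E s)%E).
  rewrite integral_cst//; have lE : lbg `[a, b] = L%:E.
    by rewrite lebesgue_measure_itv/= bE lte_fin ltrDl L0 -EFinB; congr EFin; ring.
  by rewrite [X in (_ * X)%E]lE -EFinM lee_fin /L mulrC divfK// gt_eqF.
apply: (@le_trans _ _ (\int[lbg]_(s in `[a, b]) (`|V s| `^ p)%:E)%E); last first.
  apply: ge0_subset_integral => // s _; by rewrite lee_fin powR_ge0.
apply: ge0_le_integral => //.
- by move=> s _; rewrite lee_fin powR_ge0.
- exact: measurable_funS mp.
- move=> s; rewrite /= in_itv/= bE => st; rewrite lee_fin; apply: powR_le => //.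
  + exact: ltW.
  + exact: ltW.
  + by have [//|/negP] := H s; rewrite -leNgt.
Qed.

(** The chain inequality is started from a point left of [t] where |V|^ga is at most an arbitrary
    [e]. *)
Lemma powR_primitive_bound V g ga p t : 1 < ga -> 0 < p -> primitive V g ->
  (\int[lbg]_s (`|V s| `^ p)%:E < +oo)%E ->
  ((`|V t| `^ ga)%:E <= \int[lbg]_s (ga * `|V s| `^ (ga - 1) * `|g s|)%:E)%E.
Proof.
move=> ga1 p0 Vg Voo; have [[mg _] _] := Vg; have Vc := primitive_continuous Vg.
have ga0 : 0 < ga by rewrite (lt_trans ltr01).
have mV := continuous_measurable_fun Vc.
apply/lee_addgt0Pr => e e0.
have e'0 : 0 < e `^ ga^-1 by rewrite powR_gt0.
have [L /(_ (t - L))[s /andP[_ st] Vs]] := powR_small p0 e'0 mV Voo; rewrite subrK in st.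
have Vs' : `|V s| `^ ga <= e.
  rewrite -[leRHS](powRr1 (ltW e0)) -(mulVf (lt0r_neq0 ga0)) powRrM.
  by apply: powR_le; rewrite ?normr_ge0// ltW// invr_gt0.
have := powR_primitive_le ga1 Vg st.
set f := fun t => ga * `|V t| `^ (ga - 1) * `|g t| => H.
have mf : measurable_fun setT (EFin \o f).
  apply/measurable_EFinP; apply: measurable_funM; last exact: measurableT_comp.
  apply: measurable_funM => //; apply: (measurableT_comp (measurable_powR _)).
  exact: measurableT_comp.
have f0 r : 0 <= f r by rewrite !mulr_ge0 ?powR_ge0// ltW.
apply: (@le_trans _ _ ((\int[lbg]_(r in `[s, t]) (f r)%:E) + e%:E)%E); last first.
  rewrite leeD2r//; apply: ge0_subset_integral => // r _; by rewrite lee_fin.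
have [->|foo] := eqVneq (\int[lbg]_(r in `[s, t]) (f r)%:E)%E +oo%E.
  by rewrite addye// leey.
have ffin : (\int[lbg]_(r in `[s, t]) (f r)%:E)%E \is a fin_num.
  by rewrite ge0_fin_numE ?ltey// integral_ge0// => r _; rewrite lee_fin.
rewrite -(fineK ffin) -EFinD lee_fin; move: H; rewrite /rint /Rintegral; lra.
Qed.

End chain.

Lemma ae_slices (R : realType) n (i : 'I_n.+1) (A : set 'rV[R]_n.+1) : measurable A ->
  {ae leb R n, forall y, {ae @lebesgue_measure R, forall t, A (ins i (t, y))}} ->
  {ae leb R n.+1, forall x, A x}.
Proof.
move=> mA H; exists (~` A); split=> //; first exact: measurableC.
have mC : measurable (~` A) by exact: measurableC.
rewrite -[LHS]/(leb R n.+1 _) -[~` A]setIT -(integral_indic _ measurableT mC).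
have mi : measurable_fun setT (fun x : 'rV[R]_n.+1 => (\1_(~` A) x)%:E : \bar R).
  by apply/measurable_EFinP; exact: measurable_indic.
rewrite (leb_tonelli i mi); last by move=> x; rewrite lee_fin.
have mip := measurableT_comp mi (measurable_ins i).
rewrite (fubini_tonelli (fun p => (\1_(~` A) (ins i p))%:E : \bar R))//.
transitivity (\int[leb R n]_y (0 : \bar R))%E; last exact: integral0.
apply: ge0_ae_eq_integral => //.
- exact: (measurable_fun_fubini_tonelli_G (fun p => (\1_(~` A) (ins i p))%:E : \bar R)).
- by move=> y _; apply: integral_ge0 => t _; rewrite lee_fin.
apply: ae_mono H => y H _.
transitivity (\int[@lebesgue_measure R]_t (0 : \bar R))%E; last exact: integral0.
apply: ge0_ae_eq_integral => //.
  exact: measurableT_comp mip (measurable_pair2 _).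
by apply: ae_mono H => t At _; rewrite indicE memNset//= => /(_ At).
Qed.

Lemma Lfun_sqr_integrable (R : realType) N (g : 'rV[R]_N -> R) : g \in Lfun (leb R N) 2%:E ->
  measurable_fun setT g /\ (leb R N).-integrable setT (fun x => (g x ^+ 2)%:E).
Proof.
move=> gL; have mg : measurable_fun setT g by have /andP[] := gL; rewrite inE.
split=> //; have h2 : 1 <= 2 :> R by rewrite ler1n.
apply: eq_integrable (Lfun_integrable h2 gL) => // x _.
by rewrite powR_mulrn// real_normK// num_real.
Qed.

Lemma lee_prod (R : realType) (I : Type) (s : seq I) (F G : I -> \bar R) :
  (forall i, 0 <= F i)%E -> (forall i, F i <= G i)%E ->
  (\prod_(i <- s) F i <= \prod_(i <- s) G i)%E.
Proof.
move=> F0 FG; elim: s => [|i s IH]; first by rewrite !big_nil.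
by rewrite !big_cons lee_pmul// prode_ge0.
Qed.

Section sobolev.
Context (R : realType) (N : nat).
Local Notation mu := (leb R N).
Local Notation p := (crit_exp R N).
Implicit Types v : 'rV[R]_N -> R.

Lemma ae_ord (P : 'I_N -> 'rV[R]_N -> Prop) :
  (forall i, {ae mu, forall x, P i x}) -> {ae mu, forall x, forall i, P i x}.
Proof.
move=> H; have : {ae mu, forall x, forall i, i \in enum 'I_N -> P i x}.
  elim: (enum 'I_N) => [|j s IH]; first exact: aeW.
  apply: ae_mono (ae_and (H j) IH) => x [Pj Ps] i; rewrite inE => /predU1P[->//|].
  exact: Ps.
by apply: ae_mono => x Hx i; apply: Hx; rewrite mem_enum.
Qed.

(** [weak_partial] is some weak derivative, not necessarily the square integrable one that [D12]
    provides; uniqueness up to null sets transfers the integrability. *)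
Lemma D12_partial v (i : 'I_N) : D12 v ->
  is_weak_partial i v (weak_partial i v) /\
  mu.-integrable setT (fun x => (weak_partial i v x ^+ 2)%:E).
Proof.
move=> [_ /(_ i)[g gw gL]].
have Hw : is_weak_partial i v (weak_partial i v).
  exact: (xgetPex (cst 0 : 'rV[R]_N -> R) (ex_intro _ g gw)).
split=> //; have [mg gi] := Lfun_sqr_integrable gL; have [_ [mw _] _] := Hw.
have mw2 : measurable_fun setT (fun x => (weak_partial i v x ^+ 2)%:E : \bar R).
  by apply/measurable_EFinP; exact: measurable_funX.
apply/integrableP; split => //; have [_] := integrableP _ _ _ gi.
congr (_ < _)%E; apply: ge0_ae_eq_integral => //.
- by apply: measurableT_comp => //; apply/measurable_EFinP; exact: measurable_funX.
- exact: measurableT_comp.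
by apply: ae_mono (weak_partial_unique gw Hw) => x -> _.
Qed.

Lemma grad_sq_integrable v : D12 v -> mu.-integrable setT (EFin \o grad_sq v).
Proof.
move=> vD; rewrite (_ : _ \o _ = fun x => (\sum_(i < N) (weak_partial i v x ^+ 2)%:E)%E).
  by apply: integrable_sum => // i _; exact: (D12_partial i vD).2.
by apply/funext => x /=; rewrite sumEFin.
Qed.

Lemma grad_sq_ge0 v x : 0 <= grad_sq v x.
Proof. by apply: sumr_ge0 => i _; exact: sqr_ge0. Qed.

Lemma D12_norm_ge0 v : 0 <= D12_norm v. Proof. exact: sqrtr_ge0. Qed.

Lemma D12_norm_sqr v : D12_norm v ^+ 2 = \int[mu]_x grad_sq v x.
Proof. by rewrite sqr_sqrtr// Rintegral_ge0// => x _; exact: grad_sq_ge0. Qed.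

Lemma partial_sqr_le v (i : 'I_N) : D12 v ->
  (\int[mu]_x (weak_partial i v x ^+ 2)%:E <= (D12_norm v ^+ 2)%:E)%E.
Proof.
move=> vD; rewrite D12_norm_sqr fineK; last exact: integrable_fin_num (grad_sq_integrable vD).
have [/measurable_int m _] := conj (D12_partial i vD).2 I.
apply: ge0_le_integral => //.
- by move=> x _; rewrite lee_fin sqr_ge0.
- exact: measurable_int (grad_sq_integrable vD).
move=> x _; rewrite lee_fin /grad_sq (bigD1 i)//= lerDl.
by apply: sumr_ge0 => j _; exact: sqr_ge0.
Qed.

End sobolev.

Section sobolev_ineq.
Context (R : realType) (m : nat).
Local Notation N := m.+3.
Local Notation mu := (leb R N).
Local Notation lbg := (@lebesgue_measure R).
Local Notation p := (crit_exp R N).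

(** Gagliardo's exponent 2 (N-1) / (N-2). It satisfies ga - 1 = p / 2, so that Cauchy-Schwarz on
    |v|^(ga-1) |D_i v| produces |v|^p, and ga N / (N-1) = p, so that the product over the directions
    produces |v|^p as well. *)
Let ga : R := p / 2 + 1.

Lemma crit_expE : p = 2 * m.+3%:R / m.+1%:R :> R.
Proof. by rewrite /crit_exp -natrB. Qed.

Lemma crit_exp_gt2 : 2 < p.
Proof.
by rewrite crit_expE ltr_pdivlMr ?ltr0n// ltr_pM2l// ltr_nat.
Qed.

(** On almost every line [v] agrees almost everywhere with an absolutely continuous [V] in L^p,
    which satisfies the bound at every point; [ae_slices] assembles the lines, the set of good
    points being measurable. *)
Lemma ae_slice_bound (v : 'rV[R]_N -> R) (i : 'I_N) : D12 v ->
  {ae mu, forall x, ((`|v x| `^ ga)%:E <=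
    \int[lbg]_s (ga * `|v (ins i (s, del i x))| `^ (p / 2)
       * `|weak_partial i v (ins i (s, del i x))|)%:E)%E}.
Proof.
have p2 := crit_exp_gt2.
have p0 : 0 < p by exact: lt_trans p2.
have ga1 : 1 < ga by rewrite /ga ltrDr divr_gt0.
have ga0 : 0 < ga by exact: lt_trans ga1.
have gaE : ga - 1 = p / 2 by rewrite /ga addrK.
move=> vD; have [Hw _] := D12_partial i vD; have [[mv _] [mg _] _] := Hw.
set g := weak_partial i v in Hw mg *.
have mf : measurable_fun setT (fun x => (ga * `|v x| `^ (p / 2) * `|g x|)%:E : \bar R).
  apply/measurable_EFinP; apply: measurable_funM; last exact: measurableT_comp.
  apply: measurable_funM => //; apply: (measurableT_comp (measurable_powR _)).
  exact: measurableT_comp.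
pose F (y : 'rV[R]_m.+2) := (\int[lbg]_s (ga * `|v (ins i (s, y))| `^ (p / 2) * `|g (ins i (s, y))|)%:E)%E.
have mF : measurable_fun setT F.
  apply: (measurable_fun_fubini_tonelli_G (fun q => (ga * `|v (ins i q)| `^ (p / 2) * `|g (ins i q)|)%:E)).
    exact: measurableT_comp mf (measurable_ins i).
  by move=> q; rewrite lee_fin !mulr_ge0 ?powR_ge0// ltW.
have mvp (r : R) : measurable_fun setT (fun x => (`|v x| `^ r)%:E : \bar R).
  apply/measurable_EFinP; apply: (measurableT_comp (measurable_powR _)).
  exact: measurableT_comp.
apply: (@ae_slices _ _ i [set x | ((`|v x| `^ ga)%:E <= F (del i x))%E]).
  rewrite -[X in measurable X]setTI; apply: measurable_lee => //.
  exact: measurableT_comp mF (measurable_del i).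
have vL : (\int[mu]_x (`|v x| `^ p)%:E < +oo)%E.
  have p1 : 1 <= p by rewrite (le_trans _ (ltW p2))// ler1n.
  have := Lfun_integrable p1 vD.1 => /integrableP[_]; congr (_ < _)%E.
  by apply: eq_integral => x _; rewrite gee0_abs// lee_fin powR_ge0.
have aefin : {ae leb R m.+2, forall y, (\int[lbg]_s (`|v (ins i (s, y))| `^ p)%:E < +oo)%E}.
  have vi : mu.-integrable setT (fun x => (`|v x| `^ p)%:E).
    apply/integrableP; split => //; move: vL; congr (_ < _)%E.
    by apply: eq_integral => x _; rewrite gee0_abs// lee_fin powR_ge0.
  apply: ae_mono (ae_integrable2 (integrable_ins i vi)) => y /integrableP[_].
  congr (_ < _)%E; apply: eq_integral => s _.
  by rewrite -[LHS]/(`|(`|v (ins i (s, y))| `^ p)%:E|%E) gee0_abs// lee_fin powR_ge0.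
apply: ae_mono (ae_and aefin (weak_primitive Hw)) => y [fy [lv [V Vg vV]]].
have fV : (\int[lbg]_s (`|V s| `^ p)%:E < +oo)%E.
  suff <- : (\int[lbg]_s (`|v (ins i (s, y))| `^ p)%:E = \int[lbg]_s (`|V s| `^ p)%:E)%E by [].
  apply: ge0_ae_eq_integral.
  - exact: measurableT.
  - exact: measurableT_comp (mvp p) (measurableT_comp (measurable_ins i) (measurable_pair2 y)).
  - apply/measurable_EFinP; apply: (measurableT_comp (measurable_powR _)).
    apply: measurableT_comp => //; exact: continuous_measurable_fun (primitive_continuous Vg).
  - by move=> s _; rewrite lee_fin powR_ge0.
  - by move=> s _; rewrite lee_fin powR_ge0.
  - by apply: ae_mono vV => s -> _.
have FE : (\int[lbg]_s (ga * `|V s| `^ (ga - 1) * `|g (ins i (s, y))|)%:E = F y)%E; last first.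
  apply: ae_mono vV => t vt; rewrite /= del_ins vt -FE.
  exact: powR_primitive_bound Vg fV.
rewrite gaE; apply: ge0_ae_eq_integral.
- exact: measurableT.
- apply/measurable_EFinP; apply: measurable_funM; last first.
    apply: measurableT_comp => //; exact: Vg.1.1.
  apply: measurable_funM => //; apply: (measurableT_comp (measurable_powR _)).
  apply: measurableT_comp => //; exact: continuous_measurable_fun (primitive_continuous Vg).
- exact: measurableT_comp mf (measurableT_comp (measurable_ins i) (measurable_pair2 y)).
- by move=> s _; rewrite lee_fin !mulr_ge0 ?powR_ge0// ltW.
- by move=> s _; rewrite lee_fin !mulr_ge0 ?powR_ge0// ltW.
by apply: ae_mono vV => s -> _.
Qed.

(** Multiplying the slice bounds over all directions and integrating with [gagliardo] bounds X, the
    integral of |v|^p, by a constant times a power of X smaller than 1 and a power of the gradient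
    norm. As X is finite, it can be absorbed. *)
Theorem sobolev : exists2 C : R, 0 < C & forall v : 'rV[R]_N -> R, D12 v ->
  \int[mu]_x (`|v x| `^ p) <= C * D12_norm v `^ p.
Proof.
have p2 := crit_exp_gt2.
have p0 : 0 < p by exact: lt_trans p2.
have ga1 : 1 < ga by rewrite /ga ltrDr divr_gt0.
have ga0 : 0 < ga by exact: lt_trans ga1.
exists (ga `^ p) => [|v vD]; first exact: powR_gt0.
have [[mv _] _ _] := (D12_partial ord0 vD).1.
have mg i : measurable_fun setT (weak_partial i v) by have [_ [] ] := (D12_partial i vD).1.
have mf i : measurable_fun setT (fun x => (ga * `|v x| `^ (p / 2) * `|weak_partial i v x|)%:E : \bar R).
  apply/measurable_EFinP; apply: measurable_funM; last exact: measurableT_comp.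
  apply: measurable_funM => //; apply: (measurableT_comp (measurable_powR _)).
  exact: measurableT_comp.
have f0 i x : (0 <= (ga * `|v x| `^ (p / 2) * `|weak_partial i v x|)%:E)%E.
  by rewrite lee_fin !mulr_ge0 ?powR_ge0// ltW.
have mvp (r : R) : measurable_fun setT (fun x => (`|v x| `^ r)%:E : \bar R).
  apply/measurable_EFinP; apply: (measurableT_comp (measurable_powR _)).
  exact: measurableT_comp.
pose F (i : 'I_N) (y : 'rV[R]_m.+2) := (\int[lbg]_s (ga * `|v (ins i (s, y))| `^ (p / 2)
   * `|weak_partial i v (ins i (s, y))|)%:E)%E.
have mF i : measurable_fun setT (F i).
  apply: (measurable_fun_fubini_tonelli_G (fun q => (ga * `|v (ins i q)| `^ (p / 2) * `|weak_partial i v (ins i q)|)%:E)).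
    exact: measurableT_comp (mf i) (measurable_ins i).
  by move=> q; exact: f0.
have F0 i y : (0 <= F i y)%E by apply: integral_ge0 => s _; exact: f0.
pose X := \int[mu]_x (`|v x| `^ p).
pose d := D12_norm v.
have d0 : 0 <= d by exact: D12_norm_ge0.
have X0 : 0 <= X by apply: Rintegral_ge0 => x _; exact: powR_ge0.
have XE : (\int[mu]_x (`|v x| `^ p)%:E = X%:E)%E.
  have p1 : 1 <= p by rewrite (le_trans _ (ltW p2))// ler1n.
  by rewrite fineK//; apply: (integrable_fin_num _ (Lfun_integrable p1 vD.1)).
have IF i : (\int[leb R m.+2]_y F i y <= (ga * (X `^ 2^-1 * d))%:E)%E.
  rewrite -(fubini_tonelli (fun q => (ga * `|v (ins i q)| `^ (p / 2) * `|weak_partial i v (ins i q)|)%:E)); last 2 first.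
  - exact: measurableT_comp (mf i) (measurable_ins i).
  - by move=> q; exact: f0.
  rewrite -(leb_tonelli i (mf i))//.
  have h01 : 0 < (2^-1 : R) < 1 by rewrite invr_gt0 ltr0n invf_lt1// ltr1n.
  have mg2 : measurable_fun setT (fun x => (weak_partial i v x ^+ 2)%:E : \bar R).
    by apply/measurable_EFinP; exact: measurable_funX.
  have mg2' : measurable_fun setT (fun x => (`|v x| `^ (p / 2) * `|weak_partial i v x|)%:E : \bar R).
    apply/measurable_EFinP; apply: measurable_funM; last exact: measurableT_comp.
    by apply: (measurableT_comp (measurable_powR _)); exact: measurableT_comp.
  have h12 : 1 - 2^-1 = 2^-1 :> R by lra.
  have H := @hoelder_ge0 _ _ _ mu (fun x => (`|v x| `^ p)%:E) (fun x => (weak_partial i v x ^+ 2)%:E)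
    2^-1 h01 (mvp p) mg2.
  have {}H := H (fun x => _) (fun x => _).
  rewrite XE h12 in H.
  have -> : (\int[mu]_x (ga * `|v x| `^ (p / 2) * `|weak_partial i v x|)%:E =
      ga%:E * \int[mu]_x (`|v x| `^ (p / 2) * `|weak_partial i v x|)%:E)%E.
    rewrite -ge0_integralZl//; first by apply: eq_integral => x _; rewrite -EFinM mulrA.
    by rewrite lee_fin ltW.
  rewrite EFinM lee_wpmul2l ?lee_fin ?(ltW ga0)//.
  have E : (\int[mu]_x (`|v x| `^ (p / 2) * `|weak_partial i v x|)%:E =
     \int[mu]_x ((`|v x| `^ p)%:E `^ 2^-1 * (weak_partial i v x ^+ 2)%:E `^ 2^-1))%E.
    apply: eq_integral => x _; rewrite !poweR_EFin -EFinM -powRrM; congr (_ * _)%:E.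
    by rewrite (powR12_sqrt (sqr_ge0 _)) sqrtr_sqr.
  rewrite E; apply: (le_trans (H _ _)).
  - by move=> x; rewrite lee_fin powR_ge0.
  - by move=> x; rewrite lee_fin sqr_ge0.
  rewrite poweR_EFin EFinM lee_wpmul2l ?lee_fin ?powR_ge0//.
  have dE : d%:E = ((d ^+ 2)%:E `^ 2^-1)%E.
    by rewrite poweR_EFin powR12_sqrt ?sqr_ge0// sqrtr_sqr ger0_norm.
  rewrite dE; apply: gt0_ler_poweR; rewrite ?invr_ge0//.
  - by rewrite in_itv/= leey integral_ge0// => x _; rewrite lee_fin sqr_ge0.
  - by rewrite in_itv/= leey lee_fin sqr_ge0.
  exact: partial_sqr_le.
have H : X <= (ga * (X `^ 2^-1 * d)) `^ (N%:R / m.+2%:R).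
  rewrite -lee_fin -XE.
  apply: (@le_trans _ _ (\int[mu]_x (\prod_(i < N) (F i (del i x) `^ m.+2%:R^-1)))%E).
    apply: ae_ge0_le_integral => //.
    - by move=> x _; apply: prode_ge0 => i _; exact: poweR_ge0.
    - apply: emeasurable_prod => i; apply: measurable_poweR.
      exact: measurableT_comp (mF i) (measurable_del i).
    apply: ae_mono (ae_ord (fun i => ae_slice_bound i vD)) => x Hx _.
    have -> : ((`|v x| `^ p)%:E = \prod_(i < N) (((`|v x| `^ ga)%:E) `^ m.+2%:R^-1))%E.
      rewrite (eq_bigr (fun=> (`|v x| `^ (ga / m.+2%:R))%:E)) => [|i _]; last first.
        by rewrite poweR_EFin -powRrM.
      rewrite prodEFin prodr_const card_ord -powR_mulrn ?powR_ge0// -powRrM.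
      congr (_ `^ _)%:E; rewrite /ga crit_expE; field.
      by rewrite nat1r -natrD !pnatr_eq0.
    apply: lee_prod => i.
    - exact: poweR_ge0.
    - apply: gt0_ler_poweR; rewrite ?invr_ge0//.
      + by rewrite in_itv/= leey lee_fin powR_ge0.
      + by rewrite in_itv/= leey F0.
      + exact: Hx.
  apply: (le_trans (gagliardo mF F0)).
  pose B := ga * (X `^ 2^-1 * d).
  have B0 : 0 <= B by rewrite !mulr_ge0 ?powR_ge0// ltW.
  apply: (@le_trans _ _ (\prod_(i < N) (B `^ m.+2%:R^-1)%:E)%E).
    apply: lee_prod => i; first exact: poweR_ge0.
    rewrite -poweR_EFin; apply: gt0_ler_poweR; rewrite ?invr_ge0//.
    - by rewrite in_itv/= leey integral_ge0.
    - by rewrite in_itv/= leey lee_fin B0.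
  rewrite prodEFin prodr_const card_ord -powR_mulrn ?powR_ge0// -powRrM lee_fin.
  by rewrite [X in _ `^ X <= _]mulrC.
rewrite -/X -/d -powRM ?(ltW ga0)//.
(* The absorption divides by a power of X. *)
have [Xz|Xn] := eqVneq X 0; first by rewrite Xz powR_ge0.
have Xgt : 0 < X by rewrite lt_def Xn.
pose q : R := N%:R / m.+2%:R.
have gd0 : 0 <= ga * d by rewrite mulr_ge0// ltW.
have m1 : (m%:R + 1 != 0 :> R) by rewrite natr1 pnatr_eq0.
have m2 : (m%:R + 2 != 0 :> R) by rewrite -natrD pnatr_eq0 addn2.
have m3 : (m%:R + 3 != 0 :> R) by rewrite -natrD pnatr_eq0 addn3.
have H2 : X `^ (1 - q / 2) <= (ga * d) `^ q.
  have Xq : 0 < X `^ (q / 2) by exact: powR_gt0.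
  rewrite -(ler_pM2r Xq) -powRD; last by rewrite Xn implybT.
  rewrite subrK powRr1//; apply: (le_trans H).
  rewrite -/q (_ : ga * _ = X `^ 2^-1 * (ga * d)); last by ring.
  by rewrite powRM ?powR_ge0// -powRrM mulrC [2^-1 * q]mulrC.
have pq0 : 0 <= p / q by rewrite divr_ge0 ?(ltW p0)// divr_ge0.
have := powR_le pq0 (powR_ge0 _ _) H2.
rewrite -!powRrM.
have -> : (1 - q / 2) * (p / q) = 1 by rewrite /q crit_expE; field; apply/and3P.
have -> : q * (p / q) = p by rewrite mulrC divfK// /q mulf_neq0 ?invr_eq0 ?pnatr_eq0.
by rewrite powRr1.
Qed.

End sobolev_ineq.

(** * Integration along lines *)

Section lines.
Context (R : realType).
Local Notation leb := (leb R).
Local Notation lbg := (@lebesgue_measure R).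

Lemma integral_lines0 n (i : 'I_n.+1) (h : 'rV[R]_n.+1 -> R) :
  (leb n.+1).-integrable setT (EFin \o h) ->
  {ae leb n, forall y, (\int[lbg]_t (h (ins i (t, y)))%:E = 0)%E} ->
  \int[leb n.+1]_x h x = 0.
Proof.
move=> hi H; rewrite /Rintegral (integral_ins i hi) -integral21_prod_meas1; last exact: integrable_ins.
rewrite [X in fine X](_ : _ = 0%E)//.
transitivity (\int[leb n]_y (0 : \bar R))%E; last exact: integral0.
apply: ae_eq_integral => //; first exact: measurable_fubini_G (integrable_ins i hi).
by apply: ae_mono H => y Hy _; exact: Hy.
Qed.

(* The two ends need only be small along some sequence, as the integral
   over the line converges absolutely. *)
Lemma primitive_integral0 P k : primitive P k -> lbg.-integrable setT (EFin \o k) ->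
  (forall e T : R, 0 < e -> exists2 a, a <= T & `|P a| < e) ->
  (forall e T : R, 0 < e -> exists2 b, T <= b & `|P b| < e) ->
  (\int[lbg]_t (k t)%:E = 0)%E.
Proof.
move=> [[mk _] PE] ki Ha Hb.
have en (n : nat) : (0 : R) < n.+1%:R^-1 by rewrite invr_gt0 ltr0n.
have /choice[a aP] n : exists a, a <= - n%:R /\ `|P a| < n.+1%:R^-1.
  by have [a] := Ha _ (- n%:R) (en n); exists a.
have /choice[b bP] n : exists b, n%:R <= b /\ `|P b| < n.+1%:R^-1.
  by have [b] := Hb _ n%:R (en n); exists b.
have ab n : a n <= b n.
  by rewrite (le_trans (aP n).1)// (le_trans _ (bP n).1)// (@le_trans _ _ 0)// ?oppr_le0.
pose kn n := ((EFin \o k) \_ `[a n, b n])%E.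
have c1 : (\int[lbg]_t kn n t @[n --> \oo] --> \int[lbg]_t (k t)%:E)%E.
  apply: (@dominated_cvg _ _ _ lbg setT measurableT kn _ (fun x => `|(EFin \o k) x|)%E) => //.
  - by move=> n; apply/(measurable_restrictT _ _).1 => //; apply: measurable_funTS; exact/measurable_EFinP.
  - move=> t _; apply: cvg_near_cst; near=> n; rewrite /kn patchE ifT// inE/= in_itv/=.
    have tn : `|t| <= n%:R by near: n; exact: nbhs_infty_ger.
    move: tn; rewrite ler_norml => /andP[t1 t2].
    by rewrite (le_trans (aP n).1)//= (le_trans t2)// (bP n).1.
  - exact: integrable_abse.
  - by move=> n t _; rewrite /kn patchE; case: ifP => // _; rewrite abse0 abse_ge0.
have c2 : (\int[lbg]_t kn n t @[n --> \oo] --> (0 : \bar R))%E.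
  have E n : (\int[lbg]_t kn n t)%E = (P (b n) - P (a n))%:E.
    rewrite -integral_mkcond PE// /rint /Rintegral fineK//.
    by apply: integrable_fin_num => //; apply: integrableS ki.
  under eq_fun do rewrite E.
  apply: cvg_EFin; first exact: nearW.
  apply/cvgrPdist_lt => e e0; near=> n; rewrite sub0r normrN /=.
  have n2 : n.+1%:R^-1 < e / 2.
    by near: n; apply: (near_infty_natSinv_lt (PosNum (divr_gt0 e0 (ltr0Sn R 1)))).
  rewrite (le_lt_trans (ler_normB _ _))//.
  by rewrite [ltRHS]splitr ltrD// (lt_trans _ n2)//; [exact: (bP n).2|exact: (aP n).2].
exact: (cvg_unique _ c1 c2).
Unshelve. all: by end_near. Qed.

Lemma continuous_ins n (i : 'I_n.+1) (y : 'rV[R]_n) : continuous (fun t : R => ins i (t, y)).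
Proof.
have -> : (fun t : R => ins i (t, y)) = fun t => t *: delta_mx 0 i + ins i (0 : R, y).
  by apply/funext => t; rewrite -ins_shift addr0.
move=> t; apply: cvgD; last exact: cvg_cst.
by apply: cvgZr_tmp; exact: cvg_id.
Qed.

Lemma continuous_slice n (i : 'I_n.+1) (f : 'rV[R]_n.+1 -> R) (y : 'rV[R]_n) :
  continuous f -> continuous (fun t : R => f (ins i (t, y))).
Proof. by move=> cf t; apply: continuous_comp; [exact: continuous_ins|exact: cf]. Qed.

Lemma continuous_bounded_cube n (f : 'rV[R]_n -> R) k : continuous f ->
  exists M : R, forall x, cube R n k x -> `|f x| <= M.
Proof.
move=> cf; pose K := [set x : 'rV[R]_n | forall j, `[- k%:R : R, k%:R]%classic (x ord0 j)].
have cK : compact K by apply: (@rV_compact R n (fun=> `[- k%:R : R, k%:R]%classic)) => j; exact: segment_compact.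
have : compact (f @` K) by apply: continuous_compact => //; exact: continuous_subspaceT.
move=> /compact_bounded[M [_ MK]]; exists (M + 1) => x xk; apply: (MK (M + 1)); first by rewrite ltrDl.
exists x => // j; have := xk j => /= /andP[h1 h2]; rewrite in_itv/= h2 andbT; exact: ltW.
Qed.

Lemma continuous_loc n (f : 'rV[R]_n -> R) : continuous f -> loc_integrable f.
Proof.
move=> cf; have mf := continuous_measurable_rV cf; split=> // K cK.
have [k Kk] := compact_sub_cube cK; have mK := compact_measurable_rV cK.
have [M HM] := continuous_bounded_cube k cf.
apply: (@le_lt_trans _ _ (\int[leb n]_(x in K) cst `|M|%:E x)%E).
  apply: ge0_le_integral => //.
  - by apply/measurable_EFinP; apply: measurableT_comp => //; exact: measurable_funTS.
  - by move=> x Kx; rewrite lee_fin (le_trans (HM x (Kk _ Kx)))// ler_norm.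
rewrite integral_cst// lte_mul_pinfty// ?lee_fin//.
apply: le_lt_trans (cube_fin _ n k); apply: le_measure; rewrite ?inE//.
exact: measurable_cube.
Qed.

Lemma test_function_support n (i : 'I_n.+1) (phi : 'rV[R]_n.+1 -> R) : test_function phi ->
  exists k, forall x, ~ cube R n.+1 k x -> phi x = 0 /\ partial i phi x = 0.
Proof.
(* The extra unit leaves room around [x] where [phi] vanishes identically, so that its derivative
   vanishes too. *)
move=> [_ /compact_sub_cube[k Hk]]; exists k.+1 => x xk.
have p0 z : ~ cube R n.+1 k z -> phi z = 0.
  by move=> nz; apply: contra_notP nz => /eqP nz; apply/Hk/subset_closure.
have sub z : cube R n.+1 k z -> cube R n.+1 k.+1 z.
  move=> h j; have /andP[h1 h2] := h j.
  by rewrite (le_lt_trans _ h1) ?(le_trans h2) ?lerN2 ?ler_nat.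
split; first by apply: p0 => /sub.
rewrite -[x](ins_del i) -derive_ins.
have : \forall s \near x 0 i, 0 = phi (ins i (s, del i x)).
  have [j nj] : exists j, ~ (- k.+1%:R < x 0 j <= k.+1%:R) by apply/existsNP.
  have {}nj : k.+1%:R <= `|x 0 j|.
    by move/negP: nj; rewrite negb_and -leNgt -ltNge => /orP[h|/ltW h]; rewrite ler_normr ?h// lerNr h orbT.
  have kk : (k%:R : R) < k.+1%:R by rewrite ltr_nat.
  case: (unliftP i j) nj => [l ->|->] nj.
    near=> s; rewrite p0// => /(_ (lift i l)); rewrite ins_lift mxE => /andP[h1 h2].
    have : `|x 0 (lift i l)| <= k%:R by rewrite ler_norml h2 (ltW h1).
    by lra.
  near=> s.
  have sk : k%:R < `|s|.
    near: s; have /cvgrPdist_lt/(_ (`|x 0 i| - k%:R)) := @norm_continuous _ R^o (x 0 i).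
    rewrite subr_gt0 => /(_ (lt_le_trans kk nj)); apply: filterS => s /=.
    by rewrite ltr_norml => /andP[? ?]; lra.
  rewrite p0// => /(_ i); rewrite ins_at => /andP[h1 h2].
  have : `|s| <= k%:R by rewrite ler_norml h2 (ltW h1).
  by lra.
move=> /is_derive_near/(_ (dcst _ 0)) [_ <-] //.
Unshelve. all: by end_near. Qed.

Lemma test_function_loc n (i : 'I_n.+1) (u phi : 'rV[R]_n.+1 -> R) :
  loc_integrable u -> test_function phi ->
  (leb n.+1).-integrable setT (EFin \o (fun x => u x * phi x)) /\
  (leb n.+1).-integrable setT (EFin \o (fun x => u x * partial i phi x)).
Proof.
move=> ui tphi; have [k Hk] := test_function_support i tphi.
have cphi : continuous phi by exact: (tphi.1 0%N).
have cdphi : continuous (partial i phi) by exact: ((tphi.1 1%N).2 i).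
have key (f : 'rV[R]_n.+1 -> R) : continuous f -> (forall x, ~ cube R n.+1 k x -> f x = 0) ->
    (leb n.+1).-integrable setT (EFin \o (fun x => u x * f x)).
  move=> cf f0; have [M HM] := continuous_bounded_cube k cf.
  apply: (loc_mul (M := `|M|) ui (continuous_measurable_rV cf) _ f0) => x.
  have [/HM h|/f0 ->] := pselect (cube R n.+1 k x); last by rewrite normr0.
  exact: le_trans h (ler_norm _).
by split; apply: key => // x /Hk[].
Qed.

(** On each line the product of [u] with a test function has compact support, so its derivative
    integrates to 0. *)
Lemma weak_partial_C1 n (i : 'I_n.+1) (u g : 'rV[R]_n.+1 -> R) : continuous u -> continuous g ->
  (forall (t : R) y, is_derive t 1 (fun s : R => u (ins i (s, y))) (g (ins i (t, y)))) ->
  is_weak_partial i u g.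
Proof.
move=> cu cg dug; split; [exact: continuous_loc|exact: continuous_loc|] => phi tphi.
have [k Hk] := test_function_support i tphi.
have cphi : continuous phi by exact: (tphi.1 0%N).
have cdphi : continuous (partial i phi) by exact: ((tphi.1 1%N).2 i).
have [_ i1] := test_function_loc i (continuous_loc cu) tphi.
have [i2 _] := test_function_loc i (continuous_loc cg) tphi.
have i12 : (leb n.+1).-integrable setT (EFin \o (fun x => g x * phi x + u x * partial i phi x)).
  have := integrableD measurableT i2 i1; exact: eq_integrable.
apply/eqP; rewrite -addr_eq0 addrC -RintegralD//; apply/eqP.
apply: (integral_lines0 (i := i)) => //.
apply: ae_mono (ae_integrable2 (integrable_ins i i12)) => y iy.
have dphi (t : R) : is_derive t 1 (fun s : R => phi (ins i (s, y))) (partial i phi (ins i (t, y))).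
  rewrite -derive_ins; apply: DeriveDef => //; rewrite derivable_ins.
  exact: diff_derivable ((tphi.1 1%N).1 _).
have dP (t : R) := dM (dug t y) (dphi t).
have far (t : R) : k%:R < `|t| -> phi (ins i (t, y)) = 0.
  move=> kt; apply: (proj1 (Hk _ _)) => /(_ i); rewrite ins_at => /andP[h1 h2].
  have : `|t| <= k%:R by rewrite ler_norml h2 (ltW h1).
  by lra.
have cs (f : 'rV[R]_n.+1 -> R) := @continuous_slice _ i f y.
apply: (@primitive_integral0 (fun t => u (ins i (t, y)) * phi (ins i (t, y)))) => //.
- apply: (@primitive_off_finite _ [::]) => //.
  + by move=> t; apply: cvgM; exact: cs.
  + apply: locint_continuous => t; apply: cvgD; apply: cvgM; exact: cs.
  + by move=> t _; apply: cvgD; apply: cvgM; exact: cs.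
- move=> e T e0; exists (- (k%:R + 1 + `|T|)); first by rewrite lerNl (le_trans (ler_norm _))// normrN lerDr addr_ge0.
  rewrite far ?mulr0 ?normr0// normrN ger0_norm ?addr_ge0//.
  by rewrite -addrA ltrDl ltr_wpDr.
- move=> e T e0; exists (k%:R + 1 + `|T|); first by rewrite (le_trans (ler_norm _))// lerDr addr_ge0.
  rewrite far ?mulr0 ?normr0// ger0_norm ?addr_ge0//.
  by rewrite -addrA ltrDl ltr_wpDr.
Qed.

End lines.

(** * Integrability of powers of 1 + |x|^2 *)

Definition nsq (R : realType) n (x : 'rV[R]_n) : R := \sum_(j < n) x 0 j ^+ 2.

Section decay.
Context (R : realType).
Local Notation leb := (leb R).
Local Notation lbg := (@lebesgue_measure R).

(** Any exponent in ]1/2, 3/5] would serve. Above 1/2 the function is integrable on the line; up to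
    3/5 the comparison covers the second derivatives of a radial solution in every dimension N >= 3,
    where N / (N+2) >= 3/5 with equality for N = 3. *)
Let f (t : R) : R := (1 + t ^+ 2) `^ (- (3 / 5)).

Let f0 t : 0 <= f t. Proof. exact: powR_ge0. Qed.

Let cf : continuous f.
Proof.
move=> t; have h : 0 < 1 + t ^+ 2 by rewrite ltr_wpDr// sqr_ge0.
exact: (is_derive_continuous (@dcomp _ t (fun t => 1 + t ^+ 2) (fun x => x `^ (- (3 / 5))) _ _
  (is_derive1_powR (- (3 / 5)) h) (dD (dcst t 1) (dX 2 (did t))))).
Qed.

Lemma decay1 : (\int[lbg]_t (f t)%:E < +oo)%E.
Proof.
rewrite ge0_symfun_integralT//; last by move=> t; rewrite /f/= sqrrN.
rewrite (_ : [set x | _] = `[0, +oo[%classic); last first.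
  by apply/seteqP; split => x/=; rewrite in_itv/= andbT.
rewrite lte_mul_pinfty//.
(* From (1 + t)^2 <= 2 (1 + t^2), [f] is at most K (1 + t)^(-6/5), whose primitive [G] is explicit
   and tends to 0. *)
pose K : R := 2 `^ (3 / 5); have K0 : 0 <= K by exact: powR_ge0.
pose g (t : R) : R := K * (1 + t) `^ (- (6 / 5)).
pose G (t : R) : R := - (5 * K) * (1 + t) `^ (- (1 / 5)).
have dG (t : R) : -1 < t -> is_derive t 1 G (g t).
  move=> t1; have h : 0 < 1 + t by lra.
  have -> : g t = - (5 * K) * (- (1 / 5) * (1 + t) `^ (- (1 / 5) - 1) * (0 + 1)).
    have -> : - (1 / 5) - 1 = - (6 / 5) :> R by lra.
    by rewrite /g; field.
  exact: dZ (@dcomp _ t (fun t => 1 + t) (fun x => x `^ (- (1 / 5))) _ _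
    (is_derive1_powR (- (1 / 5)) h) (dD (dcst t 1) (did t))).
have cg (t : R) : -1 < t -> {for t, continuous g}.
  move=> t1; have h : 0 < 1 + t by lra.
  exact: (is_derive_continuous (dZ K (@dcomp _ t (fun t => 1 + t) (fun x => x `^ (- (6 / 5))) _ _
    (is_derive1_powR (- (6 / 5)) h) (dD (dcst t 1) (did t))))).
have cgw : {within `[0, +oo[, continuous g}.
  apply/continuous_within_itvcyP; split => [x|].
    by rewrite in_itv/= andbT => x0; apply: cg; lra.
  by apply: cvg_at_right_filter; apply: cg; lra.
have mg : measurable_fun (`[(0 : R), +oo[%classic : set (measurableTypeR R)) (fun t => (g t)%:E : \bar R).
  by apply/measurable_EFinP; apply: subspace_continuous_measurable_fun.
apply: (@le_lt_trans _ _ (\int[lbg]_(t in `[0%R, +oo[) (g t)%:E)%E).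
  apply: ge0_le_integral => //.
  - by move=> t _; rewrite lee_fin.
  - by apply/measurable_EFinP; apply: measurable_funTS; exact: continuous_measurable_fun cf.
  move=> t /=; rewrite in_itv/= andbT => t0; rewrite lee_fin /f /g !powRN.
  have h1 : 0 < 1 + t by lra.
  have h2 : 0 < 1 + t ^+ 2 by rewrite ltr_wpDr// sqr_ge0.
  have -> : (1 + t) `^ (6 / 5) = ((1 + t) ^+ 2) `^ (3 / 5).
    rewrite -powR_mulrn ?(ltW h1)// -powRrM; congr (_ `^ _); lra.
  have A0 : 0 < (1 + t ^+ 2) `^ (3 / 5) by exact: powR_gt0.
  have B0 : 0 < ((1 + t) ^+ 2) `^ (3 / 5) by apply: powR_gt0; rewrite exprn_gt0.
  rewrite ler_pdivlMr// mulrC ler_pdivrMr// /K -powRM ?(ltW h2)//.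
  have s0 := sqr_ge0 (t - 1).
  by apply: powR_le; rewrite ?sqr_ge0//; nra.
have FE : (\int[lbg]_(t in `[0%R, +oo[) (g t)%:E = 0%:E - (G 0)%:E)%E; last by rewrite FE -EFinB ltry.
apply: ge0_continuous_FTC2y.
- by move=> x _; rewrite mulr_ge0 ?powR_ge0.
- exact: cgw.
- apply/cvgrPdist_lt => e e0; pose M := 5 * K / e + 1.
  have M0 : 0 < M by rewrite ltr_wpDl// divr_ge0 ?(ltW e0)// mulr_ge0.
  near=> t; have tM : M `^ 5 < t by near: t; exact: nbhs_pinfty_gt.
  have t0 : 0 < 1 + t by rewrite addr_gt0// (le_lt_trans _ tM)// powR_ge0.
  rewrite sub0r normrN normrM normrN (ger0_norm (powR_ge0 _ _)) ger0_norm ?mulr_ge0//.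
  rewrite powRN ltr_pdivrMr ?powR_gt0//.
  have : M < (1 + t) `^ (1 / 5).
    have <- : (M `^ 5) `^ (1 / 5) = M.
      by rewrite -powRrM mul1r divff ?pnatr_eq0// powRr1// ltW.
    by apply: powR_lt; rewrite ?powR_ge0//; lra.
  rewrite -(ltr_pM2l e0); apply: le_lt_trans.
  by rewrite /M mulrDr mulr1 mulrCA divff ?gt_eqF// mulr1 lerDl ltW.
- move=> x x0; have h : -1 < x by lra.
  by have [] := dG x h.
- have h : -1 < (0 : R) by lra.
  exact: cvg_at_right_filter (is_derive_continuous (dG 0 h)).
- move=> x; rewrite in_itv/= andbT => x0; rewrite derive1E.
  have h : -1 < x by lra.
  by have [_] := dG x h.
Unshelve. all: by end_near. Qed.

Lemma decay_tprod n : (\int[leb n]_x (tprod (fun=> f) x)%:E < +oo)%E.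
Proof.
have mt k : measurable_fun setT (fun x : 'rV[R]_k => (tprod (fun=> f) x)%:E : \bar R).
  apply/measurable_EFinP; apply: measurable_tprod => j; exact: continuous_measurable_fun cf.
have t0 k (x : 'rV[R]_k) : (0 <= (tprod (fun=> f) x)%:E)%E by rewrite lee_fin; apply: prodr_ge0.
have mf : measurable_fun setT (fun x => (f x)%:E : \bar R).
  by apply/measurable_EFinP; exact: continuous_measurable_fun cf.
elim: n => [|n IH].
  rewrite (_ : (\int[leb 0]_x _)%E = (\int[leb 0]_x cst 1%:E x)%E).
    by rewrite integral_cst// /leb/= diracT mule1 ltry.
  by apply: eq_integral => x _; rewrite /tprod big_ord0.
rewrite (leb_tonelli ord0 (mt _) (t0 _)).
have -> : (\int[lbg]_t \int[leb n]_y (tprod (fun=> f) (ins ord0 (t, y)))%:E =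
    \int[lbg]_t ((f t)%:E * \int[leb n]_y (tprod (fun=> f) y)%:E))%E.
  apply: eq_integral => t _; rewrite -ge0_integralZl//; [|exact: mt|by rewrite lee_fin].
  by apply: eq_integral => y _; rewrite tprod_ins EFinM.
rewrite ge0_integralZr//; last 2 first.
- by move=> t _; rewrite lee_fin.
- exact: integral_ge0.
have /fineK <- : (\int[leb n]_y (tprod (fun=> f) y)%:E)%E \is a fin_num.
  by rewrite ge0_fin_numE// integral_ge0.
by rewrite muleC lte_mul_pinfty ?decay1// lee_fin fine_ge0// integral_ge0.
Qed.

Lemma nsq_ge0 n (x : 'rV[R]_n) : 0 <= nsq x.
Proof. by apply: sumr_ge0 => j _; exact: sqr_ge0. Qed.

(** Each 1 + x_j^2 is at most 1 + |x|^2, so the radial power is dominated by the product function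
    [tprod (fun=> f)], integrable by Tonelli. *)
Lemma decay_integrable n (h : 'rV[R]_n -> R) (C K : R) : measurable_fun setT h ->
  0 <= C -> 3 / 5 * n%:R <= K -> (forall x, `|h x| <= C * (1 + nsq x) `^ (- K)) ->
  (leb n).-integrable setT (EFin \o h).
Proof.
move=> mh C0 nK hC.
have mt : measurable_fun setT (fun x : 'rV[R]_n => (tprod (fun=> f) x)%:E : \bar R).
  apply/measurable_EFinP; apply: measurable_tprod => j; exact: continuous_measurable_fun cf.
have t0 (x : 'rV[R]_n) : 0 <= tprod (fun=> f) x by apply: prodr_ge0.
apply: (@le_integrable _ _ _ (leb n) setT _ _ (fun x => C%:E * (tprod (fun=> f) x)%:E)%E) => //.
- exact/measurable_EFinP.
- move=> x _; rewrite -EFinM /= lee_fin [leRHS]ger0_norm ?mulr_ge0//.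
  apply: (le_trans (hC x)); rewrite ler_wpM2l//.
  have n1 : 1 <= 1 + nsq x by rewrite lerDl nsq_ge0.
  apply: (@le_trans _ _ ((1 + nsq x) `^ (- (3 / 5) * n%:R))).
    by apply: ler_powR => //; rewrite mulNr lerN2.
  rewrite powRrM powR_mulrn ?powR_ge0// -[X in _ ^+ X]card_ord -prodr_const.
  apply: ler_prod => j _; rewrite powR_ge0/= /f !powRN.
  have h2 : 0 < 1 + x 0 j ^+ 2 by rewrite ltr_wpDr// sqr_ge0.
  rewrite lef_pV2 ?posrE ?powR_gt0//; last by rewrite (lt_le_trans ltr01).
  have h3 : 1 <= 1 + x 0 j ^+ 2 by rewrite lerDl sqr_ge0.
  apply: powR_le; [lra|exact: ltW|].
  by rewrite lerD2l /nsq (bigD1 j)//= lerDl sumr_ge0// => k _; exact: sqr_ge0.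
apply: integrableZl => //; apply/integrableP; split => //.
have := decay_tprod n; congr (_ < _)%E.
by apply: eq_integral => x _; rewrite gee0_abs// lee_fin.
Qed.

End decay.

(** * Critical points of the functional *)

Section integrable_real.
Context d (T : measurableType d) (R : realType).
Variable mu : {measure set T -> \bar R}.

Lemma integrable_scale (c : R) (f : T -> R) : mu.-integrable setT (EFin \o f) ->
  mu.-integrable setT (EFin \o (fun x => c * f x)).
Proof. by move=> fi; exact: eq_integrable (integrableZl measurableT c fi). Qed.

Lemma integrable_add (f g : T -> R) : mu.-integrable setT (EFin \o f) ->
  mu.-integrable setT (EFin \o g) -> mu.-integrable setT (EFin \o (fun x => f x + g x)).
Proof. by move=> fi gi; exact: eq_integrable (integrableD measurableT fi gi). Qed.

End integrable_real.

Section d12_add.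
Context (R : realType) (m : nat).
Local Notation N := m.+3.
Local Notation mu := (leb R N).
Local Notation p := (crit_exp R N).
Implicit Types u v : 'rV[R]_N -> R.

Lemma loc_integrableD u v : loc_integrable u -> loc_integrable v -> loc_integrable (u \+ v).
Proof.
move=> [mu_ ui] [mv vi]; split=> [|K cK]; first exact: measurable_funD.
have mK := compact_measurable_rV cK.
have mabs (f : 'rV[R]_N -> R) : measurable_fun setT f -> measurable_fun K (fun x => `|f x|%:E : \bar R).
  by move=> mf; apply/measurable_EFinP; apply: measurableT_comp => //; exact: measurable_funTS.
apply: (@le_lt_trans _ _ (\int[mu]_(x in K) (`|u x|%:E + `|v x|%:E))%E).
  apply: ge0_le_integral => //.
  - by apply: mabs; exact: measurable_funD.
  - by apply: emeasurable_funD; exact: mabs.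
  - by move=> x _; rewrite -EFinD lee_fin ler_normD.
rewrite ge0_integralD//; try exact: mabs.
by apply: lte_add_pinfty; [exact: ui|exact: vi].
Qed.

Lemma is_weak_partialD (i : 'I_N) u v g h : is_weak_partial i u g -> is_weak_partial i v h ->
  is_weak_partial i (u \+ v) (g \+ h).
Proof.
move=> [ui gi H1] [vi hi H2]; split; [exact: loc_integrableD|exact: loc_integrableD|] => phi tphi.
have [gp _] := test_function_loc i gi tphi; have [hp _] := test_function_loc i hi tphi.
have [_ up] := test_function_loc i ui tphi; have [_ vp] := test_function_loc i vi tphi.
transitivity (\int[mu]_x (u x * partial i phi x + v x * partial i phi x)).
  by congr Rintegral; apply/funext => x /=; rewrite mulrDl.
rewrite RintegralD// H1// H2// -opprD -RintegralD//; congr (- _).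
by congr Rintegral; apply/funext => x /=; rewrite mulrDl.
Qed.

Lemma crit_exp_ge1 : 1 <= p.
Proof. by rewrite (le_trans _ (ltW (crit_exp_gt2 R m)))// ler1n. Qed.

Lemma D12D u v : D12 u -> D12 v -> D12 (u \+ v).
Proof.
move=> [uL uW] [vL vW]; split.
  have p1 : (1 <= p%:E)%E by rewrite lee_fin crit_exp_ge1.
  exact: (Lfun_addr_closed mu p1).2.
move=> i; have [g gw gL] := uW i; have [h hw hL] := vW i.
exists (g \+ h); first exact: is_weak_partialD.
have p1 : (1 <= 2%:E :> \bar R)%E by rewrite lee_fin ler1n.
exact: (Lfun_addr_closed mu p1).2.
Qed.

Lemma D12_partialD (i : 'I_N) u v : D12 u -> D12 v ->
  {ae mu, forall x, weak_partial i (u \+ v) x = weak_partial i u x + weak_partial i v x}.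
Proof.
move=> uD vD; have [wu _] := D12_partial i uD; have [wv _] := D12_partial i vD.
have [wuv _] := D12_partial i (D12D uD vD).
exact: weak_partial_unique wuv (is_weak_partialD wu wv).
Qed.

Lemma D12_measurable v : D12 v -> measurable_fun setT v.
Proof. by move=> /(D12_partial ord0)[[[]]]. Qed.

Lemma powR_integrable v : D12 v -> mu.-integrable setT (EFin \o (fun x => `|v x| `^ p)).
Proof. by move=> vD; exact: Lfun_integrable crit_exp_ge1 vD.1. Qed.

(** Hoelder's inequality with exponents N/2 and p/2, then Sobolev. The weights in use are the
    indicator of Omega and |u|^(p-2). *)
Lemma weighted_bound (w : 'rV[R]_N -> R) : measurable_fun setT w -> (forall x, 0 <= w x) ->
  (\int[mu]_x (w x `^ (N%:R / 2))%:E < +oo)%E ->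
  exists2 K : R, 0 <= K & forall v, D12 v ->
    mu.-integrable setT (EFin \o (fun x => w x * v x ^+ 2)) /\
    \int[mu]_x (w x * v x ^+ 2) <= K * D12_norm v ^+ 2.
Proof.
move=> mw w0 wi; have [C C0 HC] := sobolev R m.
pose th : R := 2 / N%:R.
have m3 : (m%:R + 3 != 0 :> R) by rewrite -natrD pnatr_eq0 addn3.
have m1 : (m%:R + 1 != 0 :> R) by rewrite natr1 pnatr_eq0.
have N0 : (0 : R) < N%:R by rewrite ltr0n.
have th01 : 0 < th < 1 by rewrite divr_gt0//= ltr_pdivrMr// mul1r ltr_nat.
have th1 : 0 < 1 - th by have /andP[_] := th01; rewrite subr_gt0.
have /fineK wE : (\int[mu]_x (w x `^ (N%:R / 2))%:E)%E \is a fin_num.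
  by rewrite ge0_fin_numE// integral_ge0// => x _; rewrite lee_fin powR_ge0.
set A := fine _ in wE.
have A0 : 0 <= A by rewrite fine_ge0// integral_ge0// => x _; rewrite lee_fin powR_ge0.
exists (A `^ th * C `^ (1 - th)) => [|v vD]; first by rewrite mulr_ge0 ?powR_ge0.
have mv := D12_measurable vD; have d0 := D12_norm_ge0 v.
have m1' : measurable_fun setT (fun x => (w x `^ (N%:R / 2))%:E : \bar R).
  by apply/measurable_EFinP; apply: (measurableT_comp (measurable_powR _)).
have m2 : measurable_fun setT (fun x => (`|v x| `^ p)%:E : \bar R).
  by apply: measurable_int (powR_integrable vD).
have mwv : measurable_fun setT (fun x => (w x * v x ^+ 2)%:E : \bar R).
  by apply/measurable_EFinP; apply: measurable_funM => //; exact: measurable_funX.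
have E x : ((w x * v x ^+ 2)%:E = ((w x `^ (N%:R / 2))%:E `^ th * (`|v x| `^ p)%:E `^ (1 - th)))%E.
  rewrite !poweR_EFin -EFinM -!powRrM; congr (_ * _)%:E.
    by rewrite /th (_ : _ / 2 * _ = 1) ?powRr1//; field; rewrite gt_eqF.
  rewrite (_ : _ * (1 - th) = 2) ?powR_mulrn// ?real_normK ?num_real//.
  by rewrite /th crit_expE; field; apply/andP.
have X0 : 0 <= \int[mu]_x `|v x| `^ p by apply: Rintegral_ge0 => x _; exact: powR_ge0.
have XE : (\int[mu]_x (`|v x| `^ p)%:E = (\int[mu]_x `|v x| `^ p)%:E)%E.
  by rewrite fineK//; exact: integrable_fin_num (powR_integrable vD).
have B : (\int[mu]_x (w x * v x ^+ 2)%:E <= (A `^ th * C `^ (1 - th) * D12_norm v ^+ 2)%:E)%E.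
  under eq_integral do rewrite E.
  apply: (le_trans (hoelder_ge0 _ th01 m1' m2 _ _)).
  - by move=> x; rewrite lee_fin powR_ge0.
  - by move=> x; rewrite lee_fin powR_ge0.
  rewrite -wE XE !poweR_EFin -EFinM lee_fin -mulrA ler_wpM2l ?powR_ge0//.
  have := powR_le (ltW th1) X0 (HC v vD).
  rewrite powRM ?(ltW C0) ?powR_ge0// -powRrM (_ : p * (1 - th) = 2) ?powR_mulrn//.
  by rewrite /th crit_expE; field; apply/andP.
have i : mu.-integrable setT (EFin \o (fun x => w x * v x ^+ 2)).
  apply/integrableP; split => //; apply: le_lt_trans (ltry _); apply: le_trans B.
  rewrite le_eqVlt; apply/orP; left; apply/eqP; apply: eq_integral => x _.
  by rewrite gee0_abs// lee_fin mulr_ge0 ?sqr_ge0.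
by split => //; rewrite -lee_fin fineK//; exact: integrable_fin_num i.
Qed.

End d12_add.

Section criterion.
Context (R : realType) (m : nat).
Local Notation N := m.+3.
Local Notation mu := (leb R N).
Local Notation p := (crit_exp R N).
Implicit Types u v : 'rV[R]_N -> R.
Variables (Om : set 'rV[R]_N) (lam : R).
Hypotheses (mOm : measurable Om) (Omfin : (mu Om < +oo)%E).

Let Jd v x := 2^-1 * (grad_sq v x + lam * \1_Om x * v x ^+ 2) - p^-1 * (Q Om x * `|v x| `^ p).

Let p2 := crit_exp_gt2 R m.

Let p0 : 0 < p. Proof. exact: lt_trans p2. Qed.

Lemma Q_le1 x : `|Q Om x| <= 1.
Proof. by rewrite /Q; case: ifP; rewrite ?normrN normr1. Qed.

Lemma measurable_Q : measurable_fun setT (Q Om).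
Proof.
have -> : Q Om = fun x => 2 * \1_Om x - 1 :> R.
  by apply/funext => x; rewrite /Q indicE; case: ifP => _ /=; ring.
apply: measurable_funB => //; apply: measurable_funM => //; exact: measurable_indic.
Qed.

Lemma indic_bound : exists2 K : R, 0 <= K & forall v, D12 v ->
    mu.-integrable setT (EFin \o (fun x => \1_Om x * v x ^+ 2)) /\
    \int[mu]_x (\1_Om x * v x ^+ 2) <= K * D12_norm v ^+ 2.
Proof.
apply: weighted_bound => //.
have -> : (\int[mu]_x (\1_Om x `^ (N%:R / 2))%:E = \int[mu]_x (\1_Om x)%:E)%E.
  apply: eq_integral => x _; rewrite indicE; case: (_ \in _); rewrite ?powR1// powR0//.
by have := integral_indic mu measurableT mOm; rewrite setIT => ->.
Qed.

Lemma Q_integrable v : D12 v -> mu.-integrable setT (EFin \o (fun x => Q Om x * `|v x| `^ p)).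
Proof.
move=> vD; have vi := powR_integrable vD.
apply: (@le_integrable _ _ _ mu setT _ _ (EFin \o (fun x => `|v x| `^ p))) => //.
- apply/measurable_EFinP; apply: measurable_funM; first exact: measurable_Q.
  by apply/measurable_EFinP; exact: measurable_int vi.
- move=> x _; rewrite lee_fin normrM ler_piMl ?Q_le1//.
Qed.

Lemma Jd_integrable v : D12 v -> mu.-integrable setT (EFin \o Jd v).
Proof.
move=> vD; have [K _ /(_ v vD)[i2 _]] := indic_bound.
have i1 := grad_sq_integrable vD; have i3 := Q_integrable vD.
have i2' := integrableZl measurableT lam i2.
have i12 := integrableZl measurableT 2^-1 (integrableD measurableT i1 i2').
have := integrableB measurableT i12 (integrableZl measurableT p^-1 i3).
apply: eq_integrable => // x _ /=; rewrite /Jd -!EFinM -!EFinD -?EFinB; congr EFin.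
by ring.
Qed.

Lemma JE v : D12 v -> J Om lam v = \int[mu]_x Jd v x.
Proof.
move=> vD; have [K _ /(_ v vD)[i2 _]] := indic_bound.
have i1 := grad_sq_integrable vD; have i3 := Q_integrable vD.
have i2' := integrableZl measurableT lam i2.
have i12 : mu.-integrable setT (EFin \o (fun x => grad_sq v x + lam * \1_Om x * v x ^+ 2)).
  have := integrableD measurableT i1 i2'; apply: eq_integrable => // x _ /=.
  by rewrite -EFinM -EFinD; congr EFin; ring.
by rewrite /J -!RintegralZl// -RintegralB//; exact: integrable_scale.
Qed.

(** Once the linear part [h], of zero integral, is subtracted, the increment of J is dominated
    almost everywhere by a function [B] whose integral is at most A |v|^2 as soon as |v| <= 1; a
    small [d] makes this at most e |v|. *)
Theorem critical_point_weak u : D12 u ->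
  (forall v, D12 v ->
    let h x := \sum_(i < N) weak_partial i u x * weak_partial i v x
      + v x * (lam * \1_Om x * u x - Q Om x * spow p (u x)) in
    mu.-integrable setT (EFin \o h) /\ \int[mu]_x h x = 0) ->
  solution Om lam u.
Proof.
move=> uD H; split => // e e0.
have [C1 C10 taylor] := powR_abs_taylor (ltW p2).
have [C2 C20 sob] := sobolev R m.
have [K1 K10 HK1] := indic_bound.
have mu_ := D12_measurable uD.
have [K2 K20 HK2] : exists2 K : R, 0 <= K & forall v, D12 v ->
    mu.-integrable setT (EFin \o (fun x => `|u x| `^ (p - 2) * v x ^+ 2)) /\
    \int[mu]_x (`|u x| `^ (p - 2) * v x ^+ 2) <= K * D12_norm v ^+ 2.
  apply: weighted_bound => //.
  - apply: (measurableT_comp (measurable_powR _)); exact: measurableT_comp.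
  under eq_integral do rewrite -powRrM.
  (* Criticality of the exponent: the N/2-th power of |u|^(p-2) is exactly |u|^p. *)
  have -> : (p - 2) * (N%:R / 2) = p.
    by rewrite crit_expE; field; rewrite nat1r pnatr_eq0.
  have /integrableP[_] := powR_integrable uD; congr (_ < _)%E.
  by apply: eq_integral => x _; rewrite gee0_abs// lee_fin powR_ge0.
(* The four summands bound the four terms of [B]: the gradient, the linear potential on Omega, and
   the two parts of the Taylor remainder. *)
pose A := 2^-1 + 2^-1 * `|lam| * K1 + p^-1 * C1 * K2 + p^-1 * C1 * C2.
have ip0 : 0 <= p^-1 by rewrite invr_ge0 ltW.
have A0 : 0 <= A by rewrite !addr_ge0 ?mulr_ge0 ?(ltW C20)//; lra.
exists (Num.min 1 (e / (A + 1))).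
  by rewrite lt_min ltr01 divr_gt0// ltr_wpDl.
move=> v vD; set d := D12_norm v; rewrite lt_min => /andP[d1 de].
have d0 : 0 <= d by exact: D12_norm_ge0.
have uvD := D12D uD vD.
have [hi hI] := H v vD; move: hi hI; set h := (fun x => _) => hi hI.
rewrite !JE//.
have i1 := Jd_integrable uvD; have i0 := Jd_integrable uD.
have i10 : mu.-integrable setT (EFin \o (fun x => Jd (u \+ v) x - Jd u x)).
  exact: eq_integrable (integrableB measurableT i1 i0).
have iF : mu.-integrable setT (EFin \o (fun x => Jd (u \+ v) x - Jd u x - h x)).
  exact: eq_integrable (integrableB measurableT i10 hi).
have -> : \int[mu]_x Jd (u \+ v) x - \int[mu]_x Jd u x =
    \int[mu]_x (Jd (u \+ v) x - Jd u x - h x).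
  by rewrite (RintegralB measurableT i10 hi) hI subr0 (RintegralB measurableT i1 i0).
pose B x := 2^-1 * grad_sq v x + (2^-1 * `|lam| * (\1_Om x * v x ^+ 2)
  + (p^-1 * C1 * (`|u x| `^ (p - 2) * v x ^+ 2) + p^-1 * C1 * `|v x| `^ p)).
have [j1 J1] := HK1 v vD; have [j2 J2] := HK2 v vD.
have j0 := grad_sq_integrable vD; have j3 := powR_integrable vD.
have zi := @integrable_scale _ _ R mu; have ad := @integrable_add _ _ R mu.
have k23 := ad _ _ (zi (p^-1 * C1) _ j2) (zi (p^-1 * C1) _ j3).
have k123 := ad _ _ (zi (2^-1 * `|lam|) _ j1) k23.
have iB : mu.-integrable setT (EFin \o B) by exact: ad (zi 2^-1 _ j0) k123.
have aeB : {ae mu, forall x, `|Jd (u \+ v) x - Jd u x - h x| <= B x}.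
  apply: ae_mono (ae_ord (fun i => D12_partialD i uD vD)) => x Hx.
  pose rem := `|u x + v x| `^ p - `|u x| `^ p - p * spow p (u x) * v x.
  have -> : Jd (u \+ v) x - Jd u x - h x =
      2^-1 * grad_sq v x + (2^-1 * lam * (\1_Om x * v x ^+ 2) - p^-1 * Q Om x * rem).
    have G : grad_sq (u \+ v) x = grad_sq u x + 2 * (\sum_(i < N) weak_partial i u x * weak_partial i v x) + grad_sq v x.
      rewrite /grad_sq mulr_sumr -!big_split/=; apply: eq_bigr => i _; rewrite Hx; ring.
    rewrite /Jd /h /rem G /=; move: (\sum_(i < N) _) (\1_Om x) => S I.
    by field; rewrite gt_eqF.
  rewrite (le_trans (ler_normD _ _))// lerD//.
    by rewrite ger0_norm// mulr_ge0// ?invr_ge0// grad_sq_ge0.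
  rewrite (le_trans (ler_normB _ _))// lerD//.
    rewrite 2!normrM ger0_norm ?invr_ge0// [X in _ * X]ger0_norm//.
    by rewrite mulr_ge0 ?sqr_ge0// indicE.
  rewrite -mulrDr 2!normrM (ger0_norm ip0) -!mulrA ler_wpM2l//.
  by apply: le_trans (taylor (u x) (v x)); rewrite ler_piMl ?Q_le1.
apply: (@le_trans _ _ (\int[mu]_x B x)).
  apply: (le_trans (le_normr_Rintegral measurableT iF)).
  have iaF : mu.-integrable setT (EFin \o (fun x => `|Jd (u \+ v) x - Jd u x - h x|)).
    exact: integrable_norm iF.
  rewrite -lee_fin fineK; last exact: integrable_fin_num iaF.
  rewrite fineK; last exact: integrable_fin_num iB.
  apply: ae_ge0_le_integral => //.
  - exact: measurable_int iaF.
  - move=> x _; have I0 : 0 <= \1_Om x :> R by rewrite indicE.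
    rewrite lee_fin /B; move: (v x ^+ 2) (sqr_ge0 (v x)) => w w0.
    by rewrite !addr_ge0 ?mulr_ge0 ?powR_ge0 ?grad_sq_ge0.
  - exact: measurable_int iB.
  by apply: ae_mono aeB => x Hx _; rewrite lee_fin.
have -> : \int[mu]_x B x = 2^-1 * d ^+ 2 + (2^-1 * `|lam| * \int[mu]_x (\1_Om x * v x ^+ 2)
    + (p^-1 * C1 * \int[mu]_x (`|u x| `^ (p - 2) * v x ^+ 2) + p^-1 * C1 * \int[mu]_x (`|v x| `^ p))).
  rewrite (RintegralD measurableT (zi 2^-1 _ j0) k123).
  rewrite (RintegralD measurableT (zi (2^-1 * `|lam|) _ j1) k23).
  rewrite (RintegralD measurableT (zi (p^-1 * C1) _ j2) (zi (p^-1 * C1) _ j3)).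
  by rewrite !RintegralZl// -D12_norm_sqr.
have dp : d `^ p <= d ^+ 2.
  have [->|dn] := eqVneq d 0; first by rewrite powR0 ?expr0n// gt_eqF.
  rewrite -powR_mulrn//; apply: ger_powR (ltW p2).
  by rewrite lt_def dn d0 ltW.
apply: (@le_trans _ _ (A * d ^+ 2)).
  have c1 : 0 <= 2^-1 * `|lam| by rewrite mulr_ge0.
  have c2 : 0 <= p^-1 * C1 by rewrite mulr_ge0.
  have := ler_wpM2l c1 J1; have := ler_wpM2l c2 J2; have := ler_wpM2l c2 (sob v vD).
  have := ler_wpM2l (mulr_ge0 c2 (ltW C20)) dp; rewrite /A -/d.
  by clear -c1 c2; lra.
rewrite expr2 mulrA ler_wpM2r//.
have : d * (A + 1) < e by rewrite -ltr_pdivlMr// ltr_wpDl.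
by move=> hd; apply/ltW/(le_lt_trans _ hd); rewrite mulrC ler_wpM2l ?lerDl// ltW.
Qed.

End criterion.

(** * Radial solutions *)

Lemma Lfun_of_integrable (R : realType) N (f : 'rV[R]_N -> R) (r : R) : 0 < r ->
  measurable_fun setT f -> (leb R N).-integrable setT (fun x => (`|f x| `^ r)%:E) ->
  f \in Lfun (leb R N) r%:E.
Proof.
move=> r0 mf /integrableP[_ fi]; rewrite inE/=; apply/andP; split; rewrite inE//=.
rewrite /finite_norm unlock; apply: poweR_lty; move: fi; congr (_ < _)%E.
by apply: eq_integral => x _; rewrite gee0_abs ?lee_fin ?powR_ge0// gt_eqF// poweR_EFin.
Qed.

Lemma measurable_off_finite (R : realType) (S : seq R) (f : R -> R) :
  (forall t, t \notin S -> {for t, continuous f}) -> measurable_fun setT f.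
Proof.
move=> cf; have fS : finite_set [set` S] by [].
have cS : closed ([set` S] : set R).
  have acc : accessible_space R := hausdorff_accessible (@Rhausdorff R).
  exact: (proj1 accessible_finite_set_closed acc _ fS).
have fm (B : set R) : finite_set B -> measurable (B : set (measurableTypeR R)).
  by move=> fB; apply: countable_measurable => //; exact: finite_set_countable.
have mS := fm _ fS; move=> _ B mB; rewrite setTI.
rewrite (_ : f @^-1` B = ([set` S] `&` f @^-1` B) `|` (~` [set` S] `&` f @^-1` B)); last first.
  by rewrite -setIUl setUv setTI.
apply: measurableU; first by apply: fm; exact: finite_setIl.
apply: (open_continuous_measurable_fun (closed_openC cS)) => //; last exact: measurableC.
by move=> x; rewrite inE => /negP xS; exact: cf.
Qed.

Section radial.
Context (R : realType) (m : nat).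
Local Notation N := m.+3.
Local Notation mu := (leb R N).
Local Notation lbg := (@lebesgue_measure R).
Local Notation p := (crit_exp R N).

Lemma nsq_ins n (i : 'I_n.+1) (t : R) (y : 'rV[R]_n) : nsq (ins i (t, y)) = t ^+ 2 + nsq y.
Proof.
rewrite /nsq (bigD1_ord i)//= ins_at; congr (_ + _).
by apply: eq_bigr => j _; rewrite ins_lift.
Qed.

Lemma nsq_continuous n : continuous (@nsq R n).
Proof.
move=> x; rewrite /nsq; elim: (index_enum _) => [|j s IH].
  rewrite (_ : (fun _ => _) = cst 0); first exact: cst_continuous.
  by apply/funext => z; rewrite big_nil.
have c1 := @coord_continuous R 1 n 0 j x.
rewrite (_ : (fun _ => _) = (fun z : 'rV[R]_n => z 0 j) * (fun z : 'rV[R]_n => z 0 j) + (fun z => \sum_(j <- s) z 0 j ^+ 2)).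
  by apply: continuousD => //; exact: continuousM.
by apply/funext => z; rewrite big_cons expr2.
Qed.

Variables (om : set R) (lam : R).
Local Notation Om := [set x : 'rV[R]_N | om (nsq x)].
Hypotheses (mOm : measurable Om) (Omfin : (mu Om < +oo)%E).
Variables (U V W : R -> R) (S : seq R) (C : R).
Hypotheses (hU : forall r : R, is_derive r 1 U (V r)) (cV : continuous V).
Hypotheses (hV : forall r : R, r \notin S -> is_derive r 1 V (W r)).
Hypotheses (cW : forall r : R, r \notin S -> {for r, continuous W}).
Hypotheses (C0 : 0 <= C)
  (bU : forall r : R, 0 <= r -> `|U r| <= C * (1 + r) `^ (- (N%:R / 2 - 1)))
  (bV : forall r : R, 0 <= r -> `|V r| <= C * (1 + r) `^ (- (N%:R / 2)))
  (bW : forall r : R, 0 <= r -> `|W r| <= C * (1 + r) `^ (- (N%:R / 2 + 1))).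
Hypothesis ode : forall r : R, 0 <= r ->
  4 * r * W r + 2 * N%:R * V r = lam * \1_om r * U r - (if r \in om then 1 else -1) * spow p (U r).

Let u (x : 'rV[R]_N) := U (nsq x).
Let g (i : 'I_N) (x : 'rV[R]_N) := 2 * x 0 i * V (nsq x).
(** The second partial derivative of [u] in direction [i], off the spheres of squared radius in [S].
    The sum over [i] is the Laplacian, 4 r W + 2 N V at r = |x|^2. *)
Let L (i : 'I_N) (x : 'rV[R]_N) := 2 * V (nsq x) + 4 * x 0 i ^+ 2 * W (nsq x).

Let cU : continuous U. Proof. by move=> r; exact: is_derive_continuous (hU r). Qed.

Let cu : continuous u.
Proof. by move=> x; apply: continuous_comp; [exact: nsq_continuous|exact: cU]. Qed.

Let cg i : continuous (g i).
Proof.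
move=> x; have c1 := @coord_continuous R 1 N 0 i x.
have c2 : {for x, continuous (fun x : 'rV[R]_N => V (nsq x))}.
  by apply: continuous_comp; [exact: nsq_continuous|exact: cV].
apply: (@continuousM _ _ (fun x : 'rV[R]_N => 2 * x 0 i) (fun x : 'rV[R]_N => V (nsq x))) => //.
by apply: (@continuousM _ _ (fun=> 2) (fun x : 'rV[R]_N => x 0 i)) => //; exact: cst_continuous.
Qed.

Let mL i : measurable_fun setT (L i).
Proof.
have mn : measurable_fun setT (@nsq R N) by exact: continuous_measurable_rV (@nsq_continuous _).
apply: measurable_funD.
  by apply: measurable_funM => //; apply: (measurableT_comp _ mn); exact: continuous_measurable_fun cV.
apply: measurable_funM; last by apply: (measurableT_comp _ mn); exact: measurable_off_finite cW.
by apply: measurable_funM => //; apply: measurable_funX; exact: measurable_coord.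
Qed.

Let wug i : is_weak_partial i u (g i).
Proof.
apply: weak_partial_C1; [exact: cu|exact: cg|move=> t y]; rewrite /g /u.
under eq_fun do rewrite nsq_ins.
rewrite nsq_ins ins_at.
have -> : 2 * t * V (t ^+ 2 + nsq y) = V (t ^+ 2 + nsq y) * (2%:R * t ^+ 1 * 1 + 0) by ring.
apply: (@dcomp _ t (fun s : R => s ^+ 2 + nsq y) U _ _ (hU _)).
exact: dD (dX 2 (did t)) (dcst t _).
Qed.

Let coord_le i (x : 'rV[R]_N) : x 0 i ^+ 2 <= 1 + nsq x.
Proof.
rewrite /nsq (bigD1 i)//=; have : 0 <= \sum_(j < N | j != i) x 0 j ^+ 2.
  by apply: sumr_ge0 => j _; exact: sqr_ge0.
lra.
Qed.

Let q0 (x : 'rV[R]_N) : 0 < 1 + nsq x.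
Proof. by rewrite ltr_wpDr// nsq_ge0. Qed.

Let bL i x : `|L i x| <= 6 * C * (1 + nsq x) `^ (- (N%:R / 2)).
Proof.
have n0 := nsq_ge0 x; have := bV n0; have := bW n0; have x0 := sqr_ge0 (x 0 i).
have E : (1 + nsq x) * (1 + nsq x) `^ (- (N%:R / 2 + 1)) = (1 + nsq x) `^ (- (N%:R / 2)).
  rewrite -[RHS](_ : (1 + nsq x) `^ (1 + - (N%:R / 2 + 1)) = _); last by congr (_ `^ _); ring.
  by rewrite powRD ?powRr1 ?(ltW (q0 x))// (gt_eqF (q0 x)) implybT.
move=> hW; have := ler_pM x0 (normr_ge0 _) (coord_le i x) hW.
rewrite [X in _ <= X]mulrCA E => hxW hVb.
have -> : L i x = 2 * V (nsq x) + 4 * (x 0 i ^+ 2 * W (nsq x)) by rewrite /L; ring.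
rewrite (le_trans (ler_normD _ _))// (normrM 2) (normrM 4) (normrM (_ ^+ 2)) (ger0_norm x0).
by rewrite (ger0_norm (ler0n R 2)) (ger0_norm (ler0n R 4)); lra.
Qed.

Let p2 := crit_exp_gt2 R m.

Let p0 : 0 < p. Proof. exact: lt_trans p2. Qed.

Let N0 : (0 : R) < N%:R. Proof. by rewrite ltr0n. Qed.

Let N3 : (3 : R) <= N%:R. Proof. by rewrite ler_nat. Qed.

Let decay_pow (f : 'rV[R]_N -> R) (M a r : R) : 0 < r -> 0 <= M ->
  measurable_fun setT f -> (forall x, `|f x| <= M * (1 + nsq x) `^ (- a)) ->
  3 / 5 * N%:R <= a * r -> mu.-integrable setT (EFin \o (fun x => `|f x| `^ r)).
Proof.
move=> r0 M0 mf fM ar; apply: (@decay_integrable _ _ _ (M `^ r) (a * r)) => //.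
- by apply: (measurableT_comp (measurable_powR _)); exact: measurableT_comp.
- exact: powR_ge0.
move=> x; rewrite ger0_norm ?powR_ge0//; apply: (le_trans (powR_le (ltW r0) (normr_ge0 _) (fM x))).
by rewrite powRM ?powR_ge0// -powRrM mulNr.
Qed.

Let pN : (N%:R / 2 - 1) * p = N%:R.
Proof. by rewrite crit_expE; field; rewrite nat1r pnatr_eq0. Qed.

Let ui : mu.-integrable setT (EFin \o (fun x => `|u x| `^ p)).
Proof.
apply: (@decay_pow u C (N%:R / 2 - 1)) => //.
- exact: continuous_measurable_rV.
- by move=> x; exact: bU (nsq_ge0 x).
- by rewrite pN; have := N0; lra.
Qed.

Let gi i : mu.-integrable setT (EFin \o (fun x => `|g i x| `^ 2)).
Proof.
apply: (@decay_pow (g i) (2 * C) ((N%:R - 1) / 2)) => //.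
- by rewrite mulr_ge0.
- by apply: continuous_measurable_rV; exact: cg.
- move=> x; rewrite /g !normrM (ger0_norm (ler0n _ 2)) -!mulrA ler_pM2l//.
  have xi : `|x 0 i| <= (1 + nsq x) `^ (1 / 2).
    rewrite -sqrtr_sqr mul1r powR12_sqrt ?(ltW (q0 x))//; apply: ler_wsqrtr; exact: coord_le.
  apply: (le_trans (ler_pM (normr_ge0 _) (normr_ge0 _) xi (bV (nsq_ge0 x)))).
  rewrite mulrCA -powRD; last by rewrite (gt_eqF (q0 x)) implybT.
  by rewrite (_ : 1 / 2 + - (N%:R / 2) = - ((N%:R - 1) / 2)) //; lra.
- by have := N3; lra.
Qed.

(** The exponent conjugate to p: v times L i is integrable because v is in L^p and L i in L^p'. *)
Let p' : R := 2 * N%:R / (N%:R + 2).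

Let p'0 : 0 < p'. Proof. by rewrite divr_gt0 ?mulr_gt0// addr_gt0. Qed.

Let Li i : mu.-integrable setT (EFin \o (fun x => `|L i x| `^ p')).
Proof.
apply: (@decay_pow (L i) (6 * C) (N%:R / 2)) => //; first by rewrite mulr_ge0.
rewrite /p' (_ : N%:R / 2 * _ = N%:R ^+ 2 / (N%:R + 2)); last by field; rewrite gt_eqF// addr_gt0.
rewrite ler_pdivlMr ?addr_gt0//; have := N3; have := N0; move: (N%:R : R) => M; nra.
Qed.

Let uD : D12 u.
Proof.
split; first exact: Lfun_of_integrable p0 (continuous_measurable_rV cu) ui.
move=> i; exists (g i) => //; apply: Lfun_of_integrable (gi i) => //; exact: continuous_measurable_rV.
Qed.

Let aeg i : {ae mu, forall x, weak_partial i u x = g i x}.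
Proof. exact: weak_partial_unique (D12_partial i uD).1 (wug i). Qed.

Section test.
Variable (v : 'rV[R]_N -> R).
Hypothesis vD : D12 v.

(** On almost every line this is the derivative of v times g i, so the sum over [i] is the
    divergence of v grad u. *)
Let k i x := weak_partial i v x * g i x + v x * L i x.

Let mv := D12_measurable vD.
Let mw i : measurable_fun setT (weak_partial i v).
Proof. by have [_ [] ] := (D12_partial i vD).1. Qed.

Let k_integrable i : mu.-integrable setT (EFin \o k i).
Proof.
have pp : p^-1 + p'^-1 = 1.
  rewrite /p' crit_expE; field; apply/and3P; split; rewrite ?nat1r -?natrD ?pnatr_eq0//.
pose B x := 2^-1 * weak_partial i v x ^+ 2 + (2^-1 * (`|g i x| `^ 2) + (p^-1 * (`|v x| `^ p) + p'^-1 * (`|L i x| `^ p'))).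
have iB : mu.-integrable setT (EFin \o B).
  apply: integrable_add; first by apply: integrable_scale; exact: (D12_partial i vD).2.
  apply: (@integrable_add _ _ _ mu (fun x => 2^-1 * (`|g i x| `^ 2))).
    exact: integrable_scale (gi i).
  by apply: integrable_add; [exact: integrable_scale (powR_integrable vD)|exact: integrable_scale (Li i)].
apply: (@le_integrable _ _ _ mu setT _ _ (EFin \o B)) => //.
  apply/measurable_EFinP; apply: measurable_funD; apply: measurable_funM => //.
  exact: continuous_measurable_rV.
move=> x _ /=; rewrite lee_fin; apply: le_trans (ler_norm _); rewrite /k /B addrA.
rewrite (le_trans (ler_normD _ _))// lerD// normrM.
  rewrite powR_mulrn// -[weak_partial i v x ^+ 2]real_normK ?num_real//.
  have := sqr_ge0 (`|weak_partial i v x| - `|g i x|).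
  by rewrite !expr2; nra.
have := conjugate_powR (normr_ge0 (v x)) (normr_ge0 (L i x)) p0 p'0 pp.
by rewrite [X in _ <= X + _]mulrC [X in _ <= _ + X]mulrC.
Qed.

(** On almost every line v is represented by an absolutely continuous [P] in L^p, and [F] is
    bounded, so P F takes arbitrarily small values arbitrarily far out on both sides; the integral
    of its derivative therefore vanishes. *)
Let k_integral0 i : \int[mu]_x k i x = 0.
Proof.
apply: (integral_lines0 (i := i) (k_integrable i)).
have vi := powR_integrable vD.
apply: ae_mono (ae_and (ae_integrable2 (integrable_ins i (k_integrable i)))
  (ae_and (ae_integrable2 (integrable_ins i vi)) (weak_primitive (D12_partial i vD).1))).
move=> y [ki [vy [lv [P HP vP]]]].
pose F (t : R) := 2 * t * V (t ^+ 2 + nsq y).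
pose f (t : R) := 2 * V (t ^+ 2 + nsq y) + 4 * t ^+ 2 * W (t ^+ 2 + nsq y).
have fE t : L i (ins i (t, y)) = f t by rewrite /L nsq_ins ins_at.
have FE t : g i (ins i (t, y)) = F t by rewrite /g nsq_ins ins_at.
have cq (t : R) : {for t, continuous (fun s : R => s ^+ 2 + nsq y)}.
  exact: is_derive_continuous (dD (dX 2 (did t)) (dcst t (nsq y))).
have cF : continuous F.
  move=> t; apply: cvgM; first by apply: cvgM; [exact: cvg_cst|exact: cvg_id].
  by apply: (@continuous_comp _ _ _ (fun s : R => s ^+ 2 + nsq y) V t (cq t)); exact: cV.
have lf : locint f.
  apply: (@locint_bounded _ _ (6 * C)).
    have := measurableT_comp (mL i) (measurableT_comp (measurable_ins i) (measurable_pair2 y)).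
    by congr measurable_fun; apply/funext => t; rewrite -fE.
  move=> t; rewrite -fE; apply: (le_trans (bL i _)); rewrite ler_piMr ?mulr_ge0//.
  rewrite -[leRHS](powRr0 (1 + nsq (ins i (t, y)))); apply: ler_powR; first by rewrite lerDl nsq_ge0.
  by rewrite oppr_le0 divr_ge0.
(* The points of the line lying on the exceptional spheres. The square root of a negative number is
   0, which merely adds the point 0 for spheres that the line misses. *)
pose Sy := [seq Num.sqrt (s - nsq y) | s <- S] ++ [seq - Num.sqrt (s - nsq y) | s <- S].
have HSy t : t \notin Sy -> t ^+ 2 + nsq y \notin S.
  apply: contra => tS; rewrite mem_cat.
  have E : Num.sqrt (t ^+ 2 + nsq y - nsq y) = `|t| by rewrite addrK sqrtr_sqr.
  have [t0|t0] := leP 0 t.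
    by apply/orP; left; apply/mapP; exists (t ^+ 2 + nsq y) => //; rewrite E ger0_norm.
  by apply/orP; right; apply/mapP; exists (t ^+ 2 + nsq y) => //; rewrite E ltr0_norm// opprK.
have HF : primitive F f.
  apply: (@primitive_off_finite _ Sy) => // t tS; have sS := HSy _ tS.
    apply: cvgD; first by apply: cvgM; [exact: cvg_cst|
      apply: (@continuous_comp _ _ _ (fun s : R => s ^+ 2 + nsq y) V t (cq t)); exact: cV].
    apply: cvgM; first by apply: cvgM; [exact: cvg_cst|exact: (is_derive_continuous (dX 2 (did t)))].
    by apply: (@continuous_comp _ _ _ (fun s : R => s ^+ 2 + nsq y) W t (cq t)); exact: cW.
  have -> : f t = (2 * 1) * V (t ^+ 2 + nsq y) + (2 * t) * (W (t ^+ 2 + nsq y) * (2%:R * t ^+ 1 * 1 + 0)).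
    by rewrite /f; ring.
  apply: (dM (dZ 2 (did t))).
  apply: (@dcomp _ t (fun s : R => s ^+ 2 + nsq y) V _ _ (hV sS)).
  exact: dD (dX 2 (did t)) (dcst t _).
have PF := primitive_parts HP HF.
have mP := continuous_measurable_fun (primitive_continuous HP).
have kE : {ae lbg, forall t, k i (ins i (t, y)) =
    weak_partial i v (ins i (t, y)) * F t + P t * f t}.
  by apply: ae_mono vP => t vt; rewrite /k fE FE vt.
have mk : measurable_fun setT (fun t : measurableTypeR R => (k i (ins i (t, y)))%:E).
  by apply: measurable_int ki.
have mk' : measurable_fun setT (fun t => weak_partial i v (ins i (t, y)) * F t + P t * f t) := PF.1.1.
transitivity (\int[lbg]_t (weak_partial i v (ins i (t, y)) * F t + P t * f t)%:E)%E.
  apply: ae_eq_integral => //; first exact/measurable_EFinP.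
  by apply: ae_mono kE => t -> _.
have ki' : lbg.-integrable setT (EFin \o (fun t => weak_partial i v (ins i (t, y)) * F t + P t * f t)).
  apply/integrableP; split; first exact/measurable_EFinP.
  have /integrableP[_] := ki; congr (_ < _)%E; apply: ge0_ae_eq_integral.
  - exact: measurableT.
  - exact: measurableT_comp.
  - by apply: measurableT_comp => //; exact/measurable_EFinP.
  - by [].
  - by [].
  by apply: ae_mono kE => t /= -> _.
have Poo : (\int[lbg]_s (`|P s| `^ p)%:E < +oo)%E.
  have /integrableP[_] := vy; congr (_ < _)%E; apply: ge0_ae_eq_integral.
  - exact: measurableT.
  - apply: measurableT_comp => //; exact: measurable_int vy.
  - apply/measurable_EFinP; apply: (measurableT_comp (measurable_powR _)).
    exact: measurableT_comp.
  - by [].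
  - by move=> s _; rewrite lee_fin powR_ge0.
  apply: ae_mono vP => s vs _.
  by rewrite -[LHS]/(`|(`|v (ins i (s, y))| `^ p)%:E|%E) vs gee0_abs// lee_fin powR_ge0.
have FM t : `|F t| <= 2 * C.
  rewrite -FE /g !normrM (ger0_norm (ler0n _ 2)) -mulrA ler_pM2l//.
  set x := ins i (t, y).
  have x1 : `|x 0 i| <= (1 + nsq x) `^ (1 / 2).
    rewrite -sqrtr_sqr mul1r powR12_sqrt ?(ltW (q0 x))//; apply: ler_wsqrtr; exact: coord_le.
  apply: (le_trans (ler_pM (normr_ge0 _) (normr_ge0 _) x1 (bV (nsq_ge0 x)))).
  rewrite mulrCA -powRD; last by rewrite (gt_eqF (q0 x)) implybT.
  rewrite ler_piMr// -[leRHS](powRr0 (1 + nsq x)); apply: ler_powR; first by rewrite lerDl nsq_ge0.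
  have := N3; lra.
have small e : 0 < e -> exists B : R, forall a, exists2 s, a <= s <= a + B & `|P s * F s| < e.
  move=> e0; have e'0 : 0 < e / (2 * C + 1) by rewrite divr_gt0// ltr_wpDl// mulr_ge0.
  have [B HB] := powR_small p0 e'0 mP Poo; exists B => a; have [s sB Ps] := HB a; exists s => //.
  rewrite normrM; apply: (@le_lt_trans _ _ (`|P s| * (2 * C + 1))).
    rewrite ler_wpM2l// (le_trans (FM s))//; lra.
  by rewrite -ltr_pdivlMr// ltr_wpDl// mulr_ge0.
apply: (primitive_integral0 PF ki').
- move=> e T /small[B /(_ (T - B))[s /andP[_ sT] h]]; exists s => //.
  by rewrite subrK in sT.
- by move=> e T /small[B /(_ T)[s /andP[sT _] h]]; exists s.
Qed.

(** By the equation, the integrand agrees almost everywhere with the sum of the [k i]. *)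
Lemma radial_EL :
  let h x := \sum_(i < N) weak_partial i u x * weak_partial i v x
      + v x * (lam * \1_Om x * u x - Q Om x * spow p (u x)) in
    mu.-integrable setT (EFin \o h) /\ \int[mu]_x h x = 0.
Proof.
set h := (fun x => _); cbv zeta.
have hE : {ae mu, forall x, h x = \sum_(i < N) k i x}.
  apply: ae_mono (ae_ord aeg) => x Hx; rewrite /h /k big_split/=; congr (_ + _).
    by apply: eq_bigr => i _; rewrite Hx mulrC.
  rewrite -mulr_sumr; congr (_ * _).
  have -> : lam * \1_Om x * u x - Q Om x * spow p (u x) =
      lam * \1_om (nsq x) * U (nsq x) - (if nsq x \in om then 1 else -1) * spow p (U (nsq x)).
    have xo : (x \in Om) = (nsq x \in om) by apply/idP/idP; rewrite !inE.
    by rewrite /Q !indicE xo.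
  rewrite -ode ?nsq_ge0// /L big_split/= sumr_const card_ord -mulr_suml -mulr_sumr -/(nsq x).
  by rewrite -mulr_natr; ring.
have si : mu.-integrable setT (EFin \o (fun x => \sum_(i < N) k i x)).
  rewrite (_ : _ \o _ = fun x => (\sum_(i < N) (k i x)%:E)%E).
    by apply: integrable_sum => // i _; exact: k_integrable.
  by apply/funext => x /=; rewrite sumEFin.
have mh : measurable_fun setT h.
  apply: measurable_funD.
    apply: measurable_sum => i; apply: measurable_funM => //.
    by have [_ [] ] := (D12_partial i uD).1.
  apply: measurable_funM => //; have mu_ := continuous_measurable_rV cu.
  have m1 : measurable_fun setT (\1_Om : 'rV[R]_N -> R) by exact: measurable_indic.
  apply: measurable_funB; first by apply: measurable_funM => //; exact: measurable_funM.
  apply: measurable_funM; first exact: measurable_Q.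
  apply: (measurableT_comp _ mu_); apply: continuous_measurable_fun; exact: spow_continuous (ltW p2).
have hi : mu.-integrable setT (EFin \o h).
  apply/integrableP; split; first exact/measurable_EFinP.
  have /integrableP[_] := si; congr (_ < _)%E; apply: ge0_ae_eq_integral.
  - exact: measurableT.
  - by apply: measurableT_comp => //; exact: measurable_int si.
  - by apply: measurableT_comp => //; exact/measurable_EFinP.
  - by [].
  - by [].
  by apply: ae_mono hE => x /= -> _.
split => //; transitivity (\int[mu]_x \sum_(i < N) k i x).
  congr fine; apply: ae_eq_integral => //.
  - exact/measurable_EFinP.
  - exact: measurable_int si.
  by apply: ae_mono hE => x -> _.
have : forall s, mu.-integrable setT (EFin \o (fun x => \sum_(i <- s) k i x)) /\
    \int[mu]_x \sum_(i <- s) k i x = 0.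
  elim=> [|j s [IH1 IH2]].
    have -> : (fun x : 'rV[R]_N => \sum_(i <- [::]) k i x) = fun=> 0 by apply/funext => x; rewrite big_nil.
    by rewrite Rintegral_cst// mul0r; split=> //; exact: integrable0.
  have -> : (fun x : 'rV[R]_N => \sum_(i <- j :: s) k i x) = fun x => k j x + \sum_(i <- s) k i x.
    by apply/funext => x; rewrite big_cons.
  split; first exact: integrable_add.
  by rewrite (RintegralD measurableT (k_integrable j) IH1) k_integral0 IH2 addr0.
by move=> /(_ (index_enum _))[].
Qed.

End test.

Theorem radial_solution : solution Om lam u.
Proof. by apply: critical_point_weak => // v vD; exact: radial_EL. Qed.

End radial.

(** * Planar systems of differential equations *)

Section picard.
Context (R : realType).
Implicit Types (X Y g : R -> R) (t x y : R).

Lemma near_gt (a t : R) : a < t -> \forall s \near t, a < s.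
Proof.
move=> at_; apply/nbhs_ballP; exists (t - a) => /=; first by rewrite subr_gt0.
by move=> s; rewrite /ball/= ltr_norml => /andP[_]; lra.
Qed.

Lemma half_small (d : R) : 0 < d -> exists k, 2^-1 ^+ k < d.
Proof.
move=> d0; have [k /= hk] : exists k : nat, d^-1 < k%:R.
  by exists (Num.bound d^-1); rewrite archi_boundP// invr_ge0 ltW.
exists k; rewrite exprVn -[ltRHS]invrK ltf_pV2 ?posrE ?invr_gt0 ?exprn_gt0//.
by rewrite (lt_le_trans hk)// -natrX ler_nat ltnW// ltn_expl.
Qed.

Lemma geometric_limit (u : nat -> R) (C : R) : 0 <= C ->
  (forall k j, `|u (k + j)%N - u k| <= C * 2^-1 ^+ k) ->
  exists l, forall k, `|l - u k| <= C * 2^-1 ^+ k.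
Proof.
move=> C0 H; pose c k := C * 2^-1 ^+ k.
have c0 k : 0 <= c k by rewrite mulr_ge0.
have ac k j : u k - c k <= u j + c j.
  have [kj|jk] := leqP k j.
    have := H k (j - k)%N; rewrite subnKC// ler_norml -/(c k) => /andP[+ _]; have := c0 j; lra.
  have := H j (k - j)%N; rewrite subnKC ?(ltnW jk)// ler_norml -/(c j) => /andP[_]; have := c0 k; lra.
pose S := [set u k - c k | k in [set: nat]].
have hs : has_sup S.
  split; first by exists (u 0%N - c 0%N), 0%N.
  by exists (u 0%N + c 0%N) => _ [k _ <-]; exact: ac.
exists (sup S) => k; rewrite ler_norml -/(c k).
have h1 : u k - c k <= sup S by apply: (sup_upper_bound hs); exists k.
have h2 : sup S <= u k + c k.
  by apply: ge_sup; [exact: hs.1|move=> _ [j _ <-]; exact: ac].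
by apply/andP; split; lra.
Qed.

(** The maximum freezes the integral before [t0], so that the Picard iterates are continuous on the
    whole line. *)
Definition rintm t0 g t : R := rint t0 (Num.max t0 t) g.

Lemma rintmE t0 g V t : primitive V g -> rintm t0 g t = V (Num.max t0 t) - V t0.
Proof. by move=> [_ ->]//; rewrite le_max lexx. Qed.

Lemma rintm_continuous t0 g : continuous g -> continuous (rintm t0 g).
Proof.
move=> cg; have [V VP _] := primitive_ex (locint_continuous cg).
rewrite (_ : rintm t0 g = fun t => V (Num.max t0 t) - V t0); last first.
  by apply/funext => t; exact: rintmE.
move=> t; apply: cvgB; last exact: cvg_cst.
apply: (@continuous_comp _ _ _ (fun t => Num.max t0 t) V); last exact: (primitive_continuous VP).
by apply: continuous_max; [exact: cst_continuous|move=> ?; exact: cvg_id].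
Qed.

Lemma rintm_derive t0 g t : continuous g -> t0 < t -> is_derive t 1 (rintm t0 g) (g t).
Proof.
move=> cg t0t; have [V VP _] := primitive_ex (locint_continuous cg).
apply: (@is_derive_near _ _ (fun t => V t - V t0)).
  near=> s; rewrite (rintmE _ _ VP) max_r//; apply: ltW; near: s.
  exact: near_gt.
rewrite -[g t]subr0; exact: dB (primitive_derive VP (cg t)) (dcst t _).
Unshelve. all: by end_near. Qed.

Lemma rintm_dist t0 g g' B t : continuous g -> continuous g' -> continuous B ->
  (forall s, t0 <= s -> `|g s - g' s| <= B s) ->
  `|rintm t0 g t - rintm t0 g' t| <= rintm t0 B t.
Proof.
move=> cg cg' cB H; have lg := locint_continuous cg; have lg' := locint_continuous cg'.
rewrite /rintm; set m := Num.max _ _.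
have cgg : continuous (fun s => g s - g' s) by move=> s; apply: cvgB; [exact: cg|exact: cg'].
have lgg := locint_continuous cgg.
have -> : rint t0 m g - rint t0 m g' = rint t0 m (fun s => g s - g' s).
  by rewrite /rint RintegralB//; [exact: lg.2|exact: lg'.2].
have := le_normr_Rintegral _ (lgg.2 t0 m) => /(_ (measurable_itv _))/le_trans; apply.
apply: le_rint; [exact: locint_norm|exact: locint_continuous|].
by move=> s /andP[s0 _]; exact: H.
Qed.

(* Uniform in time: bounded, Lipschitz in space, continuous along curves. *)
Definition blip (f : R -> R -> R -> R) :=
  (exists2 K : R, 0 < K & (forall t x y, `|f t x y| <= K) /\
     forall t x y x' y', `|f t x y - f t x' y'| <= K * (`|x - x'| + `|y - y'|)) /\
  forall X Y, continuous X -> continuous Y -> continuous (fun t => f t (X t) (Y t)).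

Lemma blipD (f g : R -> R -> R -> R) : blip f -> blip g -> blip (fun t x y => f t x y + g t x y).
Proof.
move=> [[K K0 [fK fL]] cf] [[K' K'0 [gK gL]] cg]; split.
  exists (K + K'); first exact: addr_gt0.
  split=> [t x y|t x y x' y']; first by rewrite (le_trans (ler_normD _ _))// lerD.
  rewrite opprD addrACA (le_trans (ler_normD _ _))// mulrDl lerD//; exact: fL.
by move=> X Y cX cY t; apply: cvgD; [exact: cf|exact: cg].
Qed.

Lemma blipM (f g : R -> R -> R -> R) : blip f -> blip g -> blip (fun t x y => f t x y * g t x y).
Proof.
move=> [[K K0 [fK fL]] cf] [[K' K'0 [gK gL]] cg]; split.
  have KK : 0 < K * K' by exact: mulr_gt0.
  exists (2 * (K * K')); first exact: mulr_gt0.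
  split=> [t x y|t x y x' y'].
    by rewrite normrM (le_trans (ler_pM _ _ (fK t x y) (gK t x y)))//; lra.
  have -> : f t x y * g t x y - f t x' y' * g t x' y' =
    f t x y * (g t x y - g t x' y') + (f t x y - f t x' y') * g t x' y' by ring.
  rewrite (le_trans (ler_normD _ _))// !normrM.
  have := ler_pM (normr_ge0 _) (normr_ge0 _) (fK t x y) (gL t x y x' y').
  have := ler_pM (normr_ge0 _) (normr_ge0 _) (fL t x y x' y') (gK t x' y').
  by move: (`|x - x'| + _) => d; lra.
by move=> X Y cX cY t; apply: cvgM; [exact: cf|exact: cg].
Qed.

Lemma blip_cst (c : R) : blip (fun _ _ _ => c).
Proof.
split; last by move=> X Y _ _; exact: cst_continuous.
exists (`|c| + 1); first by rewrite ltr_wpDl.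
split=> [t x y|t x y x' y']; first by rewrite lerDl.
by rewrite subrr normr0 mulr_ge0 ?addr_ge0.
Qed.

Lemma blip_time (A : R -> R) (K : R) : continuous A -> (forall t, `|A t| <= K) ->
  blip (fun t _ _ => A t).
Proof.
move=> cA AK; split; last by [].
exists (`|K| + 1); first by rewrite ltr_wpDl.
split=> [t x y|t x y x' y']; first by rewrite (le_trans (AK t))// ler_wpDr// ler_norm.
by rewrite subrr normr0 mulr_ge0 ?addr_ge0.
Qed.

Section solve.
Variables (f1 f2 : R -> R -> R -> R).

(** The equation is imposed in the open interval only, while continuity is global: solutions on
    adjacent intervals can then be glued where the coefficients jump. *)
Definition solves t0 t1 X Y := [/\ continuous X, continuous Y &
  forall t, t0 < t < t1 ->
    is_derive t 1 X (f1 t (X t) (Y t)) /\ is_derive t 1 Y (f2 t (X t) (Y t))].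

Hypotheses (f1b : blip f1) (f2b : blip f2).

Theorem picard t0 x0 y0 : exists X Y, [/\ X t0 = x0, Y t0 = y0 & forall t1, solves t0 t1 X Y].
Proof.
have [[K1 K10 [f1K f1L]] cf1] := f1b; have [[K2 K20 [f2K f2L]] cf2] := f2b.
pose K := K1 + K2; have K0 : 0 < K by exact: addr_gt0.
pose Phi (Z : (R -> R) * (R -> R)) :=
  ((fun t => x0 + rintm t0 (fun s => f1 s (Z.1 s) (Z.2 s)) t),
   (fun t => y0 + rintm t0 (fun s => f2 s (Z.1 s) (Z.2 s)) t)).
pose Z k := iter k Phi ((fun=> x0), (fun=> y0)).
have cPhi W : continuous W.1 -> continuous W.2 -> continuous (Phi W).1 /\ continuous (Phi W).2.
  by move=> c1 c2; split=> t; apply: cvgD; try exact: cvg_cst;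
    apply: rintm_continuous; [exact: cf1|exact: cf2].
have cZ k : continuous (Z k).1 /\ continuous (Z k).2.
  by elim: k => [|k [IH1 IH2]]; [split; exact: cst_continuous|exact: cPhi].
(* Bielecki's weight: in the norm weighted by [E] the integral operator contracts by 1/2 for all
   times at once, so no local solutions have to be pieced together. *)
pose E t := expR (2 * K * (Num.max t0 t - t0)).
have E0 t : 0 < E t by exact: expR_gt0.
have cE : continuous E.
  move=> t; apply: (@continuous_comp _ _ _ (fun t => 2 * K * (Num.max t0 t - t0)) (@expR R)); last exact: continuous_expR.
  apply: cvgM; first exact: cvg_cst; apply: cvgB; last exact: cvg_cst.
  by apply: continuous_max; [exact: cst_continuous|move=> ?; exact: cvg_id].
have IE D t : 0 <= D -> rintm t0 (fun s => D * E s) t <= D / (2 * K) * E t.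
  move=> D0.
  pose G s := D / (2 * K) * expR (2 * K * (s - t0)).
  pose g s := D * expR (2 * K * (s - t0)).
  have dG (s : R) : is_derive s 1 G (g s).
    have -> : g s = D / (2 * K) * (expR (2 * K * (s - t0)) * (2 * K * (1 - 0))).
      rewrite /g; field; rewrite gt_eqF//.
    exact: dZ (@dcomp _ s (fun s => 2 * K * (s - t0)) (@expR R) _ _
      (is_derive_expR (2 * K * (s - t0))) (dZ (2 * K) (dB (did s) (dcst s t0)))).
  have cg : continuous g.
    move=> s; have := is_derive_continuous (dG s) => _.
    apply: cvgM; first exact: cvg_cst.
    apply: (@continuous_comp _ _ _ (fun t => 2 * K * (t - t0)) (@expR R)); last exact: continuous_expR.
    by apply: cvgM; [exact: cvg_cst|apply: cvgB; [exact: cvg_id|exact: cvg_cst]].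
  have GP : primitive G g.
    apply: (@primitive_off_finite _ [::]) => //.
    + by move=> s; exact: is_derive_continuous (dG s).
    + exact: locint_continuous.
    + by move=> s _; exact: cg.
  have -> : rintm t0 (fun s => D * E s) t = rintm t0 g t.
    apply: eq_Rintegral => s; rewrite inE/= in_itv/= => /andP[s0 _].
    by rewrite /g /E max_r.
  by rewrite (rintmE _ _ GP) /G /E lerBlDr lerDl mulr_ge0 ?expR_ge0// divr_ge0// mulr_ge0// ltW.
pose d k t := `|(Z k.+1).1 t - (Z k).1 t| + `|(Z k.+1).2 t - (Z k).2 t|.
pose C : R := K.
have step W W' (D : R) : 0 <= D -> continuous W.1 -> continuous W.2 -> continuous W'.1 -> continuous W'.2 ->
    (forall t, `|W.1 t - W'.1 t| + `|W.2 t - W'.2 t| <= D * E t) ->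
    forall t, `|(Phi W).1 t - (Phi W').1 t| + `|(Phi W).2 t - (Phi W').2 t| <= D / 2 * E t.
  move=> D0 c1 c2 c1' c2' WD t.
  have h1 : `|(Phi W).1 t - (Phi W').1 t| <= K1 * D / (2 * K) * E t.
    rewrite /Phi/= opprD addrACA subrr add0r; apply: le_trans (IE _ _ _); last exact: mulr_ge0 (ltW K10) D0.
    apply: rintm_dist; [exact: cf1|exact: cf1| |].
      by move=> s; apply: cvgM; [exact: cvg_cst|exact: cE].
    by move=> s _; rewrite -mulrA (le_trans (f1L _ _ _ _ _))// ler_pM2l.
  have h2 : `|(Phi W).2 t - (Phi W').2 t| <= K2 * D / (2 * K) * E t.
    rewrite /Phi/= opprD addrACA subrr add0r; apply: le_trans (IE _ _ _); last exact: mulr_ge0 (ltW K20) D0.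
    apply: rintm_dist; [exact: cf2|exact: cf2| |].
      by move=> s; apply: cvgM; [exact: cvg_cst|exact: cE].
    by move=> s _; rewrite -mulrA (le_trans (f2L _ _ _ _ _))// ler_pM2l.
  apply: (le_trans (lerD h1 h2)); rewrite -mulrDl -mulrDl -mulrDl -/K.
  rewrite le_eqVlt; apply/orP; left; apply/eqP; congr (_ * _); field.
  by rewrite gt_eqF.
have dE k t : d k t <= 2^-1 ^+ k * E t.
  elim: k t => [|k IH] t.
    rewrite expr0 mul1r /d /Z/= /Phi/=.
    have h0 (c : R) f Kf : 0 <= Kf -> continuous f -> (forall s, `|f s| <= Kf) ->
        `|c + rintm t0 f t - c| <= Kf / (2 * K) * E t.
      move=> Kf0 cf fK; rewrite addrAC subrr add0r.
      have := @rintm_dist t0 f (fun=> 0) (fun s => Kf * E s) t cf (@cst_continuous _ _ _).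
      have -> : rintm t0 (fun=> 0) t = 0 by rewrite /rintm /rint Rintegral_cst ?mul0r.
      rewrite subr0 => H; apply: (le_trans (H _ _)).
      - by move=> s; apply: cvgM; [exact: cvg_cst|exact: cE].
      - move=> s s0; rewrite subr0 (le_trans (fK s))// ler_peMr// /E -expR0 ler_expR.
        by rewrite !mulr_ge0 ?(ltW K0)// subr_ge0 le_max lexx.
      - exact: IE.
    have c0 (c : R) : continuous (fun _ : R => c) by exact: cst_continuous.
    have := lerD (h0 x0 _ K1 (ltW K10) (cf1 _ _ (c0 x0) (c0 y0)) (fun s => f1K s _ _))
      (h0 y0 _ K2 (ltW K20) (cf2 _ _ (c0 x0) (c0 y0)) (fun s => f2K s _ _)).
    move=> /le_trans; apply; rewrite -mulrDl -mulrDl -/K ler_piMl ?(ltW (E0 t))//.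
    rewrite ler_pdivrMr ?mulr_gt0//; have := K0; lra.
  rewrite exprS mulrC [_ * 2^-1 ^+ k]mulrC.
  have [c1 c2] := cZ k; have [c1' c2'] := cZ k.+1.
  have p0 : (0 : R) <= 2^-1 ^+ k by rewrite exprn_ge0.
  by have := @step (Z k.+1) (Z k) _ p0 c1' c2' c1 c2 IH t; rewrite mulrC.
have tail k j t : `|(Z (k + j)%N).1 t - (Z k).1 t| + `|(Z (k + j)%N).2 t - (Z k).2 t|
    <= (2 * 2^-1 ^+ k - 2 * 2^-1 ^+ (k + j)) * E t.
  elim: j => [|j IH]; first by rewrite addn0 !subrr normr0 mul0r addr0.
  have := dE (k + j)%N t; rewrite /d -addnS; move: IH.
  have -> : (2^-1 : R) ^+ (k + j.+1) = 2^-1 * 2^-1 ^+ (k + j) by rewrite addnS exprS.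
  set a := Z (k + j)%N; set b := Z (k + j.+1)%N; set c := Z k.
  have := ler_distD (a.1 t) (b.1 t) (c.1 t); have := ler_distD (a.2 t) (b.2 t) (c.2 t).
  lra.
have /choice[Xl XlP] (t : R) : exists x : R, forall k, `|x - (Z k).1 t| <= 2 * E t * 2^-1 ^+ k.
  apply: geometric_limit; first by rewrite mulr_ge0// ltW.
  move=> k j; have := tail k j t; have := normr_ge0 ((Z (k + j)%N).2 t - (Z k).2 t).
  have h : (0 : R) <= 2^-1 ^+ (k + j) by rewrite exprn_ge0.
  by have := mulr_ge0 h (ltW (E0 t)); lra.
have /choice[Yl YlP] (t : R) : exists y : R, forall k, `|y - (Z k).2 t| <= 2 * E t * 2^-1 ^+ k.
  apply: geometric_limit; first by rewrite mulr_ge0// ltW.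
  move=> k j; have := tail k j t; have := normr_ge0 ((Z (k + j)%N).1 t - (Z k).1 t).
  have h : (0 : R) <= 2^-1 ^+ (k + j) by rewrite exprn_ge0.
  by have := mulr_ge0 h (ltW (E0 t)); lra.
have cl (l : R -> R) (z : nat -> R -> R) : (forall k, continuous (z k)) ->
    (forall t k, `|l t - z k t| <= 2 * E t * 2^-1 ^+ k) -> continuous l.
  move=> cz lz t; apply/cvgrPdist_lt => e e0.
  have Et : 0 < 2 * (E t + 1) by rewrite mulr_gt0// addr_gt0.
  have [k hk] := half_small (divr_gt0 (divr_gt0 e0 (ltr0Sn R 2)) Et).
  have /cvgrPdist_lt/(_ _ (divr_gt0 e0 (ltr0Sn R 2))) h1 := cz k t.
  have /cvgrPdist_lt/(_ 1 ltr01) h2 := cE t.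
  near=> s; have g1 : `|z k t - z k s| < e / 3 by near: s.
  have g2 : `|E t - E s| < 1 by near: s.
  move: hk; rewrite ltr_pdivlMr// => hk.
  have p0 : (0 : R) <= 2^-1 ^+ k by rewrite exprn_ge0.
  have Es : E s <= E t + 1 by move: g2; rewrite ltr_norml => /andP[? ?]; lra.
  have := lz t k; have := lz s k; rewrite distrC => a1 a2.
  have := ler_wpM2r p0 Es => b1; have := ler_distD (z k t) (l t) (l s).
  have := ler_distD (z k s) (z k t) (l s).
  have b2 : E t * 2^-1 ^+ k <= (E t + 1) * 2^-1 ^+ k by rewrite ler_wpM2r// lerDl.
  lra.
have cX : continuous Xl by apply: (cl _ (fun k => (Z k).1)) => // k; exact: (cZ k).1.
have cY : continuous Yl by apply: (cl _ (fun k => (Z k).2)) => // k; exact: (cZ k).2.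
have fixed t k : `|Xl t - (Phi (Xl, Yl)).1 t| + `|Yl t - (Phi (Xl, Yl)).2 t| <= 4 * E t * 2^-1 ^+ k.
  have [c1 c2] := cZ k; have p0 : (0 : R) <= 2^-1 ^+ k by rewrite exprn_ge0.
  have := @step (Xl, Yl) (Z k) (4 * 2^-1 ^+ k) (mulr_ge0 (ler0n _ 4) p0) cX cY c1 c2.
  have H s : `|Xl s - (Z k).1 s| + `|Yl s - (Z k).2 s| <= 4 * 2^-1 ^+ k * E s.
    by have := XlP s k; have := YlP s k; lra.
  move=> /(_ H t); rewrite -/(Z k.+1).
  have := XlP t k.+1; have := YlP t k.+1; rewrite exprS.
  have := ler_distD ((Z k.+1).1 t) (Xl t) ((Phi (Xl, Yl)).1 t).
  have := ler_distD ((Z k.+1).2 t) (Yl t) ((Phi (Xl, Yl)).2 t).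
  rewrite [`|(Z k.+1).1 t - _|]distrC [`|(Z k.+1).2 t - _|]distrC.
  rewrite -[Phi (Z k)]/(Z k.+1); lra.
have fix0 t : `|Xl t - (Phi (Xl, Yl)).1 t| + `|Yl t - (Phi (Xl, Yl)).2 t| <= 0.
  rewrite leNgt; apply/negP => d0.
  have [k] := half_small (divr_gt0 d0 (mulr_gt0 (ltr0Sn R 3) (E0 t))).
  by rewrite ltr_pdivlMr ?mulr_gt0// mulrC ltNge fixed.
have XE : Xl = (Phi (Xl, Yl)).1.
  apply/funext => t; apply/eqP; rewrite -subr_eq0 -normr_le0.
  by have := fix0 t; have := normr_ge0 (Yl t - (Phi (Xl, Yl)).2 t); lra.
have YE : Yl = (Phi (Xl, Yl)).2.
  apply/funext => t; apply/eqP; rewrite -subr_eq0 -normr_le0.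
  by have := fix0 t; have := normr_ge0 (Xl t - (Phi (Xl, Yl)).1 t); lra.
have at0 (c : R) g : c + rintm t0 g t0 = c by rewrite /rintm maxxx rintxx addr0.
exists Xl, Yl; split; [by rewrite XE; exact: at0|by rewrite YE; exact: at0|move=> t1].
split => // t /andP[t0t _]; split.
  have EX s : (Phi (Xl, Yl)).1 s = Xl s by rewrite -XE.
  apply: (@is_derive_near _ t (Phi (Xl, Yl)).1); first by near=> s; exact: EX.
  have := dD (dcst t x0) (rintm_derive (cf1 _ _ cX cY) t0t).
  by rewrite add0r.
have EY s : (Phi (Xl, Yl)).2 s = Yl s by rewrite -YE.
apply: (@is_derive_near _ t (Phi (Xl, Yl)).2); first by near=> s; exact: EY.
have := dD (dcst t y0) (rintm_derive (cf2 _ _ cX cY) t0t).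
by rewrite add0r.
Unshelve. all: by end_near. Qed.

(** The squared distance of two solutions, differentiable also where they meet, grows at rate at
    most 4 (K1 + K2). *)
Lemma gronwall : exists2 L : R, 0 <= L & forall t0 t1 X Y X' Y', solves t0 t1 X Y -> solves t0 t1 X' Y' ->
  forall t, t0 <= t <= t1 ->
  (X t - X' t) ^+ 2 + (Y t - Y' t) ^+ 2 <=
  ((X t0 - X' t0) ^+ 2 + (Y t0 - Y' t0) ^+ 2) * expR (L * (t - t0)).
Proof.
have [[K1 K10 [f1K f1L]] cf1] := f1b; have [[K2 K20 [f2K f2L]] cf2] := f2b.
pose K := K1 + K2; have K0 : 0 < K by exact: addr_gt0.
exists (4 * K) => [|t0 t1 X Y X' Y' [cX cY dXY] [cX' cY' dXY'] t /andP[t0t tt1]].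
  by rewrite mulr_ge0// ltW.
pose D s := (X s - X' s) ^+ 2 + (Y s - Y' s) ^+ 2.
pose w s := expR (- (4 * K) * (s - t0)).
pose G s := D s * w s.
pose dx s := f1 s (X s) (Y s) - f1 s (X' s) (Y' s).
pose dy s := f2 s (X s) (Y s) - f2 s (X' s) (Y' s).
pose D' s := 2%:R * (X s - X' s) ^+ 1 * dx s + 2%:R * (Y s - Y' s) ^+ 1 * dy s.
have cw (s : R) : is_derive s 1 w (w s * (- (4 * K) * (1 - 0))).
  exact: (@dcomp _ s (fun s => - (4 * K) * (s - t0)) (@expR R) _ _
      (is_derive_expR (- (4 * K) * (s - t0))) (dZ (- (4 * K)) (dB (did s) (dcst s t0)))).
have dD (s : R) : t0 < s < t1 -> is_derive s 1 D (D' s).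
  move=> /[dup] /dXY[d1 d2] /dXY'[d1' d2'].
  by apply: dD; [apply: (@dX _ s (fun s => X s - X' s) _ 2)|apply: (@dX _ s (fun s => Y s - Y' s) _ 2)]; exact: dB.
have cD : continuous D.
  move=> s; have c1 : {for s, continuous (fun s => X s - X' s)} by apply: cvgB; [exact: cX|exact: cX'].
  have c2 : {for s, continuous (fun s => Y s - Y' s)} by apply: cvgB; [exact: cY|exact: cY'].
  by apply: cvgD; rewrite expr2; under eq_fun do rewrite expr2; exact: cvgM.
have cG : continuous G by move=> s; apply: cvgM; [exact: cD|exact: is_derive_continuous (cw s)].
have := @derive_le0_ge _ G (fun s => D' s * w s + D s * (w s * (- (4 * K) * (1 - 0)))) t0 t t0t.
have w0 : w t0 = 1 by rewrite /w subrr mulr0 expR0.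
have -> : G t0 = D t0 by rewrite /G w0 mulr1.
move=> H; have {}H : G t <= D t0.
  apply: H; first exact: continuous_subspaceT.
    move=> s /andP[s0 st]; have s01 : t0 < s < t1 by rewrite s0 (lt_le_trans st).
    exact: (dM (dD s s01) (cw s)).
  move=> s /andP[s0 st].
  have -> : D' s * w s + D s * (w s * (- (4 * K) * (1 - 0))) = (D' s - 4 * K * D s) * w s by ring.
  rewrite mulr_le0_ge0 ?expR_ge0// subr_le0 /D' /D !expr1.
  have h1 : (X s - X' s) * dx s <= `|X s - X' s| * (K1 * (`|X s - X' s| + `|Y s - Y' s|)).
    by rewrite (le_trans (ler_norm _))// normrM ler_wpM2l//; exact: f1L.
  have h2 : (Y s - Y' s) * dy s <= `|Y s - Y' s| * (K2 * (`|X s - X' s| + `|Y s - Y' s|)).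
    by rewrite (le_trans (ler_norm _))// normrM ler_wpM2l//; exact: f2L.
  rewrite -[(X s - X' s) ^+ 2]real_normK ?num_real// -[(Y s - Y' s) ^+ 2]real_normK ?num_real//.
  move: h1 h2; rewrite /K; move: (normr_ge0 (X s - X' s)) (normr_ge0 (Y s - Y' s)).
  move: `|X s - X' s| `|Y s - Y' s| => p q p0 q0.
  have := mulr_ge0 (ltW K10) (sqr_ge0 (p - q)); have := mulr_ge0 (ltW K20) (sqr_ge0 (p - q)).
  have := mulr_ge0 (ltW K10) (sqr_ge0 p); have := mulr_ge0 (ltW K20) (sqr_ge0 p).
  have := mulr_ge0 (ltW K10) (sqr_ge0 q); have := mulr_ge0 (ltW K20) (sqr_ge0 q).
  rewrite -!mulrA; move: ((X s - X' s) * _) ((Y s - Y' s) * _) => u v; lra.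
move: H; rewrite /G -ler_pdivlMr ?expR_gt0// => /le_trans; apply.
by rewrite /w mulNr expRN invrK.
Qed.

End solve.
End picard.

(** * Polar coordinates *)

Section lipschitz.
Context (R : realType).
Implicit Types (x y : R).

Lemma derive_le1_lip (f f' : R -> R) : (forall x, is_derive x 1 f (f' x)) ->
  (forall x, `|f' x| <= 1) -> forall x y, `|f x - f y| <= `|x - y|.
Proof.
move=> df f1; have cf : continuous f by move=> x; exact: is_derive_continuous (df x).
have key x y : x <= y -> `|f x - f y| <= `|x - y|.
  move=> xy; rewrite distrC [`|x - y|]distrC (ger0_norm (_ : 0 <= y - x)) ?subr_ge0// ler_norml.
  have := @derive_ge0_le _ (fun t => t - f t) (fun t => 1 - f' t) x y xy.
  have := @derive_ge0_le _ (fun t => t + f t) (fun t => 1 + f' t) x y xy.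
  have b t : -1 <= f' t <= 1 by rewrite -ler_norml.
  move=> H1 H2; apply/andP; split.
    suff : x + f x <= y + f y by lra.
    apply: H1; first by apply: continuous_subspaceT => t; apply: cvgD; [exact: cvg_id|exact: cf].
    by move=> t _; have /andP[] := b t; lra.
  suff : x - f x <= y - f y by lra.
  apply: H2; first by apply: continuous_subspaceT => t; apply: cvgB; [exact: cvg_id|exact: cf].
  by move=> t _; have /andP[] := b t; lra.
move=> x y; have [/key//|/ltW/key] := leP x y; by rewrite distrC [`|y - x|]distrC.
Qed.

Lemma sin_lip x y : `|sin x - sin y| <= `|x - y|.
Proof.
apply: (@derive_le1_lip sin cos) => t.
by rewrite ler_norml cos_geN1 cos_le1.
Qed.

Lemma cos_lip x y : `|cos x - cos y| <= `|x - y|.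
Proof.
apply: (@derive_le1_lip cos (fun t => - sin t)) => t.
by rewrite normrN ler_norml sin_geN1 sin_le1.
Qed.

Lemma norm_sin_le1 x : `|sin x| <= 1. Proof. by rewrite ler_norml sin_geN1 sin_le1. Qed.
Lemma norm_cos_le1 x : `|cos x| <= 1. Proof. by rewrite ler_norml cos_geN1 cos_le1. Qed.

Lemma norm_spow_le1 p x : 2 <= p -> `|x| <= 1 -> `|spow p x| <= 1.
Proof.
move=> p2 x1; rewrite norm_spow; last by rewrite (lt_le_trans _ p2)// ltr1n.
have e1 : (1 : R) `^ (p - 1) = 1 by rewrite powR1.
by rewrite -[leRHS]e1; apply: powR_le => //; lra.
Qed.

End lipschitz.

Section polar.
Context (R : realType).
Variables (p mu eps : R) (A B : R -> R) (A0 A1 B0 B1 : R).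
Hypotheses (p2 : 2 < p) (mu0 : 0 <= mu) (eps1 : `|eps| <= 1).
Hypotheses (cA : continuous A) (cB : continuous B).
Hypotheses (A00 : 0 < A0) (B00 : 0 < B0).
Hypotheses (hA : forall t, A0 <= A t <= A1) (hB : forall t, B0 <= B t <= B1).
Implicit Types (X Y : R -> R) (t x y e M : R).

(* For h = e^y sin x and z = e^y cos x these are the equations of x and y when
   h' = A z and z' = - B (mu h + eps |h|^(p-2) h); here e stands for e^((p-2) y),
   which [cut] truncates to make the field Lipschitz. *)
Definition g1 e x : R := mu * sin x + eps * e * spow p (sin x).
Definition F1 e t x : R := A t * cos x * cos x + B t * g1 e x * sin x.
Definition F2 e t x : R := A t * sin x * cos x - B t * g1 e x * cos x.

Definition cut M y : R := expR ((p - 2) * Num.min y M).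
Definition full y : R := expR ((p - 2) * y).

Definition psol M := solves (fun t x y => F1 (cut M y) t x) (fun t x y => F2 (cut M y) t x).
Definition fsol := solves (fun t x y => F1 (full y) t x) (fun t x y => F2 (full y) t x).

Let p20 : 0 < p - 2. Proof. by rewrite subr_gt0. Qed.

Let blipB (f g : R -> R -> R -> R) : blip f -> blip g -> blip (fun t x y => f t x y - g t x y).
Proof.
move=> bf bg; have := blipD bf (blipM (blip_cst (-1)) bg).
by under eq_fun do under eq_fun do under eq_fun do rewrite mulN1r.
Qed.

Let blip_sin : blip (fun _ x _ : R => sin x).
Proof.
split; last by move=> X Y cX cY t; apply: (@continuous_comp _ _ _ X sin); [exact: cX|exact: continuous_sin].
exists 1 => //; split=> [t x y|t x y x' y']; first exact: norm_sin_le1.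
by rewrite mul1r (le_trans (sin_lip _ _))// lerDl.
Qed.

Let blip_cos : blip (fun _ x _ : R => cos x).
Proof.
split; last by move=> X Y cX cY t; apply: (@continuous_comp _ _ _ X cos); [exact: cX|exact: continuous_cos].
exists 1 => //; split=> [t x y|t x y x' y']; first exact: norm_cos_le1.
by rewrite mul1r (le_trans (cos_lip _ _))// lerDl.
Qed.

Let blip_spow : blip (fun _ x _ : R => spow p (sin x)).
Proof.
have q0 : 0 < 2 * p by rewrite mulr_gt0// (lt_trans _ p2).
split; last first.
  move=> X Y cX cY t; apply: (@continuous_comp _ _ _ (sin \o X) (spow p)); last exact: (spow_continuous (ltW p2)).
  by apply: (@continuous_comp _ _ _ X sin); [exact: cX|exact: continuous_sin].
exists (2 * p) => //; split=> [t x y|t x y x' y'].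
  by rewrite (le_trans (norm_spow_le1 (ltW p2) (norm_sin_le1 x)))//; have := p2; lra.
apply: (le_trans (spow_lip _ _ (ltW p2))).
have h z : `|sin z| `^ (p - 2) <= 1.
  have e1 : (1 : R) `^ (p - 2) = 1 by rewrite powR1.
  by rewrite -[leRHS]e1; apply: powR_le; rewrite ?norm_sin_le1// ltW.
have p1 : 0 <= p - 1 by have := p2; lra.
apply: ler_pM; [by rewrite mulr_ge0// addr_ge0 ?powR_ge0|by []| |by rewrite (le_trans (sin_lip _ _))// lerDl].
apply: (@le_trans _ _ ((p - 1) * 2)); last by have := p2; lra.
by rewrite ler_wpM2l//; have := h x; have := h x'; lra.
Qed.

Let cut_gt0 M y : 0 < cut M y. Proof. exact: expR_gt0. Qed.

Let cut_le M y : cut M y <= full M.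
Proof. by rewrite ler_expR ler_pM2l// ge_min lexx orbT. Qed.

Let min_lip y y' M : `|Num.min y M - Num.min y' M| <= `|y - y'|.
Proof.
have h1 := ler_norm (y - y'); have h2 := ler_norm (y' - y); rewrite distrC in h2.
by case: (leP y M) => ?; case: (leP y' M) => ?; rewrite ler_norml; apply/andP; split; lra.
Qed.

Let blip_cut M : blip (fun _ _ y : R => cut M y).
Proof.
split; last first.
  move=> X Y cX cY t; apply: (@continuous_comp _ _ _ (fun t => (p - 2) * Num.min (Y t) M) (@expR R)); last exact: continuous_expR.
  by apply: cvgM; [exact: cvg_cst|apply: continuous_min; [exact: cY|exact: cst_continuous]].
have f0 : 0 < full M by exact: expR_gt0.
exists ((1 + (p - 2)) * full M); first by rewrite mulr_gt0// addr_gt0.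
split=> [t x y|t x y x' y'].
  rewrite ger0_norm ?(ltW (cut_gt0 _ _))// (le_trans (cut_le _ _))// ler_peMl//; first exact: ltW.
  by rewrite lerDl ltW.
have key a b : cut M a - cut M b <= (1 + (p - 2)) * full M * (`|x - x'| + `|a - b|).
  have : cut M a - cut M b <= cut M a * ((p - 2) * (Num.min a M - Num.min b M)).
    have := expR_ge1Dx ((p - 2) * (Num.min b M - Num.min a M)).
    have E : cut M a * expR ((p - 2) * (Num.min b M - Num.min a M)) = cut M b.
      by rewrite -expRD; congr expR; ring.
    by move=> /(ler_wpM2l (ltW (cut_gt0 M a))); rewrite E; lra.
  move=> /le_trans; apply; apply: (@le_trans _ _ (full M * ((p - 2) * `|a - b|))).
    apply: (@le_trans _ _ (cut M a * ((p - 2) * `|a - b|))).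
      rewrite ler_wpM2l ?(ltW (cut_gt0 _ _))// ler_wpM2l ?(ltW p20)//.
      by rewrite (le_trans (ler_norm _))// min_lip.
    by rewrite ler_wpM2r// mulr_ge0// ltW.
  rewrite mulrCA -mulrA; have := mulr_ge0 (mulr_ge0 (ltW f0) (ltW p20)) (normr_ge0 (x - x')).
  have := mulr_ge0 (ltW f0) (addr_ge0 (normr_ge0 (x - x')) (normr_ge0 (a - b))).
  lra.
rewrite ler_norml; have := key y y'; have := key y' y; rewrite [`|y' - y|]distrC.
by move=> h1 h2; apply/andP; split; lra.
Qed.

Let Ab t : `|A t| <= A1.
Proof. by have /andP[h1 h2] := hA t; rewrite ger0_norm// (le_trans _ h1)// ltW. Qed.

Let Bb t : `|B t| <= B1.
Proof. by have /andP[h1 h2] := hB t; rewrite ger0_norm// (le_trans _ h1)// ltW. Qed.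

Let blip_g1 M : blip (fun _ x y : R => g1 (cut M y) x).
Proof.
apply: blipD; first exact: blipM (blip_cst mu) blip_sin.
by apply: blipM; [exact: blipM (blip_cst eps) (blip_cut M)|exact: blip_spow].
Qed.

Let bF1 M : blip (fun t x y => F1 (cut M y) t x).
Proof.
apply: blipD; first exact: blipM (blipM (blip_time cA Ab) blip_cos) blip_cos.
exact: blipM (blipM (blip_time cB Bb) (blip_g1 M)) blip_sin.
Qed.

Let bF2 M : blip (fun t x y => F2 (cut M y) t x).
Proof.
apply: blipB; first exact: blipM (blipM (blip_time cA Ab) blip_sin) blip_cos.
exact: blipM (blipM (blip_time cB Bb) (blip_g1 M)) blip_cos.
Qed.

Lemma cut_full M y : y <= M -> cut M y = full y.
Proof. by move=> yM; rewrite /cut min_l. Qed.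

Lemma psol_full M t0 t1 X Y : (forall t, t0 <= t <= t1 -> Y t <= M) ->
  psol M t0 t1 X Y <-> fsol t0 t1 X Y.
Proof.
move=> H; split=> -[cX cY dXY]; split=> // t /[dup] /andP[t1_ t2_] /dXY;
  by rewrite cut_full// H// !ltW.
Qed.

Lemma solves_le t0 t1 t1' f1 f2 X Y : t1' <= t1 -> solves f1 f2 t0 t1 X Y ->
  solves f1 f2 t0 t1' X Y :> Prop.
Proof.
move=> tt [cX cY H]; split=> // t /andP[h1 h2]; apply: H.
by rewrite h1 (lt_le_trans h2).
Qed.

Lemma fsol_bounded t0 t1 X Y : fsol t0 t1 X Y -> exists M, forall t, t0 <= t <= t1 -> Y t <= M.
Proof.
move=> [_ cY _]; have [M H] := continuous_bounded_itv cY t0 t1.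
by exists M => t /H; exact: le_trans (ler_norm _).
Qed.

Lemma fsol_unique t0 t1 X Y X' Y' : fsol t0 t1 X Y -> fsol t0 t1 X' Y' ->
  X t0 = X' t0 -> Y t0 = Y' t0 -> forall t, t0 <= t <= t1 -> X t = X' t /\ Y t = Y' t.
Proof.
move=> S S' Xe Ye t tt; have [M HM] := fsol_bounded S; have [M' HM'] := fsol_bounded S'.
pose K := Num.max M M'.
have P : psol K t0 t1 X Y by apply/psol_full => // s /HM h; rewrite le_max h.
have P' : psol K t0 t1 X' Y' by apply/psol_full => // s /HM' h; rewrite le_max h orbT.
have [L _ /(_ _ _ _ _ _ _ P P' t tt)] := gronwall (bF1 K) (bF2 K).
rewrite Xe Ye !subrr expr0n/= addr0 mul0r => h.
have h1 := sqr_ge0 (X t - X' t); have h2 := sqr_ge0 (Y t - Y' t).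
split; apply/eqP; rewrite -subr_eq0 -sqrf_eq0; apply/eqP; lra.
Qed.

(** Survival up to [t1] is an open condition. The field is cut one unit above a bound for [Y]; by
    Gronwall a neighbouring solution of the cut system stays within one unit of [Y], where the cut
    is not felt. *)
Lemma fsol_open t0 t1 X Y : t0 <= t1 -> fsol t0 t1 X Y -> forall e, 0 < e ->
  exists2 d, 0 < d & forall x0 y0, `|x0 - X t0| < d -> `|y0 - Y t0| < d ->
  exists X' Y', [/\ fsol t0 t1 X' Y', X' t0 = x0, Y' t0 = y0 &
    forall t, t0 <= t <= t1 -> `|X' t - X t| < e /\ `|Y' t - Y t| < e].
Proof.
move=> t01 S e e0; have [M HM] := fsol_bounded S; pose K := M + 1.
have P : psol K t0 t1 X Y by apply/psol_full => // s /HM h; rewrite /K; lra.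
have [L L0 HG] := gronwall (bF1 K) (bF2 K).
pose e' := Num.min e 1; have e'0 : 0 < e' by rewrite lt_min e0 ltr01.
pose E := expR (L * (t1 - t0)); have E0 : 0 < E by exact: expR_gt0.
have E1 : 1 <= E by rewrite /E -expR0 ler_expR mulr_ge0// subr_ge0.
pose d := e' / (2 * E); have d0 : 0 < d by rewrite divr_gt0// mulr_gt0.
exists d => // x0 y0 xd yd.
have [X' [Y' [X'0 Y'0 /(_ t1) P']]] := picard (bF1 K) (bF2 K) t0 x0 y0.
have close t : t0 <= t <= t1 -> `|X' t - X t| < e' /\ `|Y' t - Y t| < e'.
  move=> tt; have := HG _ _ _ _ _ _ P' P t tt; rewrite X'0 Y'0.
  have /andP[t0t tt1] := tt.
  have h : ((x0 - X t0) ^+ 2 + (y0 - Y t0) ^+ 2) * expR (L * (t - t0)) < e' ^+ 2.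
    have w : expR (L * (t - t0)) <= E by rewrite ler_expR ler_wpM2l// lerB.
    apply: (@le_lt_trans _ _ (((x0 - X t0) ^+ 2 + (y0 - Y t0) ^+ 2) * E)).
      by rewrite ler_wpM2l// addr_ge0 ?sqr_ge0.
    have a1 : (x0 - X t0) ^+ 2 < d ^+ 2 by rewrite -[ltLHS]real_normK ?num_real// ltrXn2r ?nnegrE// ltW.
    have a2 : (y0 - Y t0) ^+ 2 < d ^+ 2 by rewrite -[ltLHS]real_normK ?num_real// ltrXn2r ?nnegrE// ltW.
    apply: (@lt_le_trans _ _ (2 * d ^+ 2 * E)); first by rewrite ltr_pM2r//; lra.
    have -> : 2 * d ^+ 2 * E = e' ^+ 2 / (2 * E) by rewrite /d; field; rewrite gt_eqF.
    by rewrite ler_pdivrMr ?mulr_gt0// ler_peMr ?sqr_ge0//; lra.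
  move=> /le_lt_trans/(_ h) {}h; have b1 := sqr_ge0 (X' t - X t); have b2 := sqr_ge0 (Y' t - Y t).
  by split; rewrite -(@ltr_pXn2r _ 2) ?nnegrE// ?(ltW e'0)// real_normK ?num_real//; lra.
exists X', Y'; split => //.
- apply/(@psol_full K) => // t tt; have [_ h] := close t tt.
  have := HM t tt; move: h; rewrite /e' lt_min => /andP[_]; rewrite ltr_norml /K => /andP[_]; lra.
- move=> t /close; rewrite /e' !lt_min => -[/andP[h1 _] /andP[h2 _]]; split; [exact: h1|exact: h2].
Qed.

Lemma norm_F2 e t x : 0 <= e -> `|F2 e t x| <= A1 + B1 * (mu + e).
Proof.
move=> e0; have s1 := norm_sin_le1 x; have c1 := norm_cos_le1 x.
have q1 := norm_spow_le1 (ltW p2) s1.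
have B10 : 0 <= B1 by exact: le_trans (Bb t).
have G : `|g1 e x| <= mu + e.
  rewrite (le_trans (ler_normD _ _))// lerD//.
    by rewrite normrM (ger0_norm mu0) ler_piMr.
  by rewrite 2!normrM (ger0_norm e0) mulrAC ler_piMl// mulr_ile1.
rewrite /F2 (le_trans (ler_normB _ _))// lerD// !normrM.
  by rewrite -mulrA (le_trans _ (Ab t))// ler_piMr// mulr_ile1.
rewrite (@le_trans _ _ (`|B t| * `|g1 e x|)) ?ler_piMr ?mulr_ge0//.
by apply: ler_pM.
Qed.

Lemma fsol_small t0 t1 x0 y0 : t0 <= t1 -> y0 + (A1 + B1 * (mu + 1)) * (t1 - t0) <= 0 ->
  exists X Y, [/\ fsol t0 t1 X Y, X t0 = x0, Y t0 = y0 &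
    Y t1 <= y0 + (A1 + B1 * (mu + 1)) * (t1 - t0)].
Proof.
set C := A1 + _ => t01 hC.
have C0 : 0 <= C.
  have h1 := le_trans (normr_ge0 _) (Ab t0); have h2 := le_trans (normr_ge0 _) (Bb t0).
  by rewrite addr_ge0 ?mulr_ge0// addr_ge0.
have [X [Y [X0 Y0 /(_ t1) [cX cY dXY]]]] := picard (bF1 0) (bF2 0) t0 x0 y0.
have YC t : t0 <= t <= t1 -> Y t <= y0 + C * (t - t0).
  move=> /andP[t0t tt1].
  pose G s := Y s - C * (s - t0).
  suff : G t <= G t0 by rewrite /G subrr mulr0 subr0 Y0; lra.
  apply: (@derive_le0_ge _ G (fun s => F2 (cut 0 (Y s)) s (X s) - C * (1 - 0))) => //.
  - apply: continuous_subspaceT => s; apply: cvgB; first exact: cY.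
    by apply: cvgM; [exact: cvg_cst|apply: cvgB; [exact: cvg_id|exact: cvg_cst]].
  - move=> s /andP[h1 h2]; have h : t0 < s < t1 by rewrite h1 (lt_le_trans h2).
    exact: (dB (dXY s h).2 (dZ C (dB (did s) (dcst s t0)))).
  - move=> s _; rewrite subr0 mulr1 subr_le0 (le_trans (ler_norm _))//.
    apply: (le_trans (norm_F2 _ _ (ltW (cut_gt0 _ _)))).
    rewrite /C lerD2l ler_wpM2l ?(le_trans (normr_ge0 _) (Bb t0))// lerD2l.
    by rewrite (le_trans (cut_le _ _))// /full mulr0 expR0.
exists X, Y; split => //; last by apply: YC; rewrite t01 lexx.
apply/(@psol_full 0) => // t tt; apply: (le_trans (YC t tt)).
apply: le_trans hC; rewrite lerD2l ler_wpM2l// lerB//; by case/andP: tt.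
Qed.

(** The solution of the system cut at K + 1 is a true solution as long as Y <= K + 1. By the a
    priori bound Y <= K at the last such time, so that time cannot precede [t1]. *)
Lemma fsol_continue t0 t1 x0 y0 K : t0 <= t1 ->
  (forall t X Y, t0 <= t <= t1 -> fsol t0 t X Y -> X t0 = x0 -> Y t0 = y0 -> Y t <= K) ->
  exists X Y, [/\ fsol t0 t1 X Y, X t0 = x0 & Y t0 = y0].
Proof.
move=> t01 HK; pose M := K + 1.
have [X [Y [X0 Y0 HP]]] := picard (bF1 M) (bF2 M) t0 x0 y0.
have cY : continuous Y by have [] := HP t1.
pose S := [set t | t0 <= t <= t1 /\ forall s, t0 <= s <= t -> Y s <= M].
have good t : t0 <= t <= t1 -> (forall s, t0 <= s < t -> Y s <= M) -> S t.
  move=> tt H; have P : fsol t0 t X Y.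
    have [c1 c2 d] := HP t; split=> // s /[dup] /andP[s1 s2] /d.
    by rewrite cut_full// H// s2 ltW.
  have YK := HK t X Y tt P X0 Y0.
  split=> // s /andP[s1]; rewrite le_eqVlt => /predU1P[->|s2]; first by rewrite /M; lra.
  by apply: H; rewrite s1.
have S0 : S t0 by apply: good => [|s /andP[h1 h2]]; [rewrite lexx|lra].
have hs : has_sup S by split; [exists t0|exists t1 => t [/andP[]]].
have s0 : t0 <= sup S by exact: (sup_upper_bound hs).
have s1 : sup S <= t1 by apply: ge_sup; [exists t0|move=> t [/andP[]]].
have Ss : S (sup S).
  apply: good => [|s /andP[h1 h2]]; first by rewrite s0.
  have ds : 0 < sup S - s by rewrite subr_gt0.
  have [t [_ Ht] ht] := sup_adherent ds hs.
  by move=> /=; move: ht; rewrite subKr => /ltW ht; apply: Ht; rewrite h1.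
suff : sup S = t1.
  move=> E; exists X, Y; split; [|exact: X0|exact: Y0].
  apply/(@psol_full M); last exact: HP.
  by move=> t; rewrite -E; exact: Ss.2.
apply/eqP; rewrite eq_le s1 leNgt; apply/negP => slt.
have fs : fsol t0 (sup S) X Y by apply/(@psol_full M); [exact: Ss.2|exact: HP].
have YK : Y (sup S) <= K by apply: (HK _ _ _ _ fs) => //; rewrite s0.
have /cvgrPdist_lt/(_ 1 ltr01)/nbhs_ballP[del /= del0 Hd] := cY (sup S).
pose t' := Num.min t1 (sup S + del / 2).
have t'1 : t' <= t1 by rewrite ge_min lexx.
have t'd : t' <= sup S + del / 2 by rewrite ge_min lexx orbT.
have st' : sup S < t' by rewrite lt_min slt ltrDl divr_gt0.
have : S t'.
  apply: good => [|s /andP[h1 h2]]; first by rewrite t'1 (le_trans s0 (ltW st')).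
  have [ss|ss] := leP s (sup S); first by apply: Ss.2; rewrite h1.
  have := Hd s; rewrite /ball/= => /(_ _)/=.
  have : `|sup S - s| < del by rewrite ltr0_norm; lra.
  by move=> hd /(_ hd); rewrite ltr_norml => /andP[? ?]; rewrite /M; lra.
by move=> /(sup_upper_bound hs); lra.
Qed.

Section cartesian.
Variables (t0 t1 : R) (X Y : R -> R).
Hypothesis S : fsol t0 t1 X Y.

Definition hh t : R := expR (Y t) * sin (X t).
Definition zz t : R := expR (Y t) * cos (X t).

Let cX : continuous X. Proof. by case: S. Qed.
Let cY : continuous Y. Proof. by case: S. Qed.

Lemma hh_continuous : continuous hh.
Proof.
move=> t; apply: cvgM.
  by apply: (@continuous_comp _ _ _ Y (@expR R)); [exact: cY|exact: continuous_expR].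
by apply: (@continuous_comp _ _ _ X sin); [exact: cX|exact: continuous_sin].
Qed.

Lemma zz_continuous : continuous zz.
Proof.
move=> t; apply: cvgM.
  by apply: (@continuous_comp _ _ _ Y (@expR R)); [exact: cY|exact: continuous_expR].
by apply: (@continuous_comp _ _ _ X cos); [exact: cX|exact: continuous_cos].
Qed.

Lemma spow_hh t : spow p (hh t) = full (Y t) * expR (Y t) * spow p (sin (X t)).
Proof.
have e0 := expR_gt0 (Y t).
rewrite /spow /hh normrM (ger0_norm (ltW e0)) powRM ?normr_ge0 ?(ltW e0)//.
rewrite /full (mulrC (p - 2)) expRM; ring.
Qed.

Lemma hh_derive t : t0 < t < t1 -> is_derive t 1 hh (A t * zz t).
Proof.
move=> tt; have [_ _ /(_ t tt)[dX_ dY_]] := S.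
have -> : A t * zz t = expR (Y t) * F2 (full (Y t)) t (X t) * sin (X t) +
    expR (Y t) * (cos (X t) * F1 (full (Y t)) t (X t)).
  rewrite /zz /F1 /F2; have := cos2Dsin2 (X t).
  move: (g1 _ _) (sin (X t)) (cos (X t)) (expR _) => g s c e H.
  rewrite -[LHS]mulr1 -H; ring.
exact: (dM (dcomp (is_derive_expR (Y t)) dY_) (dcomp (is_derive_sin (X t)) dX_)).
Qed.

Lemma zz_derive t : t0 < t < t1 ->
  is_derive t 1 zz (- (B t * (mu * hh t + eps * spow p (hh t)))).
Proof.
move=> tt; have [_ _ /(_ t tt)[dX_ dY_]] := S.
have -> : - (B t * (mu * hh t + eps * spow p (hh t))) =
    expR (Y t) * F2 (full (Y t)) t (X t) * cos (X t) +
    expR (Y t) * (- sin (X t) * F1 (full (Y t)) t (X t)).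
  rewrite spow_hh /hh /F1 /F2 -!mulrA; have := cos2Dsin2 (X t).
  have -> : mu * (expR (Y t) * sin (X t)) + eps * (full (Y t) * (expR (Y t) * spow p (sin (X t)))) =
    expR (Y t) * g1 (full (Y t)) (X t) by rewrite /g1; ring.
  move: (g1 _ _) (sin (X t)) (cos (X t)) (expR _) => g s c e H.
  rewrite -[LHS]mulr1 -H; ring.
exact: (dM (dcomp (is_derive_expR (Y t)) dY_) (dcomp (is_derive_cos (X t)) dX_)).
Qed.

Lemma hhzz t : hh t ^+ 2 + zz t ^+ 2 = expR (Y t) ^+ 2.
Proof. by rewrite /hh /zz !exprMn -mulrDr addrC cos2Dsin2 mulr1. Qed.

End cartesian.

End polar.

(** * Crossing an annulus *)

Section rotation.
Context (R : realType).
Implicit Types (X f : R -> R) (t u v : R).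

(* On a strip 0 < X < pi the angle atan (cos X / (ka sin X)) decreases at rate
   at least a0 ka, while it ranges in an interval of length pi. *)
Lemma rotation_strip X f u v (a0 ka : R) : u <= v -> 0 < a0 -> 0 < ka -> continuous X ->
  (forall t, u < t < v -> is_derive t 1 X (f t)) ->
  (forall t, u < t < v -> a0 * (ka ^+ 2 * sin (X t) ^+ 2 + cos (X t) ^+ 2) <= f t) ->
  0 < X u -> X v < pi -> (v - u) * (a0 * ka) < pi.
Proof.
move=> uv a00 ka0 cX dX_ fX Xu Xv.
have f0 t : u < t < v -> 0 <= f t.
  move=> /fX; apply: le_trans; rewrite mulr_ge0 ?(ltW a00)// addr_ge0 ?sqr_ge0//.
  by rewrite mulr_ge0 ?sqr_ge0.
have mono a b : u <= a -> a <= b -> b <= v -> X a <= X b.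
  move=> ua ab bv; apply: (@derive_ge0_le _ X f) => //; first exact: continuous_subspaceT.
    by move=> t /andP[h1 h2]; apply: dX_; rewrite (le_lt_trans ua h1) (lt_le_trans h2 bv).
  by move=> t /andP[h1 h2]; apply: f0; rewrite (le_lt_trans ua h1) (lt_le_trans h2 bv).
have s0 t : u <= t <= v -> 0 < sin (X t).
  move=> /andP[h1 h2]; apply: sin_gt0_pi.
  by rewrite (lt_le_trans Xu (mono _ _ (lexx _) h1 h2)) (le_lt_trans (mono _ _ h1 h2 (lexx _)) Xv).
pose w t := cos (X t) * (ka * sin (X t))^-1.
pose w' t := (- sin (X t) * f t) * (ka * sin (X t))^-1 +
  cos (X t) * (- (ka * (cos (X t) * f t)) / (ka * sin (X t)) ^+ 2).
have dw t : u < t < v -> is_derive t 1 w (w' t).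
  move=> tt; have st : 0 < sin (X t) by apply: s0; have /andP[/ltW-> /ltW->] := tt.
  apply: (dM (dcomp (is_derive_cos (X t)) (dX_ t tt))).
  apply: (@dV _ t (fun t => ka * sin (X t))); first by rewrite mulf_neq0// gt_eqF.
  exact: (dZ ka (dcomp (is_derive_sin (X t)) (dX_ t tt))).
have cw t : u <= t <= v -> {for t, continuous w}.
  move=> tt.
  have c1 : {for t, continuous (fun t => sin (X t))}.
    by apply: (@continuous_comp _ _ _ X sin); [exact: cX|exact: continuous_sin].
  have c2 : {for t, continuous (fun t => cos (X t))}.
    by apply: (@continuous_comp _ _ _ X cos); [exact: cX|exact: continuous_cos].
  apply: cvgM; first exact: c2.
  apply: cvgV; first by rewrite mulf_neq0 ?gt_eqF// s0.
  by apply: cvgM; [exact: cvg_cst|exact: c1].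
pose G t := atan (w t) + a0 * ka * t.
have : G v <= G u.
  apply: (@derive_le0_ge _ G (fun t => (1 + w t ^+ 2)^-1 * w' t + a0 * ka * 1)) => //.
  - apply: continuous_in_subspaceT => t; rewrite inE/= in_itv/= => tt.
    apply: cvgD; last by apply: cvgM; [exact: cvg_cst|exact: cvg_id].
    by apply: (@continuous_comp _ _ _ w atan); [exact: cw tt|exact: continuous_atan].
  - by move=> t tt; exact: dD (dcomp (is_derive1_atan (w t)) (dw t tt)) (dZ (a0 * ka) (did t)).
  - move=> t tt; have st : 0 < sin (X t) by apply: s0; have /andP[/ltW-> /ltW->] := tt.
    have q0 : 0 < ka ^+ 2 * sin (X t) ^+ 2 + cos (X t) ^+ 2.
      by rewrite ltr_pwDl ?sqr_ge0// mulr_gt0 ?exprn_gt0.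
    have -> : (1 + w t ^+ 2)^-1 * w' t = - (ka * f t) / (ka ^+ 2 * sin (X t) ^+ 2 + cos (X t) ^+ 2).
      have := cos2Dsin2 (X t); rewrite /w' /w; move: st q0.
      move: (sin (X t)) (cos (X t)) (f t) => s c y st q0 H.
      have -> : - (ka * y) = - (ka * y) * (c ^+ 2 + s ^+ 2) by rewrite H mulr1.
      field; rewrite !gt_eqF//=.
      by rewrite ltr_pwDl ?sqr_ge0// exprn_gt0// mulr_gt0.
    rewrite mulr1 mulNr addrC subr_le0 ler_pdivlMr//.
    by have := ler_wpM2l (ltW ka0) (fX t tt); lra.
rewrite /G; have := atan_gtNpi2 (w v); have := atan_ltpi2 (w u); lra.
Qed.

Lemma sin_shift_sqr (x : R) j : sin (x + pi - j%:R * pi) ^+ 2 = sin x ^+ 2.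
Proof.
elim: j x => [|j IH] x; first by rewrite mul0r subr0 sinDpi sqrrN.
rewrite -(IH x) -natr1 mulrDl mul1r opprD addrA.
by rewrite -[in RHS](subrK pi (x + pi - j%:R * pi)) sinDpi sqrrN.
Qed.

Lemma cos_shift_sqr (x : R) j : cos (x + pi - j%:R * pi) ^+ 2 = cos x ^+ 2.
Proof. by have := cos2Dsin2 (x + pi - j%:R * pi); have := cos2Dsin2 x; rewrite sin_shift_sqr; lra. Qed.

(** The interval is divided into [J] equal parts. In the first half of a part the strip bound forces
    the angle through what remains of a strip of width pi; the second half makes the inequality
    strict, ready for the next strip. *)
Lemma rotation_count X f t0 t1 (a0 ka : R) (J : nat) : t0 < t1 -> 0 < a0 -> 1 <= ka ->
  continuous X -> (forall t, t0 < t < t1 -> is_derive t 1 X (f t)) ->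
  (forall t, t0 < t < t1 -> a0 * (ka ^+ 2 * sin (X t) ^+ 2 + cos (X t) ^+ 2) <= f t) ->
  2 * pi * J%:R <= (t1 - t0) * (a0 * ka) -> 0 <= X t0 -> J%:R * pi < X t1 + pi.
Proof.
move=> t01 a00 ka1 cX dX_ fX hJ X0.
have ka0 : 0 < ka by rewrite (lt_le_trans ltr01).
have pi0 := @pi_gt0 R.
have [->|Jn] := eqVneq J 0%N.
  rewrite mul0r; have : X t0 <= X t1; last lra.
  apply: (@derive_ge0_le _ X f) => //; [exact: ltW|exact: continuous_subspaceT|].
  by move=> t /fX; apply: le_trans; rewrite mulr_ge0 ?(ltW a00)// addr_ge0 ?sqr_ge0// mulr_ge0 ?sqr_ge0.
have J0 : (0 : R) < J%:R by rewrite ltr0n lt0n.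
pose l := (t1 - t0) / J%:R.
have l0 : 0 < l by rewrite divr_gt0// subr_gt0.
have la : 2 * pi <= l * (a0 * ka) by rewrite /l mulrAC ler_pdivlMr.
pose v (j : nat) := t0 + j%:R * l.
have vJ : v J = t1 by rewrite /v /l mulrC divfK ?gt_eqF// addrC subrK.
have strict a b : t0 <= a -> a < b -> b <= t1 -> X a < X b.
  move=> ta ab bt; have : X a - a0 * a <= X b - a0 * b.
    apply: (@derive_ge0_le _ (fun t => X t - a0 * t) (fun t => f t - a0 * 1)); first exact: ltW.
    - apply: continuous_subspaceT => t; apply: cvgB; first exact: cX.
      by apply: cvgM; [exact: cvg_cst|exact: cvg_id].
    - move=> t /andP[h1 h2]; apply: (dB _ (dZ a0 (did t))).
      by apply: dX_; rewrite (le_lt_trans ta h1) (lt_le_trans h2 bt).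
    - move=> t /andP[h1 h2]; have : t0 < t < t1 by rewrite (le_lt_trans ta h1) (lt_le_trans h2 bt).
      move=> /fX; rewrite mulr1 subr_ge0; apply: le_trans; rewrite ler_peMr ?(ltW a00)//.
      rewrite -[leLHS](cos2Dsin2 (X t)) addrC lerD2r ler_peMl ?sqr_ge0//.
      by rewrite exprn_ege1.
  have : a0 * a < a0 * b by rewrite ltr_pM2l.
  lra.
have vt j : (j <= J)%N -> t0 <= v j <= t1.
  move=> jJ; rewrite -vJ /v lerDl mulr_ge0 ?(ltW l0)//= lerD2l ler_wpM2r ?(ltW l0)// ler_nat//.
have key j : (j <= J)%N -> j%:R * pi < X (v j) + pi.
  elim: j => [_|j IH jJ]; first by rewrite mul0r /v mul0r addr0; lra.
  have {}IH := IH (ltnW jJ); have /andP[vj0 vj1] := vt j (ltnW jJ).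
  have /andP[_ vj2] := vt j.+1 jJ.
  have vS : v j.+1 = v j + l by rewrite /v -natr1; ring.
  pose w := v j + l / 2.
  have wlt : w < v j.+1 by rewrite vS /w; lra.
  have vw : v j < w by rewrite /w; lra.
  suff : j%:R * pi <= X w.
    have := strict _ _ (le_trans vj0 (ltW vw)) wlt vj2; rewrite -natr1; lra.
  rewrite leNgt; apply/negP => Xw.
  have := @rotation_strip (fun t => X t + pi - j%:R * pi) f (v j) w a0 ka (ltW vw) a00 ka0.
  suff H : w - v j = l / 2.
    rewrite H => K; have : l / 2 * (a0 * ka) < pi; last lra.
    apply: K.
    - by move=> t; apply: cvgB; [apply: cvgD; [exact: cX|exact: cvg_cst]|exact: cvg_cst].
    - move=> t /andP[h1 h2]; rewrite -[f t]subr0 -[X in X - 0]addr0.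
      have tt : t0 < t < t1 by rewrite (le_lt_trans vj0 h1) (lt_le_trans h2)// (le_trans (ltW wlt)).
      exact: (dB (dD (dX_ t tt) (dcst t pi)) (dcst t (j%:R * pi))).
    - move=> t /andP[h1 h2]; rewrite sin_shift_sqr cos_shift_sqr.
      by apply: fX; rewrite (le_lt_trans vj0 h1) (lt_le_trans h2)// (le_trans (ltW wlt)).
    - lra.
    - lra.
  by rewrite /w; ring.
by rewrite -vJ; exact: key.
Qed.

End rotation.

Section annulus.
Context (R : realType).
Variables (p mu : R) (A B D : R -> R) (A0 A1 B0 B1 kap t0 t1 : R).
Hypotheses (p2 : 2 < p) (mu0 : 0 <= mu).
Hypotheses (cA : continuous A) (cB : continuous B).
Hypotheses (A00 : 0 < A0) (B00 : 0 < B0).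
Hypotheses (hA : forall t, A0 <= A t <= A1) (hB : forall t, B0 <= B t <= B1).
Hypotheses (t01 : t0 < t1) (dq : forall t, t0 < t < t1 -> is_derive t 1 (fun s => B s / A s) (D t)).
Hypothesis hD : forall t, t0 < t < t1 -> 0 <= D t <= kap * (B t / A t).

Local Notation fs := (fsol p mu 1 A B).
Local Notation q := (fun s => B s / A s).

Let p0 : 0 < p. Proof. exact: lt_trans p2. Qed.
Let p1 : 1 < p. Proof. by rewrite (lt_trans _ p2)// ltr1n. Qed.
Let A10 : 0 < A1. Proof. by have /andP[h1 h2] := hA 0; rewrite (lt_le_trans A00)// (le_trans h1). Qed.
Let B10 : 0 < B1. Proof. by have /andP[h1 h2] := hB 0; rewrite (lt_le_trans B00)// (le_trans h1). Qed.
Let At t : 0 < A t. Proof. by have /andP[h1 _] := hA t; exact: lt_le_trans h1. Qed.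
Let Bt t : 0 < B t. Proof. by have /andP[h1 _] := hB t; exact: lt_le_trans h1. Qed.
Let q0 : R := B0 / A1.
Let q1 : R := B1 / A0.
Let q00 : 0 < q0. Proof. exact: divr_gt0. Qed.
Let q10 : 0 < q1. Proof. exact: divr_gt0. Qed.
Let hq t : q0 <= q t <= q1.
Proof.
have /andP[a1 a2] := hA t; have /andP[b1 b2] := hB t.
by apply/andP; split; apply: ler_pM; rewrite ?invr_ge0 ?lef_pV2 ?posrE//; exact: ltW.
Qed.

Definition pot (h : R) : R := mu / 2 * h ^+ 2 + p^-1 * `|h| `^ p.

Lemma pot_ge0 h : 0 <= pot h.
Proof.
apply: addr_ge0; apply: mulr_ge0; [exact: divr_ge0|exact: sqr_ge0| |exact: powR_ge0].
by rewrite invr_ge0 ltW.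
Qed.

Definition energy (X Y : R -> R) t : R := 2^-1 * zz X Y t ^+ 2 + q t * pot (hh X Y t).

(** The energy would be conserved for constant [q]. Here its derivative is q' times the potential,
    hence nonnegative and at most kap times the energy. *)
Lemma energy_bounds tau X Y : t0 <= tau <= t1 -> fs t0 tau X Y ->
  energy X Y t0 <= energy X Y tau <= energy X Y t0 * expR (kap * (tau - t0)).
Proof.
move=> /andP[t0t tt1] S; set H := energy X Y.
have cz := zz_continuous S; have ch := hh_continuous S.
have sq (f : R -> R) : continuous f -> continuous (fun t => f t ^+ 2).
  rewrite (_ : (fun t => _) = (fun t => f t * f t)); last by apply/funext => t; rewrite expr2.
  by move=> cf t; apply: cvgM; exact: cf.
have cH : {within `[t0, tau], continuous H}.
  apply: continuous_subspaceT => t; apply: cvgD.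
    by apply: cvgM; [exact: cvg_cst|exact: (sq _ cz)].
  apply: cvgM.
    by apply: cvgM; [exact: cB|apply: cvgV; [rewrite gt_eqF|exact: cA]].
  apply: cvgD; apply: cvgM; try exact: cvg_cst; first exact: (sq _ ch).
  apply: (@continuous_comp _ _ _ (hh X Y) (fun x => `|x| `^ p)); first exact: ch.
  exact: powR_abs_continuous.
pose H' t := D t * pot (hh X Y t).
have inner t : t0 < t < tau -> t0 < t < t1 by move=> /andP[-> h]; rewrite (lt_le_trans h).
have dH t : t0 < t < tau -> is_derive t 1 H (H' t).
  move=> tt; have dh := hh_derive S tt; have dz := zz_derive S tt.
  set h := hh X Y t in dh dz; set z := zz X Y t in dh dz.
  have -> : H' t = 2^-1 * (2%:R * z ^+ 1 * - (B t * (mu * h + 1 * spow p h))) +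
    (D t * pot h + q t * (mu / 2 * (2%:R * h ^+ 1 * (A t * z)) + p^-1 * (p * spow p h * (A t * z)))).
    rewrite /H' -/h; field; rewrite !gt_eqF//.
  apply: dD; first exact: dZ 2^-1 (dX 2 dz).
  apply: (dM (dq (inner t tt))); apply: dD; first exact: dZ (mu / 2) (dX 2 dh).
  exact: dZ p^-1 (dcomp (is_derive_powR_abs h (ltW p2)) dh).
have H'0 t : t0 < t < tau -> 0 <= H' t.
  by move=> /inner/hD/andP[h _]; rewrite mulr_ge0 ?pot_ge0.
apply/andP; split; first exact: (@derive_ge0_le _ H H').
pose w t := expR (- kap * (t - t0)).
have dw (t : R) : is_derive t 1 w (w t * (- kap * (1 - 0))).
  exact: (@dcomp _ t (fun t => - kap * (t - t0)) (@expR R) _ _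
    (is_derive_expR (- kap * (t - t0))) (dZ (- kap) (dB (did t) (dcst t t0)))).
have : H tau * w tau <= H t0 * w t0.
  apply: (@derive_le0_ge _ (fun t => H t * w t) (fun t => H' t * w t + H t * (w t * (- kap * (1 - 0))))) => //.
  - move=> t; apply: cvgM; first exact: cH.
    apply: (continuous_subspaceT (f := w)); move=> s; exact: is_derive_continuous (dw s).
  - by move=> t tt; exact: dM (dH t tt) (dw t).
  - move=> t tt; have -> : H' t * w t + H t * (w t * (- kap * (1 - 0))) = (H' t - kap * H t) * w t by ring.
    rewrite mulr_le0_ge0 ?expR_ge0// subr_le0 /H /energy /H' [kap * (_ + _)]mulrDr.
    have kap0 : 0 <= kap.
      have /andP[h1 h2] := hD (inner t tt).
      by have := le_trans h1 h2; rewrite pmulr_lge0// divr_gt0.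
    have /andP[_ h2] := hD (inner t tt).
    apply: (@le_trans _ _ (kap * (q t * pot (hh X Y t)))).
      by rewrite mulrA ler_wpM2r ?pot_ge0.
    by rewrite lerDr mulr_ge0// mulr_ge0 ?sqr_ge0.
rewrite /w subrr mulr0 expR0 mulr1 -ler_pdivlMr ?expR_gt0// => /le_trans; apply.
by rewrite mulNr expRN invrK.
Qed.

Lemma expR_energy X Y t : expR (Y t) ^+ 2 <= (2 + p / q0) * energy X Y t + 1.
Proof.
rewrite -(hhzz X Y t) /energy; have /andP[hq1 _] := hq t; set h := hh X Y t; set z := zz X Y t.
have a1 : h ^+ 2 <= 1 + `|h| `^ p.
  rewrite -[h ^+ 2]real_normK ?num_real//; have [h1|h1] := leP `|h| 1.
    have hp := powR_ge0 `|h| p; have h21 : `|h| ^+ 2 <= 1 by rewrite exprn_ile1.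
    by lra.
  by rewrite -powR_mulrn// ler_wpDl// ler_powR// ltW.
have pp : p^-1 * `|h| `^ p <= pot h by rewrite /pot lerDr mulr_ge0 ?sqr_ge0// mulr_ge0.
have a2 : `|h| `^ p <= p / q0 * (q t * pot h).
  have := ler_pM (ltW q00) (mulr_ge0 _ (powR_ge0 _ _)) hq1 pp; rewrite invr_ge0 (ltW p0) => /(_ isT) k.
  have := ler_wpM2l (divr_ge0 (ltW p0) (ltW q00)) k; apply: le_trans.
  by rewrite le_eqVlt; apply/orP; left; apply/eqP; field; rewrite !gt_eqF.
have k1 : 0 <= q t * pot h by rewrite mulr_ge0 ?pot_ge0// (le_trans (ltW q00)).
have k2 : 0 <= p / q0 by rewrite divr_ge0// ltW.
have := mulr_ge0 k2 (sqr_ge0 z); have := mulr_ge0 k2 k1; have := sqr_ge0 z.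
by move: a1 a2 k1; move: (q t * pot h) (p / q0) => u v; lra.
Qed.

(** With eps = 1 the energy is coercive, and its exponential bound is the a priori bound that rules
    out explosion. *)
Lemma annulus_exists x0 y0 : exists X Y, [/\ fs t0 t1 X Y, X t0 = x0 & Y t0 = y0].
Proof.
have e1 : `|1 : R| <= 1 by rewrite normr1.
pose E0 := 2^-1 * (expR y0 * cos x0) ^+ 2 + q t0 * pot (expR y0 * sin x0).
have E00 : 0 <= E0.
  apply: addr_ge0; first by rewrite mulr_ge0 ?sqr_ge0.
  by rewrite mulr_ge0 ?pot_ge0// divr_ge0// ltW.
apply: (@fsol_continue _ p mu 1 A B A0 A1 B0 B1 p2 cA cB A00 B00 hA hB _ _ _ _ ((2 + p / q0) * (E0 * expR (`|kap| * (t1 - t0))) + 1)); first exact: ltW.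
move=> t X Y tt S X0 Y0; have /andP[_ h] := energy_bounds tt S.
have EE : energy X Y t0 = E0 by rewrite /energy /zz /hh X0 Y0.
have k2 : 0 <= p / q0 by rewrite divr_ge0// ltW.
apply: (@le_trans _ _ (expR (Y t) ^+ 2)).
  rewrite -expRM_natr; have := expR_ge1Dx (Y t * 2); have := expR_ge0 (Y t * 2).
  by have [] := leP 0 (Y t); lra.
apply: (le_trans (expR_energy X Y t)); rewrite lerD2r ler_wpM2l ?addr_ge0//.
apply: (le_trans h); rewrite EE ler_wpM2l// ler_expR.
have /andP[h1 h2] := tt.
apply: (@le_trans _ _ (`|kap| * (t - t0))); first by rewrite ler_wpM2r ?subr_ge0// ler_norm.
by rewrite ler_wpM2l// lerB.
Qed.

Lemma energy_large : exists2 c, 0 < c & forall X Y t, c * expR (Y t) ^+ 2 - q0 / p <= energy X Y t.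
Proof.
have k0 : 0 < q0 / p by exact: divr_gt0.
exists (Num.min 2^-1 (q0 / p)) => [|X Y t]; first by rewrite lt_min k0 invr_gt0 ltr0n.
rewrite -(hhzz X Y t) /energy; have /andP[hq1 _] := hq t; set h := hh X Y t; set z := zz X Y t.
have a1 : h ^+ 2 - 1 <= `|h| `^ p.
  rewrite -[h ^+ 2]real_normK ?num_real//; have [h1|h1] := leP `|h| 1.
    have hp := powR_ge0 `|h| p; have h21 : `|h| ^+ 2 <= 1 by rewrite exprn_ile1.
    by lra.
  by rewrite lerBlDr ler_wpDr// -powR_mulrn// ler_powR// ltW.
have pp : p^-1 * `|h| `^ p <= pot h by rewrite /pot lerDr mulr_ge0 ?sqr_ge0// mulr_ge0.
have b : q0 / p * (h ^+ 2 - 1) <= q t * pot h.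
  apply: (@le_trans _ _ (q0 * (p^-1 * `|h| `^ p))).
    by rewrite -mulrA ler_wpM2l ?(ltW q00)// ler_wpM2l// invr_ge0 ltW.
  by apply: ler_pM => //; [exact: ltW|rewrite mulr_ge0 ?powR_ge0// invr_ge0 ltW].
have c1 : Num.min 2^-1 (q0 / p) <= 2^-1 by rewrite ge_min lexx.
have c2 : Num.min 2^-1 (q0 / p) <= q0 / p by rewrite ge_min lexx orbT.
have := ler_wpM2r (sqr_ge0 h) c2; have := ler_wpM2r (sqr_ge0 z) c1.
by move: (Num.min _ _) b => c; lra.
Qed.

Lemma energy_le X Y t K : Y t <= K ->
  energy X Y t <= expR K ^+ 2 + q1 * (mu / 2 * expR K ^+ 2 + p^-1 * expR K `^ p).
Proof.
move=> YK; have /andP[_ hq1] := hq t.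
have E0 := expR_gt0 (Y t); have EK : expR (Y t) <= expR K by rewrite ler_expR.
have h1 : `|hh X Y t| <= expR K.
  rewrite /hh normrM (ger0_norm (ltW E0)) (le_trans _ EK)// ler_piMr ?(ltW E0)//; exact: norm_sin_le1.
have z1 : `|zz X Y t| <= expR K.
  rewrite /zz normrM (ger0_norm (ltW E0)) (le_trans _ EK)// ler_piMr ?(ltW E0)//; exact: norm_cos_le1.
have h2 : hh X Y t ^+ 2 <= expR K ^+ 2 by rewrite -[leLHS]real_normK ?num_real// lerXn2r ?nnegrE// ?expR_ge0.
have z2 : zz X Y t ^+ 2 <= expR K ^+ 2 by rewrite -[leLHS]real_normK ?num_real// lerXn2r ?nnegrE// ?expR_ge0.
rewrite /energy lerD//; first by have := sqr_ge0 (zz X Y t); lra.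
apply: ler_pM; [by rewrite divr_ge0// ltW|exact: pot_ge0|exact: hq1|].
rewrite /pot lerD ?ler_wpM2l ?mulr_ge0 ?invr_ge0 ?(ltW p0)//.
by apply: powR_le => //; exact: ltW.
Qed.

(** The energy does not decrease, is large at [t0] when the amplitude is, and would be at most HK if
    the amplitude at [t1] were below the level [K]. *)
Lemma annulus_big K : exists E, forall X Y, fs t0 t1 X Y -> E <= Y t0 -> K <= Y t1.
Proof.
have [c c0 Hc] := energy_large.
set HK := expR K ^+ 2 + q1 * (mu / 2 * expR K ^+ 2 + p^-1 * expR K `^ p).
have k0 : 0 < q0 / p by exact: divr_gt0.
exists ((HK + q0 / p) / c) => X Y S EY; rewrite leNgt; apply/negP => /ltW YK.
have := energy_le X YK; rewrite -/HK => h1.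
have tt : t0 <= t1 <= t1 by rewrite lexx (ltW t01).
have /andP[h2 _] := energy_bounds tt S.
have := Hc X Y t0; have : (HK + q0 / p) / c < expR (Y t0) ^+ 2.
  apply: (le_lt_trans EY); rewrite -expRM_natr.
  have := expR_ge1Dx (Y t0 * 2); have := expR_gt0 (Y t0 * 2).
  by have [] := leP 0 (Y t0); lra.
by rewrite ltr_pdivrMr// [_ * c]mulrC; lra.
Qed.

(** The angular speed times the squared amplitude is A z^2 + B (mu h^2 + |h|^p). For large |h| the
    superlinear term alone dominates a0 ka^2 h^2; for the other values of h the large energy forces
    |z| >= ka |h|, and the half of A z^2 not spent on a0 z^2 pays for it. *)
Lemma annulus_rot (J : nat) : exists E, forall X Y, fs t0 t1 X Y -> 0 <= X t0 -> E <= Y t0 ->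
  J%:R * pi < X t1 + pi.
Proof.
have [c c0 Hc] := energy_large.
pose a0 := A0 / 2; have a00 : 0 < a0 by rewrite divr_gt0.
have l0 : 0 < (t1 - t0) * a0 by rewrite mulr_gt0// subr_gt0.
(* The aspect ratio for which [rotation_count] yields [J] strips in the time t1 - t0. *)
pose ka := 1 + 2 * pi * J%:R / ((t1 - t0) * a0).
have pi0 := @pi_gt0 R.
have ka1 : 1 <= ka by rewrite lerDl divr_ge0 ?(ltW l0)// !mulr_ge0// ltW.
have p20 : 0 < p - 2 by have := p2; lra.
(* The height beyond which B0 |h|^(p-2) is at least a0 ka^2. *)
pose hk := (ka ^+ 2 * a0 / B0) `^ (p - 2)^-1.
have hk0 : 0 <= hk by exact: powR_ge0.
(* At energy [HK] or more, |h| <= hk leaves at least ka^2 hk^2 / 2 to the kinetic part z^2 / 2. *)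
pose HK := ka ^+ 2 * hk ^+ 2 / 2 + q1 * pot hk.
have k0 : 0 < q0 / p by exact: divr_gt0.
exists ((HK + q0 / p) / c) => X Y S X0 EY.
have Hbig t : t0 <= t <= t1 -> HK <= energy X Y t.
  move=> /[dup] tt /andP[_ h2]; have /andP[+ _] := energy_bounds tt (solves_le h2 S).
  apply: le_trans; apply: le_trans (Hc X Y t0).
  have : (HK + q0 / p) / c < expR (Y t0) ^+ 2.
    apply: (le_lt_trans EY); rewrite -expRM_natr.
    have := expR_ge1Dx (Y t0 * 2); have := expR_gt0 (Y t0 * 2).
    by have [] := leP 0 (Y t0); lra.
  by rewrite ltr_pdivrMr// [_ * c]mulrC; lra.
have [cX _ dXY] := S.
apply: (@rotation_count _ X (fun t => F1 p mu 1 A B (full p (Y t)) t (X t)) t0 t1 a0 ka J) => //.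
- by move=> t /dXY[].
- move=> t tt; have E0 := expR_gt0 (Y t).
  have E20 : 0 < expR (Y t) ^+ 2 by rewrite exprn_gt0.
  rewrite -(ler_pM2l E20).
  have -> : expR (Y t) ^+ 2 * F1 p mu 1 A B (full p (Y t)) t (X t) =
      A t * zz X Y t ^+ 2 + B t * (mu * hh X Y t ^+ 2 + `|hh X Y t| `^ p).
    by rewrite -(spowM (hh X Y t) p1) spow_hh /F1 /g1 /hh /zz; ring.
  have -> : expR (Y t) ^+ 2 * (a0 * (ka ^+ 2 * sin (X t) ^+ 2 + cos (X t) ^+ 2)) =
      a0 * (ka ^+ 2 * hh X Y t ^+ 2 + zz X Y t ^+ 2) by rewrite /hh /zz; ring.
  have tt' : t0 <= t <= t1 by have /andP[/ltW-> /ltW->] := tt.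
  have := Hbig t tt'; rewrite /energy; set h := hh X Y t; set z := zz X Y t => HH.
  have /andP[b1 _] := hB t; have /andP[a1 _] := hA t; have /andP[_ hq1] := hq t.
  have hp := powR_ge0 `|h| p.
  have m0 : 0 <= mu * h ^+ 2 by rewrite mulr_ge0 ?sqr_ge0.
  have Az : 2 * a0 * z ^+ 2 <= A t * z ^+ 2 by rewrite ler_wpM2r ?sqr_ge0// /a0; lra.
  have Bh : B0 * `|h| `^ p <= B t * (mu * h ^+ 2 + `|h| `^ p).
    by apply: ler_pM => //; [exact: ltW|lra].
  have [big|small] := leP (a0 * ka ^+ 2 * h ^+ 2) (B0 * `|h| `^ p).
    have := mulr_ge0 (ltW a00) (sqr_ge0 z); lra.
  have hn : h != 0 by apply/eqP => h0; move: small; rewrite h0 normr0 powR0 ?gt_eqF// expr0n/= !mulr0 ltxx.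
  have habs : 0 < `|h| by rewrite normr_gt0.
  have hhk : `|h| <= hk.
    have e2 : `|h| `^ p = `|h| `^ (p - 2) * h ^+ 2.
      rewrite -[h ^+ 2]real_normK ?num_real// -powR_mulrn// -powRD ?subrK//.
      by rewrite gt_eqF// implybT.
    move: small; rewrite e2 mulrA ltr_pM2r ?exprn_even_gt0// => small.
    have E : (`|h| `^ (p - 2)) `^ (p - 2)^-1 = `|h|.
      by rewrite -powRrM mulfV ?gt_eqF// powRr1// ltW.
    rewrite /hk -[leLHS]E.
    apply: powR_le; rewrite ?invr_ge0 ?powR_ge0 ?(ltW p20)//.
    by rewrite ler_pdivlMr// mulrC ltW// [ka ^+ 2 * a0]mulrC.
  have h2 : h ^+ 2 <= hk ^+ 2 by rewrite -[leLHS]real_normK ?num_real// lerXn2r ?nnegrE.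
  have ph : pot h <= pot hk.
    rewrite /pot lerD ?ler_wpM2l ?mulr_ge0 ?invr_ge0 ?(ltW p0)//.
    by rewrite (ger0_norm hk0); apply: powR_le => //; exact: ltW.
  have qp : q t * pot h <= q1 * pot hk.
    by apply: ler_pM => //; [rewrite divr_ge0// ltW|exact: pot_ge0].
  have zb : ka ^+ 2 * h ^+ 2 <= z ^+ 2.
    have := ler_wpM2l (sqr_ge0 ka) h2; move: HH; rewrite /HK; lra.
  have := ler_wpM2l (ltW a00) zb.
  have : 0 <= B t * (mu * h ^+ 2 + `|h| `^ p) by rewrite mulr_ge0 ?addr_ge0// ltW.
  lra.
- rewrite mulrA; have -> : (t1 - t0) * a0 * ka = (t1 - t0) * a0 + 2 * pi * J%:R.
      by rewrite /ka; move: (_ * a0) l0 => l l0; field; rewrite gt_eqF.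
  lra.
Qed.

Lemma annulus_mono X Y : fs t0 t1 X Y -> X t0 <= X t1.
Proof.
move=> [cX _ dXY].
apply: (@derive_ge0_le _ X (fun t => F1 p mu 1 A B (full p (Y t)) t (X t))); [exact: ltW|exact: continuous_subspaceT| |].
  by move=> t /dXY[].
move=> t _; rewrite /F1 /g1 -[A t * _ * _]mulrA addr_ge0//.
  by rewrite mulr_ge0 ?(ltW (At t))// -expr2 sqr_ge0.
rewrite -mulrA mulr_ge0 ?(ltW (Bt t))// mulrDl addr_ge0//.
  by rewrite -mulrA mulr_ge0// -expr2 sqr_ge0.
by rewrite -mulrA spowM// mul1r mulr_ge0 ?expR_ge0 ?powR_ge0.
Qed.

End annulus.

(** * Crossing a gap *)

(** If f(b) < 0, then after the last time where f >= 0 the function f(t) exp(- C t) is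
    nondecreasing, so it cannot become negative. *)
Lemma barrier_ge0 (R : realType) (f f' : R -> R) (a b C : R) : a <= b -> continuous f ->
  (forall t, a < t < b -> is_derive t 1 f (f' t)) ->
  (forall t, a < t < b -> f t <= 0 -> C * f t <= f' t) -> 0 <= f a -> 0 <= f b.
Proof.
move=> ab cf df Hf fa; rewrite leNgt; apply/negP => fb.
pose S := [set t | a <= t <= b /\ 0 <= f t].
have Sa : S a by rewrite /S/= lexx ab.
have hs : has_sup S by split; [exists a|exists b => t [/andP[_]]].
have a_tau : a <= sup S by exact: (sup_upper_bound hs).
have tau_b : sup S <= b by apply: ge_sup; [exists a|move=> t [/andP[_]]].
have ftau : 0 <= f (sup S).
  rewrite leNgt; apply/negP => ft.
  have /cvgrPdist_lt/(_ (- f (sup S))) := cf (sup S); rewrite oppr_gt0 => /(_ ft)/nbhs_ballP[d /= d0 Hd].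
  have [t St ht] := sup_adherent d0 hs; have [_ f0] := St.
  have tS : t <= sup S := sup_upper_bound hs St.
  have := Hd t; rewrite /ball/= ger0_norm ?subr_ge0// => /(_ _); rewrite ltr_norml.
  have h : sup S - t < d by lra.
  by move=> /(_ h)/andP[]; lra.
have neg t : sup S < t <= b -> f t < 0.
  move=> /andP[h1 h2]; rewrite ltNge; apply/negP => f0.
  have : S t by split=> //; rewrite h2 (le_trans a_tau (ltW h1)).
  by move/(sup_upper_bound hs); lra.
pose w t := expR (- C * t).
have dw (t : R) : is_derive t 1 w (w t * (- C * 1)).
  exact: (@dcomp _ t (fun t => - C * t) (@expR R) _ _ (is_derive_expR (- C * t)) (dZ (- C) (did t))).
have : f (sup S) * w (sup S) <= f b * w b.
  apply: (@derive_ge0_le _ (fun t => f t * w t) (fun t => f' t * w t + f t * (w t * (- C * 1)))) => //.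
  - by apply: continuous_subspaceT => t; apply: cvgM; [exact: cf|exact: is_derive_continuous (dw t)].
  - move=> t /andP[h1 h2]; have tt : a < t < b by rewrite (le_lt_trans a_tau).
    exact: dM (df t tt) (dw t).
  - move=> t /andP[h1 h2]; have tt : a < t < b by rewrite (le_lt_trans a_tau).
    have -> : f' t * w t + f t * (w t * (- C * 1)) = (f' t - C * f t) * w t by ring.
    rewrite mulr_ge0 ?expR_ge0// subr_ge0; apply: Hf => //; apply: ltW; apply: neg.
    by rewrite h1 ltW.
have w0 t : 0 < w t by exact: expR_gt0.
have := mulr_ge0 ftau (ltW (w0 (sup S))).
have : f b * w b < 0 by rewrite pmulr_llt0.
lra.
Qed.

Section gap.
Context (R : realType).
Variables (p : R) (A B : R -> R) (A0 A1 B0 B1 t0 t1 : R).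
Hypotheses (p2 : 2 < p).
Hypotheses (A00 : 0 < A0) (B00 : 0 < B0).
Hypotheses (hA : forall t, A0 <= A t <= A1) (hB : forall t, B0 <= B t <= B1).
Hypotheses (t01 : t0 < t1).

Local Notation fs := (fsol p 0 (-1) A B).

Let p0 : 0 < p. Proof. exact: lt_trans p2. Qed.
Let p1 : 1 < p. Proof. by rewrite (lt_trans _ p2)// ltr1n. Qed.
Let A10 : 0 < A1. Proof. by have /andP[h1 h2] := hA 0; rewrite (lt_le_trans A00)// (le_trans h1). Qed.
Let B10 : 0 < B1. Proof. by have /andP[h1 h2] := hB 0; rewrite (lt_le_trans B00)// (le_trans h1). Qed.
Let At t : 0 < A t. Proof. by have /andP[h1 _] := hA t; exact: lt_le_trans h1. Qed.
Let Bt t : 0 < B t. Proof. by have /andP[h1 _] := hB t; exact: lt_le_trans h1. Qed.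

(** In a gap the term that turns the angle back is bounded by a constant times |sin X|^p, which is
    at most -X when X <= 0: zero is a barrier for the angle. *)
Lemma gap_theta X Y : fs t0 t1 X Y -> 0 <= X t0 -> 0 <= X t1.
Proof.
move=> S; have [M HM] := fsol_bounded S; have [cX _ dXY] := S.
apply: (@barrier_ge0 _ X (fun t => F1 p 0 (-1) A B (full p (Y t)) t (X t)) t0 t1 (B1 * full p M)) => //.
- exact: ltW.
- by move=> t /dXY[].
move=> t tt Xt; have tt' : t0 <= t <= t1 by have /andP[/ltW-> /ltW->] := tt.
have eM : full p (Y t) <= full p M.
  by rewrite ler_expR ler_wpM2l ?HM// subr_ge0 ltW.
have e0 : 0 <= full p (Y t) by exact: expR_ge0.
rewrite /F1 /g1 mul0r add0r mulN1r -[A t * _ * _]mulrA.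
have -> : B t * (- full p (Y t) * spow p (sin (X t))) * sin (X t) =
    - (B t * full p (Y t) * (spow p (sin (X t)) * sin (X t))) by ring.
rewrite spowM//.
have s1 : `|sin (X t)| `^ p <= - X t.
  have h1 : `|sin (X t)| <= - X t.
    by have := sin_lip (X t) 0; rewrite sin0 !subr0 (ler0_norm Xt).
  apply: le_trans h1; have [->|sn] := eqVneq (sin (X t)) 0; first by rewrite normr0 powR0// gt_eqF.
  rewrite -[leRHS]powRr1//; apply: ger_powR; last exact: ltW.
  by rewrite normr_gt0 sn norm_sin_le1.
have c0 : 0 <= A t * (cos (X t) * cos (X t)) by rewrite mulr_ge0 ?(ltW (At t))// -expr2 sqr_ge0.
have /andP[_ b1] := hB t.
have := ler_pM (ltW (Bt t)) e0 b1 eM => k1.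
have := ler_pM (mulr_ge0 (ltW (Bt t)) e0) (powR_ge0 _ _) k1 s1.
by lra.
Qed.

Let hz (X Y : R -> R) (t : R) : R := hh X Y t * zz X Y t.

(** With eps = -1 the derivative of h z is A z^2 + B |h|^p. The product h z has the sign of the
    growth of the amplitude. *)
Let hz_mono X Y a b : fs t0 t1 X Y -> t0 <= a -> a <= b -> b <= t1 -> hz X Y a <= hz X Y b.
Proof.
move=> S ta ab bt; apply: (@derive_ge0_le _ (hz X Y)
    (fun t => (A t * zz X Y t) * zz X Y t + hh X Y t * (- (B t * (0 * hh X Y t + (-1) * spow p (hh X Y t)))))) => //.
- by apply: continuous_subspaceT => t; apply: cvgM; [exact: (hh_continuous S)|exact: (zz_continuous S)].
- move=> t /andP[h1 h2]; have tt : t0 < t < t1 by rewrite (le_lt_trans ta h1) (lt_le_trans h2 bt).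
  exact: dM (hh_derive S tt) (zz_derive S tt).
- move=> t _; rewrite (_ : _ + _ = A t * zz X Y t ^+ 2 + B t * (spow p (hh X Y t) * hh X Y t)); last by ring.
  rewrite spowM//; apply: addr_ge0; apply: mulr_ge0; rewrite ?sqr_ge0 ?powR_ge0//; exact: ltW.
Qed.

(** Y' has the sign of h z, which is nondecreasing: the log-amplitude first decreases, then
    increases, and is maximal at an end of the gap. *)
Lemma gap_eta X Y t : fs t0 t1 X Y -> t0 <= t <= t1 -> Y t <= Num.max (Y t0) (Y t1).
Proof.
move=> S /andP[ht0 ht1]; have [cX cY dXY] := S.
pose f s := F2 p 0 (-1) A B (full p (Y s)) s (X s).
have fE s : expR (Y s) ^+ 2 * f s = (A s + B s * (full p (Y s) * `|sin (X s)| `^ (p - 2))) * hz X Y s.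
  by rewrite /f /F2 /g1 /hz /hh /zz /spow; ring.
have c0 s : 0 <= A s + B s * (full p (Y s) * `|sin (X s)| `^ (p - 2)).
  by rewrite addr_ge0 ?(ltW (At s))// mulr_ge0 ?(ltW (Bt s))// mulr_ge0 ?powR_ge0 ?expR_ge0.
have E0 s : 0 < expR (Y s) ^+ 2 by rewrite exprn_gt0 ?expR_gt0.
have cYs a b : {within `[a, b], continuous Y} by exact: continuous_subspaceT.
rewrite le_max; have [P0|/ltW P0] := leP (hz X Y t) 0; apply/orP; [left|right].
  apply: (@derive_le0_ge _ Y f) => // s /andP[h1 h2].
    by have /dXY[] : t0 < s < t1 by rewrite h1 (lt_le_trans h2).
  rewrite -(pmulr_rle0 _ (E0 s)) fE mulr_ge0_le0//.
  by rewrite (le_trans _ P0)// hz_mono// ltW.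
apply: (@derive_ge0_le _ Y f) => // s /andP[h1 h2].
  by have /dXY[] : t0 < s < t1 by rewrite h2 andbT (le_lt_trans ht0).
rewrite -(pmulr_rge0 _ (E0 s)) fE mulr_ge0//.
by rewrite (le_trans P0)// hz_mono// ltW.
Qed.

(** Starting from h = 0 and a large z > 0, z stays above its initial value and h becomes large in
    the first half of the gap. Then z^2 >= k h^p gives h' >= A0 sqrt(k) h^(p/2) with p/2 > 1, which
    cannot last through the second half. *)
Lemma gap_blowup : exists E, forall X Y, fs t0 t1 X Y -> sin (X t0) = 0 -> cos (X t0) = 1 ->
  Y t0 < E.
Proof.
(* A lower bound for the ratio of (z^2)' = 2 B z h^(p-1) to (h^p)' = p A z h^(p-1), hence for that
   of z^2 to h^p. *)
pose k := 2 * B0 / (p * A1); have k0 : 0 < k by rewrite divr_gt0// mulr_gt0.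
pose r := p / 2 - 1; have r0 : 0 < r by have := p2; rewrite /r; lra.
pose tau := t1 - t0; have tau0 : 0 < tau by rewrite subr_gt0.
pose del := r * A0 * Num.sqrt k * (tau / 2).
have del0 : 0 < del by rewrite !mulr_gt0 ?sqrtr_gt0// divr_gt0.
(* Since e^Y > Y, this start makes h at the middle of the gap at least A0 e^Y tau / 2 >=
   del^(-1/r). *)
exists (2 * del `^ (- r^-1) / (A0 * tau)) => X Y S sX cX; rewrite ltNge; apply/negP => EY.
have ch := hh_continuous S; have cz := zz_continuous S.
pose ze := expR (Y t0); have ze0 : 0 < ze by exact: expR_gt0.
have h0 : hh X Y t0 = 0 by rewrite /hh sX mulr0.
have z0 : zz X Y t0 = ze by rewrite /zz cX mulr1.
have P0 t : t0 <= t <= t1 -> 0 <= hz X Y t.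
  by move=> /andP[h1 h2]; have := hz_mono S (lexx _) h1 h2; rewrite /hz h0 mul0r.
have spow_hz t : zz X Y t * spow p (hh X Y t) = `|hh X Y t| `^ (p - 2) * hz X Y t.
  by rewrite /spow /hz; ring.
have dz2 t : t0 < t < t1 -> is_derive t 1 (fun t => zz X Y t ^+ 2)
    (2%:R * zz X Y t ^+ 1 * - (B t * (0 * hh X Y t + (-1) * spow p (hh X Y t)))).
  by move=> tt; exact: dX 2 (zz_derive S tt).
have cz2 : continuous (fun t => zz X Y t ^+ 2).
  rewrite (_ : (fun t => _) = (fun t => zz X Y t * zz X Y t)); last by apply/funext => t; rewrite expr2.
  by move=> t; apply: cvgM; exact: cz.
have dz2E t : 2%:R * zz X Y t ^+ 1 * - (B t * (0 * hh X Y t + (-1) * spow p (hh X Y t))) =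
    2 * (B t * (`|hh X Y t| `^ (p - 2) * hz X Y t)).
  by rewrite -spow_hz; ring.
have inn t u : u <= t1 -> t0 < t < u -> t0 < t < t1.
  by move=> ut /andP[-> h]; rewrite (lt_le_trans h).
have z2 t : t0 <= t <= t1 -> ze ^+ 2 <= zz X Y t ^+ 2.
  move=> /andP[h1 h2]; rewrite -z0.
  apply: (@derive_ge0_le _ (fun t => zz X Y t ^+ 2) _ _ _ h1 (continuous_subspaceT cz2) (fun s hs => dz2 s (inn _ _ h2 hs))).
  move=> s hs; rewrite dz2E mulr_ge0// mulr_ge0 ?(ltW (Bt s))// mulr_ge0 ?powR_ge0// P0//.
  by have /andP[/ltW-> /ltW->] := inn _ _ h2 hs.
have zpos t : t0 <= t <= t1 -> 0 < zz X Y t.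
  move=> /[dup] tt /andP[h1 h2]; rewrite ltNge; apply/negP => zn.
  have [c ct zc] : exists2 c, c \in `[t0, t] & zz X Y c = 0.
    apply: IVT => //; first exact: continuous_subspaceT.
    by rewrite ge_min le_max zn z0 (ltW ze0) orbT.
  move: ct; rewrite in_itv/= => /andP[c1 c2].
  have := z2 c; rewrite c1 (le_trans c2 h2) zc expr0n/= => /(_ isT).
  by rewrite leNgt exprn_gt0.
have zge t : t0 <= t <= t1 -> ze <= zz X Y t.
  move=> tt; rewrite -(@ler_pXn2r _ 2) ?nnegrE ?(ltW ze0) ?(ltW (zpos t tt))//; exact: z2.
have hge t : t0 <= t <= t1 -> A0 * ze * (t - t0) <= hh X Y t.
  move=> /andP[h1 h2].
  pose G s := hh X Y s - A0 * ze * (s - t0).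
  suff : G t0 <= G t by rewrite /G h0 subrr mulr0; lra.
  apply: (@derive_ge0_le _ G (fun s => A s * zz X Y s - A0 * ze * (1 - 0))) => //.
  - apply: continuous_subspaceT => s; apply: cvgB; first exact: ch.
    by apply: cvgM; [exact: cvg_cst|apply: cvgB; [exact: cvg_id|exact: cvg_cst]].
  - by move=> s hs; exact: (dB (hh_derive S (inn _ _ h2 hs)) (dZ _ (dB (did s) (dcst s t0)))).
  - move=> s hs; rewrite subr0 mulr1 subr_ge0; have /andP[a1 _] := hA s.
    by apply: ler_pM => //; [exact: ltW|exact: ltW|apply: zge; have /andP[/ltW-> /ltW->] := inn _ _ h2 hs].
have h_ge0 t : t0 <= t <= t1 -> 0 <= hh X Y t.
  move=> /[dup] tt /andP[h1 h2]; apply: le_trans (hge t tt).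
  by rewrite mulr_ge0 ?subr_ge0// ltW// mulr_gt0.
have zk t : t0 <= t <= t1 -> k * `|hh X Y t| `^ p <= zz X Y t ^+ 2.
  move=> /andP[h1 h2].
  pose G s := zz X Y s ^+ 2 - k * `|hh X Y s| `^ p.
  suff : G t0 <= G t.
    by rewrite /G h0 normr0 powR0 ?gt_eqF// mulr0 subr0; have := sqr_ge0 (zz X Y t0); lra.
  apply: (@derive_ge0_le _ G (fun t => 2%:R * zz X Y t ^+ 1 * - (B t * (0 * hh X Y t + (-1) * spow p (hh X Y t)))
      - k * (p * spow p (hh X Y t) * (A t * zz X Y t)))) => //.
  - apply: continuous_subspaceT => s; apply: cvgB; first exact: cz2.
    apply: cvgM; first exact: cvg_cst.
    apply: (@continuous_comp _ _ _ (hh X Y) (fun x => `|x| `^ p)); first exact: ch.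
    exact: powR_abs_continuous.
  - move=> s hs; have hs' := inn _ _ h2 hs.
    exact: (dB (dz2 s hs') (dZ k (dcomp (is_derive_powR_abs (hh X Y s) (ltW p2)) (hh_derive S hs')))).
  - move=> s hs; have hs' := inn _ _ h2 hs.
    have ss : t0 <= s <= t1 by have /andP[/ltW-> /ltW->] := hs'.
    rewrite dz2E -spow_hz.
    have -> : 2 * (B s * (zz X Y s * spow p (hh X Y s))) - k * (p * spow p (hh X Y s) * (A s * zz X Y s)) =
       (2 * B s - k * p * A s) * (spow p (hh X Y s) * zz X Y s) by ring.
    apply: mulr_ge0.
      have /andP[b1 _] := hB s; have /andP[_ a1] := hA s.
      rewrite subr_ge0 (@le_trans _ _ (2 * B0))//; last by rewrite ler_pM2l.
      have -> : k * p * A s = 2 * B0 * (A s / A1) by rewrite /k; field; rewrite !gt_eqF.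
      by rewrite ler_piMr ?mulr_ge0 ?(ltW B00)// ler_pdivrMr// mul1r.
    by rewrite mulr_ge0 ?(ltW (zpos s ss))// /spow mulr_ge0 ?powR_ge0// h_ge0.
pose tm := t0 + tau / 2.
have tm0 : t0 < tm by rewrite /tm ltrDl divr_gt0.
have tm1 : tm < t1 by rewrite /tm /tau; have := t01; lra.
have hm t : tm <= t <= t1 -> A0 * ze * (tau / 2) <= hh X Y t.
  move=> /andP[h1 h2]; apply: le_trans (hge t _); last by rewrite h2 (le_trans (ltW tm0)).
  by rewrite ler_pM2l ?mulr_gt0//; rewrite /tm in h1; lra.
have hpos t : tm <= t <= t1 -> 0 < hh X Y t.
  by move=> /hm; apply: lt_le_trans; rewrite !mulr_gt0// divr_gt0.
(* The positive quantity h^(-r) loses at least r A0 sqrt(k) per unit of time. Over the second half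
   of the gap the loss is [del], at least as much as it has at [tm]. *)
pose G t := hh X Y t `^ (- r) + r * A0 * Num.sqrt k * t.
have : G t1 <= G tm.
  apply: (@derive_le0_ge _ G (fun t => - r * hh X Y t `^ (- r - 1) * (A t * zz X Y t) + r * A0 * Num.sqrt k * 1)); first exact: ltW.
  - apply: continuous_in_subspaceT => t; rewrite inE/= in_itv/= => tt.
    apply: cvgD; last by apply: cvgM; [exact: cvg_cst|exact: cvg_id].
    apply: (@continuous_comp _ _ _ (hh X Y) (fun x => x `^ (- r))); first exact: ch.
    exact: is_derive_continuous (is_derive1_powR (- r) (hpos t tt)).
  - move=> t /andP[h1 h2]; have tt : tm <= t <= t1 by rewrite !ltW.
    have hs' : t0 < t < t1 by rewrite h2 (lt_trans tm0).
    exact: (dD (@dcomp _ t (hh X Y) (fun x => x `^ (- r)) _ _ (is_derive1_powR (- r) (hpos t tt)) (hh_derive S hs')) (dZ _ (did t))).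
  - move=> t /andP[h1 h2]; have tt : tm <= t <= t1 by rewrite !ltW.
    have ss : t0 <= t <= t1 by rewrite !ltW// (lt_trans tm0).
    have hp := hpos t tt.
    have zs : Num.sqrt k * hh X Y t `^ (p / 2) <= zz X Y t.
      have a0 := mulr_ge0 (sqrtr_ge0 k) (powR_ge0 (hh X Y t) (p / 2)).
      have b0 := ltW (zpos t ss).
      rewrite -(@ler_pXn2r _ 2)//.
      rewrite exprMn sqr_sqrtr ?(ltW k0)// -powR_mulrn ?powR_ge0// -powRrM divfK//.
      by have := zk t ss; rewrite (ger0_norm (ltW hp)).
    have pw : hh X Y t `^ (- r - 1) * hh X Y t `^ (p / 2) = 1.
      rewrite -powRD ?(gt_eqF hp) ?implybT// (_ : _ + _ = 0) ?powRr0// /r; lra.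
    have /andP[a1 _] := hA t.
    have q0 : 0 <= hh X Y t `^ (- r - 1) by exact: powR_ge0.
    have : A0 * (Num.sqrt k * hh X Y t `^ (p / 2)) <= A t * zz X Y t.
      exact: ler_pM (ltW A00) (mulr_ge0 (sqrtr_ge0 _) (powR_ge0 _ _)) a1 zs.
    move=> /(ler_wpM2l q0)/(ler_wpM2l (ltW r0)).
    have -> : r * (hh X Y t `^ (- r - 1) * (A0 * (Num.sqrt k * hh X Y t `^ (p / 2)))) =
      r * A0 * Num.sqrt k * (hh X Y t `^ (- r - 1) * hh X Y t `^ (p / 2)) by ring.
    rewrite pw; lra.
rewrite /G => H.
have Gt1 : 0 < hh X Y t1 `^ (- r) by apply: powR_gt0; apply: hpos; rewrite lexx ltW.
have : del < hh X Y tm `^ (- r).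
  have -> : del = r * A0 * Num.sqrt k * t1 - r * A0 * Num.sqrt k * tm by rewrite /del /tm /tau; field.
  lra.
have tmm : tm <= tm <= t1 by rewrite lexx ltW.
have hmp := hpos tm tmm.
move=> d1.
have : hh X Y tm < del `^ (- r^-1).
  have ri : 0 < r^-1 by rewrite invr_gt0.
  have := powR_lt ri (ltW del0) d1; rewrite -powRrM mulNr mulfV ?gt_eqF// powR_inv1 ?(ltW hmp)//.
  by rewrite powRN -[X in _ -> X < _]invrK ltf_pV2 ?posrE ?invr_gt0 ?powR_gt0.
apply/negP; rewrite -leNgt; apply: le_trans (hm tm tmm).
have EZ : 2 * del `^ (- r^-1) / (A0 * tau) <= ze.
  by apply: (le_trans EY); have := expR_ge1Dx (Y t0); rewrite /ze; lra.
move: EZ; rewrite ler_pdivrMr ?mulr_gt0//; lra.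
Qed.

End gap.

(** * Shooting *)

Lemma near_lt (R : realType) (t b : R) : t < b -> \forall s \near t, s < b.
Proof.
move=> tb; apply/nbhs_ballP; exists (b - t) => /=; first by rewrite subr_gt0.
by move=> s; rewrite /ball/= ltr_norml => /andP[]; lra.
Qed.

Section shoot.
Context (R : realType).
Implicit Types (sg s d K : R) (th et : R -> R).

(* th and et are the angle and the log-amplitude, at a given time, as functions
   of the shooting parameter s. *)
Definition family sg th et : Prop :=
  [/\ forall s, 0 < s < sg -> {for s, continuous th} /\ {for s, continuous et},
      forall s, 0 < s < sg -> 0 <= th s,
      forall K, exists2 d, 0 < d & forall s, 0 < s < sg -> s < d -> et s <= K &
      forall K, exists2 d, d < sg & forall s, 0 < s < sg -> d < s -> K <= et s].

Definition turning sg th : Prop :=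
  forall J : nat, exists2 d, d < sg & forall s, 0 < s < sg -> d < s -> J%:R * pi <= th s.

Section step.
Variables (p mu eps : R) (A B : R -> R) (A0 A1 B0 B1 t0 t1 : R).
Hypotheses (p2 : 2 < p) (mu0 : 0 <= mu) (eps1 : `|eps| <= 1).
Hypotheses (cA : continuous A) (cB : continuous B).
Hypotheses (A00 : 0 < A0) (B00 : 0 < B0).
Hypotheses (hA : forall t, A0 <= A t <= A1) (hB : forall t, B0 <= B t <= B1).
Hypothesis t01 : t0 < t1.

Local Notation fs := (fsol p mu eps A B).

Definition linked (x0 y0 x1 y1 : R) : Prop :=
  exists X Y, [/\ fs t0 t1 X Y, X t0 = x0, Y t0 = y0, X t1 = x1 & Y t1 = y1].

Lemma linked_fun X Y x0 y0 x1 y1 : linked x0 y0 x1 y1 -> fs t0 t1 X Y -> X t0 = x0 -> Y t0 = y0 ->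
  X t1 = x1 /\ Y t1 = y1.
Proof.
move=> [X' [Y' [S' X'0 Y'0 <- <-]]] S X0 Y0.
have tt : t0 <= t1 <= t1 by rewrite lexx ltW.
have [] // := fsol_unique p2 cA cB A00 B00 hA hB S S' _ _ tt.
- by rewrite X0.
- by rewrite Y0.
Qed.

Variables (sg : R) (th et th' et' : R -> R).
Hypothesis links : forall s, 0 < s < sg -> linked (th s) (et s) (th' s) (et' s).

Lemma linked_continuous s : 0 < s < sg -> {for s, continuous th} -> {for s, continuous et} ->
  {for s, continuous th'} /\ {for s, continuous et'}.
Proof.
move=> sI cth cet; have [X [Y [S X0 Y0 X1 Y1]]] := links sI.
have tt : t0 <= t1 <= t1 by rewrite lexx ltW.
suff key e : 0 < e -> \forall r \near s, `|th' s - th' r| < e /\ `|et' s - et' r| < e.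
  by split; apply/cvgrPdist_lt => e /key; apply: filterS => r [].
move=> e0; have [d d0 Hd] := fsol_open p2 cA cB A00 B00 hA hB (ltW t01) S e0.
move/cvgrPdist_lt: cth => /(_ d d0) h1; move/cvgrPdist_lt: cet => /(_ d d0) h2.
have /andP[s0 s1] := sI.
near=> r.
have rI : 0 < r < sg.
  by apply/andP; split; near: r; [exact: near_gt|exact: near_lt].
have r1 : `|th r - X t0| < d by rewrite X0 distrC; near: r.
have r2 : `|et r - Y t0| < d by rewrite Y0 distrC; near: r.
have [X' [Y' [S' X'0 Y'0 /(_ _ tt)]]] := Hd _ _ r1 r2.
by have [-> ->] := linked_fun (links rI) S' X'0 Y'0; rewrite X1 Y1 distrC [`|et' r - _|]distrC.
Unshelve. all: by end_near. Qed.

Lemma linked_small : (forall K, exists2 d, 0 < d & forall s, 0 < s < sg -> s < d -> et s <= K) ->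
  forall K, exists2 d, 0 < d & forall s, 0 < s < sg -> s < d -> et' s <= K.
Proof.
move=> H K; pose C := (A1 + B1 * (mu + 1)) * (t1 - t0).
have [d d0 Hd] := H (Num.min (- C) (K - C)); exists d => // s sI sd.
have := Hd s sI sd; rewrite le_min => /andP[h1 h2].
have hC : et s + C <= 0 by lra.
have [X [Y [S X0 Y0 Y1]]] := fsol_small p2 mu0 eps1 cA cB A00 B00 hA hB (th s) (ltW t01) hC.
have [_ <-] := linked_fun (links sI) S X0 Y0.
by rewrite (le_trans Y1)// -/C; lra.
Qed.

End step.

Section annulus_step.
Variables (p mu : R) (A B D : R -> R) (A0 A1 B0 B1 kap t0 t1 : R).
Hypotheses (p2 : 2 < p) (mu0 : 0 <= mu).
Hypotheses (cA : continuous A) (cB : continuous B).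
Hypotheses (A00 : 0 < A0) (B00 : 0 < B0).
Hypotheses (hA : forall t, A0 <= A t <= A1) (hB : forall t, B0 <= B t <= B1).
Hypotheses (t01 : t0 < t1) (dq : forall t, t0 < t < t1 -> is_derive t 1 (fun s => B s / A s) (D t)).
Hypothesis hD : forall t, t0 < t < t1 -> 0 <= D t <= kap * (B t / A t).

Lemma annulus_step sg th et : family sg th et -> exists th' et',
  (forall s, 0 < s < sg -> linked p mu 1 A B t0 t1 (th s) (et s) (th' s) (et' s)) /\
  family sg th' et' /\ turning sg th'.
Proof.
move=> [cF th0 F0 F1_].
have e1 : `|1 : R| <= 1 by rewrite normr1.
have /choice[z Hz] s : exists z : R * R, linked p mu 1 A B t0 t1 (th s) (et s) z.1 z.2.
  have [X [Y [S X0 Y0]]] := annulus_exists p2 mu0 cA cB A00 B00 hA hB t01 dq hD (th s) (et s).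
  by exists (X t1, Y t1), X, Y.
exists (fst \o z), (snd \o z).
have L s : 0 < s < sg -> linked p mu 1 A B t0 t1 (th s) (et s) ((fst \o z) s) ((snd \o z) s).
  by move=> _; exact: Hz.
split; first exact: L.
split.
- split.
  + by move=> s sI; have [c1 c2] := cF s sI; exact: (linked_continuous p2 cA cB A00 B00 hA hB t01 L sI c1 c2).
  + move=> s sI; have [X [Y [S X0 Y0 <- _]]] := L s sI.
    apply: le_trans (annulus_mono p2 mu0 A00 B00 hA hB t01 S); rewrite X0; exact: th0.
  + exact: (linked_small p2 mu0 e1 cA cB A00 B00 hA hB t01 L F0).
  + move=> K; have [E HE] := annulus_big p2 mu0 cA cB A00 B00 hA hB t01 dq hD K.
    have [d d0 Hd] := F1_ E; exists d => // s sI sd; have [X [Y [S X0 Y0 _ <-]]] := L s sI.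
    by apply: HE S _; rewrite Y0; exact: Hd.
move=> J; have [E HE] := annulus_rot p2 mu0 cA cB A00 B00 hA hB t01 dq hD J.+1.
have [d d0 Hd] := F1_ E; exists d => // s sI sd; have [X [Y [S X0 Y0 <- _]]] := L s sI.
have : J.+1%:R * pi < X t1 + pi.
  by apply: HE S _ _; [rewrite X0; exact: th0|rewrite Y0; exact: Hd].
by rewrite -natr1; lra.
Qed.

End annulus_step.

Section gap_step.
Variables (p : R) (A B : R -> R) (A0 A1 B0 B1 t0 t1 : R).
Hypotheses (p2 : 2 < p).
Hypotheses (cA : continuous A) (cB : continuous B).
Hypotheses (A00 : 0 < A0) (B00 : 0 < B0).
Hypotheses (hA : forall t, A0 <= A t <= A1) (hB : forall t, B0 <= B t <= B1).
Hypothesis t01 : t0 < t1.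

Local Notation fs := (fsol p 0 (-1) A B).

Lemma sin_2pi (j : nat) : sin (j.*2%:R * pi : R) = 0 /\ cos (j.*2%:R * pi : R) = 1.
Proof.
elim: j => [|j [IHs IHc]]; first by rewrite double0 mul0r sin0 cos0.
have E : j.+1.*2%:R * pi = j.*2%:R * pi + pi + pi :> R.
  by rewrite doubleS -[j.*2.+2]addn2 natrD; ring.
by rewrite E !sinDpi !cosDpi !opprK IHs IHc.
Qed.

(** The new upper end sg' is the supremum of the parameters up to which all solutions cross the gap.
    The solution at sg' does not cross, and this non-survival forces the amplitude at the end of the
    gap to diverge as s tends to sg'. *)
Lemma gap_step sg th et : 0 < sg -> family sg th et -> turning sg th -> exists sg' th' et',
  [/\ 0 < sg' <= sg,
   forall s, 0 < s < sg' -> linked p 0 (-1) A B t0 t1 (th s) (et s) (th' s) (et' s) &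
   family sg' th' et'].
Proof.
move=> sg0 [cF th0 F0 F1_] Tn.
have e1 : `|-1 : R| <= 1 by rewrite normrN normr1.
pose surv s := exists X Y, [/\ fs t0 t1 X Y, X t0 = th s & Y t0 = et s].
pose S := [set s | 0 < s < sg /\ forall r, 0 < r <= s -> surv r].
(* The intermediate value theorem is used beyond the parameter [d] where amplitudes exceed the
   explosion threshold: from there on the angle still climbs from th(sa) to arbitrarily high values,
   so it takes some value 2 j pi. *)
have [ss ssI ssN] : exists2 s, 0 < s < sg & ~ surv s.
  have [E HE] := gap_blowup p2 A00 B00 hA hB t01.
  have [d d0 Hd] := F1_ E.
  pose a := Num.max d (sg / 2); have a0 : 0 < a by rewrite lt_max divr_gt0// orbT.
  have asg : a < sg by rewrite gt_max d0; lra.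
  pose sa := (a + sg) / 2; have saI : 0 < sa < sg by rewrite /sa; apply/andP; split; lra.
  have ada : a < sa by rewrite /sa; lra.
  have da : d <= a by rewrite le_max lexx.
  have pi0 := @pi_gt0 R.
  have [j /= hj] : exists j : nat, th sa / pi < j%:R.
    by exists (Num.bound (th sa / pi)); rewrite archi_boundP// divr_ge0 ?th0// ltW.
  have {}hj : th sa <= j.*2%:R * pi.
    rewrite -ler_pdivrMr// (le_trans (ltW hj))// ler_nat -addnn; exact: leq_addr.
  have [d' d'sg Hd'] := Tn j.*2.
  pose sb := Num.max sa ((Num.max d' sa + sg) / 2).
  have m1 : Num.max d' sa < sg by rewrite gt_max d'sg; have /andP[] := saI.
  have sbE : sb = (Num.max d' sa + sg) / 2.
    rewrite /sb max_r//; have : sa <= Num.max d' sa by rewrite le_max lexx orbT.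
    lra.
  have sab : sa <= sb by rewrite /sb le_max lexx.
  have sbI : 0 < sb < sg by rewrite (lt_le_trans _ sab) ?sbE/=; [lra|case/andP: saI].
  have hb : j.*2%:R * pi <= th sb.
    apply: Hd' => //; rewrite sbE; have : d' <= Num.max d' sa by rewrite le_max lexx.
    lra.
  have [c cI thc] : exists2 c, c \in `[sa, sb] & th c = j.*2%:R * pi.
    apply: IVT => //.
      apply: continuous_in_subspaceT => s; rewrite inE/= in_itv/= => /andP[s1 s2].
      have sI : 0 < s < sg.
        by have /andP[h1 _] := saI; have /andP[_ h2] := sbI; rewrite (lt_le_trans h1 s1) (le_lt_trans s2 h2).
      exact: (cF s sI).1.
    by rewrite ge_min hj/= le_max hb orbT.
  move: cI; rewrite in_itv/= => /andP[c1 c2].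
  have cI : 0 < c < sg.
    by have /andP[h1 _] := saI; have /andP[_ h2] := sbI; rewrite (lt_le_trans h1 c1) (le_lt_trans c2 h2).
  exists c => // -[X [Y [Sc X0 Y0]]]; have [s2 c2'] := sin_2pi j.
  have := HE X Y Sc; rewrite X0 Y0 thc => /(_ s2 c2').
  by rewrite ltNge Hd//; lra.
have S_lt s : S s -> s < ss.
  move=> [sI Hs]; rewrite ltNge; apply/negP => h; apply: ssN; apply: Hs.
  by rewrite h andbT; case/andP: ssI.
(* Near s = 0 the amplitude is so small that [fsol_small] carries the solution across. *)
have [s0 S0] : S !=set0.
  pose C := (A1 + B1 * (0 + 1)) * (t1 - t0).
  have [d d0 Hd] := F0 (- C); pose s := Num.min (d / 2) (sg / 2).
  have s0 : 0 < s by rewrite lt_min !divr_gt0.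
  have sd : s <= d / 2 by rewrite ge_min lexx.
  have ssg : s <= sg / 2 by rewrite ge_min lexx orbT.
  exists s; split=> [|r /andP[r0 rs]]; first by rewrite s0; lra.
  have rI : 0 < r < sg by rewrite r0; lra.
  have hC : et r + C <= 0 by have := Hd r rI; rewrite -lerBrDr sub0r; apply; lra.
  have [X [Y [Sr X0 Y0 _]]] := fsol_small p2 (lexx 0) e1 cA cB A00 B00 hA hB (th r) (ltW t01) hC.
  by exists X, Y.
have hs : has_sup S by split; [exists s0|exists ss => s /S_lt/ltW].
pose sg' := sup S.
have sg'0 : 0 < sg' by apply: lt_le_trans (sup_upper_bound hs S0); case: S0 => /andP[].
have sg'ss : sg' <= ss by apply: ge_sup; [exists s0|move=> s /S_lt/ltW].
have sg'sg : sg' < sg by apply: (le_lt_trans sg'ss); case/andP: ssI.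
have sg'I : 0 < sg' < sg by rewrite sg'0.
have inS s : 0 < s < sg' -> surv s.
  move=> /andP[h1 h2]; have ds : 0 < sg' - s by rewrite subr_gt0.
  have [r [rI Hr] hr] := sup_adherent ds hs; apply: Hr; rewrite h1/=.
  by move: hr; rewrite -/sg'; lra.
(* Survival is open, so if sg' survived, so would all parameters slightly beyond it. *)
have noS : ~ surv sg'.
  move=> [X [Y [Sx X0 Y0]]].
  have [d d0 Hd] := fsol_open p2 cA cB A00 B00 hA hB (ltW t01) Sx ltr01.
  have [cth cet] := cF sg' sg'I.
  move/cvgrPdist_lt: cth => /(_ d d0) h1; move/cvgrPdist_lt: cet => /(_ d d0) h2.
  have [e e0 He] : exists2 e, 0 < e & forall r, `|sg' - r| < e -> surv r.
    suff : \forall r \near sg', surv r by move=> /nbhs_ballP[e /= e0 He]; exists e.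
    near=> r; have r1 : `|th r - X t0| < d by rewrite X0 distrC; near: r.
    have r2 : `|et r - Y t0| < d by rewrite Y0 distrC; near: r.
    by have [X' [Y' [S' X'0 Y'0 _]]] := Hd _ _ r1 r2; exists X', Y'.
  pose s := Num.min (sg' + e / 2) ((sg' + sg) / 2).
  have s1 : s <= sg' + e / 2 by rewrite ge_min lexx.
  have s2 : s <= (sg' + sg) / 2 by rewrite ge_min lexx orbT.
  have s3 : sg' < s by rewrite lt_min; apply/andP; split; lra.
  have : S s.
    split=> [|r /andP[r0 rs]]; first by rewrite (lt_trans sg'0 s3); lra.
    have [rs'|rs'] := ltP r sg'; first by apply: inS; rewrite r0.
    by apply: He; rewrite ler0_norm; lra.
  by move/(sup_upper_bound hs); rewrite -/sg'; lra.
have /choice[z Hz] s : exists z : R * R, 0 < s < sg' -> linked p 0 (-1) A B t0 t1 (th s) (et s) z.1 z.2.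
  have [sI|nI] := pselect (0 < s < sg'); last by exists (0, 0).
  by have [X [Y [Sx X0 Y0]]] := inS s sI; exists (X t1, Y t1) => _; exists X, Y.
have L s : 0 < s < sg' -> linked p 0 (-1) A B t0 t1 (th s) (et s) ((fst \o z) s) ((snd \o z) s).
  exact: Hz.
have wid s : 0 < s < sg' -> 0 < s < sg by move=> /andP[-> h]; exact: lt_trans sg'sg.
exists sg', (fst \o z), (snd \o z); split; [by rewrite sg'0 ltW|exact: L|].
split.
- by move=> s sI; have [c1 c2] := cF s (wid s sI); exact: (linked_continuous p2 cA cB A00 B00 hA hB t01 L sI c1 c2).
- move=> s sI; have [X [Y [Sx X0 Y0 <- _]]] := L s sI.
  by apply: (gap_theta p2 A00 B00 hA hB t01 Sx); rewrite X0; apply: th0; exact: wid.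
- apply: (linked_small p2 (lexx 0) e1 cA cB A00 B00 hA hB t01 L).
  by move=> K; have [d d0 Hd] := F0 K; exists d => // s /wid; exact: Hd.
(* Otherwise parameters s arbitrarily close to sg' have final amplitude below [K]. Their
   trajectories are bounded on the whole gap by [gap_eta], and continuous dependence passes the
   bound, up to one unit, to the trajectory at sg' for as long as it lives; it would then cross the
   gap. *)
move=> K; apply: contrapT => /forall2NP HK.
have [cth cet] := cF sg' sg'I.
pose K' := Num.max (et sg' + 1) K.
apply: noS; apply: (@fsol_continue _ p 0 (-1) A B A0 A1 B0 B1 p2 cA cB A00 B00 hA hB t0 t1 _ _ (K' + 1)); first exact: ltW.
move=> t X Y tt Sx X0 Y0; have /andP[ht0 ht1] := tt.
have [d d0 Hd] := fsol_open p2 cA cB A00 B00 hA hB ht0 Sx ltr01.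
move/cvgrPdist_lt: (cth) => /(_ d d0) h1; move/cvgrPdist_lt: (cet) => /(_ d d0) h2.
move/cvgrPdist_lt: (cet) => /(_ 1 ltr01) h3.
have [e e0 He] : exists2 e, 0 < e & forall r, `|sg' - r| < e ->
    [/\ `|th sg' - th r| < d, `|et sg' - et r| < d & `|et sg' - et r| < 1].
  suff : \forall r \near sg', [/\ `|th sg' - th r| < d, `|et sg' - et r| < d & `|et sg' - et r| < 1].
    by move=> /nbhs_ballP[e /= e0 He]; exists e.
  by near=> r; split; near: r.
have [s [sI sd eK]] : exists s, [/\ 0 < s < sg', sg' - e < s & (snd \o z) s < K].
  have [|/existsNP[s /not_implyP[sI /not_implyP[h /negP]]]] := HK (sg' - e).
    by move=> h; exfalso; apply: h; lra.
  by rewrite -ltNge => hK; exists s.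
have /andP[s1 s2] := sI.
have /He[r1 r2 r3] : `|sg' - s| < e by rewrite ger0_norm; lra.
rewrite -X0 distrC in r1; rewrite -Y0 distrC in r2.
have [X' [Y' [S' X'0 Y'0 Hcl]]] := Hd _ _ r1 r2.
have [X2 [Y2 [S2 X20 Y20 X21 Y21]]] := L s sI.
have tt' : t0 <= t <= t by rewrite ht0 lexx.
have [_] := Hcl t tt'.
have [_ ->] : X' t = X2 t /\ Y' t = Y2 t.
  apply: (fsol_unique p2 cA cB A00 B00 hA hB S' (solves_le ht1 S2) _ _ tt').
  - by rewrite X'0 X20.
  - by rewrite Y'0 Y20.
have := gap_eta p2 A00 B00 hA hB S2 tt; rewrite Y20 Y21 => h4.
have h5 : Num.max (et s) ((snd \o z) s) <= K'.
  rewrite /K' ge_max !le_max; apply/andP; split; apply/orP; [left|right; exact: ltW].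
  by move: r3; rewrite ltr_norml => /andP[]; lra.
by rewrite ltr_norml => /andP[]; lra.
Unshelve. all: by end_near. Qed.

End gap_step.

End shoot.

(** * Bubbles *)

Section bubble.
Context (R : realType) (m : nat).
Local Notation p := (crit_exp R m.+3).

(** The exponent (N - 2) / 2, for N = m + 3: half the decay rate of the fundamental solution, as r
    is the squared distance. *)
Definition dec : R := m.+1%:R / 2.
Local Notation c := dec.

Lemma dec_gt0 : 0 < c.
Proof. by rewrite /dec divr_gt0. Qed.

Lemma dim_dec : m.+3%:R = 2 * (c + 1) :> R.
Proof. by rewrite /dec -addn2 natrD; field. Qed.

Lemma crit_dec : c * (p - 2) = 2.
Proof.
rewrite crit_expE /dec -[m.+3]addn2 natrD.
have : m.+1%:R != 0 :> R by rewrite pnatr_eq0.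
by move: (m.+1%:R) => x x0; field.
Qed.

Section one.
Variables (e k mu : R).
Hypothesis e2 : e ^+ 2 = 1.

(** The sign [e] = -1 describes the bubble left of its pole [mu], the inner one, and [e] = 1 the
    bubble right of it, the outer one. *)
Definition bubU r : R := k * (e * (r - mu)) `^ (- c).
Definition bubV r : R := - (c * e * k) * (e * (r - mu)) `^ (- c - 1).
Definition bubW r : R := c * (c + 1) * k * (e * (r - mu)) `^ (- c - 2).

Lemma is_derive_bub (K q : R) r : 0 < e * (r - mu) ->
  is_derive r 1 (fun x => K * (e * (x - mu)) `^ q) (K * q * e * (e * (r - mu)) `^ (q - 1)).
Proof.
move=> X0.
have h1 : is_derive r 1 (fun x => e * (x - mu)) (e * (1 - 0)).
  by apply: (dZ e); exact: dB (did r) (dcst r mu).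
have h2 := @dcomp _ r (fun x => e * (x - mu)) (fun y => y `^ q) _ _ (is_derive1_powR q X0) h1.
have := dZ K h2; congr is_derive; ring.
Qed.

Lemma bubU_derive r : 0 < e * (r - mu) -> is_derive r 1 bubU (bubV r).
Proof. by move=> X0; have := is_derive_bub k (- c) X0; congr is_derive; rewrite /bubV; ring. Qed.

Lemma bubV_derive r : 0 < e * (r - mu) -> is_derive r 1 bubV (bubW r).
Proof.
move=> X0; have := is_derive_bub (- (c * e * k)) (- c - 1) X0; congr is_derive.
rewrite /bubW (_ : - c - 1 - 1 = - c - 2); last ring.
rewrite (_ : _ * e = (c * (c + 1) * k) * e ^+ 2); last ring.
by rewrite e2 mulr1.
Qed.

Lemma bubW_continuous r : 0 < e * (r - mu) -> {for r, continuous bubW}.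
Proof. by move=> X0; apply: is_derive_continuous (is_derive_bub _ _ X0). Qed.

(** With X = e (r - mu) and r = e X + mu, the terms in X^(-c-1) cancel and 4 c (c+1) mu k X^(-c-2)
    remains. As c (p - 2) = 2, this has the same power of X as the nonlinearity; equating the
    coefficients gives the condition on |k|. *)
Lemma bub_ode r : 0 < e * (r - mu) -> `|k| `^ (p - 2) = 2 * m.+3%:R * c * mu ->
  4 * r * bubW r + 2 * m.+3%:R * bubV r = spow p (bubU r).
Proof.
move=> X0 kmu; rewrite /spow /bubU normrM (ger0_norm (powR_ge0 _ _)).
rewrite (powRM _ (normr_ge0 _) (powR_ge0 _ _)) kmu -powRrM mulNr crit_dec.
set X := e * (r - mu) in X0 *.
have XD a b : X `^ a * X `^ b = X `^ (a + b).
  by rewrite powRD// (gt_eqF X0) implybT.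
have X2 : X ^+ 2 = X `^ 2 by rewrite -(powR_mulrn 2 (ltW X0)).
have E1 : X `^ (- c) = X `^ (-c -2) * X ^+ 2.
  by rewrite X2 XD; congr (_ `^ _); ring.
have E2 : X `^ (- c - 1) = X `^ (-c -2) * X.
  by rewrite -[X in _ * X](powRr1 (ltW X0)) XD; congr (_ `^ _); ring.
have E3 : X `^ (-2) * X ^+ 2 = 1 by rewrite X2 XD addNr powRr0.
rewrite /bubW /bubV -/X E2 E1 dim_dec.
have E4 : r = e * X + mu by rewrite /X mulrA -expr2 e2 mul1r subrK.
rewrite [X in _ = X](_ : _ = 4 * (c+1) * c * mu * k * X `^ (- c - 2) * (X `^ (-2) * X ^+ 2)); last ring.
rewrite E3 {1}E4.
ring.
Qed.
End one.

Section init.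
Variable al : R.
Hypothesis al0 : 0 < al.

Local Notation M := (2 * m.+3%:R * c).
Local Notation g := (c * al `^ (c + 1)).
Definition pole (s : R) : R := al + (1 - s) / s.
Definition height (mu : R) : R := (M * mu) `^ (c / 2).
(** With w = pole s - al, the bubble takes at [al] the value height w^(-c) = init_q^(c/2). *)
Definition init_q (s : R) : R := M * pole s / ((1 - s) / s) ^+ 2.
(** At [al] the ratio h / z is w / g, since z = al^(c+1) U' and U' = c U / w. The log-amplitude
    below is accordingly ln h plus half of ln (1 + (z/h)^2). *)
Definition init_th (s : R) : R := atan ((1 - s) / s / g).
Definition init_et (s : R) : R := c / 2 * ln (init_q s) + 2^-1 * ln (1 + (g / ((1 - s) / s)) ^+ 2).

Let M0 : 0 < M. Proof. by rewrite !mulr_gt0// dec_gt0. Qed.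
Let g0 : 0 < g. Proof. by rewrite mulr_gt0 ?dec_gt0// powR_gt0. Qed.
Let w0 (s : R) : 0 < s < 1 -> 0 < (1 - s) / s.
Proof. by move=> /andP[s0 s1]; rewrite divr_gt0// subr_gt0. Qed.

Lemma pole_gt (s : R) : 0 < s < 1 -> al < pole s.
Proof. by move=> /w0; rewrite /pole; lra. Qed.

Lemma height_crit (mu : R) : 0 < mu -> `|height mu| `^ (p - 2) = M * mu.
Proof.
move=> mu0; have Mm : 0 < M * mu by rewrite mulr_gt0.
rewrite ger0_norm ?powR_ge0// -powRrM (_ : c / 2 * (p - 2) = 1) ?powRr1// ?ltW//.
by have := crit_dec; lra.
Qed.

Let q0 (s : R) : 0 < s < 1 -> 0 < init_q s.
Proof.
move=> sI; rewrite /init_q divr_gt0 ?exprn_gt0 ?w0// mulr_gt0//.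
by have := pole_gt sI; have := al0; lra.
Qed.

Lemma init_polar (s : R) : 0 < s < 1 ->
  expR (init_et s) * sin (init_th s) = bubU (-1) (height (pole s)) (pole s) al /\
  al `^ (- (c + 1)) * (expR (init_et s) * cos (init_th s)) = bubV (-1) (height (pole s)) (pole s) al.
Proof.
move=> sI; have W0 := w0 sI; have P0 : 0 < pole s by have := pole_gt sI; have := al0; lra.
rewrite /bubU /bubV (_ : -1 * (al - pole s) = (1 - s) / s); last by rewrite /pole; ring.
set h := height (pole s); rewrite /init_et /init_th.
have Q0 := q0 sI; rewrite /init_q in Q0 *; set w := (1 - s) / s in W0 Q0 *.
set q := M * pole s / w ^+ 2 in Q0 *; set G := g; have G0 : 0 < G by exact: g0.
have x0 : 0 < w / G by rewrite divr_gt0.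
set y := 1 + (G / w) ^+ 2.
have y0 : 0 < y by rewrite /y ltr_wpDr ?sqr_ge0.
have sq0 : 0 < 1 + (w / G) ^+ 2 by rewrite ltr_wpDr ?sqr_ge0.
have Eh : expR (c / 2 * ln q) = h * w `^ (- c).
  have -> : expR (c / 2 * ln q) = q `^ (c / 2) by rewrite /powR gt_eqF.
  rewrite /q powRM ?invr_ge0 ?sqr_ge0 ?mulr_ge0 ?ltW// /h /height; congr (_ * _).
  rewrite -powR_inv1 ?sqr_ge0// -[w ^+ 2](powR_mulrn 2 (ltW W0)) -!powRrM; congr (_ `^ _); by field.
have Ey : expR (2^-1 * ln y) = Num.sqrt (1 + (w / G) ^+ 2) * (G / w).
  have -> : expR (2^-1 * ln y) = y `^ 2^-1 by rewrite /powR gt_eqF.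
  have -> : G / w = Num.sqrt ((G / w) ^+ 2) by rewrite sqrtr_sqr ger0_norm// divr_ge0// ltW.
  rewrite powR12_sqrt ?ltW// -sqrtrM ?ltW//.
  congr Num.sqrt; rewrite /y; field; rewrite !gt_eqF//.
have Ec : expR (c / 2 * ln q + 2^-1 * ln y) * cos (atan (w / G)) = h * w `^ (- c) * (G / w).
  rewrite expRD Eh Ey cos_atan; field; rewrite gt_eqF//= gt_eqF// sqrtr_gt0//.
have Es : sin (atan (w / G)) = cos (atan (w / G)) * (w / G).
  have ct : cos (atan (w / G)) != 0 by rewrite cos_atan invr_neq0// gt_eqF// sqrtr_gt0.
  have /(canRL (divfK ct)) -> : sin (atan (w / G)) / cos (atan (w / G)) = w / G := atanK _.
  by rewrite mulrC.
split.
  rewrite Es mulrA Ec; field; rewrite !gt_eqF//.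
rewrite Ec /G powRN.
have -> : w `^ (- c - 1) = w `^ (- c) / w.
  by rewrite powRD ?(gt_eqF W0) ?implybT// powR_inv1// ltW.
field; rewrite !gt_eqF ?powR_gt0//.
Qed.

Lemma init_family : family 1 init_th init_et.
Proof.
split.
- move=> s sI; have [s0 s1] := andP sI.
  have cw := dM (dB (dcst s 1) (did s)) (dV (f := fun s => s) (lt0r_neq0 s0) (did s)).
  have cw' := is_derive_continuous cw.
  have W0 := w0 sI; have Q0 := q0 sI.
  have cg : {for s, continuous (fun s : R => (1 - s) / s / g)}.
    by apply: cvgM => //; exact: cvg_cst.
  have cgi : {for s, continuous (fun s : R => (g / ((1 - s) / s)) ^+ 2)}.
    have h : {for s, continuous (fun s : R => g / ((1 - s) / s))}.
      by apply: cvgM; [exact: cvg_cst|apply: cvgV => //; rewrite gt_eqF].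
    by apply: cvgM.
  split; first exact: continuous_comp cg (@continuous_atan _ _).
  have cq : {for s, continuous init_q}.
    apply: cvgM.
      by apply: cvgM; [exact: cvg_cst|apply: cvgD => //; exact: cvg_cst].
    apply: cvgV; first by rewrite gt_eqF// exprn_gt0.
    exact: cvgM.
  apply: cvgD; (apply: cvgM; first exact: cvg_cst).
    apply: continuous_comp cq _; exact: continuous_ln.
  apply: (@continuous_comp _ _ _ (fun s : R => 1 + (g / ((1 - s) / s)) ^+ 2)).
    by apply: cvgD => //; exact: cvg_cst.
  by apply: continuous_ln; rewrite ltr_wpDr ?sqr_ge0.
- move=> s sI; rewrite -atan0 /init_th; apply: le_atan; rewrite divr_ge0 ?ltW//; exact: w0.
- move=> K; pose E := expR (2 / c * (K - 2^-1 * ln (1 + g ^+ 2))).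
  have E0 : 0 < E := expR_gt0 _.
  (* For s < 1/2 one has init_q <= 4 M (al + 1) s, because (1 - s)^2 >= 1/4, and w > 1, which bounds
     the second logarithm by its value at w = 1. *)
  exists (Num.min 2^-1 (E / (4 * M * (al + 1)))).
    rewrite lt_min invr_gt0 ltr0n/= divr_gt0//; apply: mulr_gt0; last exact: addr_gt0.
    by rewrite mulr_gt0.
  move=> s sI; rewrite lt_min => /andP[s2 sE]; have [s0 s1] := andP sI.
  have c0 := dec_gt0; have W0 := w0 sI.
  have h1 : init_q s <= E.
    apply/ltW; move: sE; rewrite ltr_pdivlMr; last by rewrite mulr_gt0 ?addr_gt0// mulr_gt0.
    apply: le_lt_trans; rewrite /init_q /pole.
    rewrite (_ : _ / _ = M * (al * s + (1 - s)) * s / (1 - s) ^+ 2); last by field; rewrite !gt_eqF ?subr_gt0.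
    have s12 : 0 < (1 - s) ^+ 2 by rewrite exprn_gt0// subr_gt0.
    rewrite ler_pdivrMr//.
    rewrite (_ : _ * s = M * s * (al * s + (1 - s))); last ring.
    rewrite (_ : _ * (1 - s) ^+ 2 = M * s * ((al + 1) * (4 * (1 - s) ^+ 2))); last ring.
    rewrite ler_pM2l ?mulr_gt0//.
    have u1 : 1 <= 4 * (1 - s) ^+ 2 by nra.
    have u2 : al * s + (1 - s) <= al + 1 by have := al0; nra.
    by rewrite (le_trans u2)// ler_peMr// addr_ge0// ltW.
  have h2 : ln (init_q s) <= 2 / c * (K - 2^-1 * ln (1 + g ^+ 2)).
    by rewrite -[leRHS]expRK ler_ln ?posrE// q0.
  have h3 : ln (1 + (g / ((1 - s) / s)) ^+ 2) <= ln (1 + g ^+ 2).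
    have w1 : 1 < (1 - s) / s by rewrite ltr_pdivlMr//; lra.
    have pos (x : R) : 0 < 1 + x ^+ 2 by rewrite ltr_wpDr ?sqr_ge0.
    rewrite ler_ln ?posrE ?pos// lerD2l ler_sqr ?nnegrE; last exact: ltW.
      by rewrite ler_pdivrMr// ler_peMr// ltW.
    by rewrite divr_ge0// ltW.
  rewrite /init_et.
  have : c / 2 * ln (init_q s) <= K - 2^-1 * ln (1 + g ^+ 2).
    rewrite (_ : K - _ = c / 2 * (2 / c * (K - 2^-1 * ln (1 + g ^+ 2)))); last by field; rewrite gt_eqF.
    by rewrite ler_pM2l// divr_gt0.
  lra.
- move=> K; pose E := expR (2 / c * K); have E0 : 0 < E := expR_gt0 _; have c0 := dec_gt0.
  have Ma0 : 0 < M * al by rewrite mulr_gt0.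
  (* For s > 1/2 the numerator of init_q is at least M al / 4, and (1 - s)^2 <= 1 - s. *)
  exists (Num.max 2^-1 (1 - M * al / 4 / E)).
    rewrite gt_max; apply/andP; split; first lra.
    have : 0 < M * al / 4 / E by rewrite !divr_gt0.
    lra.
  move=> s sI; rewrite gt_max => /andP[s2 sE]; have [s0 s1] := andP sI; have W0 := w0 sI.
  have h1 : E <= init_q s.
    have {}sE : 1 - s < M * al / 4 / E by lra.
    rewrite ltr_pdivlMr// in sE.
    rewrite /init_q /pole.
    rewrite (_ : _ / _ = M * (al * s + (1 - s)) * s / (1 - s) ^+ 2); last by field; rewrite !gt_eqF ?subr_gt0.
    have s12 : 0 < (1 - s) ^+ 2 by rewrite exprn_gt0// subr_gt0.
    rewrite ler_pdivlMr//.
    have : M * al / 4 <= M * (al * s + (1 - s)) * s.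
      rewrite -subr_ge0 (_ : _ - _ = M * (al * (s ^+ 2 - 4^-1) + (1 - s) * s)); last by field.
      by rewrite mulr_ge0 ?ltW// addr_gt0 ?mulr_gt0//; nra.
    apply: le_trans; apply: le_trans (ltW sE).
    by rewrite mulrC; apply: ler_wpM2r; [exact: ltW|nra].
  have h2 : 2 / c * K <= ln (init_q s).
    by rewrite -[leLHS]expRK ler_ln ?posrE// q0.
  have h3 : 0 <= ln (1 + (g / ((1 - s) / s)) ^+ 2) by rewrite ln_ge0// lerDl sqr_ge0.
  rewrite /init_et.
  have : K <= c / 2 * ln (init_q s).
    rewrite (_ : K = c / 2 * (2 / c * K)); last by field; rewrite gt_eqF.
    by rewrite ler_pM2l// divr_gt0.
  lra.
Qed.

End init.
End bubble.

(** * Trajectories *)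

Section glue.
Context (R : realType).
Implicit Types (f g : R -> R) (T r : R).

(** Truncating the arguments by minimum and maximum gives continuity on the whole line without
    cases; the right half equals [g] once f T = g T. *)
Definition glue f g T r : R := f (Num.min r T) + g (Num.max r T) - g T.

Lemma glueL f g T r : r <= T -> glue f g T r = f r.
Proof. by move=> rT; rewrite /glue min_l// max_r// addrK. Qed.

Lemma glueR f g T r : f T = g T -> T <= r -> glue f g T r = g r.
Proof. by move=> fg rT; rewrite /glue min_r// max_l// fg addrAC subrr add0r. Qed.

Lemma glue_continuous f g T : (forall r, r <= T -> {for r, continuous f}) ->
  (forall r, T <= r -> {for r, continuous g}) -> continuous (glue f g T).
Proof.
move=> cf cg r; rewrite /glue; apply: cvgB; last exact: cvg_cst.
apply: cvgD.
  apply: (@continuous_comp _ _ _ (fun r => Num.min r T)); last by apply: cf; rewrite ge_min lexx orbT.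
  by apply: continuous_min => //; exact: cvg_cst.
apply: (@continuous_comp _ _ _ (fun r => Num.max r T)); last by apply: cg; rewrite le_max lexx orbT.
by apply: continuous_max => //; exact: cvg_cst.
Qed.

Lemma glue_deriveL f g T r d : r < T -> is_derive r 1 f d -> is_derive r 1 (glue f g T) d.
Proof.
move=> rT; apply: is_derive_near; have := near_lt rT; apply: filterS => y yT.
by rewrite glueL// ltW.
Qed.

Lemma glue_deriveR f g T r d : f T = g T -> T < r -> is_derive r 1 g d -> is_derive r 1 (glue f g T) d.
Proof.
move=> fg rT; apply: is_derive_near; have := near_gt rT; apply: filterS => y yT.
by rewrite glueR// ltW.
Qed.

End glue.

Section coef.
Context (R : realType) (m : nat).
Variables (r0 r1 : R).
Hypotheses (r00 : 0 < r0) (r01 : r0 < r1).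
Local Notation c := (dec R m).

Definition clamp (r : R) : R := Num.max r0 (Num.min r r1).
(** The coefficients r^(-N/2) and r^(N/2-1) / 4 of the first-order system for h = U and z = r^(N/2)
    U'. Clamping r to [r0, r1] makes them continuous, positive and bounded on the whole line. *)
Definition cofA (r : R) : R := clamp r `^ (- (c + 1)).
Definition cofB (r : R) : R := clamp r `^ c / 4.
Definition cofD (r : R) : R := (2 * c + 1) / 4 * r `^ (2 * c).

Let cl r : r0 <= clamp r <= r1.
Proof. by rewrite /clamp le_max lexx ge_max (ltW r01) ge_min lexx orbT. Qed.

Let cl0 r : 0 < clamp r.
Proof. by have /andP[h _] := cl r; exact: lt_le_trans r00 h. Qed.

Lemma clampE r : r0 <= r <= r1 -> clamp r = r.
Proof. by move=> /andP[h1 h2]; rewrite /clamp min_l// max_r. Qed.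

Lemma clamp_near r : r0 < r < r1 -> \forall y \near r, clamp y = y.
Proof.
move=> /andP[h1 h2]; near=> y; apply: clampE; apply/andP; split; apply: ltW; near: y.
- exact: near_gt.
- exact: near_lt.
Unshelve. all: by end_near. Qed.

Let clamp_cont : continuous clamp.
Proof.
move=> r; have : {for r, continuous (fun r => Num.max r0 (Num.min r r1))}; last by [].
apply: continuous_max; first exact: cvg_cst.
by apply: continuous_min => //; exact: cvg_cst.
Qed.

Let clp q r : {for r, continuous (fun r => clamp r `^ q)}.
Proof.
apply: (@continuous_comp _ _ _ clamp (fun y => y `^ q)); first exact: clamp_cont.
exact: is_derive_continuous (is_derive1_powR q (cl0 r)).
Qed.

Lemma cofA_continuous : continuous cofA.
Proof. by move=> r; exact: clp. Qed.

Lemma cofB_continuous : continuous cofB.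
Proof. by move=> r; apply: cvgM; [exact: clp|exact: cvg_cst]. Qed.

Lemma cofA_bounds r : r1 `^ (- (c + 1)) <= cofA r <= r0 `^ (- (c + 1)).
Proof.
have c0 := dec_gt0 R m; have /andP[h1 h2] := cl r.
have r10 : 0 < r1 by exact: lt_trans r01.
have c1 : 0 <= c + 1 by lra.
rewrite /cofA !powRN !lef_pV2 ?posrE ?powR_gt0 ?cl0//.
by rewrite (powR_le c1 (ltW (cl0 _)) h2) (powR_le c1 (ltW r00) h1).
Qed.

Lemma cofB_bounds r : r0 `^ c / 4 <= cofB r <= r1 `^ c / 4.
Proof.
have c0 := dec_gt0 R m; have /andP[h1 h2] := cl r.
have r10 : 0 < r1 by exact: lt_trans r01.
rewrite /cofB !ler_pM2r ?invr_gt0//.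
by rewrite (powR_le (ltW c0) (ltW (cl0 _)) h2) (powR_le (ltW c0) (ltW r00) h1).
Qed.

Lemma cofA_derive r : r0 < r < r1 -> is_derive r 1 cofA (- (c + 1) * r `^ (- (c + 1) - 1)).
Proof.
move=> rI; have /andP[h1 _] := rI.
apply: (is_derive_near (f := fun y => y `^ (- (c + 1)))).
  by have := clamp_near rI; apply: filterS => y; rewrite /cofA => ->.
by apply: is_derive1_powR; exact: lt_trans h1.
Qed.

Lemma cofBA r : r0 <= r <= r1 -> cofB r / cofA r = 4^-1 * r `^ (2 * c + 1).
Proof.
move=> rI; have /andP[h1 _] := rI; have r0' : 0 < r := lt_le_trans r00 h1.
rewrite /cofB /cofA clampE// -powRN opprK (_ : 2 * c + 1 = c + (c + 1)); last ring.
by rewrite [in RHS]powRD ?(gt_eqF r0') ?implybT//; ring.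
Qed.

Lemma cofBA_derive r : r0 < r < r1 -> is_derive r 1 (fun s => cofB s / cofA s) (cofD r).
Proof.
move=> rI; have /andP[h1 h2] := rI; have r0' : 0 < r := lt_trans r00 h1.
apply: (is_derive_near (f := fun y => 4^-1 * y `^ (2 * c + 1))).
  near=> y; rewrite cofBA//; apply/andP; split; apply: ltW; near: y.
  - exact: near_gt.
  - exact: near_lt.
have := dZ 4^-1 (is_derive1_powR (2 * c + 1) r0'); congr is_derive.
by rewrite /cofD addrK; ring.
Unshelve. all: by end_near. Qed.

Lemma cofD_bounds r : r0 < r < r1 -> 0 <= cofD r <= (2 * c + 1) / r0 * (cofB r / cofA r).
Proof.
move=> rI; have /andP[h1 h2] := rI; have r0' : 0 < r := lt_trans r00 h1.
have c0 := dec_gt0 R m; have d0 : 0 < 2 * c + 1 by lra.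
rewrite cofBA; last by rewrite !ltW.
have k0 : 0 <= (2 * c + 1) / 4 * r `^ (2 * c) by rewrite mulr_ge0 ?powR_ge0// divr_ge0// ltW.
rewrite /cofD k0/=.
rewrite powRD ?(gt_eqF r0') ?implybT// (powRr1 (ltW r0')).
rewrite (_ : _ * (4^-1 * _) = (2 * c + 1) / 4 * r `^ (2 * c) * (r / r0)); last by field; rewrite gt_eqF.
by rewrite ler_peMr// ler_pdivlMr// mul1r ltW.
Qed.

End coef.

Section traj.
Context (R : realType) (m : nat).
Variables (om : set R) (lam r0 r1 : R) (S : seq R).
Hypotheses (r00 : 0 < r0) (r01 : r0 < r1).
Local Notation N := m.+3.
Local Notation p := (crit_exp R N).
Local Notation c := (dec R m).
Local Notation A := (cofA m r0 r1).
Local Notation B := (cofB m r0 r1).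

Definition accel (r u v : R) : R :=
  (lam * \1_om r * u - (if r \in om then 1 else -1) * spow p u - 2 * N%:R * v) / (4 * r).

(* A solution (U, V) of the equation in the variable r = |x|^2, with V = U',
   which is an inner bubble for r <= r0 and is followed up to r = T, where its
   phase and log-amplitude are x and y. *)
Definition traj (mu T : R) (U V : R -> R) (x y : R) : Prop :=
  [/\ continuous U, continuous V,
      forall r, r <= r0 -> U r = bubU m (-1) (height m mu) mu r /\ V r = bubV m (-1) (height m mu) mu r,
      forall r, r0 < r < T -> r \notin S ->
        is_derive r 1 U (V r) /\ is_derive r 1 V (accel r (U r) (V r)) &
      U T = expR y * sin x /\ V T = A T * (expR y * cos x)].

Lemma traj_init s : 0 < s < 1 ->
  exists U V, traj (pole r0 s) r0 U V (init_th m r0 s) (init_et m r0 s).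
Proof.
move=> sI; have Pg := pole_gt r0 sI; set mu := pole r0 s in Pg *.
have [E1 E2] := init_polar m r00 sI; rewrite -/mu in E1 E2.
have X0 r : r <= r0 -> 0 < -1 * (r - mu) by lra.
exists (glue (bubU m (-1) (height m mu) mu) (cst (bubU m (-1) (height m mu) mu r0)) r0).
exists (glue (bubV m (-1) (height m mu) mu) (cst (bubV m (-1) (height m mu) mu r0)) r0).
have e2 : (-1) ^+ 2 = 1 :> R by rewrite sqrrN expr1n.
split.
- apply: glue_continuous => r h; last exact: cst_continuous.
  exact: is_derive_continuous (bubU_derive m _ (X0 _ h)).
- apply: glue_continuous => r h; last exact: cst_continuous.
  exact: is_derive_continuous (bubV_derive m _ e2 (X0 _ h)).
- by move=> r h; rewrite !glueL.
- by move=> r /andP[h1 h2]; have := lt_trans h1 h2; rewrite ltxx.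
- rewrite !glueL// -E1 -E2; split => //; congr (_ * _).
  by rewrite /cofA clampE// lexx ltW.
Qed.

Lemma traj_extend mu nu eps T T' U V x y x' y' : r0 <= T -> T < T' -> T' <= r1 -> T \in S ->
  (forall r, T < r < T' -> lam * \1_om r = - nu /\ (if r \in om then 1 else -1) = eps :> R) ->
  traj mu T U V x y -> linked p nu eps A B T T' x y x' y' ->
  exists U' V', traj mu T' U' V' x' y'.
Proof.
move=> r0T TT' T'r1 TS Heps [cU cV inn ode [UT VT]] [X [Y [F XT YT XT' YT']]].
have gU : U T = hh X Y T by rewrite UT /hh XT YT.
have gV : V T = A T * zz X Y T by rewrite VT /zz XT YT.
have cA : continuous A := cofA_continuous r00 r01.
exists (glue U (hh X Y) T), (glue V (fun r => A r * zz X Y r) T).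
split.
- by apply: glue_continuous => r _; [exact: cU|exact: (hh_continuous F)].
- apply: glue_continuous => r _; first exact: cV.
  by apply: cvgM; [exact: cA|exact: (zz_continuous F)].
- by move=> r h; have [] := inn r h; rewrite !glueL// (le_trans h).
- move=> r /andP[h1 h2] rS; have [rT|Tr|E] := ltgtP r T; last by rewrite -E (negbTE rS) in TS.
    have rI : r0 < r < T by rewrite h1.
    have [d1 d2] := ode r rI rS; rewrite !(glueL _ _ (ltW rT)).
    by split; apply: glue_deriveL.
  have rI : T < r < T' by rewrite Tr.
  have rI' : r0 < r < r1 by rewrite h1 (lt_le_trans h2).
  rewrite (glueR gU (ltW Tr)) (glueR (g := fun r => A r * zz X Y r) gV (ltW Tr)).
  split; apply: glue_deriveR => //; first exact: hh_derive F _ rI.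
  have := dM (cofA_derive m r00 rI') (zz_derive F rI); congr is_derive.
  have [E1 E2] := Heps r rI; rewrite /accel E1 E2.
  have rp : 0 < r := lt_trans r00 h1.
  (* Differentiating V = A z with A B = 1 / (4 r) and A' = - (c + 1) A / r gives back the equation
     solved for U''. *)
  have AB : A r * B r = (4 * r)^-1.
    rewrite /cofA /cofB clampE ?(ltW h1) ?(le_trans (ltW h2))// mulrA -powRD ?(gt_eqF rp) ?implybT//.
    by rewrite (_ : - (c + 1) + c = -1); [rewrite powR_inv1 ?ltW// -invfM mulrC|ring].
  have Ar : r `^ (- (c + 1) - 1) = A r / r.
    rewrite /cofA clampE ?(ltW h1) ?(le_trans (ltW h2))//.
    by rewrite powRD ?(gt_eqF rp) ?implybT// powR_inv1 ?ltW.
  rewrite Ar mulrN [A r * (B r * _)]mulrA AB dim_dec; field; rewrite gt_eqF//.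
- by rewrite (glueR gU (ltW TT')) (glueR (g := fun r => A r * zz X Y r) gV (ltW TT')) /hh /zz XT' YT'.
Qed.

End traj.

(** * Matching an outer bubble *)

Lemma near_continuous (R : realType) (f g : R -> R) (r : R) :
  (\forall y \near r, f y = g y) -> {for r, continuous g} -> {for r, continuous f}.
Proof.
move=> fg cg; have E : f r = g r := nbhs_singleton fg.
apply/cvgrPdist_lt => e e0; move/cvgrPdist_lt: cg => /(_ e e0).
by apply: filterS2 fg => z Ez; rewrite E Ez.
Qed.

Section global.
Context (R : realType) (m : nat).
Variables (om : set R) (lam r0 r1 be : R) (S : seq R).
Hypotheses (r00 : 0 < r0) (r0S : r0 \in S) (beS : be \in S) (r0be : r0 < be).
Hypotheses (om_lo : forall r : R, r <= r0 -> ~ om r) (om_hi : forall r : R, be <= r -> ~ om r).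
Hypothesis omS : forall r : R, r \notin S -> \forall y \near r, (y \in om) = (r \in om).
Local Notation N := m.+3.
Local Notation p := (crit_exp R N).
Local Notation c := (dec R m).

Lemma decay_bound (f : R -> R) (M K q mb : R) : 0 <= q -> 0 <= mb < be ->
  (forall r, 0 <= r <= be -> `|f r| <= M) ->
  (forall r, be <= r -> `|f r| <= K * (r - mb) `^ (- q)) ->
  exists2 C : R, 0 <= C & forall r, 0 <= r -> `|f r| <= C * (1 + r) `^ (- q).
Proof.
move=> q0 /andP[mb0 mbb] hM hK; have be0 : 0 < be := lt_trans r00 r0be.
(* The value at r = be of (r - mb) / (1 + r), which is nondecreasing: r - mb >= d (1 + r) from there
   on. *)
pose d := (be - mb) / (1 + be).
have d0 : 0 < d by rewrite divr_gt0 ?subr_gt0 ?addr_gt0.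
have M0 : 0 <= M by apply: le_trans (hM 0 _); rewrite ?normr_ge0// lexx ltW.
have K0 : 0 <= K.
  have := hK be (lexx _); rewrite leNgt; apply: contraNT; rewrite -ltNge => Kn.
  have bm : 0 < be - mb by rewrite subr_gt0.
  by apply: lt_le_trans (normr_ge0 _); rewrite nmulr_rlt0// powR_gt0.
exists (M * (1 + be) `^ q + K * d `^ (- q)).
  by rewrite addr_ge0 ?mulr_ge0 ?powR_ge0.
move=> r rp; have r1' : 0 < 1 + r by rewrite ltr_pwDl.
rewrite mulrDl; have [rb|/ltW rb] := leP r be.
  rewrite -[leLHS]addr0; apply: lerD; last by rewrite !mulr_ge0 ?powR_ge0.
  apply: le_trans (hM r _) _; first by rewrite rp.
  rewrite -mulrA ler_peMr// powRN ler_pdivlMr ?powR_gt0// mul1r.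
  by apply: powR_le; rewrite ?lerD2l// ltW.
rewrite -[leLHS]add0r; apply: lerD; first by rewrite !mulr_ge0 ?powR_ge0.
apply: le_trans (hK r rb) _; rewrite -mulrA ler_wpM2l// -(powRM _ (ltW d0) (ltW r1')).
have rm : 0 < r - mb by rewrite subr_gt0 (lt_le_trans mbb).
rewrite !powRN lef_pV2 ?posrE ?powR_gt0 ?(mulr_gt0 d0 r1')//.
apply: powR_le => //; first by rewrite mulr_ge0// ltW.
rewrite /d mulrAC ler_pdivrMr ?addr_gt0// -subr_ge0.
rewrite (_ : _ - _ = (r - be) * (1 + mb)); last ring.
by rewrite mulr_ge0 ?subr_ge0// addr_ge0.
Qed.

Variables (mu : R) (U0 V0 : R -> R) (x y : R).
Hypotheses (mu0 : r0 < mu) (tr : traj m om lam r0 r1 S mu be U0 V0 x y).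
Variables (k mb : R).
Hypotheses (mbI : 0 <= mb < be) (kmb : `|k| `^ (p - 2) = 2 * N%:R * c * mb).
Hypotheses (matchU : U0 be = bubU m 1 k mb be) (matchV : V0 be = bubV m 1 k mb be).

Local Notation hm := (height m mu).
Let U := glue U0 (bubU m 1 k mb) be.
Let V := glue V0 (bubV m 1 k mb) be.
Let acc r := accel m om lam r (U r) (V r).
(** Left of [r0] the second derivative is that of the bubble, as [accel] divides by r and is
    unusable at the origin. *)
Let W r := if r < r0 then bubW m (-1) hm mu r else acc r.

Let e1 : (1 : R) ^+ 2 = 1. Proof. exact: expr1n. Qed.
Let eN1 : (-1 : R) ^+ 2 = 1. Proof. by rewrite sqrrN expr1n. Qed.
Let X1 r : be <= r -> 0 < 1 * (r - mb).
Proof. by move=> h; rewrite mul1r subr_gt0; apply: lt_le_trans h; case/andP: mbI. Qed.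
Let XN r : r <= r0 -> 0 < -1 * (r - mu).
Proof. by move=> h; have := mu0; lra. Qed.

Let cU : continuous U.
Proof.
have [h _ _ _ _] := tr; apply: glue_continuous => r hr; first exact: h.
exact: is_derive_continuous (bubU_derive m _ (X1 hr)).
Qed.

Let cV : continuous V.
Proof.
have [_ h _ _ _] := tr; apply: glue_continuous => r hr; first exact: h.
exact: is_derive_continuous (bubV_derive m _ e1 (X1 hr)).
Qed.

Let UVL r : r <= r0 -> U r = bubU m (-1) hm mu r /\ V r = bubV m (-1) hm mu r.
Proof.
move=> h; have [_ _ inn _ _] := tr; have hb : r <= be := le_trans h (ltW r0be).
by rewrite /U /V !glueL//; exact: inn.
Qed.

Let UVR r : be <= r -> U r = bubU m 1 k mb r /\ V r = bubV m 1 k mb r.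
Proof. by move=> h; rewrite /U /V !glueR. Qed.

Let accR r : be <= r -> acc r = bubW m 1 k mb r.
Proof.
move=> h; have [EU EV] := UVR h; rewrite /acc /accel EU EV.
have on := om_hi h.
rewrite indicE memNset// mulr0 mul0r sub0r mulN1r opprK -(bub_ode e1 (X1 h) kmb).
have rp : 0 < r := lt_le_trans (lt_trans r00 r0be) h.
by rewrite addrK mulrAC divff ?mul1r// mulf_neq0// gt_eqF.
Qed.

Let dUV r : r \notin S -> is_derive r 1 U (V r) /\ is_derive r 1 V (W r).
Proof.
move=> rS; have [rr|rr|E] := ltgtP r r0; last by rewrite E r0S in rS.
- have [EU EV] := UVL (ltW rr); rewrite /W rr EV; have X0 := XN (ltW rr).
  have nr : \forall y \near r, y < r0 by exact: near_lt.
  split.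
    apply: is_derive_near (bubU_derive m _ X0).
    by apply: filterS nr => z /ltW/UVL[].
  apply: is_derive_near (bubV_derive m _ eN1 X0).
  by apply: filterS nr => z /ltW/UVL[].
- rewrite /W ltNge (ltW rr)/=; have [rb|rb|E] := ltgtP r be; last by rewrite E beS in rS.
    have [_ _ _ ode _] := tr; have rI : r0 < r < be by rewrite rr.
    have [d1 d2] := ode r rI rS; rewrite /acc /U /V !(glueL _ _ (ltW rb)).
    by split; apply: glue_deriveL.
  have [EU EV] := UVR (ltW rb); rewrite (accR (ltW rb)) EV; have X0 := X1 (ltW rb).
  split; first exact: glue_deriveR matchU rb (bubU_derive m k X0).
  exact: glue_deriveR matchV rb (bubV_derive m k e1 X0).
Qed.

Let cW r : r \notin S -> {for r, continuous W}.
Proof.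
move=> rS; have [rr|rr|E] := ltgtP r r0; last by rewrite E r0S in rS.
  have X0 := XN (ltW rr).
  have nr : \forall y \near r, W y = bubW m (-1) hm mu y.
    by have := near_lt rr; apply: filterS => z zr; rewrite /W zr.
  exact: near_continuous nr (bubW_continuous X0).
have rp : 0 < r := lt_trans r00 rr.
pose Wr z := (lam * \1_om r * U z - (if r \in om then 1 else -1) * spow p (U z) - 2 * N%:R * V z) / (4 * z).
have nr : \forall y \near r, W y = Wr y.
  have := near_gt rr; have := omS rS; apply: filterS2 => z omz zr.
  by rewrite /W ltNge (ltW zr)/= /acc /accel /Wr !indicE omz.
have cWr : {for r, continuous Wr}.
  apply: cvgM; last first.
    apply: cvgV; first by rewrite mulf_neq0// gt_eqF.
    by apply: cvgM => //; exact: cvg_cst.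
  have cs : {for r, continuous (fun z => spow p (U z))}.
    apply: (@continuous_comp _ _ _ U (spow p)); first exact: cU.
    by apply: spow_continuous; exact/ltW/crit_exp_gt2.
  apply: cvgB; last by apply: cvgM; [exact: cvg_cst|exact: cV].
  apply: cvgB; apply: cvgM => //; try exact: cvg_cst.
  exact: cU.
exact: near_continuous nr cWr.
Qed.

Let odeW r : 0 <= r ->
  4 * r * W r + 2 * N%:R * V r =
  lam * \1_om r * U r - (if r \in om then 1 else -1) * spow p (U r).
Proof.
move=> rp; rewrite /W; have [rr|rr] := ltP r r0.
  have [EU EV] := UVL (ltW rr); have X0 := XN (ltW rr).
  have on := om_lo (ltW rr); rewrite indicE memNset// mulr0 mul0r sub0r mulN1r opprK EU EV.
  apply: bub_ode => //; apply: height_crit; exact: lt_trans mu0.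
rewrite /acc /accel [4 * r * _]mulrC divfK ?subrK// gt_eqF// mulr_gt0//; exact: lt_le_trans rr.
Qed.

Let bnd (f : R -> R) (q K : R) : 0 <= q -> (forall r, be <= r -> `|f r| <= K * (r - mb) `^ (- q)) ->
  (exists M, forall r, 0 <= r <= be -> `|f r| <= M) ->
  exists2 C : R, 0 <= C & forall r, 0 <= r -> `|f r| <= C * (1 + r) `^ (- q).
Proof. by move=> q0 h [M hM]; exact: decay_bound hM h. Qed.

Let bW0 : exists M, forall r, 0 <= r <= be -> `|W r| <= M.
Proof.
have [M1 h1] : exists M, forall r, 0 <= r <= be -> `|bubW m (-1) hm mu (Num.min r r0)| <= M.
  apply: continuous_bounded_itv => r.
  apply: (@continuous_comp _ _ _ (fun r => Num.min r r0) (bubW m (-1) hm mu)).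
    by apply: continuous_min => //; exact: cvg_cst.
  by apply: bubW_continuous; apply: XN; rewrite ge_min lexx orbT.
have [M2 h2] := continuous_bounded_itv cU 0 be.
have cs : continuous (fun z => spow p (U z)).
  move=> r; apply: (@continuous_comp _ _ _ U (spow p)); first exact: cU.
  by apply: spow_continuous; exact/ltW/crit_exp_gt2.
have [M3 h3] := continuous_bounded_itv cs 0 be.
have [M4 h4] := continuous_bounded_itv cV 0 be.
exists (`|M1| + (`|lam| * M2 + M3 + 2 * N%:R * M4) / (4 * r0)) => r rI.
have k2 := le_trans (normr_ge0 _) (h2 r rI).
have k3 := le_trans (normr_ge0 _) (h3 r rI).
have k4 := le_trans (normr_ge0 _) (h4 r rI).
have k5 : 0 <= `|lam| * M2 + M3 + 2 * N%:R * M4 by rewrite !addr_ge0// !mulr_ge0.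
rewrite /W; have [rr|rr] := ltP r r0.
  rewrite -[leLHS]addr0 lerD//; last by rewrite divr_ge0// mulr_ge0// ltW.
  by have := h1 r rI; rewrite min_l ?(ltW rr)// => h; rewrite (le_trans h)// ler_norm.
rewrite -[leLHS]add0r lerD// /acc /accel normrM.
have rp : 0 < r := lt_le_trans r00 rr.
rewrite ler_pM//.
  rewrite (le_trans (ler_normB _ _))// lerD//; last first.
    by rewrite normrM ger0_norm ?mulr_ge0// ler_wpM2l ?mulr_ge0//; exact: h4.
  rewrite (le_trans (ler_normB _ _))// lerD//.
    rewrite !normrM ler_pM//; last exact: h2.
    by rewrite -[leRHS]mulr1 ler_wpM2l// indicE; case: (_ \in _); rewrite ?normr1 ?normr0.
  rewrite normrM (_ : `|if _ then _ else _| = 1) ?mul1r; first exact: h3.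
  by case: ifP; rewrite ?normrN normr1.
rewrite ger0_norm; last by rewrite invr_ge0 mulr_ge0// ltW.
by rewrite lef_pV2 ?posrE ?mulr_gt0// ler_pM2l.
Qed.

Lemma profile_solution : measurable [set x : 'rV[R]_N | om (nsq x)] ->
  (leb R N [set x | om (nsq x)] < +oo)%E -> exists F : R -> R,
  [/\ continuous F, F 0 = bubU m (-1) hm mu 0 &
      solution [set x : 'rV[R]_N | om (nsq x)] lam (fun x => F (nsq x))].
Proof.
move=> mO fO; exists U; split; first exact: cU.
  by have [->] := UVL (ltW r00).
have c0 := dec_gt0 R m.
(* At the radii of [S] the pieces only match to first order; there U' = V holds because U is a
   primitive of the continuous V. *)
have dU (r : R) : is_derive r 1 U (V r).
  have P : primitive U V.
    apply: (@primitive_off_finite _ S _ _ cU (locint_continuous cV)) => t tS; first exact: cV.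
    exact: (dUV tS).1.
  by apply: primitive_derive P _; exact: cV.
have [CU CU0 bU] : exists2 C : R, 0 <= C & forall r, 0 <= r -> `|U r| <= C * (1 + r) `^ (- c).
  apply: (@bnd U c `|k|) => //; first exact: ltW.
    by move=> r h; rewrite (UVR h).1 /bubU normrM mul1r (ger0_norm (powR_ge0 _ _)).
  exact: continuous_bounded_itv.
have [CV CV0 bV] : exists2 C : R, 0 <= C & forall r, 0 <= r -> `|V r| <= C * (1 + r) `^ (- (c + 1)).
  apply: (@bnd V _ `|c * 1 * k|) => //; first by lra.
    by move=> r h; rewrite (UVR h).2 /bubV normrM normrN mul1r (ger0_norm (powR_ge0 _ _)) opprD.
  exact: continuous_bounded_itv.
have [CW CW0 bW] : exists2 C : R, 0 <= C & forall r, 0 <= r -> `|W r| <= C * (1 + r) `^ (- (c + 2)).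
  apply: (@bnd W _ `|c * (c + 1) * k|) => //; first by lra.
  move=> r h; rewrite /W ltNge (le_trans (ltW r0be) h)/= accR//.
  by rewrite /bubW normrM mul1r (ger0_norm (powR_ge0 _ _)) [- (c + 2)]opprD.
have N2 : N%:R / 2 = c + 1 by rewrite dim_dec; field.
have wid (C : R) q r (z : R) : 0 <= r -> C <= CU + CV + CW -> z <= C * (1 + r) `^ q ->
    z <= (CU + CV + CW) * (1 + r) `^ q.
  by move=> _ hC hz; apply: (le_trans hz); apply: ler_wpM2r => //; exact: powR_ge0.
have C0 : 0 <= CU + CV + CW by rewrite !addr_ge0.
have dV' r (rS : r \notin S) : is_derive r 1 V (W r) := (dUV rS).2.
apply: (radial_solution mO fO dU cV dV' cW C0 _ _ _ odeW) => r rp.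
- rewrite N2 addrK. apply: (wid CU _ _ _ rp _ (bU r rp)); lra.
- rewrite N2; apply: (wid CV _ _ _ rp _ (bV r rp)); lra.
- rewrite N2 (_ : c + 1 + 1 = c + 2); last ring.
  apply: (wid CW _ _ _ rp _ (bW r rp)); lra.
Qed.

End global.

(** * Shells *)

Section reach.
Context (R : realType) (m n : nat).
Variables (al be : nat -> R) (lam : R).
Hypotheses (n1 : (1 <= n)%N) (al0 : 0 < al 1%N).
Hypothesis albe : forall i, (1 <= i <= n)%N -> al i < be i.
Hypothesis beal : forall i, (1 <= i < n)%N -> be i < al i.+1.
Hypothesis lam0 : lam <= 0.
Local Notation N := m.+3.
Local Notation p := (crit_exp R N).
Local Notation c := (dec R m).

Definition shell : set R := [set r | exists2 i, (1 <= i <= n)%N & al i < r < be i].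
Definition radii : seq R := [seq al i | i <- iota 1 n] ++ [seq be i | i <- iota 1 n].

Local Notation r0 := (al 1%N).
Local Notation r1 := (be n).

Lemma be_lt_al i j : (1 <= i)%N -> (i < j)%N -> (j <= n)%N -> be i < al j.
Proof.
move=> i1; elim: j => // j IH; rewrite ltnS leq_eqVlt => /orP[/eqP <-|ij] jn.
  by apply: beal; rewrite i1.
apply: lt_trans (IH ij (ltnW jn)) _; have j1 : (1 <= j)%N by apply: leq_trans (ltnW ij).
apply: lt_trans (beal _); last by rewrite j1.
by apply: albe; rewrite j1 ltnW.
Qed.

Lemma al_ge i : (1 <= i <= n)%N -> r0 <= al i.
Proof.
move=> /andP[]; rewrite leq_eqVlt => /orP[/eqP <- //|i1] i2.
apply/ltW/(lt_trans _ (be_lt_al _ i1 i2)) => //; exact: albe.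
Qed.

Lemma be_le i : (1 <= i <= n)%N -> be i <= r1.
Proof.
move=> /andP[i1]; rewrite leq_eqVlt => /orP[/eqP -> //|i2].
apply/ltW/(lt_trans (be_lt_al i1 i2 (leqnn _))); apply: albe; by rewrite n1 leqnn.
Qed.

Lemma r01 : r0 < r1.
Proof. by have := albe (i := 1%N); rewrite n1 => /(_ isT) h; apply: lt_le_trans h (be_le _); rewrite n1. Qed.

Lemma shell_lo r : r <= r0 -> ~ shell r.
Proof. by move=> h [i iI /andP[/(le_lt_trans (al_ge iI)) + _]]; rewrite ltNge h. Qed.

Lemma shell_hi r : r1 <= r -> ~ shell r.
Proof. by move=> h [i iI /andP[_ /lt_le_trans/(_ (be_le iI))]]; rewrite ltNge h. Qed.

Lemma shell_gap k r : (1 <= k < n)%N -> be k < r < al k.+1 -> ~ shell r.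
Proof.
move=> /andP[k1 kn] /andP[h1 h2] [i /andP[i1 i2] /andP[h3 h4]].
have [ik|ki] := leqP i k.
  have : be i <= be k.
    move: ik; rewrite leq_eqVlt => /orP[/eqP -> //|ik].
    apply/ltW/(lt_trans (be_lt_al i1 ik (ltnW kn))); apply: albe; by rewrite k1 ltnW.
  by move=> h; have := lt_trans h1 (lt_le_trans h4 h); rewrite ltxx.
have : al k.+1 <= al i.
  move: ki; rewrite leq_eqVlt => /orP[/eqP -> //|ki].
  apply/ltW/(lt_trans _ (be_lt_al _ ki i2)) => //; apply: albe; by rewrite kn.
by move=> h; have := lt_trans h2 (le_lt_trans h h3); rewrite ltxx.
Qed.

Lemma al_radii i : (1 <= i <= n)%N -> al i \in radii.
Proof. by move=> iI; rewrite mem_cat map_f// mem_iota add1n ltnS. Qed.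

Lemma be_radii i : (1 <= i <= n)%N -> be i \in radii.
Proof. by move=> iI; rewrite mem_cat orbC map_f// mem_iota add1n ltnS. Qed.

Lemma shell_near r : r \notin radii -> \forall y \near r, (y \in shell) = (r \in shell).
Proof.
move=> rS.
have H : forall s : seq R, r \notin s -> \forall y \near r, forall t, t \in s -> (t < y) = (t < r) /\ (y < t) = (r < t).
  elim=> [_|t s IH]; first by near=> y.
  rewrite inE negb_or => /andP[rt /IH{}IH].
  have h : \forall y \near r, (t < y) = (t < r) /\ (y < t) = (r < t).
    have [h|h|E] := ltgtP r t; last by rewrite E eqxx in rt.
      by have := near_lt h; apply: filterS => y yt; rewrite yt ltNge (ltW yt).
    by have := near_gt h; apply: filterS => y yt; rewrite yt ltNge (ltW yt).
  by apply: filterS2 h IH => y h1 h2 u; rewrite inE => /orP[/eqP ->|/h2].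
have := H _ rS; apply: filterS => y Hy.
have E i : (1 <= i <= n)%N -> (al i < y < be i) = (al i < r < be i).
  by move=> iI; rewrite (Hy _ (al_radii iI)).1 (Hy _ (be_radii iI)).2.
by apply/idP/idP; rewrite !inE => -[i iI h]; exists i => //; [rewrite -E|rewrite E].
Unshelve. all: by end_near. Qed.

Local Notation tr := (traj m shell lam r0 r1 radii).

Definition reached k : Prop := exists sg th et,
  [/\ 0 < sg <= 1, family sg th et, turning sg th &
      forall s, 0 < s < sg -> exists U V, tr (pole r0 s) (be k) U V (th s) (et s)].

Lemma reach_annulus k sg th et : (1 <= k <= n)%N -> 0 < sg <= 1 -> family sg th et ->
  (forall s, 0 < s < sg -> exists U V, tr (pole r0 s) (al k) U V (th s) (et s)) -> reached k.
Proof.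
move=> kI sgI fam ht.
have p2 := crit_exp_gt2 R m.
have mu0 : 0 <= - lam by rewrite oppr_ge0.
have hd1 r : al k < r < be k -> r0 < r < r1.
  by move=> /andP[h1 h2]; rewrite (le_lt_trans (al_ge kI) h1) (lt_le_trans h2 (be_le kI)).
have A0 : 0 < r1 `^ (- (c + 1)) by rewrite powR_gt0// (lt_trans al0 r01).
have B0 : 0 < r0 `^ c / 4 by rewrite divr_gt0// powR_gt0.
have dBA r : al k < r < be k -> is_derive r 1 (fun s => cofB m r0 r1 s / cofA m r0 r1 s) (cofD m r).
  by move=> /hd1; exact: cofBA_derive.
have dD r : al k < r < be k -> 0 <= cofD m r <= (2 * c + 1) / r0 * (cofB m r0 r1 r / cofA m r0 r1 r).
  by move=> /hd1; exact: cofD_bounds.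
have [th' [et' [L [fam' tu]]]] := annulus_step p2 mu0 (cofA_continuous al0 r01) (cofB_continuous al0 r01)
  A0 B0 (cofA_bounds m al0 r01) (cofB_bounds m al0 r01) (albe kI) dBA dD fam.
exists sg, th', et'; split => // s sI; have [U [V T]] := ht s sI.
apply: traj_extend T (L s sI) => //.
- exact: r01.
- exact: al_ge.
- exact: albe.
- exact: be_le.
- exact: al_radii.
- move=> r rI; have rs : shell r by exists k.
  by rewrite indicE mem_set// mulr1 opprK.
Qed.

Lemma reach_all k : (1 <= k <= n)%N -> reached k.
Proof.
elim: k => // -[_ kI|k IH kI].
  apply: (@reach_annulus 1%N 1 (init_th m r0) (init_et m r0)) => //.
  - by rewrite ltr01 lexx.
  - exact: init_family.
  - by move=> s sI; apply: traj_init => //; exact: r01.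
have kn : (1 <= k.+1 < n)%N by case/andP: kI.
have kI' : (1 <= k.+1 <= n)%N by apply/andP; split => //; exact: ltnW.
have [sg [th [et [/andP[sg0 sg1] fam tu ht]]]] := IH kI'.
have p2 := crit_exp_gt2 R m.
have A0 : 0 < r1 `^ (- (c + 1)) by rewrite powR_gt0// (lt_trans al0 r01).
have B0 : 0 < r0 `^ c / 4 by rewrite divr_gt0// powR_gt0.
have [sg' [th' [et' [/andP[sg'0 sg'1] L fam']]]] := gap_step p2 (cofA_continuous al0 r01) (cofB_continuous al0 r01)
  A0 B0 (cofA_bounds m al0 r01) (cofB_bounds m al0 r01) (beal kn) sg0 fam tu.
apply: reach_annulus fam' _ => //; first by rewrite sg'0 (le_trans sg'1).
move=> s /andP[s0 s1]; have sI' : 0 < s < sg' by rewrite s0.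
have [|U [V T]] := ht s; first by rewrite s0 (lt_le_trans s1).
apply: traj_extend T (L s sI') => //.
- exact: r01.
- by apply: le_trans (al_ge kI') (ltW (albe kI')).
- exact: beal.
- by apply: le_trans (ltW (albe kI)) (be_le kI).
- exact: be_radii.
- move=> r rI; have rs := shell_gap kn rI.
  by rewrite indicE memNset// mulr0 oppr0.
Qed.

Local Notation kk := (2 * r1 / (N%:R * c)).

(* Vanishes exactly when the data (h, v) at r1 extend to an outer bubble. *)
Definition mismatch (h v : R) : R :=
  2 * r1 * v + c * h * (1 + Num.sqrt (1 + kk * `|h| `^ (p - 2))).

(** Let L = r1 - mb be the distance to the pole. The outer bubble through [h] has v = - c h / L, and
    its height condition reads |h|^(p-2) L^2 = 2 N c (r1 - L). The positive root of this quadratic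
    equation is 2 r1 / (1 + s), a form that stays valid at h = 0. *)
Lemma match_bubble h v : mismatch h v = 0 -> exists k mb,
  [/\ 0 <= mb < r1, `|k| `^ (p - 2) = 2 * N%:R * c * mb, h = bubU m 1 k mb r1 & v = bubV m 1 k mb r1].
Proof.
have c0 := dec_gt0 R m; have r1p : 0 < r1 := lt_trans al0 r01.
have k0 : 0 <= kk by rewrite divr_ge0 ?mulr_ge0// ltW.
rewrite /mismatch; set g := `|h| `^ (p - 2); set s := Num.sqrt _ => F0.
have g0 : 0 <= g := powR_ge0 _ _.
have s1 : 1 <= s by rewrite -[leLHS]sqrtr1 ler_wsqrtr// lerDl mulr_ge0.
have s2 : s ^+ 2 = 1 + kk * g by rewrite sqr_sqrtr// addr_ge0// mulr_ge0.
pose L := 2 * r1 / (1 + s); have L0 : 0 < L by rewrite divr_gt0 ?mulr_gt0//; lra.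
exists (h * L `^ c), (r1 - L).
have LE : 1 * (r1 - (r1 - L)) = L by ring.
have sp : 1 + s != 0 by rewrite gt_eqF//; lra.
split.
- rewrite subr_ge0 ltrBlDr ltrDl L0 andbT ler_pdivrMr; last lra.
  rewrite -subr_ge0 (_ : _ - _ = r1 * (s - 1)); last ring.
  by rewrite mulr_ge0 ?subr_ge0// ltW.
- rewrite normrM (ger0_norm (powR_ge0 _ _)) powRM ?powR_ge0// -/g -powRrM crit_dec (powR_mulrn 2 (ltW L0)).
  have -> : g = (s ^+ 2 - 1) * (N%:R * c) / (2 * r1).
    by rewrite s2; field; rewrite !gt_eqF// mulr_gt0.
  by rewrite /L; field; rewrite sp gt_eqF.
- by rewrite /bubU LE -mulrA -powRD ?subrr ?powRr0 ?mulr1// (gt_eqF L0) implybT.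
- rewrite /bubV LE (_ : _ * _ = - (c * h) * (L `^ c * L `^ (- c - 1))); last ring.
  rewrite -powRD ?(gt_eqF L0) ?implybT//.
  rewrite (_ : c + (- c - 1) = -1); last ring.
  rewrite powR_inv1 ?ltW// /L; apply: (mulfI (x := 2 * r1)); first by rewrite mulf_neq0// gt_eqF.
  move/eqP: F0; rewrite addr_eq0 => /eqP ->; field; rewrite sp gt_eqF//.
Qed.

Lemma mismatch_continuous (T : topologicalType) (h v : T -> R) t :
  {for t, continuous h} -> {for t, continuous v} -> {for t, continuous (fun t => mismatch (h t) (v t))}.
Proof.
move=> ch cv; apply: cvgD; first by apply: cvgM => //; exact: cvg_cst.
apply: cvgM; first by apply: cvgM => //; exact: cvg_cst.
apply: cvgD; first exact: cvg_cst.
apply: (@continuous_comp _ _ _ (fun t => 1 + kk * `|h t| `^ (p - 2)) Num.sqrt); last exact: sqrt_continuous.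
apply: cvgD; first exact: cvg_cst.
apply: cvgM; first exact: cvg_cst.
apply: (@continuous_comp _ _ _ h (fun y => `|y| `^ (p - 2))) => //.
by apply: powR_abs_continuous; have := crit_exp_gt2 R m; lra.
Qed.

(** At the angles 2 j pi and (2 j + 1) pi one has h = 0, and the mismatch has the sign of z,
    positive then negative. The unbounded continuous angle takes both values beyond any parameter,
    and the mismatch vanishes in between. *)
Lemma zeros sg (th et : R -> R) : 0 < sg -> family sg th et -> turning sg th -> forall r, r < sg ->
  exists s, [/\ 0 < s < sg, r < s &
    mismatch (expR (et s) * sin (th s)) (cofA m r0 r1 r1 * (expR (et s) * cos (th s))) = 0].
Proof.
move=> sg0 [cF th0 _ _] Tn r rsg;
pose F s := mismatch (expR (et s) * sin (th s)) (cofA m r0 r1 r1 * (expR (et s) * cos (th s))).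
have pi0 := @pi_gt0 R; have r1p : 0 < r1 := lt_trans al0 r01.
have A0 : 0 < cofA m r0 r1 r1.
  by have /andP[h _] := cofA_bounds m al0 r01 r1; apply: lt_le_trans h; rewrite powR_gt0.
have cFF s : 0 < s < sg -> {for s, continuous F}.
  move=> sI; have [cth cet] := cF s sI.
  have ce : {for s, continuous (fun s => expR (et s))}.
    by apply: (@continuous_comp _ _ _ et (@expR R)) => //; exact: continuous_expR.
  apply: mismatch_continuous.
    apply: cvgM => //; apply: (@continuous_comp _ _ _ th sin) => //; exact: continuous_sin.
  apply: cvgM; first exact: cvg_cst.
  apply: cvgM => //; apply: (@continuous_comp _ _ _ th cos) => //; exact: continuous_cos.
pose a := Num.max r 0; have a0 : 0 <= a by rewrite le_max lexx orbT.
have ra : r <= a by rewrite le_max lexx.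
have asg : a < sg by rewrite gt_max rsg.
pose sa := (a + sg) / 2; have saI : 0 < sa < sg by rewrite /sa; apply/andP; split; lra.
have ada : a < sa by rewrite /sa; lra.
have [j /= hj] : exists j : nat, th sa / pi < j%:R.
  by exists (Num.bound (th sa / pi)); rewrite archi_boundP// divr_ge0 ?th0// ltW.
have {}hj : th sa <= j.*2%:R * pi.
  rewrite -ler_pdivrMr// (le_trans (ltW hj))// ler_nat -addnn; exact: leq_addr.
have [d' d'sg Hd'] := Tn j.*2.+1.
have m1 : Num.max d' sa < sg by rewrite gt_max d'sg; case/andP: saI.
have m2 : d' <= Num.max d' sa by rewrite le_max lexx.
have m3 : sa <= Num.max d' sa by rewrite le_max lexx orbT.
pose sb := (Num.max d' sa + sg) / 2.
have sab : sa <= sb by rewrite /sb; lra.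
have sbI : 0 < sb < sg by have /andP[h1 h2] := saI; rewrite /sb; apply/andP; split; lra.
have hb : j.*2.+1%:R * pi <= th sb by apply: Hd' => //; rewrite /sb; lra.
have ivt (f : R -> R) u v w : 0 < u < sg -> 0 < v < sg -> u <= v -> f u <= w <= f v \/ f v <= w <= f u ->
    (forall s, 0 < s < sg -> {for s, continuous f}) -> exists2 z, u <= z <= v & f z = w.
  move=> /andP[u0 _] /andP[_ v1] uv fw cf.
  have [z] : exists2 z, z \in `[u, v] & f z = w.
    apply: IVT => //.
      apply: continuous_in_subspaceT => s; rewrite inE/= in_itv/= => /andP[s1 s2].
      by apply: cf; rewrite (lt_le_trans u0 s1) (le_lt_trans s2 v1).
    by rewrite ge_min le_max; case: fw => /andP[-> ->]; rewrite ?orbT.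
  by rewrite in_itv/= => zI fz; exists z.
have jj : j.*2.+1%:R * pi = j.*2%:R * pi + pi :> R by rewrite -natr1; ring.
have cth s (sI : 0 < s < sg) : {for s, continuous th} := (cF s sI).1.
have [z1 /andP[z1a z1b] thz1] : exists2 z, sa <= z <= sb & th z = j.*2%:R * pi.
  by apply: ivt => //; left; rewrite hj (le_trans _ hb)// jj lerDl ltW.
have z1I : 0 < z1 < sg.
  by have /andP[h1 _] := saI; have /andP[_ h2] := sbI; rewrite (lt_le_trans h1 z1a) (le_lt_trans z1b h2).
have [z2 /andP[z2a z2b] thz2] : exists2 z, z1 <= z <= sb & th z = j.*2.+1%:R * pi.
  by apply: ivt => //; left; rewrite thz1 jj lerDl (ltW pi0)/= -jj.
have z2I : 0 < z2 < sg.
  by have /andP[h1 _] := z1I; have /andP[_ h2] := sbI; rewrite (lt_le_trans h1 z2a) (le_lt_trans z2b h2).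
have [s2 c2] := sin_2pi R j.
have Fz1 : 0 <= F z1.
  rewrite /F /mismatch thz1 s2 c2 mulr0 mulr0 mul0r addr0 mulr1.
  by rewrite !mulr_ge0// ?expR_ge0// ltW.
have Fz2 : F z2 <= 0.
  rewrite /F /mismatch thz2 jj sinDpi cosDpi s2 c2 oppr0 mulr0 mulr0 mul0r addr0 mulrN1 !mulrN oppr_le0.
  by rewrite !mulr_ge0// ?expR_ge0// ltW.
have [z /andP[zz1 zz2] Fz] : exists2 z, z1 <= z <= z2 & F z = 0.
  by apply: ivt => //; right; rewrite Fz1 Fz2.
exists z; split => //; last by lra.
have /andP[h1 _] := z1I; have /andP[_ h2] := z2I.
by rewrite (lt_le_trans h1 zz1) (le_lt_trans zz2 h2).
Qed.

Lemma shell_solutions : measurable [set x : 'rV[R]_N | shell (nsq x)] ->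
  (leb R N [set x | shell (nsq x)] < +oo)%E ->
  exists mu : nat -> R, exists F : nat -> R -> R,
    (forall k, r0 < mu k.+1 < mu k) /\
    forall k, [/\ continuous (F k), F k 0 = bubU m (-1) (height m (mu k)) (mu k) 0 &
      solution [set x : 'rV[R]_N | shell (nsq x)] lam (fun x => F k (nsq x))].
Proof.
move=> mO fO.
have nn : (1 <= n <= n)%N by rewrite n1 leqnn.
have [sg [th [et [/andP[sg0 sg1] fam tu ht]]]] := reach_all nn.
have /choice[nxt Hn] (r : R) : exists s, r < sg -> [/\ 0 < s < sg, r < s &
    mismatch (expR (et s) * sin (th s)) (cofA m r0 r1 r1 * (expR (et s) * cos (th s))) = 0].
  by have [h|h] := ltP r sg; [have [s Hs] := zeros sg0 fam tu h; exists s|exists 0].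
(* The index is shifted because 0 is not itself an admissible parameter. Each zero lies beyond the
   previous one, so the poles decrease strictly. *)
pose s k := iter k.+1 nxt 0.
have slt k : s k < sg.
  by elim: k => [|k /Hn[/andP[]//]]; have [/andP[]] := Hn 0 sg0.
have sP k : [/\ 0 < s k < sg, s k < s k.+1 & mismatch (expR (et (s k)) * sin (th (s k)))
    (cofA m r0 r1 r1 * (expR (et (s k)) * cos (th (s k)))) = 0].
  have [h1 h2 _] := Hn _ (slt k).
  by case: k h1 h2 => [|k] h1 h2; [have [] := Hn 0 sg0|have [] := Hn _ (slt k)].
have sI k : 0 < s k < 1.
  by have [/andP[h1 h2] _ _] := sP k; rewrite h1 (lt_le_trans h2).
have /choice[F HF] (k : nat) : exists F : R -> R, [/\ continuous F,
    F 0 = bubU m (-1) (height m (pole r0 (s k))) (pole r0 (s k)) 0 &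
      solution [set x : 'rV[R]_N | shell (nsq x)] lam (fun x => F (nsq x))].
  have [skI _ mk] := sP k; have [U [V T]] := ht _ skI.
  have [kp [mb [h1 h2 h3 h4]]] := match_bubble mk.
  have [_ _ _ _ [UT VT]] := T.
  apply: (@profile_solution R m shell lam r0 r1 r1 radii al0 _ _ r01 shell_lo shell_hi shell_near
    (pole r0 (s k)) U V _ _ (pole_gt r0 (sI k)) T kp mb h1 h2 _ _ mO fO).
  - by apply: al_radii; rewrite n1.
  - exact: be_radii.
  - by rewrite UT.
  - by rewrite VT.
exists (fun k => pole r0 (s k)), F; split => // k.
rewrite (pole_gt _ (sI _))/= /pole.
have /andP[h1 h2] := sI k; have /andP[h3 h4] := sI k.+1; have [_ h5 _] := sP k.
by rewrite ltrD2l !mulrBl !mul1r !divff ?gt_eqF// ltrD2r ltf_pV2.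
Qed.

End reach.

(** * Infinitely many solutions *)

(** Continuous profiles that differ at 0 differ on a small box around the origin, which has positive
    measure. *)
Lemma ae_class_center (R : realType) m (F G : R -> R) : continuous F -> continuous G ->
  ae_class (fun x : 'rV[R]_m.+1 => F (nsq x)) = ae_class (fun x => G (nsq x)) -> F 0 = G 0.
Proof.
move=> cF cG E; apply: contrapT => FG.
have [Z [mZ Z0 HZ]] : {ae leb R m.+1, forall x : 'rV[R]_m.+1, F (nsq x) = G (nsq x)}.
  have : ae_class (fun x : 'rV[R]_m.+1 => F (nsq x)) (fun x => F (nsq x)).
    by apply: (ae_mono (P := fun _ => True)) => //; exact: aeW.
  by rewrite E /ae_class/=; apply: ae_mono => x /(_ Logic.I).
have : \forall r \near 0, F r != G r.
  have c : {for (0 : R), continuous (fun r => F r - G r)} by apply: cvgB; [exact: cF|exact: cG].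
  have d0 : 0 < `|F 0 - G 0| by rewrite normr_gt0 subr_eq0; exact/eqP.
  move/cvgrPdist_lt: c => /(_ _ d0); apply: filterS => r.
  by apply: contraTneq => ->; rewrite subrr subr0 ltxx.
move=> /nbhs_ballP[d /= d0 Hd].
(* In the box x_j^2 <= e^2 <= e for each of the m + 1 coordinates, so |x|^2 <= (m + 1) e < d. *)
pose e := Num.min 1 (d / m.+2%:R); have e0 : 0 < e by rewrite lt_min ltr01 divr_gt0.
have /andP[box0 _] := @leb_ocbox R m.+1 (fun=> - e) (fun=> e) (fun=> (gt0_cp e0).2).
pose box := ocbox (fun _ : 'I_m.+1 => - e) (fun=> e).
suff : (leb R m.+1 box <= 0)%E by rewrite leNgt box0.
rewrite -Z0; apply: le_measure; rewrite ?inE//; first exact: measurable_ocbox.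
move=> x bx; apply: HZ => /= Ex; have := Hd (nsq x); rewrite /ball/= sub0r normrN Ex => /(_ _)/eqP; apply => //.
rewrite ger0_norm ?nsq_ge0//.
have h j : x 0 j ^+ 2 <= e.
  have := bx j => /andP[h1 h2]; have e1 : e <= 1 by rewrite ge_min lexx.
  have : x 0 j ^+ 2 <= e ^+ 2 by rewrite -[x 0 j ^+ 2]real_normK ?num_real// ler_sqr ?nnegrE ?(ltW e0)// ler_norml h2 (ltW h1).
  by move=> h; apply: (le_trans h); rewrite expr2 ler_piMl// ltW.
apply: (@le_lt_trans _ _ (m.+1%:R * e)).
  have -> : m.+1%:R * e = \sum_(j < m.+1) e by rewrite sumr_const card_ord mulr_natl.
  by apply: ler_sum => j _; exact: h.
have : e <= d / m.+2%:R by rewrite ge_min lexx orbT.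
rewrite ler_pdivlMr// mulrC; apply: lt_le_trans.
by rewrite ltr_pM2r// ltr_nat.
Qed.

(** The value at the origin is a constant times mu^(-c/2). *)
Lemma height_inj (R : realType) m (mu nu : R) : 0 < mu -> 0 < nu ->
  bubU m (-1) (height m mu) mu 0 = bubU m (-1) (height m nu) nu 0 -> mu = nu.
Proof.
move=> mu0 nu0; have c0 := dec_gt0 R m.
have E (x : R) : 0 < x -> bubU m (-1) (height m x) x 0 = (2 * m.+3%:R * dec R m) `^ (dec R m / 2) * x `^ (- (dec R m / 2)).
  move=> x0; rewrite /bubU /height sub0r mulN1r opprK powRM ?mulr_ge0 ?ltW// -mulrA -powRD ?(gt_eqF x0) ?implybT//.
  by congr (_ * _ `^ _); field.
rewrite !E// => /mulfI h.
have {}h : mu `^ (- (dec R m / 2)) = nu `^ (- (dec R m / 2)).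
  by apply: h; rewrite gt_eqF// powR_gt0// !mulr_gt0.
have {}h : mu `^ (dec R m / 2) = nu `^ (dec R m / 2) by apply: invr_inj; rewrite -!powRN.
apply: (@powR_injective _ (dec R m / 2)) => //; rewrite ?nnegrE ?ltW//.
by rewrite divr_gt0.
Qed.

Theorem corollary1p6 (R : realType) (N : nat) (hN : (3 <= N)%N)
  (n : nat) (hn : (1 <= n)%N) (a b : nat -> R)
  (ha1 : 0 < a 1%N)
  (hab : forall i : nat, (1 <= i <= n)%N -> a i < b i)
  (hba : forall i : nat, (1 <= i < n)%N -> b i < a i.+1)
  (Omega : set 'rV[R]_N)
  (hOmega : Omega = \bigcup_(i in [set k | (1 <= k <= n)%N]) annulus (a i) (b i))
  (lambda : R) (hlambda1 : (- Lambda Omega < lambda%:E)%E) (hlambda2 : lambda <= 0) :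
  infinite_set
    [set ae_class u | u in [set u | solution Omega lambda u /\ radial u]].
Proof.
case: N hN Omega hOmega hlambda1 => [|[|[|m]]]// _ Omega hOmega _.
have a0 i : (1 <= i <= n)%N -> 0 < a i.
  elim: i => // -[|i] IH /andP[_ h] //.
  have iI : (1 <= i.+1 <= n)%N by apply/andP; split => //; exact: ltnW.
  by apply: lt_trans (IH iI) (lt_trans (hab _ iI) (hba _ _)).
have b0 i (iI : (1 <= i <= n)%N) : 0 < b i := lt_trans (a0 i iI) (hab i iI).
pose al i := a i ^+ 2; pose be i := b i ^+ 2.
have al1 : 0 < al 1%N by rewrite exprn_gt0.
have albe i : (1 <= i <= n)%N -> al i < be i.
  by move=> iI; rewrite ltr_sqr ?nnegrE ?ltW ?a0 ?b0 ?hab.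
have beal i : (1 <= i < n)%N -> be i < al i.+1.
  move=> iI; have iI' : (1 <= i <= n)%N by case/andP: iI => -> /ltnW.
  have iI'' : (1 <= i.+1 <= n)%N by case/andP: iI.
  by rewrite ltr_sqr ?nnegrE ?ltW ?a0 ?b0 ?hba.
have OE : Omega = [set x | shell n al be (nsq x)].
  have key i (x : 'rV[R]_m.+3) : (1 <= i <= n)%N -> (a i < enorm x < b i) = (al i < nsq x < be i).
    move=> iI; have ai := a0 i iI; have bi := b0 i iI; have x0 := nsq_ge0 x.
    rewrite /enorm -/(nsq x) /al /be -[in RHS](sqr_sqrtr x0).
    by rewrite !ltr_sqr ?nnegrE ?sqrtr_ge0 ?ltW.
  rewrite hOmega; apply/seteqP; split => x.
    by move=> [i iI h]; exists i => //; rewrite -key.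
  by move=> [i iI h]; exists i => //; rewrite /annulus/= key.
have mO : measurable [set x : 'rV[R]_m.+3 | shell n al be (nsq x)].
  have mS : measurable (shell n al be : set (measurableTypeR R)).
    have -> : shell n al be = \bigcup_(i in [set k | (1 <= k <= n)%N]) `]al i, be i[%classic.
      apply/seteqP; split => r [i iI h]; exists i => //; move: h; by rewrite /= in_itv/=.
    by apply: bigcup_measurable => i _; exact: measurable_itv.
  have := continuous_measurable_rV (@nsq_continuous R m.+3) measurableT mS.
  by rewrite setTI.
have fO : (leb R m.+3 [set x | shell n al be (nsq x)] < +oo)%E.
  have [k /= hk] : exists k : nat, be n < k%:R.
    by exists (Num.bound (be n)); rewrite archi_boundP// sqr_ge0.
  apply: (@le_lt_trans _ _ (leb R m.+3 (cube R m.+3 k.+1))); last exact: cube_fin.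
  apply: le_measure; rewrite ?inE//; first exact: measurable_ocbox.
  move=> x /= [i iI /andP[_ h]] j.
  have h1 : nsq x < k.+1%:R.
    by apply: lt_trans h (le_lt_trans (be_le hn albe beal iI) (lt_trans hk _)); rewrite ltr_nat.
  have h2 : x 0 j ^+ 2 < k.+1%:R ^+ 2.
    apply: le_lt_trans (lt_le_trans h1 _).
      by rewrite /nsq (bigD1 j)//= lerDl sumr_ge0// => l _; exact: sqr_ge0.
    by rewrite expr2 ler_peMr// ler1n.
  have : `|x 0 j| < k.+1%:R by rewrite -ltr_sqr ?nnegrE// real_normK// num_real.
  by rewrite ltr_norml => /andP[-> /ltW ->].
have [mu [F [Hmu HF]]] := shell_solutions hn al1 albe beal hlambda2 mO fO.
have mu0 k : 0 < mu k.
  by have /andP[h1 h2] := Hmu k; apply: lt_trans (lt_trans h1 h2).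
have mu_lt i j : (i < j)%N -> mu j < mu i.
  elim: j => // j IH; rewrite ltnS leq_eqVlt => /orP[/eqP ->|/IH h]; first by case/andP: (Hmu j).
  by apply: lt_trans h; case/andP: (Hmu j).
pose g k : set ('rV[R]_m.+3 -> R) := ae_class (fun x : 'rV[R]_m.+3 => F k (nsq x)).
have ginj : injective g.
  move=> i j /ae_class_center E; have [ci Fi _] := HF i; have [cj Fj _] := HF j.
  have := E ci cj; rewrite Fi Fj => /(height_inj (mu0 i) (mu0 j)) e.
  by case: (ltngtP i j) => // /mu_lt; rewrite e ltxx.
move=> fin; apply: infinite_nat.
have gsub : range g `<=` [set ae_class u | u in [set u | solution Omega lambda u /\ radial u]].
  move=> _ [k _ <-]; exists (fun x => F k (nsq x)) => //; split.
    by rewrite OE; have [] := HF k.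
  move=> x y; rewrite /enorm -/(nsq x) -/(nsq y) => e; congr (F k).
  by rewrite -(sqr_sqrtr (nsq_ge0 x)) e sqr_sqrtr// nsq_ge0.
have := finite_preimage (f := g) (fun x y _ _ => @ginj x y) (sub_finite_set gsub fin).
by rewrite preimage_range.
Qed.
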